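(* Let $c\geq 0$ be a real number, fix a value of $\arg\beta\in(-\pi/2,\pi/2)$, and fix $x\in\mathbb C$. If $c=0$, assume that $x\notin 2\pi \mathrm{i}\mathbb Z+\beta\mathbb R_{\leq 0}$. If $c>0$, assume that $x\notin \beta^{1-c}\mathbb R_{\leq 0}$. (These conditions depend only on $\arg\beta$.) Then, as $\beta\rightarrow 0$ with the given argument, $F(\beta)=\log(e^{-x\beta^c};e^{-\beta})_\infty$ is given by the following asymptotic series. (a) If $c=0$, $$F(\beta)\sim \sum_{k=0}^{\infty}\frac{(-1)^{k-1}B_{k}\operatorname{Li}_{2-k}(e^{-x})}{k!}\,\beta^{k-1}.$$ (b) If $0<c<1$, $$F(\beta)\sim -\frac{\pi^2}{6}\,\beta^{-1}+x\left(1-\log x-c\log\beta\right)\beta^{c-1}+\frac c2\log\beta+\frac 12\log x-\sum_{k=1}^\infty\frac{B_{2k}}{2k(2k-1)x^{2k-1}}\,\beta^{(1-c)(2k-1)}-\sum_{n=1}^\infty\sum_{k=0}^{n+1}\frac{B_kB_nx^{n+1-k}}{k!\,n\,(n+1-k)!}\,\beta^{(1-c)(k-1)+cn}.$$ (c) If $c=1$, $$F(\beta)\sim -\frac{\pi^2}{6}\,\beta^{-1}+\left(\frac 12-x\right)\log\beta-\log\Gamma(x)+\frac 12\log(2\pi)-\sum_{n=1}^{\infty}\frac{B_nB_{n+1}(x)}{n\,(n+1)!}\,\beta^n,$$ where $B_n(x)=\sum_{k=0}^n\binom nk B_kx^{n-k}$ are the Bernoulli polynomials. (d) If $c>1$,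 $$F(\beta)\sim-\frac{\pi^2}{6}\,\beta^{-1}+\left(c-\frac 12\right)\log\beta +\log x+\frac 12\log(2\pi)+x(\gamma-\log\beta)\beta^{c-1}-\sum_{k=2}^\infty\frac{\zeta(k)(-x)^k}{k}\beta^{(c-1)k}-\sum_{n=1}^\infty\sum_{k=0}^{n+1}\frac{B_kB_nx^{n+1-k}}{k!\,n\,(n+1-k)!}\,\beta^{k-1+c(n+1-k)},$$ where $\zeta(k)$ are Riemann zeta values and $\gamma$ is Euler's constant. In (a), $\operatorname{Li}_1(e^{-x})$ and $\operatorname{Li}_2(e^{-x})$ denote the branches that are real-valued for $x>0$ and analytic for $x\notin 2\pi \mathrm{i}\mathbb Z+\beta\mathbb R_{\leq 0}$. In (b)–(d), $\log x$ and $\log\Gamma(x)$ denote the branches that are real-valued for $x>0$ and analytic for $x\notin \beta^{1-c}\mathbb R_{\leq 0}$.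
   Context: For $|q|<1$, $(z;q)_\infty=\prod_{j=0}^\infty(1-zq^j)$. For $\operatorname{Re}\beta>0$, the function $y\mapsto(e^{-y};e^{-\beta})_\infty$ vanishes exactly on $2\pi \mathrm{i}\mathbb Z+\beta\mathbb Z_{\le0}$, and $\log(e^{-y};e^{-\beta})_\infty$ denotes the analytic branch of its logarithm on $\mathbb C\setminus(2\pi \mathrm{i}\mathbb Z+\beta\mathbb R_{\le0})$ that tends to $0$ as $\operatorname{Re}y\to+\infty$; for $\operatorname{Re}y>0$ it equals $\sum_{k=0}^\infty\log(1-e^{-y-\beta k})$ with principal logarithms. $F(\beta)$ is this function evaluated at $y=x\beta^c$ (for $c>0$ this point lies in the domain for all sufficiently small $|\beta|$). Powers $\beta^s$ and $\log\beta$ are principal, using the given $\arg\beta$. The Bernoulli numbers $B_k$ are defined by $\frac{1}{e^x-1}=\sum_{k=0}^\infty \frac{B_kx^{k-1}}{k!}$, so $B_1=-\tfrac12$. The polylogarithms are $\operatorname{Li}_n(x)=\sum_{k=1}^\infty x^k/k^n$ for $|x|<1$, $n\in\mathbb Z$, continued analytically; for $n\le0$ they are rational functions with pole only at $x=1$. The symbol $\sim$ means: for every $L>0$, if each infinite sum on the right (the sum over $k$ and, in the double sums, the sum over $n$) is truncated at any sufficiently large order, then the difference between the two sides is $\mathcal O(|\beta|^{L})$ as $\beta\to0$ along the ray of fixed argument, with $x$ and $c$ fixed.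
   Formalization: In (d), if |(1-c) arg β| ≥ π (only for c>3), log x is the branch with arg x within π of (1-c) arg β, not the one real for x>0, which does not exist or makes the formula wrong by a nonzero multiple of 2πi (e.g. c=5, arg β=1.2, x=1). *)

(* Defs.v *)
From Stdlib Require Import Reals ZArith Lra Lia.
From Coquelicot Require Import Coquelicot.
Open Scope R_scope.

Definition Cexp (z : C) : C := (exp (Re z) * cos (Im z), exp (Re z) * sin (Im z)).

Definition analytic_on (D : C -> Prop) (f : C -> C) : Prop :=
  forall z0 : C, D z0 ->
  exists (a : nat -> C) (d : R), 0 < d /\
    forall z : C, Cmod (z - z0)%C < d ->
      is_pseries (K := C_AbsRing) (V := C_NormedModule) a (z - z0)%C (f z).

(* [beta = r * exp (i * theta)] with the given argument [theta]; its logarithm and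
   powers are taken with this argument, hence are the principal ones when
   [- PI / 2 < theta < PI / 2]. *)
Definition beta_of (theta r : R) : C := (RtoC r * Cexp (0%R, theta))%C.

Definition log_beta (theta r : R) : C := (ln r, theta).

Definition pow_beta (theta r s : R) : C := Cexp (RtoC s * log_beta theta r)%C.

(* Complement of [2 pi i Z + beta R_{<= 0}]. *)
Definition log_qpoch_domain (beta y : C) : Prop :=
  ~ exists (n : Z) (s : R),
      s <= 0 /\ y = (RtoC (2 * PI * IZR n) * Ci + beta * RtoC s)%C.

(* Complement of [exp (i * phi) R_{<= 0}].  Since
   [beta^(1-c) = r^(1-c) exp (i (1-c) theta)], the complement of
   [beta^(1-c) R_{<= 0}] is the case [phi = (1 - c) * theta]. *)
Definition slit_plane (phi : R) (x : C) : Prop :=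
  ~ exists s : R, s <= 0 /\ x = (Cexp (0%R, phi) * RtoC s)%C.

Fixpoint qpoch (z q : C) (n : nat) : C :=
  match n with
  | O => RtoC 1
  | S m => (qpoch z q m * (1 - z * q ^ m))%C
  end.

Definition is_qpoch_inf (z q l : C) : Prop :=
  filterlim (qpoch z q) eventually (locally l).

(* [G] is the branch of [y |-> log (e^(-y); e^(-beta))_infinity] that is analytic
   on the cut plane and tends to 0 as [Re y] tends to [+oo].  It is unique, since
   the cut plane is connected. *)
Definition is_log_qpoch (beta : C) (G : C -> C) : Prop :=
  analytic_on (log_qpoch_domain beta) G /\
  (forall y : C, log_qpoch_domain beta y ->
     is_qpoch_inf (Cexp (- y)%C) (Cexp (- beta)%C) (Cexp (G y))) /\
  (forall eps : R, 0 < eps ->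
     exists M : R, forall y : C, M < Re y -> Cmod (G y) < eps).

(* [l] is the function [x |-> Li_n (e^(-x))]: given by the defining series when
   [|e^(-x)| < 1], that is [0 < Re x], and continued analytically to the
   (connected) complement of [2 pi i Z + beta R_{<= 0}], where
   [beta = exp (i * theta)].  For [n = 1, 2] this selects the branch that is real
   for [x > 0]; for [n <= 0] it is a rational function of [e^(-x)]. *)
Definition is_polylog_exp (theta : R) (n : Z) (l : C -> C) : Prop :=
  analytic_on (log_qpoch_domain (Cexp (0%R, theta))) l /\
  forall x : C, 0 < Re x ->
    is_series (K := C_AbsRing) (V := C_NormedModule)
      (fun k : nat => (Cexp (- x) ^ S k / RtoC (powerRZ (INR (S k)) n))%C) (l x).

(* [l] is the branch of the logarithm that is analytic on [slit_plane phi] and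
   real for [x > 0].  For [|phi| >= PI] this normalization is no longer available
   in the form needed: at odd multiples of [PI] the half-line [x > 0] is the slit
   itself, and beyond [PI] it is separated by the slit from the sheet reached by
   rotating the slit continuously from angle 0 to angle [phi].  In that case [l]
   is the logarithm on this sheet, i.e. with [phi - PI < arg x < phi + PI].  For
   [|phi| < PI] both normalizations select the same branch. *)
Definition is_log_branch (phi : R) (l : C -> C) : Prop :=
  analytic_on (slit_plane phi) l /\
  (forall x : C, slit_plane phi x -> Cexp (l x) = x) /\
  (Rabs phi < PI -> forall t : R, 0 < t -> Im (l (RtoC t)) = 0) /\
  (PI <= Rabs phi -> l (Cexp (0%R, phi)) = (0%R, phi)).

Fixpoint rising (z : C) (n : nat) : C :=
  match n with
  | O => RtoC 1
  | S m => (rising z m * (z + RtoC (INR m)))%C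
  end.

(* Euler's limit [Gamma z = lim n! n^z / (z (z + 1) ... (z + n))]. *)
Definition is_Gamma (z g : C) : Prop :=
  filterlim
    (fun n : nat =>
       (RtoC (INR (fact n)) * Cexp (z * RtoC (ln (INR n))) / rising z (S n))%C)
    eventually (locally g).

Definition is_log_Gamma_branch (phi : R) (l : C -> C) : Prop :=
  analytic_on (slit_plane phi) l /\
  (forall x : C, slit_plane phi x -> is_Gamma x (Cexp (l x))) /\
  (forall t : R, 0 < t -> Im (l (RtoC t)) = 0).

(* [bern_coef m k = B_k / k!] for [k <= m], by the recursion expressing that the
   Cauchy product of [sum_k B_k x^k / k!] and [(e^x - 1) / x] is 1; see
   [bernoulli_generating] for the generating function. *)
Fixpoint bern_coef (m k : nat) : R :=
  match m with
  | O => 1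
  | S p =>
      if (k <=? p)%nat then bern_coef p k
      else - sum_n (fun j => bern_coef p j / INR (fact (S (S p) - j))) p
  end.

Definition bernoulli (n : nat) : R := INR (fact n) * bern_coef n n.

Definition bernoulli_poly (n : nat) (x : C) : C :=
  sum_n (G := C_AbelianGroup)
    (fun k => (RtoC (Binomial.C n k * bernoulli k) * x ^ (n - k))%C) n.

Definition zeta_nat (k : nat) : R := Series (fun n => / INR (S n) ^ k).

Definition euler_gamma : R :=
  real (Lim_seq (fun n => sum_n_m (fun k => / INR k) 1 n - ln (INR n))).

Definition bigO_pow (L : R) (g : R -> C) : Prop :=
  exists K : R, at_right 0 (fun r => Cmod (g r) <= K * Rpower r L).

(* Here [r] is [|beta|], and [S K r] is a right-hand side with its infinite sum truncated at order [K]. *)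
Definition asymp (f : R -> C) (S : nat -> R -> C) : Prop :=
  forall L : R, 0 < L ->
  exists N0 : nat, forall K : nat, (N0 <= K)%nat ->
    bigO_pow L (fun r => (f r - S K r)%C).

(* [S K N r] has its two infinite sums truncated, independently, at [K] and [N]. *)
Definition asymp2 (f : R -> C) (S : nat -> nat -> R -> C) : Prop :=
  forall L : R, 0 < L ->
  exists N0 : nat, forall K N : nat, (N0 <= K)%nat -> (N0 <= N)%nat ->
    bigO_pow L (fun r => (f r - S K N r)%C).

Definition Csum (a b : nat) (u : nat -> C) : C := sum_n_m (G := C_AbelianGroup) u a b.

Lemma bern_coef_stable m k : (k <= m)%nat -> bern_coef m k = bern_coef k k.
Proof.
induction m as [|m IH]; intros H.
- now replace k with 0%nat by lia.
- destruct (Nat.eq_dec k (S m)) as [->|Hk]; [reflexivity|].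
  cbn [bern_coef]. destruct (Nat.leb_spec k m); [apply IH; lia|lia].
Qed.

Lemma bernoulli_cauchy n :
  sum_n (fun j => bernoulli j / INR (fact j) / INR (fact (S n - j))) n
  = if (n =? 0)%nat then 1 else 0.
Proof.
assert (E : forall j, bernoulli j / INR (fact j) = bern_coef j j).
{ intros j. unfold bernoulli. field. apply INR_fact_neq_0. }
destruct n as [|n].
- rewrite sum_O, E. simpl. field.
- rewrite sum_Sn, E. cbn [Nat.eqb bern_coef].
  destruct (Nat.leb_spec (S n) n); [lia|].
  replace (S (S n) - S n)%nat with 1%nat by lia.
  rewrite (sum_n_ext_loc _ (fun j => bern_coef n j / INR (fact (S (S n) - j)))).
  + unfold plus; simpl fact; simpl INR; simpl; field.
  + intros j Hj. now rewrite E, (bern_coef_stable n j).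
Qed.

Lemma half_sum n : sum_n (fun j => (/ 2) ^ (S n - j)) n <= 1.
Proof.
induction n as [|n IH].
- rewrite sum_O; simpl; lra.
- rewrite sum_Sn.
  rewrite (sum_n_ext_loc _ (fun j => mult (/ 2) ((/ 2) ^ (S n - j)))).
  + rewrite sum_n_mult_l. replace (S (S n) - S n)%nat with 1%nat by lia.
    rewrite pow_1.
    set (t := sum_n _ n) in *. clearbody t.
    change (/ 2 * t + / 2 <= 1). lra.
  + intros j Hj. replace (S (S n) - j)%nat with (S (S n - j)) by lia. reflexivity.
Qed.

Lemma inv_fact_le m : / INR (fact (S m)) <= (/ 2) ^ m.
Proof.
induction m as [|m IH].
- simpl; lra.
- change (fact (S (S m))) with (S (S m) * fact (S m))%nat.
  rewrite mult_INR, Rinv_mult. simpl pow.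
  assert (2 <= INR (S (S m))) by (rewrite !S_INR; pose proof (pos_INR m); lra).
  apply Rmult_le_compat; try assumption.
  + left; apply Rinv_0_lt_compat; lra.
  + left; apply Rinv_0_lt_compat, INR_fact_lt_0.
  + apply Rinv_le_contravar; lra.
Qed.

Lemma bern_coef_bound m k : (k <= m)%nat -> Rabs (bern_coef m k) <= 1.
Proof.
revert k; induction m as [|m IH]; intros k Hk.
- simpl; rewrite Rabs_R1; apply Rle_refl.
- cbn [bern_coef]. destruct (Nat.leb_spec k m) as [|_]; [now apply IH|].
  rewrite Rabs_Ropp.
  apply Rle_trans with (sum_n (fun j => Rabs (bern_coef m j / INR (fact (S (S m) - j)))) m).
  { apply (norm_sum_n_m (V := R_NormedModule)). }
  eapply Rle_trans; [|apply (half_sum m)].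
  rewrite 2!sum_n_Reals. apply sum_Rle; intros j Hj.
  replace (S (S m) - j)%nat with (S (S m - j)) by lia.
  unfold Rdiv. rewrite Rabs_mult.
  rewrite (Rabs_pos_eq (/ _)) by (left; apply Rinv_0_lt_compat, INR_fact_lt_0).
  pose proof (IH j Hj) as H1. pose proof (inv_fact_le (S m - j)) as H2.
  pose proof (Rabs_pos (bern_coef m j)).
  assert (0 < / INR (fact (S (S m - j)))) by apply Rinv_0_lt_compat, INR_fact_lt_0.
  eapply Rle_trans; [|exact H2]. nra.
Qed.

Lemma CV_radius_ge_1 (a : nat -> R) :
  (forall n, Rabs (a n) <= 1) -> Rbar_le 1 (CV_radius a).
Proof.
intros H. apply (proj1 (CV_radius_bounded a)).
exists 1; intros n. rewrite pow1, Rmult_1_r. apply H.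
Qed.

Theorem bernoulli_generating (x : R) : x <> 0 -> Rabs x < 1 ->
  is_series (fun k => bernoulli k / INR (fact k) * powerRZ x (Z.of_nat k - 1))
    (/ (exp x - 1)).
Proof.
intros Hx0 Hx.
set (b := fun k => bernoulli k / INR (fact k)).
set (e := fun k => / INR (fact (S k))).
assert (Eb : forall j, b j = bern_coef j j).
{ intros j. unfold b, bernoulli. field. apply INR_fact_neq_0. }
assert (Rb : Rbar_lt (Rabs x) (CV_radius b)).
{ apply Rbar_lt_le_trans with 1; [exact Hx|]. apply CV_radius_ge_1.
  intros n. rewrite Eb. now apply bern_coef_bound. }
assert (Re : Rbar_lt (Rabs x) (CV_radius e)).
{ apply Rbar_lt_le_trans with 1; [exact Hx|]. apply CV_radius_ge_1.
  intros n. unfold e.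
  rewrite Rabs_pos_eq by (left; apply Rinv_0_lt_compat, INR_fact_lt_0).
  eapply Rle_trans; [apply inv_fact_le|].
  rewrite <- (pow1 n). apply pow_incr; lra. }
assert (He : is_pseries e x ((exp x - 1) / x)).
{ pose proof (is_pseries_decr_1 _ x (/ x) _ (Rinv_l x Hx0) (is_exp_Reals x)) as H.
  replace ((exp x - 1) / x) with (scal (/ x) (plus (exp x) (opp (/ INR (fact 0))))).
  - exact H.
  - unfold scal, plus, opp; simpl; unfold mult; simpl. field; assumption. }
assert (Hb : is_pseries b x (PSeries b x)).
{ apply PSeries_correct, CV_radius_inside, Rb. }
pose proof (is_pseries_mult b e x _ _ Hb He Rb Re) as Hm.
assert (H1 : PSeries (PS_mult b e) x = 1).
{ rewrite (PSeries_ext _ (fun n => if (n =? 0)%nat then 1 else 0)).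
  - unfold PSeries. apply is_series_unique.
    apply filterlim_ext with (fun _ => 1); [|apply filterlim_const].
    intros n; induction n as [|n IH].
    + rewrite sum_O; unfold scal; simpl; unfold mult; simpl; ring.
    + rewrite sum_Sn, <- IH; unfold scal, plus; simpl; unfold mult; simpl; ring.
  - intros n. rewrite <- bernoulli_cauchy. unfold PS_mult.
    rewrite sum_n_Reals. apply sum_eq; intros j Hj. unfold b, e.
    replace (S (n - j)) with (S n - j)%nat by lia. reflexivity. }
rewrite (is_pseries_unique _ _ _ Hm) in H1.
assert (Hexp : exp x - 1 <> 0).
{ intros E. rewrite E in H1. unfold Rdiv in H1. rewrite Rmult_0_l, Rmult_0_r in H1. symmetry in H1; exact (R1_neq_R0 H1). }
replace (/ (exp x - 1)) with (scal (/ x) (PSeries b x)).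
- apply (is_series_ext (fun k => scal (/ x) (scal (pow_n x k) (b k)))).
  + intros k. rewrite pow_n_pow. unfold scal; simpl; unfold mult; simpl.
    fold (b k). unfold Z.sub. rewrite powerRZ_add by assumption.
    rewrite <- pow_powerRZ. simpl. field; assumption.
  + exact (is_series_scal (K := R_AbsRing) (V := R_NormedModule) (/ x) _ _ Hb).
- unfold scal; simpl; unfold mult; simpl.
  apply Rmult_eq_reg_r with (exp x - 1); [|assumption].
  rewrite Rinv_l by assumption.
  apply eq_trans with (PSeries b x * ((exp x - 1) / x)); [field; assumption|exact H1].
Qed.

(* Main.v *)
Require Import Defs.
From Stdlib Require Import Reals ZArith Lra Lia Ranalysis5 Classical.
From Coquelicot Require Import Coquelicot.
Open Scope R_scope.

(** Write b_j = B_j / j!, and let G be the given branch of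
    y |-> log (e^(-y); e^(-beta))_inf.
Since (e^(-y); q)_inf = (1 - e^(-y)) (q e^(-y); q)_inf with q = e^(-beta), the difference
G(y) - G(y + beta) is a logarithm of 1 - e^(-y).  Along a ray y + beta [0, oo) two continuous
logarithms of one function differ by a constant, and G vanishes at infinity, so the correct
logarithm is the one continued backwards along the ray from Re z > 0 ([log_qpoch_step_const],
[log_qpoch_step_pos], [log_qpoch_step]).  Thus G(y) is the sum of log (1 - e^(-z)) over the
points z = y + k beta, and the theorem becomes a statement on sums over arithmetic progressions.

Such sums are handled by the Euler-Maclaurin formula in the following form.  If each h_(j+1) is
the derivative of h_j, then A = b_0 h_0 + ... + b_N h_N satisfies
    A(s + 1) - A(s) = h_1(s) + O(sup |h_(N+1)|):
expand every h_j(s + 1) by Taylor's formula at s and use that the b_j invert the coefficients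
of (e^x - 1)/x ([euler_maclaurin_step]).  No integral is involved; h_0, an antiderivative of
h_1, takes its place.

If c = 0, the chain h_j(z) = (-1)^j Li_(2-j)(e^(-z)), each the derivative of the one before,
decays exponentially along the ray, and one application of the formula with step beta gives
the expansion ([expansion_c_eq_0]).

If c > 0, the ray starts at x beta^c = beta t with t = x beta^(c-1), and this point approaches
the singularity z = 0 of log (1 - e^(-z)) = log z + psi_1(z), where psi_1 is analytic in the
disc |z| < 1.  Cut the sum after K steps, K close to 1 / (4 |beta|).  In the first part, the terms
log (beta (t + k)) add up to K log beta + log Gamma(t + K) - log Gamma(t), and psi_1 is summed by
Euler-Maclaurin inside the disc.  The second part lies in a half plane Re z >= const > 0 and is
summed by Euler-Maclaurin with the polylogarithms.  At the point beta (t + K), where the parts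
meet, the polylogarithmic chain is the sum of the chain of z log z - z, of the psi_j and, for
j = 0, of pi^2/6 ([polylog_chain_overlap], [polylog_chain_0_overlap]).  So the psi terms of the
two parts cancel there, and the logarithmic terms cancel against Stirling's formula for
log Gamma(t + K).  What remains is
    G(beta t) = - pi^2/(6 beta) + (1/2 - t) log beta - log Gamma(t) + log(2 pi)/2
                - sum_(j <= N+1) b_j beta^(j-1) psi_j(beta t) + O(|beta|^N),
uniformly in t off the negative axis with beta t small ([log_qpoch_uniform_expansion]).
Expanding psi_j in powers of beta t produces the double sum of the statement
([double_sum_psi_coef], [log_qpoch_expansion]).

The three cases c > 0 differ only in what becomes of log Gamma(t).  If c < 1 then t tends to
infinity in a fixed direction off the negative axis, and Stirling's formula applies.
If c = 1 then t = x.  If c > 1 then t tends to 0, and log Gamma(t) is expanded there with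
coefficients Euler's constant and the zeta values ([log_Gamma_small]).  The given branches of
log x and log Gamma(x) are identified by continuity on their star-shaped domains
([log_branch_eq], [logGamma_eq]).

The constant pi^2/6 enters as Li_2(1); it is computed from the integrals of x^2 cos^(2n) x
([basel]).  The constant log(2 pi)/2 comes from Wallis' product ([factorial_defect_lim]). *)

(** * Curves in the complex plane and finite sums *)

Notation is_Cderive f z l :=
  (@is_derive C_AbsRing (AbsRing_NormedModule C_AbsRing) f z l).

Lemma Cplus_minus_l (z h : C) : (z + h - z)%C = h.
Proof. ring. Qed.

Lemma Cminus_plus_l (z y : C) : (z + (y - z))%C = y.
Proof. ring. Qed.

Lemma is_Cderive_iff (f : C -> C) (z l : C) :
  is_Cderive f z l <->
  forall eps, 0 < eps -> exists d, 0 < d /\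
    forall h, Cmod h < d -> Cmod (f (z + h) - f z - l * h)%C <= eps * Cmod h.
Proof.
split.
- intros [_ H] eps He.
  destruct (H z (fun P HP => HP) (mkposreal eps He)) as [d Hd].
  exists d. split; [apply cond_pos|]. intros h Hh.
  assert (B : ball (M := AbsRing_UniformSpace C_AbsRing) z d (z + h)%C).
  { change (Cmod ((z + h) - z)%C < d). now rewrite Cplus_minus_l. }
  specialize (Hd _ B).
  change (Cmod (f (z + h) - f z - ((z + h) - z) * l)%C <= eps * Cmod ((z + h) - z)%C) in Hd.
  rewrite Cplus_minus_l in Hd. now rewrite (Cmult_comm l h).
- intros H. split; [apply is_linear_scal_l|].
  intros x Hx.
  assert (E : z = x) by exact (is_filter_lim_locally_unique (K := C_AbsRing) (V := AbsRing_NormedModule C_AbsRing) _ _ Hx).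
  subst x. intros eps. destruct (H eps (cond_pos eps)) as [d [Hd0 Hd]].
  exists (mkposreal d Hd0). intros y Hy.
  change (Cmod (y - z)%C < d) in Hy. specialize (Hd _ Hy).
  change (Cmod (f y - f z - (y - z) * l)%C <= eps * Cmod (y - z)%C).
  rewrite Cminus_plus_l in Hd. now rewrite (Cmult_comm _ l).
Qed.

Lemma Cmod_minus_sym (a b : C) : Cmod (a - b)%C = Cmod (b - a)%C.
Proof. rewrite <- Cmod_opp. f_equal. ring. Qed.

Lemma Cmod_pos_re (z : C) : Re z <= Cmod z.
Proof. pose proof (re_le_Cmod z). pose proof (Rle_abs (Re z)). lra. Qed.

Lemma im_le_Cmod (z : C) : Rabs (Im z) <= Cmod z.
Proof. eapply Rle_trans; [apply Rmax_r|apply Rmax_Cmod]. Qed.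

Lemma Cmod_le_re_im (z : C) : Cmod z <= Rabs (Re z) + Rabs (Im z).
Proof.
destruct z as [x y]. unfold Cmod; simpl fst; simpl snd; simpl Re; simpl Im.
rewrite <- (sqrt_Rsqr (Rabs x + Rabs y)).
- apply sqrt_le_1_alt. unfold Rsqr.
  pose proof (Rabs_pos x). pose proof (Rabs_pos y).
  assert (x ^ 2 = Rabs x ^ 2) by (rewrite pow2_abs; reflexivity).
  assert (y ^ 2 = Rabs y ^ 2) by (rewrite pow2_abs; reflexivity). nra.
- pose proof (Rabs_pos x). pose proof (Rabs_pos y). lra.
Qed.

Lemma Cmod_triangle_sub (a b : C) : Cmod (a - b)%C <= Cmod a + Cmod b.
Proof. unfold Cminus. eapply Rle_trans; [apply Cmod_triangle|]. rewrite Cmod_opp; lra. Qed.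

Lemma Cmod_triangle_rev (a b : C) : Cmod a - Cmod b <= Cmod (a - b)%C.
Proof.
pose proof (Cmod_triangle (a - b)%C b) as H.
replace (a - b + b)%C with a in H by ring. lra.
Qed.

Lemma Cmod_RtoC_pos (x : R) : 0 <= x -> Cmod x = x.
Proof. intros H. rewrite Cmod_R. now apply Rabs_pos_eq. Qed.

(** Turning a complex number onto the positive axis reduces an estimate of its modulus to one of
    a real part, to which the real mean value theorem applies. *)
Lemma Cmod_rotation (z : C) :
  exists c : C, Cmod c <= 1 /\ Re (c * z)%C = Cmod z.
Proof.
destruct (Ceq_dec z 0) as [->|Hz].
- exists 0%R. rewrite Cmod_0, Cmult_0_l. split; [lra|reflexivity].
- exists (Cconj z / Cmod z)%C.
  assert (Hm : 0 < Cmod z) by now apply Cmod_gt_0.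
  assert (Hm' : RtoC (Cmod z) <> 0) by (intros E; apply RtoC_inj in E; lra).
  split.
  + rewrite Cmod_div by assumption. rewrite Cmod_conj, Cmod_RtoC_pos by lra.
    right; field; lra.
  + replace (Cconj z / Cmod z * z)%C with (RtoC (Cmod z)); [reflexivity|].
    replace (Cconj z / Cmod z * z)%C with (z * Cconj z / Cmod z)%C by (field; assumption).
    rewrite <- Cmod2_conj. rewrite RtoC_pow. field. assumption.
Qed.

(** The derivative of a curve, by components: mean value estimates for complex functions are
    taken along curves, where real calculus applies. *)
Definition curve_derive (f : R -> C) (s : R) (l : C) : Prop :=
  is_derive (fun u => Re (f u)) s (Re l) /\ is_derive (fun u => Im (f u)) s (Im l).

Lemma is_derive_eps (f : R -> R) (s l : R) :
  (forall eps, 0 < eps -> exists d, 0 < d /\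
    forall h, Rabs h < d -> Rabs (f (s + h) - f s - l * h) <= eps * Rabs h) ->
  is_derive f s l.
Proof.
intros H. apply is_derive_Reals. intros eps He.
destruct (H (eps / 2)) as [d [Hd Hh]]; [lra|].
exists (mkposreal d Hd). intros h Hh0 Hhd. simpl in Hhd.
specialize (Hh h Hhd).
replace ((f (s + h) - f s) / h - l) with ((f (s + h) - f s - l * h) / h) by (field; assumption).
unfold Rdiv at 1. rewrite Rabs_mult, Rabs_inv.
assert (0 < Rabs h) by now apply Rabs_pos_lt.
apply Rle_lt_trans with (eps / 2 * Rabs h * / Rabs h).
- apply Rmult_le_compat_r; [left; now apply Rinv_0_lt_compat|assumption].
- rewrite Rmult_assoc, Rinv_r by lra. lra.
Qed.

Lemma curve_derive_line (f : C -> C) (w b l : C) (s : R) :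
  is_Cderive f (w + RtoC s * b)%C l -> curve_derive (fun u => f (w + RtoC u * b)%C) s (l * b)%C.
Proof.
intros H. rewrite is_Cderive_iff in H.
assert (K : forall eps, 0 < eps -> exists d, 0 < d /\ forall h, Rabs h < d ->
   Cmod (f (w + RtoC (s + h) * b) - f (w + RtoC s * b) - l * b * RtoC h)%C <= eps * Rabs h).
{ intros eps He. pose proof (Cmod_ge_0 b) as Hb.
  destruct (H (eps / (Cmod b + 1))) as [d [Hd Hh]].
  { apply Rdiv_lt_0_compat; lra. }
  exists (d / (Cmod b + 1)). split; [apply Rdiv_lt_0_compat; lra|].
  intros h Hhd.
  assert (E : Cmod (RtoC h * b)%C = Rabs h * Cmod b) by now rewrite Cmod_mult, Cmod_R.
  pose proof (Rabs_pos h).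
  assert (Hlt : Rabs h * Cmod b < d).
  { apply Rle_lt_trans with (Rabs h * (Cmod b + 1)); [nra|].
    apply Rmult_lt_reg_r with (/ (Cmod b + 1)); [apply Rinv_0_lt_compat; lra|].
    rewrite Rmult_assoc, Rinv_r by lra. rewrite Rmult_1_r. exact Hhd. }
  rewrite <- E in Hlt. specialize (Hh _ Hlt). rewrite E in Hh.
  replace (w + RtoC (s + h) * b)%C with (w + RtoC s * b + RtoC h * b)%C
    by (rewrite RtoC_plus; ring).
  replace (l * b * RtoC h)%C with (l * (RtoC h * b))%C by ring.
  eapply Rle_trans; [exact Hh|].
  replace (eps / (Cmod b + 1) * (Rabs h * Cmod b)) with (eps * Rabs h * (Cmod b / (Cmod b + 1))) by (field; lra).
  rewrite <- (Rmult_1_r (eps * Rabs h)) at 2.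
  apply Rmult_le_compat_l; [nra|].
  apply Rmult_le_reg_r with (Cmod b + 1); [lra|]. unfold Rdiv.
  rewrite Rmult_assoc, Rinv_l; lra. }
split; apply is_derive_eps; intros eps He; destruct (K eps He) as [d [Hd Hh]];
  exists d; (split; [assumption|]); intros h Hhd; specialize (Hh h Hhd);
  eapply Rle_trans; try exact Hh.
- eapply Rle_trans; [|apply re_le_Cmod]. right; f_equal.
  unfold Re; simpl; ring.
- eapply Rle_trans; [|apply im_le_Cmod]. right; f_equal.
  unfold Im; simpl; ring.
Qed.

Lemma curve_derive_const (c : C) s : curve_derive (fun _ => c) s 0.
Proof.
split; [exact (is_derive_const (K := R_AbsRing) (V := R_NormedModule) (Re c) s)|].
exact (is_derive_const (K := R_AbsRing) (V := R_NormedModule) (Im c) s).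
Qed.

Lemma curve_derive_plus f g s l m : curve_derive f s l -> curve_derive g s m ->
  curve_derive (fun u => f u + g u)%C s (l + m)%C.
Proof.
intros [H1 H2] [H3 H4]. split.
- exact (is_derive_plus (K := R_AbsRing) (V := R_NormedModule) _ _ s _ _ H1 H3).
- exact (is_derive_plus (K := R_AbsRing) (V := R_NormedModule) _ _ s _ _ H2 H4).
Qed.

Lemma curve_derive_minus f g s l m : curve_derive f s l -> curve_derive g s m ->
  curve_derive (fun u => f u - g u)%C s (l - m)%C.
Proof.
intros [H1 H2] [H3 H4]. split.
- exact (is_derive_minus (K := R_AbsRing) (V := R_NormedModule) _ _ s _ _ H1 H3).
- exact (is_derive_minus (K := R_AbsRing) (V := R_NormedModule) _ _ s _ _ H2 H4).
Qed.

Lemma is_derive_mult_combo (a b c d : R -> R) (s e da db dc dd : R) :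
  is_derive a s da -> is_derive b s db -> is_derive c s dc -> is_derive d s dd ->
  is_derive (fun u => a u * b u + e * (c u * d u)) s
    (da * b s + a s * db + e * (dc * d s + c s * dd)).
Proof.
intros H1 H2 H3 H4.
apply (is_derive_plus (K := R_AbsRing) (V := R_NormedModule)).
- exact (is_derive_mult a b s da db H1 H2 Rmult_comm).
- exact (is_derive_scal _ s e _ (is_derive_mult c d s dc dd H3 H4 Rmult_comm)).
Qed.

Lemma curve_derive_mult f g s l m : curve_derive f s l -> curve_derive g s m ->
  curve_derive (fun u => f u * g u)%C s (l * g s + f s * m)%C.
Proof.
intros [H1 H2] [H3 H4]. split.
- apply (is_derive_ext (fun u => Re (f u) * Re (g u) + (-1) * (Im (f u) * Im (g u)))).
  { intros u. unfold Re, Im; simpl; ring. }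
  replace (Re (l * g s + f s * m)%C) with
    (Re l * Re (g s) + Re (f s) * Re m + (-1) * (Im l * Im (g s) + Im (f s) * Im m))
    by (unfold Re, Im; simpl; ring).
  now apply is_derive_mult_combo.
- apply (is_derive_ext (fun u => Re (f u) * Im (g u) + 1 * (Im (f u) * Re (g u)))).
  { intros u. unfold Re, Im; simpl; ring. }
  replace (Im (l * g s + f s * m)%C) with
    (Re l * Im (g s) + Re (f s) * Im m + 1 * (Im l * Re (g s) + Im (f s) * Re m))
    by (unfold Re, Im; simpl; ring).
  now apply is_derive_mult_combo.
Qed.

Lemma curve_derive_scal (c : C) f s l : curve_derive f s l -> curve_derive (fun u => c * f u)%C s (c * l)%C.
Proof.
intros H. replace (c * l)%C with (0 * f s + c * l)%C by ring.
apply (curve_derive_mult (fun _ => c) f s 0 l); [apply curve_derive_const|assumption].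
Qed.

Lemma curve_derive_Re_mult (c : C) f s l : curve_derive f s l -> is_derive (fun u => Re (c * f u)%C) s (Re (c * l)%C).
Proof. intros H. apply (curve_derive_scal c) in H. apply H. Qed.

Lemma curve_derive_ext f g s l : (forall u, f u = g u) -> curve_derive f s l -> curve_derive g s l.
Proof.
intros E [H1 H2]. split.
- apply (is_derive_ext (fun u => Re (f u))); [intros; now rewrite E|assumption].
- apply (is_derive_ext (fun u => Im (f u))); [intros; now rewrite E|assumption].
Qed.

(** The mean value equality fails for complex values.  The inequality follows from the real
    theorem for the real part of [c * f], where [c] rotates the increment onto the positive
    axis. *)
Lemma curve_derive_mean_value (f g : R -> C) (a b B : R) :
  a <= b ->
  (forall s, a <= s <= b -> curve_derive f s (g s)) ->
  (forall s, a <= s <= b -> Cmod (g s) <= B) ->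
  Cmod (f b - f a)%C <= B * (b - a).
Proof.
intros Hab Hd HB.
destruct (Cmod_rotation (f b - f a)%C) as [c [Hc E]].
destruct (MVT_gen (fun u => Re (c * f u)%C) a b (fun u => Re (c * g u)%C)) as [s [Hs Es]].
- intros x Hx. rewrite Rmin_left, Rmax_right in Hx by assumption.
  apply curve_derive_Re_mult, Hd. lra.
- intros x Hx. rewrite Rmin_left, Rmax_right in Hx by assumption.
  apply derivable_continuous_pt. exists (Re (c * g x)%C). apply is_derive_Reals, curve_derive_Re_mult, Hd. lra.
- rewrite Rmin_left, Rmax_right in Hs by assumption.
  replace (Re (c * (f b - f a))%C) with (Re (c * f b)%C - Re (c * f a)%C) in E by (unfold Re; simpl; ring).
  rewrite <- E, Es. apply Rmult_le_compat_r; [lra|].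
  eapply Rle_trans; [apply Cmod_pos_re|]. rewrite Cmod_mult.
  specialize (HB s Hs). pose proof (Cmod_ge_0 (g s)). pose proof (Cmod_ge_0 c). nra.
Qed.

Lemma curve_derive_zero_const (f : R -> C) (a b : R) : a <= b ->
  (forall s, a <= s <= b -> curve_derive f s 0) -> f b = f a.
Proof.
intros Hab H. apply Ceq_minus, Cmod_eq_0.
pose proof (curve_derive_mean_value f (fun _ => RtoC 0) a b 0 Hab H) as K.
pose proof (Cmod_ge_0 (f b - f a)%C).
assert (Cmod (f b - f a)%C <= 0 * (b - a)) by (apply K; intros; rewrite Cmod_0; lra). lra.
Qed.

Fixpoint csum (n : nat) (u : nat -> C) : C :=
  match n with O => RtoC 0 | S m => (csum m u + u m)%C end.

Lemma csum_ext n u v : (forall k, (k < n)%nat -> u k = v k) -> csum n u = csum n v.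
Proof. induction n; simpl; intros H; [reflexivity|]. rewrite IHn, H; auto. Qed.

Lemma csum_plus n u v : csum n (fun k => u k + v k)%C = (csum n u + csum n v)%C.
Proof. induction n; simpl; [ring|]. rewrite IHn; ring. Qed.

Lemma csum_minus n u v : csum n (fun k => u k - v k)%C = (csum n u - csum n v)%C.
Proof. induction n; simpl; [ring|]. rewrite IHn; ring. Qed.

Lemma csum_scal n c u : csum n (fun k => c * u k)%C = (c * csum n u)%C.
Proof. induction n; simpl; [ring|]. rewrite IHn; ring. Qed.

Lemma csum_zero n (u : nat -> C) : (forall k, (k < n)%nat -> u k = RtoC 0) -> csum n u = RtoC 0.
Proof. induction n; simpl; intros H; [reflexivity|]. rewrite IHn, H; auto. ring. Qed.

Lemma csum_add n m u : csum (n + m) u = (csum n u + csum m (fun k => u (n + k)%nat))%C.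
Proof. induction m; [rewrite Nat.add_0_r; simpl; ring|]. rewrite Nat.add_succ_r; simpl. rewrite IHm. ring. Qed.

Lemma csum_S_l n u : csum (S n) u = (u 0%nat + csum n (fun k => u (S k)))%C.
Proof. change (S n) with (1 + n)%nat. rewrite csum_add. simpl. ring. Qed.

Lemma csum_telescope n u : csum n (fun k => u (S k) - u k)%C = (u n - u 0%nat)%C.
Proof. induction n; simpl; [ring|]. rewrite IHn; ring. Qed.

Lemma Cmod_csum_const n u B : (forall k, (k < n)%nat -> Cmod (u k) <= B) ->
  Cmod (csum n u) <= INR n * B.
Proof.
induction n; intros H; simpl csum.
- rewrite Cmod_0; simpl; lra.
- rewrite S_INR. eapply Rle_trans; [apply Cmod_triangle|].
  assert (Cmod (u n) <= B) by (apply H; lia).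
  assert (Cmod (csum n u) <= INR n * B) by (apply IHn; intros; apply H; lia). lra.
Qed.

Lemma Csum_csum n u : Csum 0 n u = csum (S n) u.
Proof.
unfold Csum. induction n.
- rewrite sum_n_n. simpl. ring.
- rewrite sum_n_Sm by lia. rewrite IHn. reflexivity.
Qed.

Lemma Csum_csum_from a n u : Csum a n u = csum (S n - a) (fun k => u (a + k)%nat).
Proof.
unfold Csum. destruct (Nat.le_gt_cases a n) as [H|H].
- revert a u H. induction n; intros a u H.
  + replace a with 0%nat by lia. rewrite sum_n_n. simpl. ring.
  + destruct (Nat.eq_dec a (S n)) as [->|Ha].
    * rewrite sum_n_n. replace (S (S n) - S n)%nat with 1%nat by lia. simpl.
      rewrite Nat.add_0_r. ring.
    * rewrite sum_n_Sm by lia. rewrite IHn by lia.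
      replace (S (S n) - a)%nat with (S (S n - a)) by lia.
      remember (S n - a)%nat as q eqn:Eq. simpl csum.
      replace (a + q)%nat with (S n) by lia. reflexivity.
- rewrite sum_n_m_zero by lia. replace (S n - a)%nat with 0%nat by lia. reflexivity.
Qed.

(** * The Euler-Maclaurin step *)

Lemma curve_derive_monomial (a x : R) (i : nat) (c : C) :
  curve_derive (fun s => RtoC ((s - a) ^ S i / INR (fact (S i))) * c)%C x
       (RtoC ((x - a) ^ i / INR (fact i)) * c)%C.
Proof.
assert (H : is_derive (fun s => (s - a) ^ S i / INR (fact (S i))) x ((x - a) ^ i / INR (fact i))).
{ assert (EK : INR (fact (S i)) = INR (S i) * INR (fact i)) by (rewrite fact_simpl, mult_INR; reflexivity).
  set (K := INR (fact (S i))) in *.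
  auto_derive; [trivial|]. rewrite EK.
  replace (match i with | 0%nat => 1 | S _ => INR i + 1 end) with (INR (S i)) by reflexivity.
  replace (x + - a) with (x - a) by ring. simpl Nat.pred. pose proof (INR_fact_neq_0 i). pose proof (not_0_INR (S i) ltac:(lia)) as Hi. set (q := INR (S i)) in *. field. auto. }
assert (K : curve_derive (fun s => RtoC ((s - a) ^ S i / INR (fact (S i)))) x (RtoC ((x - a) ^ i / INR (fact i)))).
{ split; [exact H|]. exact (is_derive_const (K := R_AbsRing) (V := R_NormedModule) 0 x). }
pose proof (curve_derive_mult _ _ _ _ _ K (curve_derive_const c x)) as L.
cbv beta in L.
match type of L with curve_derive _ _ ?l => replace (RtoC ((x - a) ^ i / INR (fact i)) * c)%C with l by ring end.
exact L.
Qed.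

Lemma curve_derive_taylor_poly (a x : R) (m : nat) (c : nat -> C) :
  curve_derive (fun s => csum (S m) (fun i => RtoC ((s - a) ^ i / INR (fact i)) * c i)%C) x
       (csum m (fun i => RtoC ((x - a) ^ i / INR (fact i)) * c (S i))%C).
Proof.
induction m.
- simpl. apply (curve_derive_ext (fun _ => 0 + RtoC (1 / 1) * c 0%nat)%C); [reflexivity|apply curve_derive_const].
- change (csum (S m) ?u) with (csum m u + u m)%C.
  apply (curve_derive_ext (fun s => csum (S m) (fun i => RtoC ((s - a) ^ i / INR (fact i)) * c i) +
     RtoC ((s - a) ^ S m / INR (fact (S m))) * c (S m))%C); [reflexivity|].
  apply curve_derive_plus; [exact IHm|]. apply curve_derive_monomial.
Qed.

(** Taylor's formula for all members of a chain of derivatives at once, by induction on the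
    number of terms: the remainder of [f j] has the remainder of [f (S j)] as its derivative and
    vanishes at [a], so the mean value inequality carries the bound upwards.  Bounding the
    length of the interval by 1 instead of integrating gives [B] itself. *)
Lemma taylor_curve (f : nat -> R -> C) (a B : R) (N : nat) :
  (forall j s, (j < N)%nat -> a <= s <= a + 1 -> curve_derive (f j) s (f (S j) s)) ->
  (forall s, a <= s <= a + 1 -> Cmod (f N s) <= B) ->
  forall m j, (j + m = N)%nat -> forall x, a <= x <= a + 1 ->
  Cmod (f j x - csum m (fun i => RtoC ((x - a) ^ i / INR (fact i)) * f (j + i)%nat a))%C <= B.
Proof.
intros Hd HB m. induction m; intros j Hj x Hx.
- simpl. rewrite Nat.add_0_r in Hj. subst j.
  replace (f N x - 0)%C with (f N x) by ring. now apply HB.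
(* The remainder of order S m of f j, as a function of the end point. *)
- set (E := fun x => (f j x - csum (S m) (fun i => RtoC ((x - a) ^ i / INR (fact i)) * f (j + i)%nat a))%C).
  assert (Ea : E a = 0).
  { unfold E. rewrite csum_S_l. rewrite csum_zero.
    - rewrite Nat.add_0_r. simpl pow. simpl INR. replace (1 / 1) with 1 by field. ring.
    - intros k _. rewrite Rminus_diag by reflexivity. rewrite pow_ne_zero by lia.
      unfold Rdiv; rewrite Rmult_0_l. ring. }
  assert (HB0 : 0 <= B) by (eapply Rle_trans; [apply Cmod_ge_0|apply (HB a); lra]).
  assert (K : Cmod (E x - E a)%C <= B * (x - a)).
  { apply (curve_derive_mean_value E (fun s => f (S j) s - csum m (fun i => RtoC ((s - a) ^ i / INR (fact i)) * f (S j + i)%nat a))%C); [lra| |].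
    - intros s Hs. unfold E. apply curve_derive_minus; [apply Hd; [lia|lra]|].
      apply (curve_derive_ext (fun u => csum (S m) (fun i => RtoC ((u - a) ^ i / INR (fact i)) * (fun i => f (j + i)%nat a) i)%C)); [reflexivity|].
      replace (csum m (fun i => RtoC ((s - a) ^ i / INR (fact i)) * f (S j + i)%nat a)%C) with
        (csum m (fun i => RtoC ((s - a) ^ i / INR (fact i)) * (fun i => f (j + i)%nat a) (S i))%C).
      + apply curve_derive_taylor_poly.
      + apply csum_ext; intros k _. now replace (j + S k)%nat with (S j + k)%nat by lia.
    - intros s Hs. apply IHm; [lia|lra]. }
  rewrite Ea in K. replace (E x - 0)%C with (E x) in K by ring.
  unfold E in K. eapply Rle_trans; [exact K|]. nra.
Qed.

(** These are the coefficients of x / (e^x - 1). *)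
Definition bern_div_fact (j : nat) : R := bern_coef j j.

Lemma bern_div_fact_bernoulli j : bern_div_fact j = bernoulli j / INR (fact j).
Proof. unfold bernoulli, bern_div_fact. field. apply INR_fact_neq_0. Qed.

Lemma bern_div_fact_bound j : Rabs (bern_div_fact j) <= 1.
Proof. now apply bern_coef_bound. Qed.

Lemma bern_div_fact_0 : bern_div_fact 0 = 1.
Proof. reflexivity. Qed.

Lemma bern_div_fact_1 : bern_div_fact 1 = - / 2.
Proof. unfold bern_div_fact. simpl. rewrite sum_O. simpl. field. Qed.

Lemma RtoC_csum n (u : nat -> R) : csum (S n) (fun k => RtoC (u k)) = RtoC (sum_n u n).
Proof.
induction n.
- simpl. rewrite sum_O. ring.
- rewrite sum_Sn. change (csum (S (S n)) ?v) with (csum (S n) v + v (S n))%C.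
  rewrite IHn. unfold plus; simpl. now rewrite RtoC_plus.
Qed.

Lemma bern_div_fact_cauchy n :
  csum (S n) (fun j => RtoC (bern_div_fact j / INR (fact (S n - j)))) = RtoC (if (n =? 0)%nat then 1 else 0).
Proof.
rewrite RtoC_csum. f_equal. rewrite <- bernoulli_cauchy.
apply sum_n_ext; intros j. now rewrite bern_div_fact_bernoulli.
Qed.

(** The operators D / (e^D - 1) and (e^D - 1) / D are inverse to each other: if [c] lists the
    derivatives of a polynomial at a point, the inner sum is the difference of the [j]-th one
    over a unit step.  Raising [N] by one adds a multiple of a Cauchy coefficient of the product
    1. *)
Lemma bern_div_fact_taylor_inversion (c : nat -> C) (N : nat) :
  csum (S (S N)) (fun j => RtoC (bern_div_fact j) * csum (S N - j) (fun i => RtoC (/ INR (fact (S i))) * c (j + S i)%nat))%C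
  = c 1%nat.
Proof.
(* The last term of each inner sum contributes to c (S N), with the Cauchy coefficient of index N. *)
assert (R : forall N, csum (S (S N)) (fun j => RtoC (bern_div_fact j) * csum (S N - j) (fun i => RtoC (/ INR (fact (S i))) * c (j + S i)%nat))%C
  = (csum (S N) (fun j => RtoC (bern_div_fact j) * csum (N - j) (fun i => RtoC (/ INR (fact (S i))) * c (j + S i)%nat))
     + c (S N) * RtoC (if (N =? 0)%nat then 1 else 0))%C).
{ clear N. intros N. rewrite <- bern_div_fact_cauchy, <- csum_scal.
  rewrite <- csum_plus.
  change (csum (S (S N)) ?v) with (csum (S N) v + v (S N))%C. cbv beta.
  rewrite Nat.sub_diag. change (csum 0 ?v) with (RtoC 0). rewrite Cmult_0_r, Cplus_0_r.
  apply csum_ext. intros j Hj.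
  replace (S N - j)%nat with (S (N - j)) by lia.
  change (csum (S (N - j)) ?v) with (csum (N - j) v + v (N - j)%nat)%C. cbv beta.
  replace (j + S (N - j))%nat with (S N) by lia.
  unfold Rdiv. rewrite RtoC_mult. ring. }
induction N.
- rewrite R. simpl. rewrite bern_div_fact_0. ring.
- rewrite R, IHN. simpl. ring.
Qed.

(** Replace each difference [f j (a + 1) - f j a] by its Taylor polynomial; the polynomials
    combine to [f 1 a] by [bern_div_fact_taylor_inversion], and each remainder is at most
    [B]. *)
Lemma euler_maclaurin_step (f : nat -> R -> C) (a B : R) (N : nat) :
  (forall j s, (j < S (S N))%nat -> a <= s <= a + 1 -> curve_derive (f j) s (f (S j) s)) ->
  (forall s, a <= s <= a + 1 -> Cmod (f (S (S N)) s) <= B) ->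
  Cmod (csum (S (S N)) (fun j => RtoC (bern_div_fact j) * (f j (a + 1)%R - f j a)) - f 1%nat a)%C
   <= INR (S (S N)) * B.
Proof.
intros Hd HB.
rewrite <- (bern_div_fact_taylor_inversion (fun m => f m a) N).
rewrite <- csum_minus. apply Cmod_csum_const. intros j Hj.
pose proof (taylor_curve f a B (S (S N)) Hd HB (S (S N - j)) j ltac:(lia) (a + 1) ltac:(lra)) as T.
rewrite csum_S_l in T.
replace (a + 1 - a) with 1 in T by ring.
rewrite Nat.add_0_r in T. simpl pow in T. simpl (INR (fact 0)) in T.
replace (1 / 1) with 1 in T by field. rewrite Cmult_1_l in T.
match goal with |- Cmod ?z <= _ => replace z with
  (RtoC (bern_div_fact j) * (f j (a + 1)%R - (f j a + csum (S N - j)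
    (fun k : nat => RtoC (1 * 1 ^ k / INR (fact (S k))) * f (j + S k)%nat a))))%C end.
- rewrite Cmod_mult, Cmod_R. pose proof (bern_div_fact_bound j).
  set (X := Cmod _) in *. assert (0 <= X) by apply Cmod_ge_0.
  pose proof (Rabs_pos (bern_div_fact j)). nra.
- rewrite (csum_ext _ (fun k : nat => (RtoC (1 * 1 ^ k / INR (fact (S k))) * f (j + S k)%nat a)%C)
    (fun i : nat => (RtoC (/ INR (fact (S i))) * f (j + S i)%nat a)%C)); [ring|].
  intros k _. rewrite pow1. do 2 f_equal. unfold Rdiv; ring.
Qed.

Definition em_sum (N : nat) (f : nat -> R -> C) (s : R) : C :=
  csum (S N) (fun j => RtoC (bern_div_fact j) * f j s)%C.

Definition em_err (N : nat) (f : nat -> R -> C) (s : R) : C :=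
  (em_sum N f (s + 1)%R - em_sum N f s - f 1%nat s)%C.

Lemma em_err_bound (f : nat -> R -> C) (a B : R) (N : nat) :
  (forall j s, (j < S (S N))%nat -> a <= s <= a + 1 -> curve_derive (f j) s (f (S j) s)) ->
  (forall s, a <= s <= a + 1 -> Cmod (f (S (S N)) s) <= B) ->
  Cmod (em_err (S N) f a) <= INR (S (S N)) * B.
Proof.
intros Hd HB. eapply Rle_trans; [|apply (euler_maclaurin_step f a B N Hd HB)].
right. f_equal. unfold em_err, em_sum. rewrite <- csum_minus. f_equal.
apply csum_ext; intros; ring.
Qed.

Lemma em_sum_telescope N f n :
  csum n (fun k => f 1%nat (INR k)) =
  (em_sum N f (INR n) - em_sum N f 0 - csum n (fun k => em_err N f (INR k)))%C.
Proof.
induction n.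
- simpl. ring.
- change (csum (S n) ?v) with (csum n v + v n)%C. rewrite IHn. unfold em_err.
  rewrite S_INR. change (csum (S n) ?v) with (csum n v + v n)%C. cbv beta. ring.
Qed.

(** * Series and limits of complex numbers *)

Lemma ex_series_scal_R (c : R) (u : nat -> R) : ex_series u -> ex_series (fun n => c * u n).
Proof. exact (ex_series_scal (K := R_AbsRing) (V := R_NormedModule) c u). Qed.

Lemma ex_series_shift (u : nat -> R) n : ex_series u -> ex_series (fun k => u (n + k)%nat).
Proof. exact (proj1 (ex_series_incr_n (K := R_AbsRing) (V := R_NormedModule) u n)). Qed.

Lemma ex_series_dominated (u B : nat -> R) : (forall n, Rabs (u n) <= B n) -> ex_series B -> ex_series u.
Proof. exact (ex_series_le (K := R_AbsRing) (V := R_CompleteNormedModule) u B). Qed.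

Lemma is_series_zero : is_series (fun _ : nat => 0) 0.
Proof.
apply filterlim_ext with (fun _ => 0); [|apply filterlim_const].
intros n. rewrite sum_n_const. ring.
Qed.

Lemma ex_series_zero : ex_series (fun _ : nat => 0).
Proof. exists 0. apply is_series_zero. Qed.

(** Summation by components is a total function; its value is meaningful for absolutely summable
    sequences. *)
Definition CSeries (u : nat -> C) : C := (Series (fun n => Re (u n)), Series (fun n => Im (u n))).

Definition Csummable (u : nat -> C) : Prop := ex_series (fun n => Cmod (u n)).

Lemma Csummable_Re_abs u : Csummable u -> ex_series (fun n => Rabs (Re (u n))).
Proof.
intros H. apply (ex_series_dominated _ (fun n => Cmod (u n))); [|exact H].
intros n. rewrite Rabs_Rabsolu. apply re_le_Cmod.
Qed.

Lemma Csummable_Im_abs u : Csummable u -> ex_series (fun n => Rabs (Im (u n))).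
Proof.
intros H. apply (ex_series_dominated _ (fun n => Cmod (u n))); [|exact H].
intros n. rewrite Rabs_Rabsolu. apply im_le_Cmod.
Qed.

Lemma Csummable_Re u : Csummable u -> ex_series (fun n => Re (u n)).
Proof. intros H. now apply ex_series_Rabs, Csummable_Re_abs. Qed.
Lemma Csummable_Im u : Csummable u -> ex_series (fun n => Im (u n)).
Proof. intros H. now apply ex_series_Rabs, Csummable_Im_abs. Qed.

Lemma Csummable_le u (B : nat -> R) : (forall n, Cmod (u n) <= B n) -> ex_series B -> Csummable u.
Proof.
intros H HB. apply (ex_series_dominated _ B); [|exact HB].
intros n. rewrite Rabs_pos_eq by apply Cmod_ge_0. apply H.
Qed.

Lemma CSeries_ext u v : (forall n, u n = v n) -> CSeries u = CSeries v.
Proof. intros H. unfold CSeries. f_equal; apply Series_ext; intros; now rewrite H. Qed.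

Lemma Csummable_ext u v : (forall n, u n = v n) -> Csummable u -> Csummable v.
Proof. intros H. apply ex_series_ext. intros; now rewrite H. Qed.

Lemma Csummable_plus u v : Csummable u -> Csummable v -> Csummable (fun n => u n + v n)%C.
Proof.
intros H1 H2. apply (Csummable_le _ (fun n => Cmod (u n) + Cmod (v n))).
- intros n. apply Cmod_triangle.
- exact (ex_series_plus (K := R_AbsRing) (V := R_NormedModule) _ _ H1 H2).
Qed.

Lemma Csummable_scal c u : Csummable u -> Csummable (fun n => c * u n)%C.
Proof.
intros H. apply (Csummable_le _ (fun n => Cmod c * Cmod (u n))).
- intros n. right. apply Cmod_mult.
- exact (ex_series_scal_R (Cmod c) _ H).
Qed.

Lemma Csummable_minus u v : Csummable u -> Csummable v -> Csummable (fun n => u n - v n)%C.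
Proof.
intros H1 H2. apply (Csummable_ext (fun n => u n + (-(1)) * v n)%C); [intros; ring|].
apply Csummable_plus, Csummable_scal; assumption.
Qed.

Lemma CSeries_plus u v : Csummable u -> Csummable v ->
  CSeries (fun n => u n + v n)%C = (CSeries u + CSeries v)%C.
Proof.
intros H1 H2. unfold CSeries, Cplus; simpl. f_equal.
- rewrite <- Series_plus by now apply Csummable_Re. now apply Series_ext.
- rewrite <- Series_plus by now apply Csummable_Im. now apply Series_ext.
Qed.

Lemma CSeries_scal c u : Csummable u -> CSeries (fun n => c * u n)%C = (c * CSeries u)%C.
Proof.
intros H. unfold CSeries, Cmult; simpl.
pose proof (Csummable_Re _ H) as HR. pose proof (Csummable_Im _ H) as HI.
f_equal.
- rewrite <- !Series_scal_l, <- Series_minus by now apply ex_series_scal_R. now apply Series_ext.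
- rewrite <- !Series_scal_l, <- Series_plus by now apply ex_series_scal_R. now apply Series_ext.
Qed.

Lemma CSeries_minus u v : Csummable u -> Csummable v ->
  CSeries (fun n => u n - v n)%C = (CSeries u - CSeries v)%C.
Proof.
intros H1 H2. rewrite (CSeries_ext _ (fun n => u n + (-(1)) * v n)%C) by (intros; ring).
rewrite CSeries_plus, CSeries_scal by (try apply Csummable_scal; assumption). ring.
Qed.

Lemma Csummable_incr u : Csummable u -> Csummable (fun n => u (S n)).
Proof. intros H. unfold Csummable in *. now apply -> (ex_series_incr_1 (K := R_AbsRing) (V := R_NormedModule) (fun n => Cmod (u n))). Qed.

Lemma Csummable_decr u : Csummable (fun n => u (S n)) -> Csummable u.
Proof. intros H. unfold Csummable in *. now apply <- (ex_series_incr_1 (K := R_AbsRing) (V := R_NormedModule) (fun n => Cmod (u n))). Qed.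

Lemma CSeries_incr u : Csummable u -> CSeries u = (u 0%nat + CSeries (fun n => u (S n)))%C.
Proof.
intros H. unfold CSeries, Cplus; simpl. f_equal.
- apply Series_incr_1. now apply Csummable_Re.
- apply Series_incr_1. now apply Csummable_Im.
Qed.

Lemma Csummable_incr_n n u : Csummable u -> Csummable (fun k => u (n + k)%nat).
Proof.
intros H. induction n; [exact H|].
apply Csummable_incr in IHn. revert IHn. apply Csummable_ext. intros k. f_equal; lia.
Qed.

Lemma CSeries_incr_n n u : Csummable u -> CSeries u = (csum n u + CSeries (fun k => u (n + k)%nat))%C.
Proof.
intros H. induction n.
- simpl. change (CSeries (fun k => u k)) with (CSeries u). ring.
- rewrite IHn, (CSeries_incr (fun k => u (n + k)%nat)) by now apply Csummable_incr_n.
  simpl csum. rewrite Nat.add_0_r.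
  rewrite (CSeries_ext (fun k => u (n + S k)%nat) (fun k => u (S n + k)%nat)) by (intros; f_equal; lia). ring.
Qed.

Lemma Cmod_CSeries_le u : Csummable u -> Cmod (CSeries u) <= Series (fun n => Cmod (u n)).
Proof.
intros H. destruct (Cmod_rotation (CSeries u)) as [c [Hc E]].
rewrite <- E, <- CSeries_scal by assumption. unfold CSeries at 1. simpl.
apply Rle_trans with (Rabs (Series (fun n => Re (c * u n)%C))); [apply Rle_abs|].
eapply Rle_trans; [apply Series_Rabs, Csummable_Re_abs, Csummable_scal, H|].
apply Series_le; [|exact H]. intros n. split; [apply Rabs_pos|].
eapply Rle_trans; [apply re_le_Cmod|]. rewrite Cmod_mult.
pose proof (Cmod_ge_0 (u n)). nra.
Qed.

Lemma Cmod_CSeries_bound u (B : nat -> R) : (forall n, Cmod (u n) <= B n) -> ex_series B ->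
  Cmod (CSeries u) <= Series B.
Proof.
intros H HB. eapply Rle_trans; [apply Cmod_CSeries_le, (Csummable_le u B H HB)|].
apply Series_le; [|exact HB]. intros n; split; [apply Cmod_ge_0|apply H].
Qed.

Lemma RtoC_CSeries (u : nat -> R) : CSeries (fun n => RtoC (u n)) = RtoC (Series u).
Proof.
unfold CSeries. apply injective_projections; simpl; [reflexivity|].
exact (is_series_unique _ _ is_series_zero).
Qed.

Definition Clim (u : nat -> C) (l : C) : Prop :=
  forall eps, 0 < eps -> exists N, forall n, (N <= n)%nat -> Cmod (u n - l)%C < eps.

Lemma Clim_unique u l m : Clim u l -> Clim u m -> l = m.
Proof.
intros H1 H2. apply Ceq_minus, Cmod_eq_0.
destruct (Rle_lt_or_eq_dec 0 (Cmod (l - m)%C) (Cmod_ge_0 _)) as [H|H]; [|easy].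
destruct (H1 (Cmod (l - m)%C / 2)) as [N1 K1]; [lra|].
destruct (H2 (Cmod (l - m)%C / 2)) as [N2 K2]; [lra|].
specialize (K1 (N1 + N2)%nat ltac:(lia)). specialize (K2 (N1 + N2)%nat ltac:(lia)).
rewrite Cmod_minus_sym in K1.
pose proof (Cmod_triangle (l - u (N1 + N2)%nat)%C (u (N1 + N2)%nat - m)%C) as T.
replace (l - u (N1 + N2)%nat + (u (N1 + N2)%nat - m))%C with (l - m)%C in T by ring. lra.
Qed.

Lemma Clim_const c : Clim (fun _ => c) c.
Proof. intros e He. exists 0%nat. intros. replace (c - c)%C with (RtoC 0) by ring. now rewrite Cmod_0. Qed.

Lemma Clim_ext u v l : (forall n, u n = v n) -> Clim u l -> Clim v l.
Proof. intros E H e He. destruct (H e He) as [N K]. exists N. intros n Hn. rewrite <- E. auto. Qed.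

Lemma Clim_plus u v l m : Clim u l -> Clim v m -> Clim (fun n => u n + v n)%C (l + m)%C.
Proof.
intros H1 H2 e He. destruct (H1 (e / 2)) as [N1 K1]; [lra|]. destruct (H2 (e / 2)) as [N2 K2]; [lra|].
exists (N1 + N2)%nat. intros n Hn.
replace (u n + v n - (l + m))%C with ((u n - l) + (v n - m))%C by ring.
eapply Rle_lt_trans; [apply Cmod_triangle|].
specialize (K1 n ltac:(lia)). specialize (K2 n ltac:(lia)). lra.
Qed.

Lemma Clim_scal c u l : Clim u l -> Clim (fun n => c * u n)%C (c * l)%C.
Proof.
intros H e He. pose proof (Cmod_ge_0 c).
destruct (H (e / (Cmod c + 1))) as [N K]; [apply Rdiv_lt_0_compat; lra|].
exists N. intros n Hn. replace (c * u n - c * l)%C with (c * (u n - l))%C by ring.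
rewrite Cmod_mult. specialize (K n Hn). pose proof (Cmod_ge_0 (u n - l)%C).
apply Rle_lt_trans with ((Cmod c + 1) * Cmod (u n - l)%C); [nra|].
apply Rlt_le_trans with ((Cmod c + 1) * (e / (Cmod c + 1))); [nra|]. right; field; lra.
Qed.

Lemma Clim_minus u v l m : Clim u l -> Clim v m -> Clim (fun n => u n - v n)%C (l - m)%C.
Proof.
intros H1 H2. replace (l - m)%C with (l + (-(1)) * m)%C by ring.
apply (Clim_ext (fun n => u n + (-(1)) * v n)%C); [intros; ring|].
apply Clim_plus; [assumption|now apply Clim_scal].
Qed.

Lemma Clim_0_le u (B : nat -> R) : (forall n, Cmod (u n) <= B n) -> is_lim_seq B 0 -> Clim u 0.
Proof.
intros H HB e He. apply is_lim_seq_spec in HB. destruct (HB (mkposreal e He)) as [N K].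
exists N. intros n Hn. specialize (K n Hn). simpl in K. rewrite Rminus_0_r in K.
replace (u n - 0)%C with (u n) by ring. specialize (H n). pose proof (Rle_abs (B n)). lra.
Qed.

Lemma Clim_incr u l : Clim u l -> Clim (fun n => u (S n)) l.
Proof. intros H e He. destruct (H e He) as [N K]. exists N. intros n Hn. apply K. lia. Qed.

Lemma Clim_le u l B : Clim u l -> (forall n, Cmod (u n) <= B) -> Cmod l <= B.
Proof.
intros H HB. destruct (Rle_lt_dec (Cmod l) B) as [K|K]; [exact K|].
destruct (H (Cmod l - B)) as [N HN]; [lra|]. specialize (HN N (le_n N)). specialize (HB N).
rewrite Cmod_minus_sym in HN. pose proof (Cmod_triangle_rev l (u N)). lra.
Qed.

Lemma Clim_ReIm u l : is_lim_seq (fun n => Re (u n)) (Re l) -> is_lim_seq (fun n => Im (u n)) (Im l) -> Clim u l.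
Proof.
intros H1 H2 e He. apply is_lim_seq_spec in H1. apply is_lim_seq_spec in H2.
assert (He2 : 0 < e / 2) by lra.
destruct (H1 (mkposreal _ He2)) as [N1 K1]. destruct (H2 (mkposreal _ He2)) as [N2 K2].
exists (N1 + N2)%nat. intros n Hn. eapply Rle_lt_trans; [apply Cmod_le_re_im|].
specialize (K1 n ltac:(lia)). specialize (K2 n ltac:(lia)). simpl in K1, K2.
unfold Re, Im in *; simpl in *. unfold Rminus in *. lra.
Qed.

Lemma Clim_csum u : Csummable u -> Clim (fun n => csum n u) (CSeries u).
Proof.
intros H.
assert (S1 : forall n, csum (S n) u = (sum_n (fun k => Re (u k)) n, sum_n (fun k => Im (u k)) n)).
{ induction n.
  - rewrite !sum_O. simpl. destruct (u 0%nat). unfold Cplus, Re, Im; simpl. f_equal; ring.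
  - change (csum (S (S n)) u) with (csum (S n) u + u (S n))%C. rewrite IHn, !sum_Sn. reflexivity. }
assert (L : Clim (fun n => csum (S n) u) (CSeries u)).
{ apply Clim_ReIm.
  - apply (is_lim_seq_ext (sum_n (fun k => Re (u k)))); [intros n; now rewrite S1|].
    exact (Series_correct _ (Csummable_Re _ H)).
  - apply (is_lim_seq_ext (sum_n (fun k => Im (u k)))); [intros n; now rewrite S1|].
    exact (Series_correct _ (Csummable_Im _ H)). }
intros e He. destruct (L e He) as [N K]. exists (S N). intros n Hn. destruct n; [lia|]. apply K. lia.
Qed.

Definition cauchy_prod (u v : nat -> C) (n : nat) : C := csum (S n) (fun k => u k * v (n - k)%nat)%C.

Lemma csum_Re n u : Re (csum (S n) u) = sum_f_R0 (fun k => Re (u k)) n.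
Proof. induction n; [simpl; unfold Re; simpl; ring|]. change (csum (S (S n)) u) with (csum (S n) u + u (S n))%C. simpl sum_f_R0. rewrite <- IHn. reflexivity. Qed.
Lemma csum_Im n u : Im (csum (S n) u) = sum_f_R0 (fun k => Im (u k)) n.
Proof. induction n; [simpl; unfold Im; simpl; ring|]. change (csum (S (S n)) u) with (csum (S n) u + u (S n))%C. simpl sum_f_R0. rewrite <- IHn. reflexivity. Qed.

(** Mertens' theorem for the four real products of components. *)
Lemma CSeries_cauchy_prod u v : Csummable u -> Csummable v ->
  CSeries (cauchy_prod u v) = (CSeries u * CSeries v)%C.
Proof.
intros Hu Hv.
pose proof (Series_correct _ (Csummable_Re _ Hu)) as a1. pose proof (Series_correct _ (Csummable_Im _ Hu)) as a2.
pose proof (Series_correct _ (Csummable_Re _ Hv)) as b1. pose proof (Series_correct _ (Csummable_Im _ Hv)) as b2.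
pose proof (Csummable_Re_abs _ Hu) as A1. pose proof (Csummable_Im_abs _ Hu) as A2.
pose proof (Csummable_Re_abs _ Hv) as B1. pose proof (Csummable_Im_abs _ Hv) as B2.
pose proof (is_series_mult _ _ _ _ a1 b1 A1 B1) as RR.
pose proof (is_series_mult _ _ _ _ a2 b2 A2 B2) as II.
pose proof (is_series_mult _ _ _ _ a1 b2 A1 B2) as RI.
pose proof (is_series_mult _ _ _ _ a2 b1 A2 B1) as IR.
unfold CSeries at 1, Cmult. simpl. f_equal.
- apply is_series_unique.
  apply (is_series_ext (fun n => minus (sum_f_R0 (fun k => Re (u k) * Re (v (n - k)%nat)) n) (sum_f_R0 (fun k => Im (u k) * Im (v (n - k)%nat)) n))).
  + intros n. unfold cauchy_prod. match goal with |- ?L = _ => change (L = Re (csum (S n) (fun k => u k * v (n - k)%nat)%C)) end. rewrite csum_Re. unfold minus, plus, opp; simpl.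
    rewrite <- (Rmult_1_l (- _)), <- Ropp_mult_distr_r, Ropp_mult_distr_l.
    rewrite scal_sum, <- plus_sum. apply sum_eq; intros; unfold Re, Im; simpl; ring.
  + exact (is_series_minus (K := R_AbsRing) (V := R_NormedModule) _ _ _ _ RR II).
- apply is_series_unique.
  apply (is_series_ext (fun n => plus (sum_f_R0 (fun k => Re (u k) * Im (v (n - k)%nat)) n) (sum_f_R0 (fun k => Im (u k) * Re (v (n - k)%nat)) n))).
  + intros n. unfold cauchy_prod. match goal with |- ?L = _ => change (L = Im (csum (S n) (fun k => u k * v (n - k)%nat)%C)) end. rewrite csum_Im. unfold plus; simpl.
    rewrite <- plus_sum. apply sum_eq; intros; unfold Re, Im; simpl; ring.
  + exact (is_series_plus (K := R_AbsRing) (V := R_NormedModule) _ _ _ _ RI IR).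
Qed.

(** * Complex power series *)

Lemma filterlim_Clim (u : nat -> C) (l : C) :
  filterlim u eventually (locally l) <-> Clim u l.
Proof.
split.
- intros H. apply Clim_ReIm.
  + apply is_lim_seq_spec. intros eps.
    destruct (proj1 (filterlim_locally u l) H eps) as [N K].
    exists N. intros n Hn. exact (proj1 (K n Hn)).
  + apply is_lim_seq_spec. intros eps.
    destruct (proj1 (filterlim_locally u l) H eps) as [N K].
    exists N. intros n Hn. exact (proj2 (K n Hn)).
- intros H. apply filterlim_locally. intros eps.
  destruct (H eps (cond_pos eps)) as [N K]. exists N. intros n Hn. specialize (K n Hn). split.
  + eapply Rle_lt_trans; [|exact K]. exact (re_le_Cmod (u n - l)%C).
  + eapply Rle_lt_trans; [|exact K]. exact (im_le_Cmod (u n - l)%C).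
Qed.

Lemma sum_n_csum (u : nat -> C) n : sum_n (G := C_AbelianGroup) u n = csum (S n) u.
Proof.
induction n; [rewrite sum_O; simpl; ring|].
rewrite sum_Sn, IHn. reflexivity.
Qed.

Lemma is_series_Clim (u : nat -> C) l :
  is_series (K := C_AbsRing) (V := C_NormedModule) u l -> Clim (fun n => csum n u) l.
Proof.
intros H. assert (K : Clim (sum_n (G := C_AbelianGroup) u) l) by (apply filterlim_Clim; exact H).
intros e He. destruct (K e He) as [N HN]. exists (S N). intros n Hn. destruct n; [lia|].
rewrite <- sum_n_csum. apply HN. lia.
Qed.

Lemma is_series_CSeries (u : nat -> C) l :
  Csummable u -> is_series (K := C_AbsRing) (V := C_NormedModule) u l -> l = CSeries u.
Proof.
intros H K. apply (Clim_unique (fun n => csum n u)); [now apply is_series_Clim|now apply Clim_csum].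
Qed.

Lemma Cpow_n_Cpow (z : C) n : pow_n (K := C_Ring) z n = (z ^ n)%C.
Proof. induction n; [reflexivity|]. simpl. rewrite IHn. reflexivity. Qed.

Definition CPSeries (a : nat -> C) (z : C) : C := CSeries (fun n => a n * z ^ n)%C.
(** Only the absolute values of the coefficients enter, which makes the real theory of the
    radius of convergence available. *)
Definition Cradius (a : nat -> C) : Rbar := CV_radius (fun n => Cmod (a n)).
Definition deriv_coef (a : nat -> C) (n : nat) : C := (RtoC (INR (S n)) * a (S n))%C.

Lemma CPSeries_abs a z : Rbar_lt (Cmod z) (Cradius a) -> Csummable (fun n => a n * z ^ n)%C.
Proof.
intros H. assert (K : Rbar_lt (Rabs (Cmod z)) (Cradius a)) by (rewrite Rabs_pos_eq by apply Cmod_ge_0; exact H).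
apply CV_disk_inside in K. revert K. apply ex_series_ext. intros n.
rewrite Rabs_pos_eq, Cmod_mult, Cmod_pow; [reflexivity|].
apply Rmult_le_pos; [apply Cmod_ge_0|apply pow_le, Cmod_ge_0].
Qed.

Lemma Cradius_deriv_coef a : Cradius (deriv_coef a) = Cradius a.
Proof.
unfold Cradius. rewrite <- (CV_radius_derive (fun n => Cmod (a n))). apply CV_radius_ext.
intros n. unfold deriv_coef, PS_derive. rewrite Cmod_mult, Cmod_RtoC_pos; [reflexivity|apply pos_INR].
Qed.

Lemma Rbar_between (x : R) (l : Rbar) : Rbar_lt x l -> exists y, x < y /\ Rbar_lt y l.
Proof.
destruct l as [r| |]; simpl; intros H.
- exists ((x + r) / 2). lra.
- exists (x + 1). split; [lra|trivial].
- easy.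
Qed.

(** The factor |h|^2 is explicit and the other factor is a coefficient of the second derivative
    of the power series at [rho], so the estimate can be summed. *)
Lemma Cpow_remainder (z h : C) (rho : R) n :
  0 <= rho -> Cmod z <= rho -> Cmod (z + h)%C <= rho ->
  Cmod ((z + h) ^ S (S n) - z ^ S (S n) - h * (RtoC (INR (S (S n))) * z ^ S n))%C
  <= Cmod h ^ 2 * (INR (S (S n)) * (INR (S n) * rho ^ n)).
Proof.
intros Hr Hz Hzh. induction n.
- replace ((z + h) ^ 2 - z ^ 2 - h * (RtoC (INR 2) * z ^ 1))%C with (h ^ 2)%C.
  + rewrite Cmod_pow. simpl INR. pose proof (pow2_ge_0 (Cmod h)). simpl (rho ^ 0). lra.
  + replace (INR 2) with 2 by (simpl; ring). simpl. ring.
- replace ((z + h) ^ S (S (S n)) - z ^ S (S (S n)) - h * (RtoC (INR (S (S (S n)))) * z ^ S (S n)))%C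
    with ((z + h) * ((z + h) ^ S (S n) - z ^ S (S n) - h * (RtoC (INR (S (S n))) * z ^ S n))
          + h ^ 2 * (RtoC (INR (S (S n))) * z ^ S n))%C.
  + eapply Rle_trans; [apply Cmod_triangle|]. rewrite !Cmod_mult, !Cmod_pow, Cmod_RtoC_pos by apply pos_INR.
    set (X := Cmod (_ - _)%C) in *. assert (0 <= X) by apply Cmod_ge_0.
    pose proof (pos_INR n). pose proof (Cmod_ge_0 z). pose proof (Cmod_ge_0 (z + h)%C).
    assert (Hp : Cmod z ^ S n <= rho ^ S n) by (apply pow_incr; lra).
    assert (0 <= rho ^ n) by now apply pow_le.
    pose proof (pow2_ge_0 (Cmod h)).
    apply Rle_trans with (rho * (Cmod h ^ 2 * (INR (S (S n)) * (INR (S n) * rho ^ n))) + Cmod h ^ 2 * (INR (S (S n)) * rho ^ S n)).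
    * apply Rplus_le_compat; [apply Rmult_le_compat; assumption|].
      apply Rmult_le_compat_l; [assumption|]. apply Rmult_le_compat_l; [apply pos_INR|assumption].
    * simpl (rho ^ S n). rewrite !S_INR.
      replace (rho * (Cmod h ^ 2 * ((INR n + 1 + 1) * ((INR n + 1) * rho ^ n))) +
        Cmod h ^ 2 * ((INR n + 1 + 1) * (rho * rho ^ n))) with
        (Cmod h ^ 2 * (rho * rho ^ n) * ((INR n + 2) * (INR n + 2))) by ring.
      replace (Cmod h ^ 2 * ((INR n + 1 + 1 + 1) * ((INR n + 1 + 1) * (rho * rho ^ n)))) with
        (Cmod h ^ 2 * (rho * rho ^ n) * ((INR n + 3) * (INR n + 2))) by ring.
      apply Rmult_le_compat_l; [apply Rmult_le_pos; [assumption|nra]|nra].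
  + rewrite (S_INR (S (S n))), RtoC_plus. rewrite !Cpow_S. ring.
Qed.

Lemma Series_nonneg (B : nat -> R) : (forall n, 0 <= B n) -> ex_series B -> 0 <= Series B.
Proof.
intros H HB.
assert (E : forall n, B n = Rabs (B n)) by (intros; symmetry; apply Rabs_pos_eq, H).
rewrite (Series_ext B (fun n => Rabs (B n))) by exact E.
eapply Rle_trans; [apply Rabs_pos|]. apply Series_Rabs. now apply (ex_series_ext B).
Qed.

(** The difference quotient minus the candidate is bounded term by term by [Cpow_remainder], and
    the sum is |h|^2 times the majorant of the second derivative on a slightly larger disc. *)
Theorem CPSeries_derive a z : Rbar_lt (Cmod z) (Cradius a) -> is_Cderive (CPSeries a) z (CPSeries (deriv_coef a) z).
Proof.
intros H. apply is_Cderive_iff. intros eps He.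
destruct (Rbar_between _ _ H) as [rho [Hz Hr]].
pose proof (Cmod_ge_0 z) as Hz0.
set (B := fun n => INR (S (S n)) * (INR (S n) * rho ^ n) * Cmod (a (S (S n)))).
assert (HB : ex_series B).
{ pose proof (ex_pseries_derive (PS_derive (fun n => Cmod (a n))) rho) as K.
  rewrite CV_radius_derive, Rabs_pos_eq in K by lra. specialize (K Hr).
  revert K. apply ex_series_ext. intros n. rewrite pow_n_pow. unfold PS_derive, B, scal; simpl; unfold mult; simpl. ring. }
set (S0 := Series B).
assert (HS0 : 0 <= S0).
{ unfold S0. apply Series_nonneg; [|exact HB].
  intros n. unfold B. repeat apply Rmult_le_pos; try apply pos_INR; try apply Cmod_ge_0. apply pow_le; lra. }
exists (Rmin (rho - Cmod z) (eps / (S0 + 1))). split.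
{ apply Rmin_glb_lt; [lra|apply Rdiv_lt_0_compat; lra]. }
intros h Hh.
assert (Hh1 : Cmod h < rho - Cmod z) by (eapply Rlt_le_trans; [exact Hh|apply Rmin_l]).
assert (Hh2 : Cmod h < eps / (S0 + 1)) by (eapply Rlt_le_trans; [exact Hh|apply Rmin_r]).
assert (Hzh : Cmod (z + h)%C <= rho) by (eapply Rle_trans; [apply Cmod_triangle|lra]).
assert (C1 : Rbar_lt (Cmod (z + h)%C) (Cradius a)).
{ apply Rbar_le_lt_trans with rho; [exact Hzh|exact Hr]. }
assert (C2 : Rbar_lt (Cmod z) (Cradius (deriv_coef a))) by (rewrite Cradius_deriv_coef; exact H).
apply CPSeries_abs in C1, C2. pose proof (CPSeries_abs _ _ H) as C0.
assert (E : (CPSeries a (z + h) - CPSeries a z - CPSeries (deriv_coef a) z * h)%C =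
  CSeries (fun n => a (S (S n)) * ((z + h) ^ S (S n) - z ^ S (S n) - h * (RtoC (INR (S (S n))) * z ^ S n)))%C).
{ unfold CPSeries. rewrite (CSeries_incr_n 2 _ C1), (CSeries_incr_n 2 _ C0), (CSeries_incr_n 1 _ C2).
  rewrite (CSeries_ext (fun n => a (S (S n)) * ((z + h) ^ S (S n) - z ^ S (S n) - h * (RtoC (INR (S (S n))) * z ^ S n)))%C
   (fun n => (a (2 + n)%nat * (z + h) ^ (2 + n) - a (2 + n)%nat * z ^ (2 + n)) - h * (deriv_coef a (1 + n)%nat * z ^ (1 + n)))%C).
  2: { intros n. unfold deriv_coef. simpl Nat.add. ring. }
  rewrite CSeries_minus, CSeries_minus, CSeries_scal; try apply Csummable_minus; try apply Csummable_scal;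
    try (apply (Csummable_incr_n 2 _ C1)); try (apply (Csummable_incr_n 2 _ C0)); try (apply (Csummable_incr_n 1 _ C2)).
  set (X1 := CSeries _). set (X2 := CSeries _). set (X3 := CSeries _).
  simpl. unfold deriv_coef. simpl. ring. }
rewrite E.
assert (HC : Cmod h * S0 <= eps).
{ apply Rle_trans with (eps / (S0 + 1) * S0); [apply Rmult_le_compat_r; lra|].
  apply Rmult_le_reg_r with (S0 + 1); [lra|]. field_simplify; [nra|lra]. }
apply Rle_trans with (Series (fun n => Cmod h ^ 2 * B n)).
- apply Cmod_CSeries_bound.
  + intros n. rewrite Cmod_mult. unfold B.
    pose proof (Cpow_remainder z h rho n ltac:(lra) ltac:(lra) Hzh) as K.
    pose proof (Cmod_ge_0 (a (S (S n)))).
    rewrite <- Rmult_assoc, Rmult_comm. apply Rmult_le_compat_r; assumption.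
  + exact (ex_series_scal_R _ _ HB).
- rewrite Series_scal_l. fold S0. pose proof (Cmod_ge_0 h). simpl. nra.
Qed.

Lemma is_Cderive_cont (f : C -> C) (z l : C) : is_Cderive f z l ->
  forall eps, 0 < eps -> exists d, 0 < d /\ forall h, Cmod h < d -> Cmod (f (z + h) - f z)%C < eps.
Proof.
intros H eps He. rewrite is_Cderive_iff in H. destruct (H 1 Rlt_0_1) as [d [Hd K]].
pose proof (Cmod_ge_0 l).
exists (Rmin d (eps / (Cmod l + 2))). split; [apply Rmin_glb_lt; [lra|apply Rdiv_lt_0_compat; lra]|].
intros h Hh. assert (H1 : Cmod h < d) by (eapply Rlt_le_trans; [exact Hh|apply Rmin_l]).
assert (H2 : Cmod h < eps / (Cmod l + 2)) by (eapply Rlt_le_trans; [exact Hh|apply Rmin_r]).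
specialize (K h H1).
replace (f (z + h) - f z)%C with ((f (z + h) - f z - l * h) + l * h)%C by ring.
eapply Rle_lt_trans; [apply Cmod_triangle|]. rewrite Cmod_mult. pose proof (Cmod_ge_0 h).
apply Rle_lt_trans with ((Cmod l + 1) * Cmod h); [lra|].
apply Rlt_le_trans with ((Cmod l + 2) * (eps / (Cmod l + 2))); [|right; field; lra].
apply Rle_lt_trans with ((Cmod l + 2) * Cmod h); [nra|]. apply Rmult_lt_compat_l; lra.
Qed.

Lemma is_Cderive_unique (f : C -> C) (z l m : C) : is_Cderive f z l -> is_Cderive f z m -> l = m.
Proof.
intros H1 H2.
pose proof (curve_derive_line f z 1 l 0) as K1. pose proof (curve_derive_line f z 1 m 0) as K2.
replace (z + 0 * 1)%C with z in K1 by ring. replace (z + 0 * 1)%C with z in K2 by ring.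
destruct (K1 H1) as [a b]. destruct (K2 H2) as [c d].
rewrite Cmult_1_r in a, b, c, d. apply is_derive_unique in a, b, c, d.
destruct l, m; simpl in *. f_equal; congruence.
Qed.

Lemma is_Cderive_ext_near (f g : C -> C) (z l : C) (d : R) : 0 < d -> (forall y, Cmod (y - z)%C < d -> f y = g y) ->
  is_Cderive f z l -> is_Cderive g z l.
Proof.
intros Hd E. rewrite !is_Cderive_iff. intros H eps He. destruct (H eps He) as [d' [Hd' K]].
exists (Rmin d d'). split; [now apply Rmin_glb_lt|]. intros h Hh.
rewrite <- !E.
- apply K. eapply Rlt_le_trans; [exact Hh|apply Rmin_r].
- replace (z - z)%C with (RtoC 0) by ring. now rewrite Cmod_0.
- rewrite Cplus_minus_l. eapply Rlt_le_trans; [exact Hh|apply Rmin_l].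
Qed.

Lemma is_Cderive_ext (f g : C -> C) (z l : C) : (forall y, f y = g y) -> is_Cderive f z l -> is_Cderive g z l.
Proof. intros E. apply (is_Cderive_ext_near f g z l 1); [lra|auto]. Qed.

Lemma is_Cderive_const (c z : C) : is_Cderive (fun _ => c) z (RtoC 0).
Proof. exact (is_derive_const (K := C_AbsRing) (V := AbsRing_NormedModule C_AbsRing) c z). Qed.

Lemma is_Cderive_id (z : C) : is_Cderive (fun y => y) z (RtoC 1).
Proof. exact (is_derive_id (K := C_AbsRing) z). Qed.

Lemma is_Cderive_plus (f g : C -> C) (z l m : C) : is_Cderive f z l -> is_Cderive g z m ->
  is_Cderive (fun y => f y + g y)%C z (l + m)%C.
Proof. intros H1 H2. exact (is_derive_plus (K := C_AbsRing) (V := AbsRing_NormedModule C_AbsRing) f g z l m H1 H2). Qed.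

Lemma is_Cderive_minus (f g : C -> C) (z l m : C) : is_Cderive f z l -> is_Cderive g z m ->
  is_Cderive (fun y => f y - g y)%C z (l - m)%C.
Proof. intros H1 H2. exact (is_derive_minus (K := C_AbsRing) (V := AbsRing_NormedModule C_AbsRing) f g z l m H1 H2). Qed.

Lemma is_Cderive_mult (f g : C -> C) (z l m : C) : is_Cderive f z l -> is_Cderive g z m ->
  is_Cderive (fun y => f y * g y)%C z (l * g z + f z * m)%C.
Proof. intros H1 H2. exact (is_derive_mult (K := C_AbsRing) f g z l m H1 H2 Cmult_comm). Qed.

Lemma is_Cderive_scal (c : C) (f : C -> C) (z l : C) : is_Cderive f z l -> is_Cderive (fun y => c * f y)%C z (c * l)%C.
Proof.
intros H. replace (c * l)%C with (0 * f z + c * l)%C by ring.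
apply (is_Cderive_mult (fun _ => c)); [apply is_Cderive_const|exact H].
Qed.

Lemma is_Cderive_comp (f g : C -> C) (z l m : C) : is_Cderive f (g z) l -> is_Cderive g z m ->
  is_Cderive (fun y => f (g y)) z (m * l)%C.
Proof. intros H1 H2. exact (is_derive_comp (K := C_AbsRing) (V := AbsRing_NormedModule C_AbsRing) f g z l m H1 H2). Qed.

Lemma is_Cderive_affine (p q z : C) : is_Cderive (fun y => p + q * y)%C z q.
Proof.
pose proof (is_Cderive_plus _ _ z _ _ (is_Cderive_const p z)
  (is_Cderive_scal q _ z _ (is_Cderive_id z))) as K.
now replace (0 + q * 1)%C with q in K by ring.
Qed.

Lemma is_Cderive_inv (z : C) : z <> RtoC 0 -> is_Cderive Cinv z (- / (z * z))%C.
Proof.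
intros Hz. apply is_Cderive_iff. intros eps He.
assert (Hm : 0 < Cmod z) by now apply Cmod_gt_0.
exists (Rmin (Cmod z / 2) (eps * Cmod z ^ 3 / 2)). split.
{ apply Rmin_glb_lt; [lra|]. pose proof (pow_lt (Cmod z) 3 Hm). nra. }
intros h Hh.
assert (H1 : Cmod h < Cmod z / 2) by (eapply Rlt_le_trans; [exact Hh|apply Rmin_l]).
assert (H2 : Cmod h < eps * Cmod z ^ 3 / 2) by (eapply Rlt_le_trans; [exact Hh|apply Rmin_r]).
assert (H3 : Cmod z / 2 <= Cmod (z + h)%C).
{ pose proof (Cmod_triangle_rev z (- h)%C) as T. rewrite Cmod_opp in T.
  replace (z - - h)%C with (z + h)%C in T by ring. lra. }
assert (Hzh : (z + h)%C <> RtoC 0) by (apply Cmod_gt_0; lra).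
replace (/ (z + h) - / z - - / (z * z) * h)%C with (h * h / (z * z * (z + h)))%C by (field; split; assumption).
rewrite Cmod_div by (repeat apply Cmult_neq_0; assumption). rewrite !Cmod_mult.
pose proof (Cmod_ge_0 h).
assert (Hd : 0 < Cmod z * Cmod z * Cmod (z + h)%C) by (repeat apply Rmult_lt_0_compat; lra).
apply Rmult_le_reg_r with (Cmod z * Cmod z * Cmod (z + h)%C); [exact Hd|].
unfold Rdiv. rewrite Rmult_assoc, Rinv_l, Rmult_1_r by lra.
replace (eps * Cmod h * (Cmod z * Cmod z * Cmod (z + h)%C)) with (Cmod h * (eps * (Cmod z * Cmod z) * Cmod (z + h)%C)) by ring.
apply Rmult_le_compat_l; [assumption|].
apply Rle_trans with (eps * (Cmod z * Cmod z) * (Cmod z / 2)); [left; eapply Rlt_le_trans; [exact H2|right; field]|].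
apply Rmult_le_compat_l; [|exact H3]. left; repeat apply Rmult_lt_0_compat; assumption.
Qed.

Lemma Clim_bounded u l : Clim u l -> exists M, forall n, Cmod (u n) <= M.
Proof.
intros H. destruct (H 1 Rlt_0_1) as [N K].
assert (F : exists M, forall n, (n < N)%nat -> Cmod (u n) <= M).
{ clear K. induction N; [exists 0; intros; lia|]. destruct IHN as [M HM].
  exists (Rmax M (Cmod (u N))). intros n Hn. destruct (Nat.eq_dec n N) as [->|].
  - apply Rmax_r.
  - eapply Rle_trans; [apply HM; lia|apply Rmax_l]. }
destruct F as [M HM]. exists (Rmax M (Cmod l + 1)). intros n.
destruct (Nat.lt_ge_cases n N).
- eapply Rle_trans; [now apply HM|apply Rmax_l].
- eapply Rle_trans; [|apply Rmax_r]. specialize (K n H0).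
  pose proof (Cmod_triangle_rev (u n) l). lra.
Qed.

Lemma Cradius_ge_bounded a rho : (exists M, forall n, Cmod (a n) * rho ^ n <= M) -> 0 <= rho -> Rbar_le rho (Cradius a).
Proof.
intros [M HM] Hr. apply (proj1 (CV_radius_bounded (fun n => Cmod (a n)))).
exists M. intros n. rewrite Rabs_pos_eq; [apply HM|]. apply Rmult_le_pos; [apply Cmod_ge_0|now apply pow_le].
Qed.

Lemma Cradius_ge_below a d : 0 < d ->
  (forall rho, 0 <= rho < d -> exists M, forall n, Cmod (a n) * rho ^ n <= M) -> Rbar_le d (Cradius a).
Proof.
intros Hd H.
assert (K : forall rho, 0 <= rho < d -> Rbar_le rho (Cradius a)) by (intros; apply Cradius_ge_bounded; [auto|lra]).
destruct (Cradius a) as [r| |] eqn:E; simpl; [|trivial|].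
- destruct (Rle_lt_dec d r) as [L|L]; [exact L|].
  assert (H0 : Rbar_le 0 (Cradius a)) by apply CV_radius_ge_0. rewrite E in H0. simpl in H0.
  specialize (K ((r + d) / 2) ltac:(lra)). simpl in K. lra.
- exact (K 0 ltac:(lra)).
Qed.

Lemma Clim_csum_terms_bounded u l : Clim (fun n => csum n u) l -> exists M, forall n, Cmod (u n) <= M.
Proof.
intros L. destruct (Clim_bounded _ _ (Clim_minus _ _ _ _ (Clim_incr _ _ L) L)) as [M HM].
exists M. intros n. specialize (HM n). simpl csum in HM. now rewrite Cplus_minus_l in HM.
Qed.

(** A power series that converges in a disc has bounded terms at each positive real point of it,
    hence converges absolutely inside. *)
Lemma is_pseries_Cradius a d : 0 < d ->
  (forall z : C, Cmod z < d -> exists l, is_pseries (K := C_AbsRing) (V := C_NormedModule) a z l) ->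
  Rbar_le d (Cradius a).
Proof.
intros Hd H. apply Cradius_ge_below; [exact Hd|]. intros rho Hr.
destruct (H (RtoC rho)) as [l Hl]; [rewrite Cmod_RtoC_pos; lra|].
apply is_series_Clim, Clim_csum_terms_bounded in Hl. destruct Hl as [M HM]. exists M. intros n. specialize (HM n).
change (scal (pow_n (RtoC rho) n) (a n)) with (pow_n (K := C_Ring) (RtoC rho) n * a n)%C in HM.
rewrite Cpow_n_Cpow, Cmod_mult, Cmod_pow, Cmod_RtoC_pos in HM by lra. lra.
Qed.

Lemma is_pseries_CPSeries a z l : Rbar_lt (Cmod z) (Cradius a) ->
  is_pseries (K := C_AbsRing) (V := C_NormedModule) a z l -> l = CPSeries a z.
Proof.
intros H K. apply CPSeries_abs in H. unfold CPSeries. apply is_series_CSeries; [exact H|].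
revert K. apply (is_series_ext (K := C_AbsRing) (V := C_NormedModule)). intros n.
change (pow_n (K := C_Ring) z n * a n = a n * z ^ n)%C. rewrite Cpow_n_Cpow. ring.
Qed.

Lemma analytic_on_CPSeries (D : C -> Prop) (f : C -> C) (z0 : C) : analytic_on D f -> D z0 ->
  exists a d, 0 < d /\ Rbar_le d (Cradius a) /\ forall z, Cmod (z - z0)%C < d -> f z = CPSeries a (z - z0)%C.
Proof.
intros H HD. destruct (H z0 HD) as [a [d [Hd K]]]. exists a, d.
assert (HC : Rbar_le d (Cradius a)).
{ apply is_pseries_Cradius; [exact Hd|]. intros z Hz. exists (f (z0 + z)%C).
  specialize (K (z0 + z)%C). rewrite Cplus_minus_l in K. now apply K. }
repeat split; try assumption. intros z Hz. apply is_pseries_CPSeries; [|now apply K].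
eapply Rbar_lt_le_trans; [|exact HC]. exact Hz.
Qed.

Lemma CPSeries_0 a : CPSeries a 0 = a 0%nat.
Proof.
unfold CPSeries, CSeries. rewrite (Series_ext _ (fun n => if (n =? 0)%nat then Re (a 0%nat) else 0)).
- rewrite (Series_ext (fun n => Im _) (fun n => if (n =? 0)%nat then Im (a 0%nat) else 0)).
  + assert (S0 : forall c, Series (fun n => if (n =? 0)%nat then c else 0) = c).
    { intros c. apply is_series_unique.
      apply filterlim_ext with (fun _ => c); [|apply filterlim_const].
      intros n; induction n; [now rewrite sum_O|]. rewrite sum_Sn, <- IHn. unfold plus; simpl; ring. }
    rewrite !S0. now destruct (a 0%nat).
  + intros [|n]; cbn [Cpow Nat.eqb]; [now rewrite Cmult_1_r|]. now rewrite Cmult_0_l, Cmult_0_r.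
- intros [|n]; cbn [Cpow Nat.eqb]; [now rewrite Cmult_1_r|]. now rewrite Cmult_0_l, Cmult_0_r.
Qed.

Lemma analytic_on_Cderive (D : C -> Prop) (f : C -> C) (z0 : C) : analytic_on D f -> D z0 -> exists l, is_Cderive f z0 l.
Proof.
intros H HD. destruct (analytic_on_CPSeries D f z0 H HD) as [a [d [Hd [HC E]]]].
exists (CPSeries (deriv_coef a) 0).
apply (is_Cderive_ext_near (fun z => CPSeries a (z - z0)%C) _ _ _ d Hd); [intros y Hy; now rewrite E|].
replace (CPSeries (deriv_coef a) 0) with (1 * CPSeries (deriv_coef a) (z0 - z0))%C
  by (replace (z0 - z0)%C with (RtoC 0) by ring; ring).
apply (is_Cderive_comp (CPSeries a) (fun z => z - z0)%C).
- apply CPSeries_derive. replace (z0 - z0)%C with (RtoC 0) by ring. rewrite Cmod_0.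
  eapply Rbar_lt_le_trans; [|exact HC]. exact Hd.
- replace (RtoC 1) with (1 - 0)%C by ring. apply is_Cderive_minus; [apply is_Cderive_id|apply is_Cderive_const].
Qed.

(** * The exponential and the principal logarithm *)

Lemma Cexp_plus a b : Cexp (a + b)%C = (Cexp a * Cexp b)%C.
Proof.
destruct a as [a1 a2], b as [b1 b2]. unfold Cexp, Cmult, Cplus, Re, Im; simpl.
rewrite exp_plus, cos_plus, sin_plus. f_equal; ring.
Qed.

Lemma Cexp_0 : Cexp 0 = 1.
Proof. unfold Cexp, Re, Im; simpl. rewrite exp_0, cos_0, sin_0. apply injective_projections; simpl; ring. Qed.

Lemma Cmod_Cexp z : Cmod (Cexp z) = exp (Re z).
Proof.
unfold Cexp, Cmod; simpl.
replace (exp (Re z) * cos (Im z) * (exp (Re z) * cos (Im z) * 1) + exp (Re z) * sin (Im z) * (exp (Re z) * sin (Im z) * 1))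
  with (Rsqr (exp (Re z)) * (Rsqr (sin (Im z)) + Rsqr (cos (Im z)))) by (unfold Rsqr; ring).
rewrite sin2_cos2, Rmult_1_r. apply sqrt_Rsqr. left; apply exp_pos.
Qed.

Lemma Cexp_neq0 z : Cexp z <> RtoC 0.
Proof. apply Cmod_gt_0. rewrite Cmod_Cexp. apply exp_pos. Qed.

Lemma Cexp_opp z : Cexp (- z)%C = (/ Cexp z)%C.
Proof.
assert (H : (Cexp z * Cexp (- z))%C = 1).
{ rewrite <- Cexp_plus. replace (z + - z)%C with (RtoC 0) by ring. apply Cexp_0. }
pose proof (Cexp_neq0 z).
replace (/ Cexp z)%C with (/ Cexp z * (Cexp z * Cexp (- z)))%C by (rewrite H; ring).
field. assumption.
Qed.

Lemma Cexp_minus a b : Cexp (a - b)%C = (Cexp a / Cexp b)%C.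
Proof. unfold Cminus. rewrite Cexp_plus, Cexp_opp. reflexivity. Qed.

Lemma Cexp_pow z n : (Cexp z ^ n)%C = Cexp (RtoC (INR n) * z)%C.
Proof.
induction n.
- simpl. rewrite Cmult_0_l, Cexp_0. reflexivity.
- rewrite Cpow_S, IHn, <- Cexp_plus, S_INR, RtoC_plus. f_equal. ring.
Qed.

Lemma Cexp_RtoC x : Cexp (RtoC x) = RtoC (exp x).
Proof. unfold Cexp, RtoC, Re, Im; simpl. rewrite cos_0, sin_0. f_equal; ring. Qed.

Lemma RtoC_neq0 (x : R) : x <> 0 -> RtoC x <> RtoC 0.
Proof. intros H E. now apply RtoC_inj in E. Qed.

Definition exp_coef (n : nat) : C := RtoC (/ INR (fact n)).

Lemma Cradius_exp_coef (x : R) : Rbar_lt x (Cradius exp_coef).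
Proof.
destruct (Rbar_lt_le_dec x (Cradius exp_coef)) as [H|H]; [exact H|exfalso].
assert (K : Rbar_lt (Cradius exp_coef) (Rabs (Rabs x + 1))).
{ eapply Rbar_le_lt_trans; [exact H|]. simpl. rewrite (Rabs_pos_eq (_ + 1)).
  - pose proof (Rle_abs x). lra.
  - pose proof (Rabs_pos x). lra. }
apply (CV_disk_outside (fun n => Cmod (exp_coef n))) in K. apply K.
pose proof (is_exp_Reals (Rabs x + 1)) as E.
assert (E' : ex_series (fun n => Cmod (exp_coef n) * (Rabs x + 1) ^ n)).
{ exists (exp (Rabs x + 1)). revert E. apply is_series_ext. intros n. rewrite pow_n_pow.
  unfold exp_coef. rewrite Cmod_RtoC_pos by (left; apply Rinv_0_lt_compat, INR_fact_lt_0).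
  unfold scal; simpl; unfold mult; simpl. ring. }
now apply ex_series_lim_0.
Qed.

Lemma deriv_coef_exp_coef n : deriv_coef exp_coef n = exp_coef n.
Proof.
unfold deriv_coef, exp_coef. rewrite <- RtoC_mult. f_equal. rewrite fact_simpl, mult_INR.
field. split; [apply INR_fact_neq_0|]. apply not_0_INR. lia.
Qed.

Lemma CPSeries_ext a b z : (forall n, a n = b n) -> CPSeries a z = CPSeries b z.
Proof. intros H. apply CSeries_ext. intros n. now rewrite H. Qed.

Lemma curve_derive_Cexp_line (c : C) s : curve_derive (fun u => Cexp (RtoC u * c)%C) s (c * Cexp (RtoC s * c))%C.
Proof.
destruct c as [a b].
assert (E : forall u, Cexp (RtoC u * (a, b))%C = (exp (u * a) * cos (u * b), exp (u * a) * sin (u * b))).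
{ intros u. unfold Cexp, Re, Im, Cmult; simpl. rewrite !Rmult_0_l, Rminus_0_r, Rplus_0_r. reflexivity. }
apply (curve_derive_ext (fun u => (exp (u * a) * cos (u * b), exp (u * a) * sin (u * b)))); [intros; now rewrite E|].
rewrite E. split; unfold Re, Im; simpl.
- auto_derive; [trivial|]. ring.
- auto_derive; [trivial|]. ring.
Qed.

(** The product of the power series with [Cexp] of the opposite argument is constant along the
    segment from 0. *)
Lemma Cexp_CPSeries z : Cexp z = CPSeries exp_coef z.
Proof.
set (f := fun s : R => (CPSeries exp_coef (0 + RtoC s * z) * Cexp (RtoC s * - z))%C).
assert (H : f 1 = f 0).
{ apply curve_derive_zero_const; [lra|]. intros s _. unfold f.
  set (P := CPSeries exp_coef (0 + RtoC s * z)%C). set (Q := Cexp (RtoC s * - z)%C).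
  replace (curve_derive _ s 0) with (curve_derive (fun s : R => (CPSeries exp_coef (0 + RtoC s * z) * Cexp (RtoC s * - z))%C) s (P * z * Q + P * (- z * Q))%C)
    by (f_equal; ring).
  apply (curve_derive_mult (fun u => CPSeries exp_coef (0 + RtoC u * z)%C)).
  - apply curve_derive_line. unfold P. rewrite (CPSeries_ext exp_coef (deriv_coef exp_coef)) by (intros; now rewrite deriv_coef_exp_coef).
    apply CPSeries_derive, Cradius_exp_coef.
  - apply curve_derive_Cexp_line. }
unfold f in H.
replace (0 + RtoC 1 * z)%C with z in H by ring. replace (RtoC 1 * - z)%C with (- z)%C in H by ring.
replace (0 + RtoC 0 * z)%C with (RtoC 0) in H by ring. replace (RtoC 0 * - z)%C with (RtoC 0) in H by ring.
rewrite CPSeries_0, Cexp_0, Cexp_opp in H.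
replace (CPSeries exp_coef z) with (CPSeries exp_coef z * / Cexp z * Cexp z)%C by (field; apply Cexp_neq0).
rewrite H. unfold exp_coef. simpl. rewrite Rinv_1. ring.
Qed.

Lemma is_Cderive_Cexp (z : C) : is_Cderive Cexp z (Cexp z).
Proof.
rewrite (Cexp_CPSeries z), (CPSeries_ext exp_coef (deriv_coef exp_coef)) by (intros; now rewrite deriv_coef_exp_coef).
apply (is_Cderive_ext (CPSeries exp_coef)); [intros y; now rewrite Cexp_CPSeries|]. apply CPSeries_derive, Cradius_exp_coef.
Qed.

Lemma Cexp_eq_1 z : Cexp z = 1 -> Re z = 0 /\ exists k : Z, Im z = 2 * PI * IZR k.
Proof.
intros H.
assert (HR : Re z = 0).
{ assert (E : exp (Re z) = exp 0) by (rewrite <- Cmod_Cexp, H, Cmod_1, exp_0; reflexivity).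
  now apply exp_inv in E. }
split; [exact HR|].
apply (f_equal Re) in H. unfold Cexp in H. rewrite HR, exp_0 in H. unfold Re in H; simpl in H.
rewrite Rmult_1_l in H. replace (Im z) with (2 * (Im z / 2)) in H by field.
rewrite cos_2a_sin in H.
assert (Hs : sin (Im z / 2) = 0) by nra.
apply sin_eq_0_0 in Hs. destruct Hs as [k Hk]. exists k. lra.
Qed.

Lemma IZR_abs_lt_1 k : -1 < IZR k < 1 -> k = 0%Z.
Proof. intros [K1 K2]. apply lt_IZR in K2. apply (lt_IZR (-1)) in K1. lia. Qed.

Lemma Cexp_inj a b : - PI < Im a < PI -> - PI < Im b < PI -> Cexp a = Cexp b -> a = b.
Proof.
intros Ha Hb H.
assert (E : Cexp (a - b)%C = 1).
{ rewrite Cexp_minus, H. field. apply Cexp_neq0. }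
apply Cexp_eq_1 in E. destruct E as [E1 [k E2]].
destruct a as [a1 a2], b as [b1 b2]. unfold Re, Im in *; simpl in *.
assert (Hk : (k = 0)%Z).
{ apply IZR_abs_lt_1. pose proof PI_RGT_0. split; apply Rmult_lt_reg_l with (2 * PI); lra. }
subst k. f_equal; lra.
Qed.

Definition curve_cont (f : R -> C) (s : R) : Prop :=
  continuity_pt (fun u => Re (f u)) s /\ continuity_pt (fun u => Im (f u)) s.

Lemma curve_derive_curve_cont f s l : curve_derive f s l -> curve_cont f s.
Proof.
intros [H1 H2]. split; apply derivable_continuous_pt.
- exists (Re l). now apply is_derive_Reals.
- exists (Im l). now apply is_derive_Reals.
Qed.

Lemma curve_cont_plus f g s : curve_cont f s -> curve_cont g s -> curve_cont (fun u => f u + g u)%C s.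
Proof. intros [a b] [c d]. split; now apply continuity_pt_plus. Qed.
Lemma curve_cont_minus f g s : curve_cont f s -> curve_cont g s -> curve_cont (fun u => f u - g u)%C s.
Proof. intros [a b] [c d]. split; now apply continuity_pt_minus. Qed.

Lemma curve_cont_eps f s : (forall eps, 0 < eps -> exists d, 0 < d /\ forall h, Rabs h < d ->
   Cmod (f (s + h)%R - f s)%C < eps) -> curve_cont f s.
Proof.
intros H. split; intros eps He; destruct (H eps He) as [d [Hd K]]; exists d; (split; [exact Hd|]);
 intros x [_ Hx]; unfold R_met, Rdist, dist in *; simpl in *.
- replace x with (s + (x - s)) by ring. specialize (K (x - s) Hx).
  eapply Rle_lt_trans; [|exact K]. exact (re_le_Cmod (f (s + (x - s))%R - f s)%C).
- replace x with (s + (x - s)) by ring. specialize (K (x - s) Hx).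
  eapply Rle_lt_trans; [|exact K]. exact (im_le_Cmod (f (s + (x - s))%R - f s)%C).
Qed.

(** By the intermediate value theorem a continuous function with values in 2 pi Z cannot pass
    g(a) + pi. *)
Lemma two_pi_multiple_not_increasing (g : R -> R) a b : a <= b ->
  (forall s, a <= s <= b -> continuity_pt g s) ->
  (forall s, a <= s <= b -> exists k : Z, g s = 2 * PI * IZR k) -> ~ (g a < g b).
Proof.
intros Hab Hc Hk Hlt.
assert (a < b) by (destruct Hab as [|E]; [assumption|subst; lra]).
destruct (Hk a ltac:(lra)) as [ka Ea]. destruct (Hk b ltac:(lra)) as [kb Eb].
pose proof PI_RGT_0 as HP.
assert (Hkk : IZR ka + 1 <= IZR kb).
{ assert (IZR ka < IZR kb) by (apply Rmult_lt_reg_l with (2 * PI); lra).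
  apply lt_IZR in H0. rewrite <- plus_IZR. apply IZR_le. lia. }
destruct (IVT_interv (fun s => g s - (g a + PI)) a b) as [s [Hs E]].
- intros s Hs. apply continuity_pt_minus; [now apply Hc|]. apply continuity_pt_const. intros ? ?; reflexivity.
- assumption.
- lra.
- nra.
- destruct (Hk s Hs) as [k Ek].
  assert (E2 : 2 * PI * (IZR k - IZR ka) = PI) by lra.
  assert (E3 : 2 * (IZR k - IZR ka) = 1) by (apply Rmult_eq_reg_l with PI; lra).
  rewrite <- minus_IZR, <- mult_IZR in E3. apply eq_IZR in E3. lia.
Qed.

(** This replaces monodromy: a continuous curve of logarithms of 1 is constant.  The branches of
    log and log Gamma below are identified by applying it to the difference of two logarithms
    along a segment or a ray. *)
Lemma log_path_const (f : R -> C) a b : a <= b ->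
  (forall s, a <= s <= b -> curve_cont f s) ->
  (forall s, a <= s <= b -> Cexp (f s) = 1) -> f b = f a.
Proof.
intros Hab Hc He.
assert (HR : forall s, a <= s <= b -> Re (f s) = 0) by (intros s Hs; now apply Cexp_eq_1, He).
assert (HI : forall s, a <= s <= b -> exists k : Z, Im (f s) = 2 * PI * IZR k) by (intros s Hs; now apply Cexp_eq_1, He).
assert (~ (Im (f a) < Im (f b))).
{ apply (two_pi_multiple_not_increasing (fun s => Im (f s))); [assumption|intros s Hs; now apply Hc|assumption]. }
assert (~ (- Im (f a) < - Im (f b))).
{ apply (two_pi_multiple_not_increasing (fun s => - Im (f s))); [assumption| |].
  - intros s Hs. apply continuity_pt_opp. now apply Hc.
  - intros s Hs. destruct (HI s Hs) as [k Hk]. exists (- k)%Z. rewrite opp_IZR, Hk. ring. }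
pose proof (HR a ltac:(lra)). pose proof (HR b ltac:(lra)).
apply injective_projections; [unfold Re in *; congruence|]. unfold Im in *. lra.
Qed.

(** The complement of the closed negative half-axis, in the form that makes the half-angle
    formula of [Clog] meaningful. *)
Definition off_cut (z : C) : Prop := 0 < Cmod z + Re z.
(** The argument is twice the angle seen from the point -|z|. *)
Definition Clog (z : C) : C := (ln (Cmod z), 2 * atan (Im z / (Cmod z + Re z))).

Lemma off_cut_neq0 z : off_cut z -> z <> RtoC 0.
Proof. intros H E. subst. unfold off_cut in H. rewrite Cmod_0 in H. simpl in H. lra. Qed.

Lemma Cmod_sqr z : Cmod z * Cmod z = Re z * Re z + Im z * Im z.
Proof. pose proof (Cmod2_alt z) as H. simpl in H. lra. Qed.

Lemma off_cut_iff z : off_cut z <-> (Im z <> 0 \/ 0 < Re z).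
Proof.
unfold off_cut. pose proof (Cmod_sqr z) as E. pose proof (Cmod_ge_0 z). split.
- intros H1. destruct (Req_dec (Im z) 0) as [E0|]; [|now left]. right.
  rewrite E0 in E. destruct (Rlt_le_dec 0 (Re z)); [assumption|nra].
- intros [H1|H1]; [|lra]. assert (0 < Im z * Im z) by nra. nra.
Qed.

Lemma Cexp_Clog z : off_cut z -> Cexp (Clog z) = z.
Proof.
intros H. pose proof (off_cut_neq0 _ H) as Hz. apply Cmod_gt_0 in Hz.
pose proof (Cmod_sqr z) as E. unfold off_cut in H.
unfold Cexp, Clog, Re, Im. simpl. rewrite exp_ln by assumption.
destruct z as [x y]. unfold Re, Im in *. simpl in *. set (m := Cmod (x, y)) in *.
rewrite cos_2a, sin_2a, cos_atan, sin_atan.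
assert (Hy : y * y = m * m - x * x) by lra.
set (u := y / (m + x)).
assert (Hu : 1 + u² = 2 * m / (m + x)).
{ unfold u, Rsqr.
  replace (1 + y / (m + x) * (y / (m + x))) with (((m + x) * (m + x) + y * y) / ((m + x) * (m + x))) by (field; lra).
  rewrite Hy. field. lra. }
assert (Hu' : 1 - u * u = 2 * x / (m + x)).
{ unfold u.
  replace (1 - y / (m + x) * (y / (m + x))) with (((m + x) * (m + x) - y * y) / ((m + x) * (m + x))) by (field; lra).
  rewrite Hy. field. lra. }
assert (Hs : 0 < sqrt (1 + u²)) by (apply sqrt_lt_R0; pose proof (Rle_0_sqr u); lra).
assert (Hss : sqrt (1 + u²) * sqrt (1 + u²) = 1 + u²) by (apply sqrt_sqrt; pose proof (Rle_0_sqr u); lra).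
set (q := sqrt (1 + u²)) in *.
f_equal.
- replace (1 / q * (1 / q) - u / q * (u / q)) with ((1 - u * u) / (q * q)) by (field; lra).
  rewrite Hss, Hu, Hu'. field. lra.
- replace (2 * (u / q) * (1 / q)) with (2 * u / (q * q)) by (field; lra).
  rewrite Hss, Hu. unfold u. field. lra.
Qed.

Lemma Im_Clog z : - PI < Im (Clog z) < PI.
Proof. change (Im (Clog z)) with (2 * atan (Im z / (Cmod z + Re z))). pose proof (atan_bound (Im z / (Cmod z + Re z))). lra. Qed.

Lemma Clog_unique z l : off_cut z -> Cexp l = z -> - PI < Im l < PI -> l = Clog z.
Proof. intros Hz H Hl. apply Cexp_inj; [assumption|apply Im_Clog|]. now rewrite Cexp_Clog. Qed.

Lemma Clog_RtoC x : 0 < x -> Clog (RtoC x) = RtoC (ln x).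
Proof.
intros H. unfold Clog. rewrite Cmod_RtoC_pos by lra. simpl. unfold Rdiv. rewrite Rmult_0_l, atan_0, Rmult_0_r. reflexivity.
Qed.

Lemma off_cut_scal z x : 0 < x -> off_cut z -> off_cut (RtoC x * z)%C.
Proof.
intros Hx H. apply off_cut_iff. apply off_cut_iff in H. destruct z as [a b]. unfold Re, Im in *; simpl in *.
destruct H as [H|H]; [left|right]; nra.
Qed.

Lemma Clog_scal z x : 0 < x -> off_cut z -> Clog (RtoC x * z)%C = (RtoC (ln x) + Clog z)%C.
Proof.
intros Hx H. symmetry. apply Clog_unique.
- now apply off_cut_scal.
- rewrite Cexp_plus, Cexp_RtoC, exp_ln, Cexp_Clog by assumption. reflexivity.
- replace (Im (RtoC (ln x) + Clog z)%C) with (Im (Clog z)); [apply Im_Clog|]. unfold Im; simpl; ring.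
Qed.

Lemma atan_le_abs v : Rabs (atan v) <= Rabs v.
Proof.
destruct (MVT_gen atan 0 v (fun x => / (1 + x²))) as [c [_ E]].
- intros x _. apply is_derive_atan.
- intros x _. apply derivable_continuous_pt, derivable_pt_atan.
- rewrite atan_0, !Rminus_0_r in E. rewrite E, Rabs_mult.
  pose proof (Rle_0_sqr c). rewrite Rabs_pos_eq by (left; apply Rinv_0_lt_compat; lra).
  pose proof (Rabs_pos v). assert (/ (1 + c²) <= 1) by (rewrite <- Rinv_1; apply Rinv_le_contravar; lra). nra.
Qed.

Lemma ln_le_minus_1 x : 0 < x -> ln x <= x - 1.
Proof. intros H. pose proof (exp_ineq1_le (ln x)). rewrite exp_ln in H0 by assumption. lra. Qed.

Lemma off_cut_1_plus u : Cmod u < 1 -> off_cut (1 + u)%C.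
Proof.
intros H. apply off_cut_iff. right. pose proof (re_le_Cmod u) as K.
unfold Re in *; simpl in *. apply Rabs_le_between in K. lra.
Qed.

(** A crude bound, obtained from the explicit formula; it is what makes [Clog] continuous at 1
    and thus differentiable. *)
Lemma Clog_1_plus_bound u : Cmod u <= / 2 -> Cmod (Clog (1 + u)%C) <= 4 * Cmod u.
Proof.
intros H.
pose proof (re_le_Cmod u) as K1. pose proof (im_le_Cmod u) as K2.
assert (M1 : Cmod (1 + u)%C <= 1 + Cmod u) by (eapply Rle_trans; [apply Cmod_triangle|]; rewrite Cmod_1; lra).
assert (M2 : 1 - Cmod u <= Cmod (1 + u)%C).
{ pose proof (Cmod_triangle_rev 1 (- u)%C) as T. rewrite Cmod_1, Cmod_opp in T.
  replace (1 - - u)%C with (1 + u)%C in T by ring. exact T. }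
pose proof (Cmod_ge_0 u) as U0.
assert (L : Rabs (ln (Cmod (1 + u)%C)) <= 2 * Cmod u).
{ set (m := Cmod (1 + u)%C) in *. apply Rabs_le. split.
  - pose proof (ln_le_minus_1 (/ m)) as J. rewrite ln_Rinv in J by lra.
    assert (0 < / m) by (apply Rinv_0_lt_compat; lra). specialize (J H0).
    assert (/ m - 1 <= 2 * Cmod u); [|lra].
    apply Rmult_le_reg_r with m; [lra|]. rewrite Rmult_minus_distr_r, Rinv_l by lra. nra.
  - pose proof (ln_le_minus_1 m). lra. }
eapply Rle_trans; [apply Cmod_le_re_im|].
change (Rabs (ln (Cmod (1 + u)%C)) + Rabs (2 * atan (Im (1 + u)%C / (Cmod (1 + u)%C + Re (1 + u)%C))) <= 4 * Cmod u).
assert (A : Rabs (2 * atan (Im (1 + u)%C / (Cmod (1 + u)%C + Re (1 + u)%C))) <= 2 * Cmod u); [|lra].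
rewrite Rabs_mult, (Rabs_pos_eq 2) by lra. apply Rmult_le_compat_l; [lra|].
eapply Rle_trans; [apply atan_le_abs|]. unfold Rdiv. rewrite Rabs_mult.
apply Rabs_le_between in K1.
assert (D : 1 <= Cmod (1 + u)%C + Re (1 + u)%C) by (change (Re (1 + u)%C) with (1 + Re u); lra).
rewrite (Rabs_pos_eq (/ _)) by (left; apply Rinv_0_lt_compat; lra).
replace (Im (1 + u)%C) with (Im u) by (unfold Im; simpl; ring).
set (q := Cmod (1 + u)%C + Re (1 + u)%C) in *.
pose proof (Rinv_le_contravar 1 q Rlt_0_1 D) as I1. rewrite Rinv_1 in I1.
assert (0 < / q) by (apply Rinv_0_lt_compat; lra).
pose proof (Rabs_pos (Im u)). nra.
Qed.

Lemma Clog_mult_near z : off_cut z -> exists d, 0 < d /\ forall u, Cmod u < d ->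
  off_cut (z * (1 + u))%C /\ Clog (z * (1 + u))%C = (Clog z + Clog (1 + u))%C.
Proof.
intros Hz. pose proof (Im_Clog z) as HI.
set (gap := PI - Rabs (Im (Clog z))).
assert (Hg : 0 < gap) by (unfold gap; assert (Rabs (Im (Clog z)) < PI) by (apply Rabs_def1; lra); lra).
exists (Rmin (/ 2) (gap / 4)). split; [apply Rmin_glb_lt; lra|]. intros u Hu.
assert (H1 : Cmod u < / 2) by (eapply Rlt_le_trans; [exact Hu|apply Rmin_l]).
assert (H2 : Cmod u < gap / 4) by (eapply Rlt_le_trans; [exact Hu|apply Rmin_r]).
pose proof (Clog_1_plus_bound u ltac:(lra)) as B1.
pose proof (im_le_Cmod (Clog (1 + u)%C)) as B2.
assert (Hcut : off_cut (1 + u)%C) by (apply off_cut_1_plus; lra).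
assert (EE : Cexp (Clog z + Clog (1 + u))%C = (z * (1 + u))%C) by (rewrite Cexp_plus, !Cexp_Clog by assumption; reflexivity).
assert (II : - PI < Im (Clog z + Clog (1 + u))%C < PI).
{ replace (Im (Clog z + Clog (1 + u))%C) with (Im (Clog z) + Im (Clog (1 + u))) by reflexivity.
  apply and_comm, Rabs_def2. eapply Rle_lt_trans; [apply Rabs_triang|]. unfold gap in H2. lra. }
assert (CC : off_cut (z * (1 + u))%C).
{ rewrite <- EE. set (l := (Clog z + Clog (1 + u))%C) in *. apply off_cut_iff.
  change (exp (Re l) * sin (Im l) <> 0 \/ 0 < exp (Re l) * cos (Im l)).
  pose proof (exp_pos (Re l)) as Hp.
  destruct (Req_dec (sin (Im l)) 0) as [S|S].
  - right. apply sin_eq_0_0 in S. destruct S as [k Hk].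
    assert (Hk0 : (k = 0)%Z).
    { apply IZR_abs_lt_1. pose proof PI_RGT_0. split; apply Rmult_lt_reg_r with PI; lra. }
    rewrite Hk, Hk0, Rmult_0_l, cos_0. lra.
  - left. nra. }
split; [exact CC|]. symmetry. now apply Clog_unique.
Qed.

(** With w = Clog (1 + u), the relation e^w - 1 = u and the derivative of [Cexp] at 0 give w / u
    -> 1; multiplicativity near [z] moves this to an arbitrary point. *)
Lemma is_Cderive_Clog (z : C) : off_cut z -> is_Cderive Clog z (/ z)%C.
Proof.
intros Hz. pose proof (off_cut_neq0 _ Hz) as Hz0. pose proof (proj1 (Cmod_gt_0 z) Hz0) as Hm.
apply is_Cderive_iff. intros eps He.
destruct (Clog_mult_near z Hz) as [d0 [Hd0 K]].
pose proof (is_Cderive_Cexp 0) as DE. rewrite is_Cderive_iff in DE.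
set (e1 := eps * Cmod z / 4).
assert (He1 : 0 < e1) by (unfold e1; nra).
destruct (DE e1 He1) as [d1 [Hd1 K1]].
set (d := Rmin (/ 2) (Rmin d0 (d1 / 5))).
assert (Hd : 0 < d) by (unfold d; repeat apply Rmin_glb_lt; lra).
exists (d * Cmod z). split; [nra|]. intros h Hh.
set (u := (h / z)%C).
assert (Eu : Cmod u * Cmod z = Cmod h) by (unfold u; rewrite Cmod_div by assumption; field; lra).
assert (Hu : Cmod u < d) by (apply Rmult_lt_reg_r with (Cmod z); lra).
assert (u1 : Cmod u < / 2) by (eapply Rlt_le_trans; [exact Hu|apply Rmin_l]).
assert (u2 : Cmod u < d0) by (eapply Rlt_le_trans; [exact Hu|]; eapply Rle_trans; [apply Rmin_r|apply Rmin_l]).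
assert (u3 : Cmod u < d1 / 5) by (eapply Rlt_le_trans; [exact Hu|]; eapply Rle_trans; [apply Rmin_r|apply Rmin_r]).
destruct (K u u2) as [_ E].
replace (z + h)%C with (z * (1 + u))%C by (unfold u; field; assumption).
rewrite E. set (k := Clog (1 + u)%C).
assert (Bk : Cmod k <= 4 * Cmod u) by (apply Clog_1_plus_bound; lra).
pose proof (Cmod_ge_0 u).
specialize (K1 k ltac:(lra)).
replace (0 + k)%C with k in K1 by ring. rewrite Cexp_0 in K1.
unfold k in K1 at 1. rewrite Cexp_Clog in K1 by (apply off_cut_1_plus; lra).
replace (Clog z + k - Clog z - / z * h)%C with (- (1 + u - 1 - 1 * k))%C by (unfold u; field; assumption).
rewrite Cmod_opp. eapply Rle_trans; [exact K1|].
apply Rle_trans with (e1 * (4 * Cmod u)); [nra|]. unfold e1. rewrite <- Eu. right. field.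
Qed.

(** * The Wallis integrals and the sum of inverse squares *)

(** The Wallis integrals. *)
Definition cos_int (n : nat) : R := RInt (fun x => cos x ^ n) 0 (PI / 2).
(** Weighting the Wallis integrals with x^2 leads to the sum of inverse squares: the quotients
    [sqr_cos_int (2 * n) / cos_int (2 * n)] have consecutive differences 1 / (2 (n+1)^2). *)
Definition sqr_cos_int (n : nat) : R := RInt (fun x => x ^ 2 * cos x ^ n) 0 (PI / 2).

Lemma ex_RInt_derivable (f : R -> R) a b : (forall x, ex_derive f x) -> ex_RInt f a b.
Proof. intros H. apply (ex_RInt_continuous (V := R_CompleteNormedModule)). intros x _. apply (ex_derive_continuous f), H. Qed.

Lemma ex_RInt_cos_int n : ex_RInt (fun x => cos x ^ n) 0 (PI / 2).
Proof. apply ex_RInt_derivable. intros x. auto_derive; trivial. Qed.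
Lemma ex_RInt_sqr_cos_int n : ex_RInt (fun x => x ^ 2 * cos x ^ n) 0 (PI / 2).
Proof. apply ex_RInt_derivable. intros x. auto_derive; trivial. Qed.

Lemma is_RInt_cos_int n : is_RInt (fun x => cos x ^ n) 0 (PI / 2) (cos_int n).
Proof. apply (RInt_correct (V := R_CompleteNormedModule)), ex_RInt_cos_int. Qed.
Lemma is_RInt_sqr_cos_int n : is_RInt (fun x => x ^ 2 * cos x ^ n) 0 (PI / 2) (sqr_cos_int n).
Proof. apply (RInt_correct (V := R_CompleteNormedModule)), ex_RInt_sqr_cos_int. Qed.

Lemma RInt_FTC (F f : R -> R) a b : (forall x, is_derive F x (f x)) -> (forall x, ex_derive f x) ->
  is_RInt f a b (F b - F a).
Proof.
intros H1 H2. apply (is_RInt_derive (V := R_CompleteNormedModule) F f); intros x _; [apply H1|apply (ex_derive_continuous f), H2].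
Qed.

Lemma sin2_1_cos2 x : sin x * sin x = 1 - cos x * cos x.
Proof. pose proof (sin2_cos2 x) as H. unfold Rsqr in H. lra. Qed.

Lemma cos_int_rec n : INR (n + 2) * cos_int (n + 2) = INR (n + 1) * cos_int n.
Proof.
assert (H : is_RInt (fun x => INR (n + 2) * cos x ^ (n + 2) - INR (n + 1) * cos x ^ n) 0 (PI / 2)
   (sin (PI / 2) * cos (PI / 2) ^ (n + 1) - sin 0 * cos 0 ^ (n + 1))).
{ apply (RInt_FTC (fun x => sin x * cos x ^ (n + 1))).
  - intros x. auto_derive; [trivial|].
    replace (Nat.pred (n + 1)) with n by lia.
    replace (n + 2)%nat with (S (S n)) by lia. replace (n + 1)%nat with (S n) by lia.
    rewrite !S_INR. simpl. rewrite <- (Rmult_1_l (cos x ^ n)).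
    match goal with |- ?l = ?r => replace l with (cos x * cos x * cos x ^ n - (INR n + 1) * (sin x * sin x) * cos x ^ n) by ring end.
    rewrite sin2_1_cos2. ring.
  - intros x. auto_derive; trivial. }
rewrite sin_0, cos_PI2, Rmult_0_l, pow_ne_zero, Rmult_0_r, Rminus_diag in H by lia.
pose proof (is_RInt_minus (V := R_NormedModule) _ _ _ _ _ _
  (is_RInt_scal (V := R_NormedModule) _ _ _ (INR (n + 2)) _ (is_RInt_cos_int (n + 2)))
  (is_RInt_scal (V := R_NormedModule) _ _ _ (INR (n + 1)) _ (is_RInt_cos_int n))) as K.
apply (is_RInt_unique (V := R_CompleteNormedModule)) in H. apply (is_RInt_unique (V := R_CompleteNormedModule)) in K.
assert (E : 0 = INR (n + 2) * cos_int (n + 2) - INR (n + 1) * cos_int n) by exact (eq_trans (eq_sym H) K).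
lra.
Qed.

(** Integrate the derivative of x cos^(2n+2) x + (n+1) x^2 sin x cos^(2n+1) x, which vanishes at
    both ends. *)
Lemma sqr_cos_int_rec n : cos_int (2 * n + 2) + INR (n + 1) * (INR (2 * n + 2) * sqr_cos_int (2 * n + 2) - INR (2 * n + 1) * sqr_cos_int (2 * n)) = 0.
Proof.
set (f := fun x => cos x ^ (2 * n + 2) + INR (n + 1) * (INR (2 * n + 2) * (x ^ 2 * cos x ^ (2 * n + 2)) - INR (2 * n + 1) * (x ^ 2 * cos x ^ (2 * n)))).
set (F := fun x => x * cos x ^ (2 * n + 2) + INR (n + 1) * (x ^ 2 * (sin x * cos x ^ (2 * n + 1)))).
assert (H : is_RInt f 0 (PI / 2) (F (PI / 2) - F 0)).
{ apply RInt_FTC.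
  - intros x. unfold F, f. set (a := INR (n + 1)).
    assert (E2 : INR (2 * n + 2) = 2 * a) by (unfold a; rewrite !plus_INR, mult_INR; simpl; ring).
    assert (E1 : INR (2 * n + 1) = 2 * a - 1) by (unfold a; rewrite !plus_INR, mult_INR; simpl; ring).
    set (m := (2 * n)%nat) in *.
    auto_derive; [trivial|].
    replace (Nat.pred (m + 2)) with (S m) by lia. replace (Nat.pred (m + 1)) with m by lia.
    rewrite E2, E1.
    replace (m + 2)%nat with (S (S m)) by lia. replace (m + 1)%nat with (S m) by lia. simpl.
    match goal with |- ?l = ?r => replace l with
     (cos x * cos x * cos x ^ m + a * x * x * (cos x * cos x * cos x ^ m) - a * (2 * a - 1) * x * x * (sin x * sin x) * cos x ^ m) by ring end.
    rewrite sin2_1_cos2. ring.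
  - intros x. unfold f. auto_derive; trivial. }
unfold F in H.
rewrite cos_PI2, !(pow_ne_zero (_ + _)) in H by lia.
replace (PI / 2 * 0 + INR (n + 1) * ((PI / 2) ^ 2 * (sin (PI / 2) * 0)) -
  (0 * cos 0 ^ (2 * n + 2) + INR (n + 1) * (0 ^ 2 * (sin 0 * cos 0 ^ (2 * n + 1))))) with 0 in H by ring.
pose proof (is_RInt_minus (V := R_NormedModule) _ _ _ _ _ _
  (is_RInt_scal (V := R_NormedModule) _ _ _ (INR (2 * n + 2)) _ (is_RInt_sqr_cos_int (2 * n + 2)))
  (is_RInt_scal (V := R_NormedModule) _ _ _ (INR (2 * n + 1)) _ (is_RInt_sqr_cos_int (2 * n)))) as K.
apply (is_RInt_scal (V := R_NormedModule) _ _ _ (INR (n + 1))) in K.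
apply (is_RInt_plus (V := R_NormedModule) _ _ _ _ _ _ (is_RInt_cos_int (2 * n + 2))) in K.
apply (is_RInt_unique (V := R_CompleteNormedModule)) in H. apply (is_RInt_unique (V := R_CompleteNormedModule)) in K.
exact (eq_trans (eq_sym K) H).
Qed.

Lemma cos_range x : 0 <= x <= PI / 2 -> 0 <= cos x <= 1.
Proof. intros H. split; [apply cos_ge_0; lra|apply COS_bound]. Qed.

Lemma cos_int_le n : cos_int (S n) <= cos_int n.
Proof.
pose proof PI_RGT_0. apply RInt_le; [lra|apply ex_RInt_cos_int|apply ex_RInt_cos_int|].
intros x Hx. pose proof (cos_range x ltac:(lra)). simpl.
assert (0 <= cos x ^ n) by (apply pow_le; lra). nra.
Qed.

Lemma x_cos_le_sin x : 0 <= x <= PI / 2 -> x * cos x <= sin x.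
Proof.
intros Hx. pose proof PI_RGT_0.
destruct (MVT_gen (fun x => sin x - x * cos x) 0 x (fun x => x * sin x)) as [c [Hc E]].
- intros y _. auto_derive; [trivial|]. ring.
- intros y _. apply derivable_continuous_pt. reg.
- rewrite Rmin_left, Rmax_right in Hc by lra. rewrite sin_0, Rmult_0_l in E.
  assert (0 <= sin c) by (apply sin_ge_0; lra). assert (0 <= c * sin c * (x - 0)) by (repeat apply Rmult_le_pos; lra). lra.
Qed.

(** From x cos x <= sin x and sin^2 = 1 - cos^2. *)
Lemma sqr_cos_int_le n : sqr_cos_int (n + 2) <= cos_int n - cos_int (n + 2).
Proof.
pose proof PI_RGT_0.
assert (E : is_RInt (fun x => cos x ^ n - cos x ^ (n + 2)) 0 (PI / 2) (cos_int n - cos_int (n + 2))).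
{ exact (is_RInt_minus (V := R_NormedModule) _ _ _ _ _ _ (is_RInt_cos_int n) (is_RInt_cos_int (n + 2))). }
rewrite <- (is_RInt_unique (V := R_CompleteNormedModule) _ _ _ _ E).
apply RInt_le; [lra|apply ex_RInt_sqr_cos_int|eexists; exact E|].
intros x Hx. rewrite pow_add. pose proof (cos_range x ltac:(lra)). pose proof (x_cos_le_sin x ltac:(lra)).
assert (0 <= cos x ^ n) by (apply pow_le; lra).
pose proof (sin2_1_cos2 x).
assert ((x * cos x) * (x * cos x) <= 1 - cos x * cos x).
{ rewrite <- H3. apply Rmult_le_compat; nra. }
simpl. nra.
Qed.

Lemma sqr_cos_int_ge0 n : 0 <= sqr_cos_int n.
Proof.
pose proof PI_RGT_0. apply RInt_ge_0; [lra|apply ex_RInt_sqr_cos_int|]. intros x Hx.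
pose proof (cos_range x ltac:(lra)). apply Rmult_le_pos; [apply pow2_ge_0|apply pow_le; lra].
Qed.

Lemma cos_int_0 : cos_int 0 = PI / 2.
Proof. unfold cos_int. rewrite (RInt_ext _ (fun _ => 1)) by reflexivity. rewrite RInt_const. unfold scal; simpl; unfold mult; simpl. ring. Qed.

Lemma cos_int_1 : cos_int 1 = 1.
Proof.
assert (E : is_RInt (fun x => cos x ^ 1) 0 (PI / 2) (sin (PI / 2) - sin 0)).
{ apply (RInt_FTC sin); intros x; auto_derive; trivial; ring. }
rewrite sin_PI2, sin_0, Rminus_0_r in E. exact (is_RInt_unique (V := R_CompleteNormedModule) _ _ _ _ E).
Qed.

Lemma sqr_cos_int_0 : sqr_cos_int 0 = PI ^ 3 / 24.
Proof.
assert (E : is_RInt (fun x => x ^ 2 * cos x ^ 0) 0 (PI / 2) ((PI / 2) ^ 3 / 3 - 0 ^ 3 / 3)).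
{ apply (RInt_FTC (fun x => x ^ 3 / 3)); intros x; auto_derive; trivial; field. }
unfold sqr_cos_int. rewrite (is_RInt_unique (V := R_CompleteNormedModule) _ _ _ _ E). field.
Qed.

Lemma cos_int_pos_and_prod n : 0 < cos_int (2 * n) /\ INR (2 * n + 1) * (cos_int (2 * n) * cos_int (2 * n + 1)) = PI / 2.
Proof.
induction n.
- simpl. rewrite cos_int_0, cos_int_1. pose proof PI_RGT_0. lra.
- destruct IHn as [P E].
  pose proof (cos_int_rec (2 * n)) as R1. pose proof (cos_int_rec (2 * n + 1)) as R2.
  replace (2 * S n)%nat with (2 * n + 2)%nat by lia. replace (2 * n + 1 + 2)%nat with (2 * n + 2 + 1)%nat in R2 by lia.
  replace (2 * n + 1 + 1)%nat with (2 * n + 2)%nat in R2 by lia.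
  assert (0 < INR (2 * n + 1)) by (apply lt_0_INR; lia). assert (0 < INR (2 * n + 2)) by (apply lt_0_INR; lia).
  split.
  + apply Rmult_lt_reg_l with (INR (2 * n + 2)); [assumption|]. rewrite R1, Rmult_0_r. nra.
  + apply Rmult_eq_reg_l with (INR (2 * n + 2)); [|lra].
    replace (INR (2 * n + 2) * (INR (2 * n + 2 + 1) * (cos_int (2 * n + 2) * cos_int (2 * n + 2 + 1))))
     with ((INR (2 * n + 2) * cos_int (2 * n + 2)) * (INR (2 * n + 2 + 1) * cos_int (2 * n + 2 + 1))) by ring.
    rewrite R1, R2, <- E. ring.
Qed.

(** Wallis' product.  The integrals decrease in [n], so the square of an even one lies between
    its products with the two odd neighbours, and these products are known exactly. *)
Lemma wallis_limit : is_lim_seq (fun n => INR (S n) * cos_int (2 * S n) ^ 2) (PI / 4).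
Proof.
pose proof PI_RGT_0 as HP.
apply (is_lim_seq_le_le (fun n => PI / 4 * (1 - / INR (S n))) _ (fun n => PI / 4 * (1 + / INR (S n)))).
- intros n.
  destruct (cos_int_pos_and_prod (S n)) as [P E]. destruct (cos_int_pos_and_prod n) as [P' E'].
  pose proof (cos_int_le (2 * S n)) as L1. pose proof (cos_int_le (2 * n + 1)) as L2.
  replace (S (2 * S n)) with (2 * S n + 1)%nat in L1 by lia. replace (S (2 * n + 1)) with (2 * S n)%nat in L2 by lia.
  pose proof (cos_int_rec (2 * n)) as R1. replace (2 * n + 2)%nat with (2 * S n)%nat in R1 by lia.
  assert (Ha : 1 <= INR (S n)) by (rewrite S_INR; pose proof (pos_INR n); lra).
  assert (E1 : INR (2 * S n) = 2 * INR (S n)) by (rewrite mult_INR; simpl; ring).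
  assert (E2 : INR (2 * S n + 1) = 2 * INR (S n) + 1) by (rewrite plus_INR, E1; simpl; ring).
  assert (E3 : INR (2 * n + 1) = 2 * INR (S n) - 1) by (rewrite S_INR, plus_INR, mult_INR; simpl; ring).
  rewrite E1, E3 in R1. rewrite E2 in E. rewrite E3 in E'.
  set (a := INR (S n)) in *. set (u := cos_int (2 * S n)) in *. set (v := cos_int (2 * S n + 1)) in *.
  set (u' := cos_int (2 * n)) in *. set (v' := cos_int (2 * n + 1)) in *.
  assert (Q1 : PI / 2 <= (2 * a + 1) * u ^ 2) by (rewrite <- E; simpl; rewrite Rmult_1_r; apply Rmult_le_compat_l; [lra|]; apply Rmult_le_compat_l; lra).
  (* 2 a u^2 <= 2 a u v' = (2 a - 1) u' v' = pi/2, by the recurrence. *)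
  assert (Q2 : 2 * a * u ^ 2 <= PI / 2).
  { replace (PI / 2) with (2 * a * (u * v')); [simpl; rewrite Rmult_1_r; apply Rmult_le_compat_l; [lra|]; apply Rmult_le_compat_l; lra|].
    rewrite <- E'. replace (2 * a * (u * v')) with ((2 * a * u) * v') by ring. rewrite R1. ring. }
  assert (Hi : 0 < / a) by (apply Rinv_0_lt_compat; lra).
  assert (Hia : a * / a = 1) by (apply Rinv_r; lra).
  split.
  + assert (K : PI / 4 <= a * u ^ 2 + u ^ 2 / 2) by lra.
    assert (u ^ 2 / 2 <= PI / 4 * / a); [|lra].
    apply Rmult_le_reg_l with a; [lra|]. replace (a * (PI / 4 * / a)) with (PI / 4 * (a * / a)) by ring. rewrite Hia. lra.
  + assert (0 <= PI / 4 * / a) by nra. lra.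
- replace (Finite (PI / 4)) with (Finite (PI / 4 * (1 - 0))) by (f_equal; ring).
  apply is_lim_seq_mult'; [apply is_lim_seq_const|]. apply is_lim_seq_minus'; [apply is_lim_seq_const|].
  apply is_lim_seq_incr_1 with (u := fun n => / INR n).
  replace (Finite 0) with (Rbar_inv p_infty) by reflexivity.
  apply is_lim_seq_inv; [apply is_lim_seq_INR|easy].
- replace (Finite (PI / 4)) with (Finite (PI / 4 * (1 + 0))) by (f_equal; ring).
  apply is_lim_seq_mult'; [apply is_lim_seq_const|]. apply is_lim_seq_plus'; [apply is_lim_seq_const|].
  apply is_lim_seq_incr_1 with (u := fun n => / INR n).
  replace (Finite 0) with (Rbar_inv p_infty) by reflexivity.
  apply is_lim_seq_inv; [apply is_lim_seq_INR|easy].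
Qed.

Lemma cos_int_factorial n : cos_int (2 * n) * (4 ^ n * INR (fact n) ^ 2) = PI / 2 * INR (fact (2 * n)).
Proof.
induction n.
- simpl. rewrite cos_int_0. ring.
- pose proof (cos_int_rec (2 * n)) as R1. replace (2 * S n)%nat with (2 * n + 2)%nat by lia.
  replace (fact (2 * n + 2)) with ((2 * n + 2) * ((2 * n + 1) * fact (2 * n)))%nat by (replace (2 * n + 2)%nat with (S (S (2 * n))) by lia; replace (2 * n + 1)%nat with (S (2 * n)) by lia; reflexivity).
  rewrite fact_simpl, !mult_INR.
  assert (E : INR (2 * n + 2) = 2 * INR (S n)) by (rewrite plus_INR, mult_INR, (S_INR n); simpl; ring).
  rewrite E in *. simpl (4 ^ S n).
  replace (cos_int (2 * n + 2) * (4 * 4 ^ n * (INR (S n) * INR (fact n)) ^ 2)) with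
   ((2 * INR (S n) * cos_int (2 * n + 2)) * (2 * INR (S n)) * (4 ^ n * INR (fact n) ^ 2)) by ring.
  rewrite R1. replace (PI / 2 * (2 * INR (S n) * (INR (2 * n + 1) * INR (fact (2 * n))))) with
   (2 * INR (S n) * INR (2 * n + 1) * (PI / 2 * INR (fact (2 * n)))) by ring.
  rewrite <- IHn. ring.
Qed.

(** By the two recurrences 1/n^2 is a difference of consecutive values of twice the quotient of
    the two integrals, so the partial sums telescope from [sqr_cos_int 0] and the remaining
    quotient is O(1/n). *)
Lemma basel : is_series (fun n => / INR (S n) ^ 2) (PI ^ 2 / 6).
Proof.
assert (T : forall n, sum_n (fun k => / INR (S k) ^ 2) n = PI ^ 2 / 6 - 2 * (sqr_cos_int (2 * n + 2) / cos_int (2 * n + 2))).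
{ assert (Step : forall n, / INR (S n) ^ 2 = 2 * (sqr_cos_int (2 * n) / cos_int (2 * n)) - 2 * (sqr_cos_int (2 * n + 2) / cos_int (2 * n + 2))).
  { intros n. pose proof (sqr_cos_int_rec n) as J. pose proof (cos_int_rec (2 * n)) as R1.
    destruct (cos_int_pos_and_prod n) as [P _]. destruct (cos_int_pos_and_prod (S n)) as [P' _].
    replace (2 * S n)%nat with (2 * n + 2)%nat in P' by lia.
    replace (n + 1)%nat with (S n) in J by lia.
    assert (E : INR (2 * n + 2) = 2 * INR (S n)) by (rewrite plus_INR, mult_INR, (S_INR n); simpl; ring).
    assert (E1 : INR (2 * n + 1) = 2 * INR (S n) - 1) by (rewrite plus_INR, mult_INR, (S_INR n); simpl; ring).
    rewrite E, E1 in *. assert (Ha : 1 <= INR (S n)) by (rewrite S_INR; pose proof (pos_INR n); lra).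
    set (a := INR (S n)) in *. set (u := cos_int (2 * n)) in *. set (u2 := cos_int (2 * n + 2)) in *.
    set (j := sqr_cos_int (2 * n)) in *. set (j2 := sqr_cos_int (2 * n + 2)) in *.
    assert (Eu : u = 2 * a * u2 / (2 * a - 1)) by (rewrite R1; field; lra).
    apply Rmult_eq_reg_r with (a * a * u2); [|apply Rgt_not_eq; repeat apply Rmult_lt_0_compat; lra].
    rewrite Eu. field_simplify; try (repeat split; lra). }
  intros n. induction n.
  - rewrite sum_O, Step. simpl (2 * 0)%nat. rewrite sqr_cos_int_0, cos_int_0. pose proof PI_RGT_0. apply (f_equal (fun y => y - 2 * (sqr_cos_int (0 + 2) / cos_int (0 + 2)))). apply (Rmult_eq_reg_r PI); [field|]; lra.
  - rewrite sum_Sn, IHn, Step. unfold plus; simpl.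
    replace (n + S (n + 0))%nat with (n + (n + 0) + 1)%nat by lia.
    replace (S (n + (n + 0) + 1))%nat with (n + (n + 0) + 2)%nat by lia.
    set (q := sqr_cos_int _ / _). set (q' := sqr_cos_int _ / _). apply Rminus_diag_uniq. lra. }
change (is_lim_seq (sum_n (fun n => / INR (S n) ^ 2)) (PI ^ 2 / 6)).
apply (is_lim_seq_ext (fun n => PI ^ 2 / 6 - 2 * (sqr_cos_int (2 * n + 2) / cos_int (2 * n + 2)))); [intros; symmetry; apply T|].
replace (Finite (PI ^ 2 / 6)) with (Finite (PI ^ 2 / 6 - 2 * 0)) by (f_equal; ring).
apply is_lim_seq_minus'; [apply is_lim_seq_const|]. apply is_lim_seq_mult'; [apply is_lim_seq_const|].
apply (is_lim_seq_le_le (fun _ => 0) _ (fun n => / INR (S n))); [|apply is_lim_seq_const|].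
- intros n. destruct (cos_int_pos_and_prod n) as [P _]. destruct (cos_int_pos_and_prod (S n)) as [P' _].
  replace (2 * S n)%nat with (2 * n + 2)%nat in P' by lia.
  pose proof (sqr_cos_int_le (2 * n)) as L. pose proof (sqr_cos_int_ge0 (2 * n + 2)). pose proof (cos_int_rec (2 * n)) as R1.
  split; [apply Rdiv_le_0_compat; lra|].
  assert (E : INR (2 * n + 2) = 2 * INR (S n)) by (rewrite plus_INR, mult_INR, (S_INR n); simpl; ring).
  assert (E1 : INR (2 * n + 1) = 2 * INR (S n) - 1) by (rewrite plus_INR, mult_INR, (S_INR n); simpl; ring).
  assert (Ha : 1 <= INR (S n)) by (rewrite S_INR; pose proof (pos_INR n); lra).
  rewrite E, E1 in R1. set (a := INR (S n)) in *.
  (* The numerator is at most a difference of Wallis integrals, which is cos_int (2n+2) / (2n+1). *)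
  apply Rmult_le_reg_r with (cos_int (2 * n + 2) * a * (2 * a - 1)); [repeat apply Rmult_lt_0_compat; lra|].
  unfold Rdiv. replace (sqr_cos_int (2 * n + 2) * / cos_int (2 * n + 2) * (cos_int (2 * n + 2) * a * (2 * a - 1))) with
    (sqr_cos_int (2 * n + 2) * a * (2 * a - 1)) by (field; lra).
  replace (/ a * (cos_int (2 * n + 2) * a * (2 * a - 1))) with (cos_int (2 * n + 2) * (2 * a - 1)) by (field; lra).
  apply Rle_trans with ((cos_int (2 * n) - cos_int (2 * n + 2)) * a * (2 * a - 1)).
  + apply Rmult_le_compat_r; [lra|]. apply Rmult_le_compat_r; lra.
  + replace ((cos_int (2 * n) - cos_int (2 * n + 2)) * a * (2 * a - 1)) with
     (a * ((2 * a - 1) * cos_int (2 * n)) - a * (2 * a - 1) * cos_int (2 * n + 2)) by ring.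
    rewrite <- R1. nra.
- apply is_lim_seq_incr_1 with (u := fun n => / INR n).
  replace (Finite 0) with (Rbar_inv p_infty) by reflexivity.
  apply is_lim_seq_inv; [apply is_lim_seq_INR|easy].
Qed.

(** * The Euler product for the logarithm of the Gamma function *)

(** The function z log z - z and its successive derivatives log z, 1/z, - 1/z^2, ... *)
Definition log_chain (j : nat) (z : C) : C :=
  match j with
  | O => z * Clog z - z
  | S O => Clog z
  | S (S m) => RtoC ((-1) ^ m * INR (fact m)) * / z ^ S m
  end%C.

Lemma Cpow_neq0 z n : z <> RtoC 0 -> (z ^ n)%C <> RtoC 0.
Proof. apply Cpow_nz. Qed.

Lemma is_Cderive_inv_pow (z : C) n : z <> RtoC 0 ->
  is_Cderive (fun y => / y ^ S n)%C z (- RtoC (INR (S n)) * / z ^ S (S n))%C.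
Proof.
intros Hz. induction n.
- apply (is_Cderive_ext_near Cinv _ z _ (Cmod z)); [now apply Cmod_gt_0| |].
  + intros y Hy. f_equal. simpl. ring.
  + replace (- RtoC (INR 1) * / z ^ 2)%C with (- / (z * z))%C; [now apply is_Cderive_inv|].
    simpl. field. assumption.
- apply (is_Cderive_ext_near (fun y => / y ^ S n * / y)%C _ z _ (Cmod z)); [now apply Cmod_gt_0| |].
  + intros y Hy. assert (y <> RtoC 0).
    { intros E; subst. replace (0 - z)%C with (- z)%C in Hy by ring. rewrite Cmod_opp in Hy. lra. }
    rewrite (Cpow_S y (S n)). field; repeat split; first [assumption | now apply Cpow_neq0].
  + replace (- RtoC (INR (S (S n))) * / z ^ S (S (S n)))%C with
      (- RtoC (INR (S n)) * / z ^ S (S n) * / z + / z ^ S n * (- / (z * z)))%C.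
    * apply (is_Cderive_mult (fun y => / y ^ S n)%C Cinv); [exact IHn|now apply is_Cderive_inv].
    * rewrite (S_INR (S n)), RtoC_plus. rewrite !Cpow_S. field; repeat split; first [assumption | now apply Cpow_neq0].
Qed.

Lemma is_Cderive_log_chain j (z : C) : off_cut z -> is_Cderive (log_chain j) z (log_chain (S j) z).
Proof.
intros Hc. pose proof (off_cut_neq0 _ Hc) as Hz. destruct j as [|[|m]].
- simpl. replace (Clog z) with (1 * Clog z + z * / z - 1)%C by (field; assumption).
  apply (is_Cderive_minus (fun y => y * Clog y)%C (fun y => y)); [|apply is_Cderive_id].
  apply (is_Cderive_mult (fun y => y) Clog); [apply is_Cderive_id|now apply is_Cderive_Clog].
- replace (log_chain 2 z) with (/ z)%C; [exact (is_Cderive_Clog z Hc)|].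
  simpl. rewrite Rmult_1_l, Cmult_1_r. ring.
- change (log_chain (S (S (S m))) z) with (RtoC ((-1) ^ S m * INR (fact (S m))) * / z ^ S (S m))%C.
  change (log_chain (S (S m))) with (fun z => RtoC ((-1) ^ m * INR (fact m)) * / z ^ S m)%C.
  replace (RtoC ((-1) ^ S m * INR (fact (S m))) * / z ^ S (S m))%C with
   (RtoC ((-1) ^ m * INR (fact m)) * (- RtoC (INR (S m)) * / z ^ S (S m)))%C.
  + apply (is_Cderive_scal _ (fun y => / y ^ S m)%C). now apply is_Cderive_inv_pow.
  + rewrite fact_simpl, mult_INR. simpl ((-1) ^ S m). rewrite !RtoC_mult. ring.
Qed.

Lemma off_cut_plus_pos t s : off_cut t -> 0 <= s -> off_cut (t + RtoC s)%C.
Proof.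
intros H Hs. apply off_cut_iff. apply off_cut_iff in H. destruct t as [a b]. unfold Re, Im in *; simpl in *.
destruct H as [H|H]; [left; lra|right; lra].
Qed.

(** Along the segment from 1 to 1 + u the difference has derivative (- s u)^K u / (1 + s u), the
    tail of a geometric series, and |1 + s u| >= 1/2. *)
Lemma Clog_taylor u K : Cmod u <= / 2 ->
  Cmod (Clog (1 + u) - csum K (fun m => RtoC ((-1) ^ m / INR (S m)) * u ^ S m))%C <= 2 * Cmod u ^ S K.
Proof.
intros Hu.
set (f := fun s : R => (Clog (1 + RtoC s * u) - csum K (fun m => RtoC ((-1) ^ m / INR (S m)) * (RtoC s * u) ^ S m))%C).
set (g := fun s : R => (/ (1 + RtoC s * u) * u - csum K (fun m => RtoC ((-1) ^ m) * (RtoC s * u) ^ m * u))%C).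
assert (Hs : forall s, 0 <= s <= 1 -> Cmod (RtoC s * u)%C <= Cmod u).
{ intros s Hs. rewrite Cmod_mult, Cmod_RtoC_pos by lra. pose proof (Cmod_ge_0 u). nra. }
assert (D : forall s, 0 <= s <= 1 -> curve_derive f s (g s)).
{ intros s Hs'. unfold f, g. specialize (Hs s Hs').
  apply curve_derive_minus.
  - apply (curve_derive_line Clog 1%R u). apply is_Cderive_Clog, off_cut_1_plus. lra.
  - clear f g. induction K; [simpl; apply curve_derive_const|].
    change (csum (S K) ?v) with (csum K v + v K)%C.
    apply (curve_derive_ext (fun s => csum K (fun m => RtoC ((-1) ^ m / INR (S m)) * (RtoC s * u) ^ S m) +
      RtoC ((-1) ^ K / INR (S K)) * (RtoC s * u) ^ S K)%C); [reflexivity|].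
    apply curve_derive_plus; [exact IHK|].
    replace (RtoC ((-1) ^ K) * (RtoC s * u) ^ K * u)%C with
     (RtoC ((-1) ^ K / INR (S K)) * (RtoC (INR (S K)) * (RtoC s * u) ^ K * u))%C.
    + apply curve_derive_scal.
      apply (curve_derive_ext (fun u0 => (fun z => z ^ S K) (0 + RtoC u0 * u))%C).
      { intros v. f_equal. ring. }
      apply (curve_derive_line (fun z => z ^ S K)%C 0%R u). replace (0 + RtoC s * u)%C with (RtoC s * u)%C by ring.
      generalize (RtoC s * u)%C. clear. intros z. induction K.
      * apply (is_Cderive_ext (fun y => y)); [intros y; simpl; ring|].
        replace (RtoC (INR 1) * z ^ 0)%C with (RtoC 1) by (simpl; ring). apply is_Cderive_id.
      * apply (is_Cderive_ext (fun y => y * y ^ S K)%C); [reflexivity|].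
        replace (RtoC (INR (S (S K))) * z ^ S K)%C with (1 * z ^ S K + z * (RtoC (INR (S K)) * z ^ K))%C.
        -- apply (is_Cderive_mult (fun y => y) (fun y => y ^ S K)%C); [apply is_Cderive_id|exact IHK].
        -- rewrite (S_INR (S K)), RtoC_plus, !Cpow_S. ring.
    + unfold Rdiv. rewrite RtoC_mult.
      assert (E : (RtoC (/ INR (S K)) * RtoC (INR (S K)))%C = 1).
      { rewrite <- RtoC_mult, Rinv_l; [reflexivity|]. apply not_0_INR; lia. }
      transitivity (RtoC ((-1) ^ K) * (RtoC (/ INR (S K)) * RtoC (INR (S K))) * (RtoC s * u) ^ K * u)%C; [ring|].
      rewrite E. ring. }
assert (G : forall s, 0 <= s <= 1 -> Cmod (g s) <= 2 * Cmod u ^ S K).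
{ intros s Hs'. specialize (Hs s Hs').
  assert (Hn : (1 + RtoC s * u)%C <> RtoC 0) by (apply off_cut_neq0, off_cut_1_plus; lra).
  (* The derivative of the remainder is the tail of a geometric series in closed form. *)
  assert (E : g s = ((- (RtoC s * u)) ^ K * u / (1 + RtoC s * u))%C).
  { unfold g. clear -Hn. set (v := (RtoC s * u)%C) in *. induction K.
    - simpl. field. assumption.
    - change (csum (S K) ?w) with (csum K w + w K)%C. cbv beta.
      replace (/ (1 + v) * u - (csum K (fun m => RtoC ((-1) ^ m) * v ^ m * u) + RtoC ((-1) ^ K) * v ^ K * u))%C
       with ((/ (1 + v) * u - csum K (fun m => RtoC ((-1) ^ m) * v ^ m * u)) - RtoC ((-1) ^ K) * v ^ K * u)%C by ring.
      rewrite IHK. rewrite (Cpow_S (- v)).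
      assert (EE : ((- v) ^ K)%C = (RtoC ((-1) ^ K) * v ^ K)%C).
      { clear. induction K; [simpl; ring|]. rewrite !Cpow_S, IHK. simpl ((-1) ^ S K). rewrite RtoC_mult. ring. }
      rewrite EE. field. assumption. }
  rewrite E, Cmod_div, Cmod_mult, Cmod_pow, Cmod_opp by assumption.
  assert (H2 : / 2 <= Cmod (1 + RtoC s * u)%C).
  { pose proof (Cmod_triangle_rev 1 (- (RtoC s * u))%C) as T. rewrite Cmod_1, Cmod_opp in T.
    replace (1 - - (RtoC s * u))%C with (1 + RtoC s * u)%C in T by ring. lra. }
  assert (HP : Cmod (RtoC s * u)%C ^ K <= Cmod u ^ K) by (apply pow_incr; split; [apply Cmod_ge_0|assumption]).
  assert (0 <= Cmod (RtoC s * u)%C ^ K) by (apply pow_le, Cmod_ge_0).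
  pose proof (Cmod_ge_0 u).
  assert (/ Cmod (1 + RtoC s * u)%C <= 2) by (rewrite <- (Rinv_inv 2); apply Rinv_le_contravar; lra).
  assert (0 < / Cmod (1 + RtoC s * u)%C) by (apply Rinv_0_lt_compat; lra).
  unfold Rdiv. simpl. rewrite (Rmult_comm 2). apply Rmult_le_compat; try lra; nra. }
pose proof (curve_derive_mean_value f g 0 1 (2 * Cmod u ^ S K) ltac:(lra) D G) as M.
assert (E1 : f 1 = (Clog (1 + u) - csum K (fun m => RtoC ((-1) ^ m / INR (S m)) * u ^ S m))%C).
{ unfold f. now replace (RtoC 1 * u)%C with u by ring. }
assert (E0 : f 0 = 0).
{ unfold f. rewrite csum_zero.
  - replace (1 + RtoC 0 * u)%C with (RtoC 1) by ring. rewrite Clog_RtoC, ln_1 by lra. ring.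
  - intros k _. rewrite Cpow_S. ring. }
rewrite E1, E0 in M.
replace (Clog (1 + u) - csum K (fun m => RtoC ((-1) ^ m / INR (S m)) * u ^ S m) - 0)%C with
 (Clog (1 + u) - csum K (fun m => RtoC ((-1) ^ m / INR (S m)) * u ^ S m))%C in M by ring. lra.
Qed.

Lemma Clog_first u : Cmod u <= / 2 -> Cmod (Clog (1 + u) - u)%C <= 2 * Cmod u ^ 2.
Proof.
intros H. pose proof (Clog_taylor u 1 H) as K. simpl csum in K.
replace (Clog (1 + u) - (0 + RtoC (1 / 1) * (u * 1)))%C with (Clog (1 + u) - u)%C in K; [exact K|].
replace (1 / 1) with 1 by field. ring.
Qed.

(** The logarithm of a factor (1 + 1/k)^t / (1 + t/k) of Euler's product, with [k] shifted by
    one. *)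
Definition log_Gamma_term (t : C) (k : nat) : C :=
  (t * RtoC (ln (INR (S (S k)) / INR (S k))) - Clog (1 + t * RtoC (/ INR (S k))))%C.
(** A sum of principal logarithms of the factors of Euler's product, hence the branch of log
    Gamma on the plane without the closed negative axis that is real for positive arguments. *)
Definition log_Gamma (t : C) : C := (- Clog t + CSeries (log_Gamma_term t))%C.

Lemma INR_S_pos k : 0 < INR (S k).
Proof. apply lt_0_INR. lia. Qed.

Lemma Cmod_over_INR t k : Cmod (t * RtoC (/ INR (S k)))%C = Cmod t / INR (S k).
Proof. rewrite Cmod_mult, Cmod_RtoC_pos; [reflexivity|]. left. apply Rinv_0_lt_compat, INR_S_pos. Qed.

Lemma ln_step_bound k : Rabs (ln (INR (S (S k)) / INR (S k)) - / INR (S k)) <= 2 * (/ INR (S k)) ^ 2.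
Proof.
pose proof (INR_S_pos k) as H. set (a := INR (S k)) in *.
assert (E : INR (S (S k)) / a = 1 + / a) by (rewrite S_INR; fold a; field; lra). rewrite E.
assert (Hi : 0 < / a) by (apply Rinv_0_lt_compat; lra).
assert (H1 : ln (1 + / a) <= / a) by (pose proof (ln_le_minus_1 (1 + / a)); lra).
assert (H2 : / a - (/ a) ^ 2 <= ln (1 + / a)).
{ pose proof (ln_le_minus_1 (/ (1 + / a)) ltac:(apply Rinv_0_lt_compat; lra)) as L.
  rewrite ln_Rinv in L by lra.
  assert (1 - / (1 + / a) >= / a - (/ a) ^ 2); [|lra].
  apply Rle_ge. apply Rmult_le_reg_r with (1 + / a); [lra|].
  clear E H. generalize dependent (/ a). intros b Hi _ L.
  replace ((1 - / (1 + b)) * (1 + b)) with b by (field; lra).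
  pose proof (pow_lt b 3 Hi). simpl in *. lra. }
apply Rabs_le. assert (0 <= (/ a) ^ 2) by apply pow2_ge_0. lra.
Qed.

Lemma ex_series_inv_sqr : ex_series (fun k => / INR (S k) ^ 2).
Proof. eexists. apply basel. Qed.

Lemma log_Gamma_term_bound t k : 2 * Cmod t <= INR (S k) ->
  Cmod (log_Gamma_term t k) <= (2 * Cmod t + 2 * Cmod t ^ 2) * / INR (S k) ^ 2.
Proof.
intros Hk. pose proof (INR_S_pos k) as H.
assert (Hu : Cmod (t * RtoC (/ INR (S k)))%C <= / 2).
{ rewrite Cmod_over_INR. apply Rmult_le_reg_r with (INR (S k)); [assumption|]. unfold Rdiv. rewrite Rmult_assoc, Rinv_l; lra. }
pose proof (Clog_first _ Hu) as B1. pose proof (ln_step_bound k) as B2.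
unfold log_Gamma_term.
replace (t * RtoC (ln (INR (S (S k)) / INR (S k))) - Clog (1 + t * RtoC (/ INR (S k))))%C with
 (t * RtoC (ln (INR (S (S k)) / INR (S k)) - / INR (S k)) - (Clog (1 + t * RtoC (/ INR (S k))) - t * RtoC (/ INR (S k))))%C
 by (rewrite RtoC_minus; ring).
eapply Rle_trans; [apply Cmod_triangle_sub|]. rewrite Cmod_mult, Cmod_R.
rewrite Cmod_over_INR in B1. pose proof (Cmod_ge_0 t).
replace ((2 * Cmod t + 2 * Cmod t ^ 2) * / INR (S k) ^ 2) with (Cmod t * (2 * (/ INR (S k)) ^ 2) + 2 * (Cmod t / INR (S k)) ^ 2) by (field; lra).
apply Rplus_le_compat; [|assumption]. apply Rmult_le_compat_l; assumption.
Qed.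

Lemma exists_INR_ge x : exists n, x <= INR n.
Proof. exists (Z.to_nat (up x)). destruct (archimed x) as [H _]. rewrite INR_IZR_INZ.
destruct (Z.le_ge_cases 0 (up x)) as [K|K].
- rewrite Z2Nat.id by assumption. lra.
- assert (IZR (up x) <= 0) by (apply (IZR_le _ 0); lia).
  assert (0 <= IZR (Z.of_nat (Z.to_nat (up x)))) by (apply (IZR_le 0); lia). lra.
Qed.

Lemma log_Gamma_term_conv t : Csummable (log_Gamma_term t).
Proof.
destruct (exists_INR_ge (2 * Cmod t)) as [n Hn].
assert (K : Csummable (fun k => log_Gamma_term t (n + k)%nat)).
{ apply (Csummable_le _ (fun k => (2 * Cmod t + 2 * Cmod t ^ 2) * / INR (S (n + k)) ^ 2)).
  - intros k. apply log_Gamma_term_bound. eapply Rle_trans; [exact Hn|]. apply le_INR. lia.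
  - apply (ex_series_scal_R (2 * Cmod t + 2 * Cmod t ^ 2)).
    apply (ex_series_shift (fun k => / INR (S k) ^ 2) n), ex_series_inv_sqr. }
clear Hn. induction n; [exact K|]. apply IHn. apply Csummable_decr.
revert K. apply Csummable_ext. intros k. f_equal. lia.
Qed.

(** The logarithm of n! (n+1)^t / (t (t+1)...(t+n)), the partial Euler product. *)
Definition log_Gamma_partial (n : nat) (t : C) : C :=
  (t * RtoC (ln (INR (S n))) + RtoC (ln (INR (fact n))) - csum (S n) (fun k => Clog (t + RtoC (INR k))))%C.

Lemma Clog_shift t k : off_cut t -> Clog (t + RtoC (INR (S k)))%C = (RtoC (ln (INR (S k))) + Clog (1 + t * RtoC (/ INR (S k))))%C.
Proof.
intros H. pose proof (INR_S_pos k) as Hk. assert (RtoC (INR (S k)) <> 0) by (apply RtoC_neq0; lra).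
assert (E : (t + RtoC (INR (S k)))%C = (RtoC (INR (S k)) * (1 + t * RtoC (/ INR (S k))))%C).
{ rewrite RtoC_inv by lra. field. assumption. }
rewrite E. apply Clog_scal; [assumption|].
replace (1 + t * RtoC (/ INR (S k)))%C with (RtoC (/ INR (S k)) * (t + RtoC (INR (S k))))%C.
- apply off_cut_scal; [now apply Rinv_0_lt_compat|]. apply off_cut_plus_pos; [assumption|lra].
- rewrite RtoC_inv by lra. field. assumption.
Qed.

Lemma log_Gamma_partial_partial n t : off_cut t -> log_Gamma_partial n t = (- Clog t + csum n (log_Gamma_term t))%C.
Proof.
intros H. induction n.
- unfold log_Gamma_partial. simpl. rewrite ln_1. replace (t + RtoC 0)%C with t by ring. ring.
- unfold log_Gamma_partial in *. change (csum (S n) (log_Gamma_term t)) with (csum n (log_Gamma_term t) + log_Gamma_term t n)%C.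
  rewrite Cplus_assoc, <- IHn.
  change (csum (S (S n)) ?v) with (csum (S n) v + v (S n))%C. cbv beta.
  rewrite Clog_shift by assumption. unfold log_Gamma_term.
  pose proof (INR_S_pos n). pose proof (INR_S_pos (S n)).
  rewrite ln_div by assumption. rewrite RtoC_minus.
  rewrite fact_simpl, mult_INR, ln_mult, RtoC_plus by (try assumption; apply INR_fact_lt_0). ring.
Qed.

Lemma log_Gamma_lim t : off_cut t -> Clim (fun n => log_Gamma_partial n t) (log_Gamma t).
Proof.
intros H. apply (Clim_ext (fun n => - Clog t + csum n (log_Gamma_term t))%C); [intros; now rewrite log_Gamma_partial_partial|].
apply Clim_plus; [apply Clim_const|]. apply Clim_csum, log_Gamma_term_conv.
Qed.

Lemma is_lim_seq_inv_S : is_lim_seq (fun n => / INR (S n)) 0.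
Proof.
apply is_lim_seq_incr_1 with (u := fun n => / INR n).
replace (Finite 0) with (Rbar_inv p_infty) by reflexivity.
apply is_lim_seq_inv; [apply is_lim_seq_INR|easy].
Qed.

Lemma Clim_eventually u v l n0 : (forall n, (n0 <= n)%nat -> u n = v n) -> Clim u l -> Clim v l.
Proof.
intros E H e He. destruct (H e He) as [N K]. exists (N + n0)%nat. intros n Hn. rewrite <- E by lia. apply K. lia.
Qed.

Lemma Clim_0_ev u (B : nat -> R) n0 : (forall n, (n0 <= n)%nat -> Cmod (u n) <= B n) -> is_lim_seq B 0 -> Clim u 0.
Proof.
intros H HB e He. apply is_lim_seq_spec in HB. destruct (HB (mkposreal e He)) as [N K].
exists (N + n0)%nat. intros n Hn. specialize (K n ltac:(lia)). simpl in K. rewrite Rminus_0_r in K.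
replace (u n - 0)%C with (u n) by ring. specialize (H n ltac:(lia)). pose proof (Rle_abs (B n)). lra.
Qed.

Lemma Clog_1_plus_scaled t : Clim (fun n => RtoC (INR (S n)) * (Clog (1 + t * RtoC (/ INR (S n))) - t * RtoC (/ INR (S n))))%C 0.
Proof.
destruct (exists_INR_ge (2 * Cmod t)) as [n0 Hn0].
apply (Clim_0_ev _ (fun n => 2 * Cmod t ^ 2 * / INR (S n)) n0).
- intros n Hn. pose proof (INR_S_pos n).
  assert (Hu : Cmod (t * RtoC (/ INR (S n)))%C <= / 2).
  { rewrite Cmod_over_INR. assert (2 * Cmod t <= INR (S n)) by (eapply Rle_trans; [exact Hn0|apply le_INR; lia]).
    apply Rmult_le_reg_r with (INR (S n)); [assumption|]. unfold Rdiv. rewrite Rmult_assoc, Rinv_l; lra. }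
  pose proof (Clog_first _ Hu) as B. rewrite Cmod_mult, Cmod_RtoC_pos by lra.
  eapply Rle_trans; [apply Rmult_le_compat_l; [lra|exact B]|]. rewrite Cmod_over_INR. right. field. lra.
- replace (Finite 0) with (Finite (2 * Cmod t ^ 2 * 0)) by (f_equal; ring).
  apply is_lim_seq_mult'; [apply is_lim_seq_const|apply is_lim_seq_inv_S].
Qed.

Lemma Clim_inv_S : Clim (fun n => RtoC (/ INR (S n))) 0.
Proof.
apply (Clim_0_le _ (fun n => / INR (S n))); [|apply is_lim_seq_inv_S].
intros n. rewrite Cmod_RtoC_pos; [lra|]. left. apply Rinv_0_lt_compat, INR_S_pos.
Qed.

Lemma Clog_1_plus_lim t : Clim (fun n => Clog (1 + t * RtoC (/ INR (S n))))%C 0.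
Proof.
destruct (exists_INR_ge (2 * Cmod t)) as [n0 Hn0].
apply (Clim_0_ev _ (fun n => 4 * Cmod t * / INR (S n)) n0).
- intros n Hn. pose proof (INR_S_pos n).
  assert (Hu : Cmod (t * RtoC (/ INR (S n)))%C <= / 2).
  { rewrite Cmod_over_INR. assert (2 * Cmod t <= INR (S n)) by (eapply Rle_trans; [exact Hn0|apply le_INR; lia]).
    apply Rmult_le_reg_r with (INR (S n)); [assumption|]. unfold Rdiv. rewrite Rmult_assoc, Rinv_l; lra. }
  eapply Rle_trans; [apply Clog_1_plus_bound, Hu|]. rewrite Cmod_over_INR. right. field. lra.
- replace (Finite 0) with (Finite (4 * Cmod t * 0)) by (f_equal; ring).
  apply is_lim_seq_mult'; [apply is_lim_seq_const|apply is_lim_seq_inv_S].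
Qed.

(** The functional equation at the level of logarithms: the partial products for [t] and [t + 1]
    differ by log t up to log (1 + t / (n+1)), which tends to 0. *)
Lemma log_Gamma_step t : off_cut t -> log_Gamma (t + 1)%C = (log_Gamma t + Clog t)%C.
Proof.
intros H.
assert (H1 : off_cut (t + 1)%C) by (apply off_cut_plus_pos; [assumption|lra]).
pose proof (log_Gamma_lim t H) as L0. pose proof (log_Gamma_lim _ H1) as L1.
assert (L2 : Clim (fun n => log_Gamma_partial n (t + 1)) (log_Gamma t + Clog t - 0)%C).
{ apply (Clim_ext (fun n => log_Gamma_partial n t + Clog t - Clog (1 + t * RtoC (/ INR (S n))))%C).
  - intros n. unfold log_Gamma_partial.
    assert (E : csum (S n) (fun k => Clog (t + 1 + RtoC (INR k))) = (csum (S n) (fun k => Clog (t + RtoC (INR k))) - Clog t + Clog (t + RtoC (INR (S n))))%C).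
    { assert (T : csum (S n) (fun k => Clog (t + RtoC (INR (S k))) - Clog (t + RtoC (INR k)))%C = (Clog (t + RtoC (INR (S n))) - Clog (t + RtoC (INR 0)))%C).
      { apply (csum_telescope (S n) (fun k => Clog (t + RtoC (INR k)))%C). }
      rewrite csum_minus in T. simpl (INR 0) in T. rewrite Cplus_0_r in T.
      rewrite (csum_ext _ (fun k => Clog (t + 1 + RtoC (INR k))) (fun k => Clog (t + RtoC (INR (S k))))).
      2: { intros k _. f_equal. rewrite S_INR, RtoC_plus. ring. }
      replace (csum (S n) (fun k => Clog (t + RtoC (INR (S k)))%C)) with
       (csum (S n) (fun k => Clog (t + RtoC (INR (S k)))%C) - csum (S n) (fun k => Clog (t + RtoC (INR k))%C) + csum (S n) (fun k => Clog (t + RtoC (INR k))%C))%C by ring.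
      rewrite T. ring. }
    rewrite E, Clog_shift by assumption. ring.
  - apply Clim_minus; [|apply Clog_1_plus_lim]. apply Clim_plus; [assumption|apply Clim_const]. }
rewrite (Clim_unique _ _ _ L1 L2). ring.
Qed.

Lemma log_Gamma_shift t K : off_cut t -> log_Gamma (t + RtoC (INR K))%C = (log_Gamma t + csum K (fun k => Clog (t + RtoC (INR k))))%C.
Proof.
intros H. induction K.
- simpl. replace (t + RtoC 0)%C with t by ring. ring.
- rewrite S_INR, RtoC_plus, Cplus_assoc, log_Gamma_step, IHK.
  + simpl csum. ring.
  + apply off_cut_plus_pos; [assumption|apply pos_INR].
Qed.

(** * The Stirling expansion *)

Definition log_curve (t : C) (j : nat) (s : R) : C := log_chain j (t + RtoC s)%C.
(** The Euler-Maclaurin sum of the chain of z log z - z is Stirling's expansion (t - 1/2) log t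
    - t + sum_(j >= 2) B_j / (j (j-1) t^(j-1)), without its constant. *)
Definition stirling_sum (N : nat) (t : C) : C := csum (S (S N)) (fun j => RtoC (bern_div_fact j) * log_chain j t)%C.

Lemma stirling_sum_em N t s : em_sum (S N) (log_curve t) s = stirling_sum N (t + RtoC s)%C.
Proof. reflexivity. Qed.

Lemma log_curve_curve_derive t j s : off_cut t -> 0 <= s -> curve_derive (log_curve t j) s (log_curve t (S j) s).
Proof.
intros Ht Hs. unfold log_curve.
apply (curve_derive_ext (fun u => log_chain j (t + RtoC u * 1)%C)); [intros u; f_equal; ring|].
replace (log_chain (S j) (t + RtoC s)%C) with (log_chain (S j) (t + RtoC s)%C * 1)%C by ring.
apply (curve_derive_line (log_chain j) t 1).
replace (t + RtoC s * 1)%C with (t + RtoC s)%C by ring.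
apply is_Cderive_log_chain. now apply off_cut_plus_pos.
Qed.

Lemma Cmod_log_chain m z : z <> RtoC 0 -> Cmod (log_chain (S (S m)) z) = INR (fact m) / Cmod z ^ S m.
Proof.
intros H. unfold log_chain. rewrite Cmod_mult, Cmod_inv, Cmod_pow by now apply Cpow_neq0.
rewrite Cmod_R, Rabs_mult, pow_1_abs.
rewrite Rabs_pos_eq by apply pos_INR. unfold Rdiv. ring.
Qed.

(** Uniform distance of the half-line t + [0, oo) from the singularity 0.  It holds with one
    constant on each closed sector that avoids the negative axis. *)
Definition sector_bound (kap : R) (t : C) : Prop := forall s, 0 <= s -> kap * (Cmod t + s) <= Cmod (t + RtoC s)%C.

Lemma log_curve_err N kap t k : 0 < kap -> off_cut t -> sector_bound kap t ->
  Cmod (em_err (S N) (log_curve t) (INR k)) <=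
   INR (S (S N)) * (INR (fact N) / (kap * (Cmod t + INR k)) ^ S N).
Proof.
intros Hk Ht Hc. pose proof (pos_INR k) as Hp.
apply em_err_bound.
- intros j s _ Hs. apply log_curve_curve_derive; [assumption|lra].
- intros s Hs.
  pose proof (proj1 (Cmod_gt_0 t) (off_cut_neq0 _ Ht)) as Hm.
  unfold log_curve. rewrite Cmod_log_chain by (apply off_cut_neq0, off_cut_plus_pos; [assumption|lra]).
  apply Rmult_le_compat_l; [apply pos_INR|].
  apply Rinv_le_contravar; [apply pow_lt, Rmult_lt_0_compat; lra|].
  apply pow_incr. split; [apply Rmult_le_pos; lra|].
  eapply Rle_trans; [|apply Hc; lra]. apply Rmult_le_compat_l; lra.
Qed.

Definition stirling_const (N : nat) (kap : R) : R := INR (S (S N)) * (INR (fact N) / kap ^ S N).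

Lemma stirling_const_pos N kap : 0 < kap -> 0 < stirling_const N kap.
Proof.
intros H. unfold stirling_const. apply Rmult_lt_0_compat; [apply INR_S_pos|]. apply Rdiv_lt_0_compat; [apply INR_fact_lt_0|now apply pow_lt].
Qed.

(** Two powers of the decay make the errors summable over [k]; the others are evaluated at the
    start of the half-line. *)
Lemma log_curve_err_inv_sqr N kap t k : 0 < kap -> off_cut t -> sector_bound kap t -> 1 <= Cmod t ->
  Cmod (em_err (S (S N)) (log_curve t) (INR k)) <=
   stirling_const (S N) kap / Cmod t ^ N * (/ (Cmod t + INR k) ^ 2).
Proof.
intros Hk Ht Hc H1. eapply Rle_trans; [apply (log_curve_err (S N) kap); assumption|].
pose proof (pos_INR k) as Hp. unfold stirling_const.
rewrite Rpow_mult_distr.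
assert (0 < kap ^ S (S N)) by now apply pow_lt.
assert (0 < (Cmod t + INR k) ^ S (S N)) by (apply pow_lt; lra).
assert (0 < (Cmod t + INR k) ^ 2) by (apply pow_lt; lra).
assert (0 < Cmod t ^ N) by (apply pow_lt; lra).
replace (INR (S (S (S N))) * (INR (fact (S N)) / (kap ^ S (S N) * (Cmod t + INR k) ^ S (S N)))) with
  (INR (S (S (S N))) * (INR (fact (S N)) / kap ^ S (S N)) * / (Cmod t + INR k) ^ S (S N)) by (field; lra).
replace (INR (S (S (S N))) * (INR (fact (S N)) / kap ^ S (S N)) / Cmod t ^ N * / (Cmod t + INR k) ^ 2) with
  (INR (S (S (S N))) * (INR (fact (S N)) / kap ^ S (S N)) * / (Cmod t ^ N * (Cmod t + INR k) ^ 2)) by (field; lra).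
apply Rmult_le_compat_l; [left; apply stirling_const_pos; assumption|].
apply Rinv_le_contravar; [now apply Rmult_lt_0_compat|].
replace (S (S N)) with (N + 2)%nat by lia. rewrite pow_add.
apply Rmult_le_compat_r; [lra|]. apply pow_incr. lra.
Qed.

Lemma ex_series_shift_sqr a : 1 <= a -> ex_series (fun k => / (a + INR k) ^ 2).
Proof.
intros Ha. apply (ex_series_dominated _ (fun k => / INR (S k) ^ 2)); [|apply ex_series_inv_sqr].
intros k. pose proof (pos_INR k). pose proof (INR_S_pos k).
rewrite Rabs_pos_eq by (left; apply Rinv_0_lt_compat, pow_lt; lra).
apply Rinv_le_contravar; [apply pow_lt; lra|]. apply pow_incr. rewrite S_INR in *. lra.
Qed.

(** Compare with the telescoping sum of 2 / b - 2 / (b + 1). *)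
Lemma sum_shift_sqr a n : 1 <= a -> Cmod (csum n (fun k => RtoC (/ (a + INR k) ^ 2))) <= 2 / a.
Proof.
intros Ha. assert (K : Cmod (csum n (fun k => RtoC (/ (a + INR k) ^ 2))) <= 2 / a - 2 / (a + INR n)).
{ induction n.
  - simpl csum. rewrite Cmod_0. simpl. rewrite Rplus_0_r. lra.
  - change (csum (S n) ?v) with (csum n v + v n)%C. eapply Rle_trans; [apply Cmod_triangle|].
    pose proof (pos_INR n). rewrite Cmod_RtoC_pos by (left; apply Rinv_0_lt_compat, pow_lt; lra).
    rewrite S_INR. set (b := a + INR n) in *. assert (1 <= b) by (unfold b; lra).
    replace (a + (INR n + 1)) with (b + 1) by (unfold b; ring).
    assert (/ b ^ 2 <= 2 / b - 2 / (b + 1)); [|lra].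
    replace (2 / b - 2 / (b + 1)) with (/ (b * (b + 1) / 2)) by (field; lra).
    apply Rinv_le_contravar; [apply Rdiv_lt_0_compat; nra|]. simpl. nra. }
pose proof (pos_INR n). assert (0 < 2 / (a + INR n)) by (apply Rdiv_lt_0_compat; lra). lra.
Qed.

Lemma csum_le_real n (u : nat -> C) (v : nat -> R) : (forall k, (k < n)%nat -> Cmod (u k) <= v k) ->
  (forall k, 0 <= v k) -> Cmod (csum n u) <= Cmod (csum n (fun k => RtoC (v k))).
Proof.
intros H Hv.
assert (E : forall n, exists r, 0 <= r /\ csum n (fun k => RtoC (v k)) = RtoC r).
{ clear n H. intros n. induction n; [exists 0; split; [lra|reflexivity]|].
  destruct IHn as [r [Hr E]]. exists (r + v n). split; [specialize (Hv n); lra|]. simpl. now rewrite E, RtoC_plus. }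
induction n; [simpl; lra|]. simpl csum at 1. eapply Rle_trans; [apply Cmod_triangle|].
destruct (E n) as [r [Hr Er]]. simpl. rewrite Er in *. rewrite <- RtoC_plus.
rewrite Cmod_RtoC_pos by (specialize (Hv n); lra). rewrite Cmod_RtoC_pos in IHn by lra.
apply Rplus_le_compat; [apply IHn; intros; apply H; lia|apply H; lia].
Qed.

Lemma log_curve_err_sum N kap t n : 0 < kap -> off_cut t -> sector_bound kap t -> 1 <= Cmod t ->
  Cmod (csum n (fun k => em_err (S (S N)) (log_curve t) (INR k))) <= 2 * stirling_const (S N) kap / Cmod t ^ S N.
Proof.
intros Hk Ht Hc H1.
assert (H2 : 0 < Cmod t ^ N) by (apply pow_lt; lra).
assert (HA : 0 < stirling_const (S N) kap / Cmod t ^ N) by (apply Rdiv_lt_0_compat; [now apply stirling_const_pos|assumption]).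
eapply Rle_trans.
{ apply (csum_le_real n _ (fun k => stirling_const (S N) kap / Cmod t ^ N * (/ (Cmod t + INR k) ^ 2))).
  - intros k _. now apply log_curve_err_inv_sqr.
  - intros k. pose proof (pos_INR k). apply Rmult_le_pos; [lra|]. left. apply Rinv_0_lt_compat, pow_lt. lra. }
rewrite (csum_ext _ _ (fun k => RtoC (stirling_const (S N) kap / Cmod t ^ N) * RtoC (/ (Cmod t + INR k) ^ 2))%C) by (intros; now rewrite RtoC_mult).
rewrite csum_scal, Cmod_mult, Cmod_RtoC_pos by lra.
eapply Rle_trans; [apply Rmult_le_compat_l; [lra|apply sum_shift_sqr; assumption]|].
right. simpl. field. split; lra.
Qed.

(** Its limit is the constant in Stirling's formula.  The point n + 1 appears instead of n
    because the Euler-Maclaurin sum for [log_Gamma_partial n 1] ends there. *)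
Definition factorial_defect (n : nat) : R := ln (INR (fact n)) - (INR n + / 2) * ln (INR (S n)) + INR (S n).

Lemma Clim_csum_0 n (u : nat -> nat -> C) : (forall j, (j < n)%nat -> Clim (u j) 0) -> Clim (fun m => csum n (fun j => u j m)) 0.
Proof.
induction n; intros H; [exact (Clim_const 0)|].
simpl. replace (RtoC 0) with (0 + 0)%C by ring. apply Clim_plus; [apply IHn; intros; apply H; lia|apply H; lia].
Qed.

Lemma Clim_log_chain_0 m t : off_cut t -> Clim (fun n => log_chain (S (S m)) (t + RtoC (INR (S n)))%C) 0.
Proof.
intros Ht. destruct (exists_INR_ge (2 * Cmod t + 2)) as [n0 Hn0].
apply (Clim_0_ev _ (fun n => INR (fact m) * 2 * / INR (S n)) n0).
- intros n Hn. pose proof (INR_S_pos n).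
  rewrite Cmod_log_chain by (apply off_cut_neq0, off_cut_plus_pos; [assumption|lra]).
  assert (Hge : 2 * Cmod t + 2 <= INR (S n)) by (eapply Rle_trans; [exact Hn0|apply le_INR; lia]).
  assert (Hz : INR (S n) / 2 <= Cmod (t + RtoC (INR (S n)))%C).
  { pose proof (Cmod_triangle_rev (RtoC (INR (S n))) (- t)%C) as T. rewrite Cmod_opp, Cmod_RtoC_pos in T by lra.
    replace (RtoC (INR (S n)) - - t)%C with (t + RtoC (INR (S n)))%C in T by ring. lra. }
  pose proof (Cmod_ge_0 t). pose proof (INR_fact_lt_0 m).
  unfold Rdiv. rewrite Rmult_assoc. apply Rmult_le_compat_l; [lra|].
  replace (2 * / INR (S n)) with (/ (INR (S n) / 2)) by (field; lra).
  apply Rinv_le_contravar; [lra|].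
  set (q := Cmod (t + RtoC (INR (S n)))%C) in *. change (q ^ S m) with (q * q ^ m).
  assert (1 <= q ^ m) by (apply pow_R1_Rle; lra). nra.
- replace (Finite 0) with (Finite (INR (fact m) * 2 * 0)) by (f_equal; ring).
  apply is_lim_seq_mult'; [apply is_lim_seq_const|apply is_lim_seq_inv_S].
Qed.

Lemma Clim_mult_bounded_0 (c : C) u : Clim u 0 -> Clim (fun n => c * u n)%C 0.
Proof. intros H. replace (RtoC 0) with (c * 0)%C by ring. now apply Clim_scal. Qed.

(** The end terms of the Euler-Maclaurin sum for [log_Gamma_partial n t] depend on [t] only
    through quantities that vanish in the limit, so the constant in Stirling's formula is the
    same for all [t]. *)
Lemma stirling_sum_at_infinity N t : off_cut t ->
  Clim (fun n => t * RtoC (ln (INR (S n))) + RtoC (ln (INR (fact n))) - stirling_sum N (t + RtoC (INR (S n))) - RtoC (factorial_defect n))%C 0.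
Proof.
intros Ht.
apply (Clim_ext (fun n => - ((t - RtoC (/ 2)) * Clog (1 + t * RtoC (/ INR (S n)))) -
   RtoC (INR (S n)) * (Clog (1 + t * RtoC (/ INR (S n))) - t * RtoC (/ INR (S n)))
   - csum N (fun j => RtoC (bern_div_fact (S (S j))) * log_chain (S (S j)) (t + RtoC (INR (S n)))))%C).
- intros n. unfold stirling_sum. rewrite 2 csum_S_l. rewrite bern_div_fact_0, bern_div_fact_1. unfold log_chain at 2 3.
  rewrite Clog_shift by assumption. pose proof (INR_S_pos n).
  assert (E : (RtoC (INR (S n)) * RtoC (/ INR (S n)))%C = 1) by (rewrite <- RtoC_mult, Rinv_r; [reflexivity|lra]).
  unfold factorial_defect. rewrite S_INR in *. set (a := INR n) in *.
  repeat first [rewrite RtoC_plus | rewrite RtoC_minus | rewrite RtoC_mult | rewrite RtoC_opp].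
  rewrite RtoC_plus in E.
  set (lam := Clog _). set (X := csum _ _).
  replace ((RtoC a + 1) * (lam - t * RtoC (/ (a + 1))))%C with ((RtoC a + 1) * lam - t * ((RtoC a + 1) * RtoC (/ (a + 1))))%C by ring.
  rewrite E.
  assert (E2 : RtoC (/ 2) = (/ 2)%C) by (rewrite RtoC_inv; [reflexivity|lra]). rewrite E2.
  field.
- replace (RtoC 0) with (0 - 0 - 0)%C by ring.
  apply Clim_minus; [apply Clim_minus|].
  + apply (Clim_ext (fun n => (- (t - RtoC (/ 2))) * Clog (1 + t * RtoC (/ INR (S n))))%C); [intros; ring|].
    apply Clim_mult_bounded_0, Clog_1_plus_lim.
  + apply Clog_1_plus_scaled.
  + apply (Clim_csum_0 N (fun j n => RtoC (bern_div_fact (S (S j))) * log_chain (S (S j)) (t + RtoC (INR (S n))))%C).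
    intros j _. apply Clim_mult_bounded_0, Clim_log_chain_0. assumption.
Qed.

Lemma off_cut_1 : off_cut 1.
Proof. apply off_cut_iff. right. simpl. lra. Qed.

(** Euler-Maclaurin applied to the sum of log (t + k) in the partial Euler product. *)
Lemma log_Gamma_partial_em N n t :
  (log_Gamma_partial n t = stirling_sum (S N) t + (t * RtoC (ln (INR (S n))) + RtoC (ln (INR (fact n))) - stirling_sum (S N) (t + RtoC (INR (S n))))
    + csum (S n) (fun k => em_err (S (S N)) (log_curve t) (INR k)))%C.
Proof.
unfold log_Gamma_partial. pose proof (em_sum_telescope (S (S N)) (log_curve t) (S n)) as T.
rewrite !stirling_sum_em in T. replace (t + RtoC 0)%C with t in T by ring.
unfold log_curve at 1 in T. simpl log_chain in T. rewrite T. ring.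
Qed.

(** Convergence follows from the case [t = 1] of [log_Gamma_partial_em], in which every other
    term converges. *)
Lemma factorial_defect_Clim : exists L, Clim (fun n => RtoC (factorial_defect n)) L.
Proof.
assert (H1 : sector_bound 1 1).
{ intros s Hs. rewrite Cmod_1, <- RtoC_plus, Cmod_RtoC_pos; lra. }
assert (Hconv : Csummable (fun k => em_err 2 (log_curve 1) (INR k))).
{ apply (Csummable_le _ (fun k => stirling_const 1 1 / Cmod 1 ^ 0 * (/ (Cmod 1 + INR k) ^ 2))).
  - intros k. apply (log_curve_err_inv_sqr 0 1); [lra|apply off_cut_1|exact H1|rewrite Cmod_1; lra].
  - apply (ex_series_scal_R), ex_series_shift_sqr. rewrite Cmod_1; lra. }
exists (log_Gamma 1 - stirling_sum 1 1 - CSeries (fun k => em_err 2 (log_curve 1) (INR k)) - 0)%C.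
apply (Clim_ext (fun n => log_Gamma_partial n 1 - stirling_sum 1 1 - csum (S n) (fun k => em_err 2 (log_curve 1) (INR k)) -
   (1 * RtoC (ln (INR (S n))) + RtoC (ln (INR (fact n))) - stirling_sum 1 (1 + RtoC (INR (S n))) - RtoC (factorial_defect n)))%C).
- intros n. rewrite (log_Gamma_partial_em 0 n 1). ring.
- apply Clim_minus; [apply Clim_minus; [apply Clim_minus|]|].
  + apply log_Gamma_lim, off_cut_1.
  + apply Clim_const.
  + apply (Clim_incr (fun n => csum n _)). now apply Clim_csum.
  + apply stirling_sum_at_infinity, off_cut_1.
Qed.

(** The combination of the defects at n and 2n + 1 in which the factorials form, up to
    elementary factors, a central binomial coefficient, that is, a Wallis integral. *)
Lemma factorial_defect_wallis n : 2 * factorial_defect n - factorial_defect (2 * n + 1) =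
  ln (PI / 2) + / 2 * ln 2 - / 2 * ln (INR (S n) * cos_int (2 * S n) ^ 2).
Proof.
unfold factorial_defect.
pose proof (cos_int_factorial (S n)) as W. destruct (cos_int_pos_and_prod (S n)) as [P _].
pose proof (INR_S_pos n) as Hm. pose proof PI_RGT_0 as HP.
pose proof (INR_fact_lt_0 (S n)) as F1. pose proof (INR_fact_lt_0 (2 * S n)) as F2.
apply (f_equal ln) in W.
assert (H4 : 0 < 4 ^ S n) by (apply pow_lt; lra).
assert (F1' : 0 < INR (fact (S n)) ^ 2) by (apply pow_lt; assumption).
rewrite !ln_mult in W by (try assumption; try apply Rmult_lt_0_compat; lra).
rewrite !ln_pow in W by lra.
replace (ln 4) with (2 * ln 2) in W by (replace 4 with (2 * 2) by ring; rewrite ln_mult by lra; ring).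
rewrite ln_mult, ln_pow by (try apply pow_lt; assumption).
replace (2 * S n)%nat with (S (2 * n + 1)) in * by lia.
rewrite (fact_simpl n), mult_INR, ln_mult in W by (try apply INR_fact_lt_0; assumption).
rewrite (fact_simpl (2 * n + 1)), mult_INR, ln_mult in W by (try apply INR_fact_lt_0; apply INR_S_pos).
assert (E : INR (S (2 * n + 1)) = 2 * INR (S n)) by (rewrite !S_INR, plus_INR, mult_INR; simpl; ring).
assert (E0 : INR (2 * n + 1) = 2 * INR (S n) - 1) by (rewrite S_INR, plus_INR, mult_INR; simpl; ring).
assert (E1 : INR n = INR (S n) - 1) by (rewrite S_INR; ring).
rewrite E in *. rewrite E0, E1. rewrite ln_mult in * by lra.
simpl (INR 2) in *. set (m := INR (S n)) in *. set (lm := ln m) in *. nra.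
Qed.

(** The limit L satisfies 2 L - L = L, and the left side is computed from Wallis' product. *)
Lemma factorial_defect_lim : Clim (fun n => RtoC (factorial_defect n)) (RtoC (/ 2 * ln (2 * PI))).
Proof.
destruct factorial_defect_Clim as [L HL].
assert (E : L = RtoC (/ 2 * ln (2 * PI))); [|now rewrite <- E].
assert (H2 : Clim (fun n => RtoC (factorial_defect (2 * n + 1))) L).
{ intros e He. destruct (HL e He) as [N K]. exists N. intros n Hn. apply K. lia. }
assert (H3 : Clim (fun n => 2 * RtoC (factorial_defect n) - RtoC (factorial_defect (2 * n + 1)))%C (2 * L - L)%C).
{ apply Clim_minus; [now apply Clim_scal|assumption]. }
replace (2 * L - L)%C with L in H3 by ring.
apply (Clim_unique _ _ _ H3).
apply Clim_ReIm.
- apply (is_lim_seq_ext (fun n => ln (PI / 2) + / 2 * ln 2 - / 2 * ln (INR (S n) * cos_int (2 * S n) ^ 2))).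
  { intros n. rewrite <- factorial_defect_wallis. unfold Re; simpl; ring. }
  pose proof PI_RGT_0 as HP.
  replace (Re (RtoC (/ 2 * ln (2 * PI)))) with (ln (PI / 2) + / 2 * ln 2 - / 2 * ln (PI / 4)).
  + apply is_lim_seq_minus'; [apply is_lim_seq_const|]. apply is_lim_seq_mult'; [apply is_lim_seq_const|].
    apply (is_lim_seq_continuous ln); [|apply wallis_limit].
    apply derivable_continuous_pt. exists (/ (PI / 4)). apply derivable_pt_lim_ln. lra.
  + unfold Re; simpl. rewrite !ln_div, ln_mult by lra.
    replace (ln 4) with (2 * ln 2) by (replace 4 with (2 * 2) by ring; rewrite ln_mult by lra; ring). field.
- apply (is_lim_seq_ext (fun _ => 0)); [|apply is_lim_seq_const]. intros n. unfold Im; simpl; ring.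
Qed.

(** Let n tend to infinity in [log_Gamma_partial_em]: the bound on the sum of the errors is
    uniform in n. *)
Theorem stirling N kap t : 0 < kap -> off_cut t -> sector_bound kap t -> 1 <= Cmod t ->
  Cmod (log_Gamma t - RtoC (/ 2 * ln (2 * PI)) - stirling_sum (S N) t)%C <= 2 * stirling_const (S N) kap / Cmod t ^ S N.
Proof.
intros Hk Ht Hc H1.
apply (Clim_le (fun n => csum (S n) (fun k => em_err (S (S N)) (log_curve t) (INR k)))).
- apply (Clim_ext (fun n => log_Gamma_partial n t - RtoC (factorial_defect n) - stirling_sum (S N) t -
   (t * RtoC (ln (INR (S n))) + RtoC (ln (INR (fact n))) - stirling_sum (S N) (t + RtoC (INR (S n))) - RtoC (factorial_defect n)))%C).
  { intros n. rewrite (log_Gamma_partial_em N n t). ring. }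
  replace (log_Gamma t - RtoC (/ 2 * ln (2 * PI)) - stirling_sum (S N) t)%C with (log_Gamma t - RtoC (/ 2 * ln (2 * PI)) - stirling_sum (S N) t - 0)%C by ring.
  apply Clim_minus; [apply Clim_minus; [apply Clim_minus|]|].
  + now apply log_Gamma_lim.
  + apply factorial_defect_lim.
  + apply Clim_const.
  + now apply stirling_sum_at_infinity.
- intros n. now apply log_curve_err_sum.
Qed.

(** * Local expansion of the polylogarithms at the singular point *)

(** Dominated convergence for series. *)
Lemma tannery (u : nat -> nat -> C) (v : nat -> C) (B : nat -> R) :
  (forall n k, Cmod (u n k) <= B k) -> ex_series B -> (forall k, Clim (fun n => u n k) (v k)) ->
  Clim (fun n => CSeries (u n)) (CSeries v).
Proof.
intros Hu HB Hv.
assert (HvB : forall k, Cmod (v k) <= B k) by (intros k; apply (Clim_le _ _ _ (Hv k)); auto).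
assert (Cv : Csummable v) by now apply (Csummable_le _ B).
assert (Cu : forall n, Csummable (u n)) by (intros n; now apply (Csummable_le _ B)).
intros e He.
assert (HT : exists N, Series (fun k => B (N + k)%nat) < e / 4).
{ pose proof (Series_correct _ HB) as HS.
  assert (HS' : is_lim_seq (sum_n B) (Series B)) by exact HS.
  apply is_lim_seq_spec in HS'. assert (He4 : 0 < e / 4) by lra.
  destruct (HS' (mkposreal _ He4)) as [N K]. exists (S N). specialize (K N (le_n N)). simpl in K.
  rewrite (Series_incr_n B (S N) ltac:(lia) HB) in K. simpl pred in K. rewrite <- sum_n_Reals in K.
  apply Rabs_lt_between in K. lra. }
destruct HT as [N HN].
assert (EB : ex_series (fun k => B (N + k)%nat)) by now apply ex_series_shift.
assert (HF : Clim (fun n => csum N (fun k => u n k)) (csum N v)).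
{ clear HN EB. induction N; [exact (Clim_const 0)|]. simpl. now apply Clim_plus. }
destruct (HF (e / 2) ltac:(lra)) as [M K]. exists M. intros n Hn. specialize (K n Hn).
rewrite (CSeries_incr_n N (u n) (Cu n)), (CSeries_incr_n N v Cv).
pose proof (Cmod_CSeries_bound (fun k => u n (N + k)%nat) _ (fun k => Hu n (N + k)%nat) EB) as T1.
pose proof (Cmod_CSeries_bound (fun k => v (N + k)%nat) _ (fun k => HvB (N + k)%nat) EB) as T2.
set (X := CSeries (fun k => u n (N + k)%nat)) in *. set (Y := CSeries (fun k => v (N + k)%nat)) in *.
replace (csum N (u n) + X - (csum N v + Y))%C with ((csum N (u n) - csum N v) + (X - Y))%C by ring.
eapply Rle_lt_trans; [apply Cmod_triangle|]. pose proof (Cmod_triangle_sub X Y).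
change (csum N (fun k => u n k)) with (csum N (u n)) in K. lra.
Qed.

Lemma CPSeries_incr a z : Rbar_lt (Cmod z) (Cradius a) -> CPSeries a z = (a 0%nat + z * CPSeries (fun n => a (S n)) z)%C.
Proof.
intros H. pose proof (CPSeries_abs _ _ H) as K. unfold CPSeries. rewrite CSeries_incr by exact K.
simpl (z ^ 0)%C. rewrite Cmult_1_r. f_equal.
assert (K2 : Csummable (fun n => a (S n) * z ^ n)%C).
{ destruct (Ceq_dec z 0) as [->|Hz].
  - apply Csummable_decr. apply (Csummable_le _ (fun n => 0)).
    + intros n. rewrite Cpow_S, Cmult_0_l, Cmult_0_r, Cmod_0. lra.
    + exists 0. apply (is_series_ext (fun _ => 0)); [reflexivity|].
      apply filterlim_ext with (fun _ => 0); [|apply filterlim_const]. intros n. rewrite sum_n_const. ring.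
  - apply (Csummable_ext (fun n => / z * (a (S n) * z ^ S n))%C).
    + intros n. rewrite Cpow_S. field. assumption.
    + apply Csummable_scal. now apply (Csummable_incr (fun n => a n * z ^ n)%C). }
rewrite <- CSeries_scal by exact K2. apply CSeries_ext. intros n. rewrite Cpow_S. ring.
Qed.

Lemma Cradius_bounded_1 a : (forall n, Cmod (a n) <= 1) -> Rbar_le 1 (Cradius a).
Proof. intros H. apply Cradius_ge_bounded; [|lra]. exists 1. intros n. rewrite pow1, Rmult_1_r. apply H. Qed.

Lemma Cradius_1_lt a (z : C) : Rbar_le 1 (Cradius a) -> Cmod z < 1 -> Rbar_lt (Cmod z) (Cradius a).
Proof. intros H1 H2. eapply Rbar_lt_le_trans; [|exact H1]. exact H2. Qed.

Lemma CPSeries_geom q : Cmod q < 1 -> CPSeries (fun _ => RtoC 1) q = (/ (1 - q))%C.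
Proof.
intros H.
assert (R1 : Rbar_lt (Cmod q) (Cradius (fun _ => RtoC 1))).
{ apply Cradius_1_lt; [|exact H]. apply Cradius_bounded_1. intros; rewrite Cmod_1; lra. }
pose proof (CPSeries_incr _ _ R1) as E. simpl in E.
assert (Hq : (1 - q)%C <> RtoC 0).
{ intros Z. assert (Eq : q = 1) by (replace q with (1 - (1 - q))%C by ring; rewrite Z; ring). rewrite Eq, Cmod_1 in H. lra. }
set (S0 := CPSeries (fun _ => RtoC 1) q) in *.
replace (/ (1 - q))%C with ((S0 - q * S0) * / (1 - q))%C; [field; assumption|].
replace (S0 - q * S0)%C with (RtoC 1); [ring|]. rewrite E at 1. ring.
Qed.

Lemma CSeries_zero u : (forall n, u n = RtoC 0) -> CSeries u = 0.
Proof.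
intros H. apply (Clim_unique (fun n => csum n u)).
- apply Clim_csum. apply (Csummable_le _ (fun _ => 0)).
  + intros n. rewrite H, Cmod_0. lra.
  + apply ex_series_zero.
- apply (Clim_ext (fun _ => RtoC 0)); [|apply Clim_const]. intros n. symmetry. apply csum_zero. auto.
Qed.

Lemma CPSeries_delta z : CPSeries (fun n => RtoC (if (n =? 0)%nat then 1 else 0)) z = 1.
Proof.
unfold CPSeries. rewrite CSeries_incr.
- rewrite CSeries_zero; [simpl; ring|]. intros n. simpl. ring.
- apply Csummable_decr. apply (Csummable_le _ (fun _ => 0)).
  + intros n. simpl. rewrite Cmult_0_l, Cmod_0. lra.
  + apply ex_series_zero.
Qed.

(** With [j = 1] these are the coefficients B_m / (m m!) of log ((1 - e^(-z)) / z), and raising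
    [j] by one differentiates.  The first branch sets the constant terms of the members [j = 0]
    and [j = 1] to 0: the former is an integration constant, the latter is log 1. *)
Definition psi_coef (j m : nat) : C :=
  if (m + j <=? 1)%nat then RtoC 0
  else RtoC (bern_div_fact (m + j - 1) * INR (fact (m + j - 2)) / INR (fact m)).
(** The derivatives of the regular part log ((1 - e^(-z)) / z), numbered so that [psi 1] is this
    function and [psi 0] an antiderivative. *)
Definition psi (j : nat) (z : C) : C := CPSeries (psi_coef j) z.

Lemma deriv_coef_psi_coef j m : deriv_coef (psi_coef j) m = psi_coef (S j) m.
Proof.
unfold deriv_coef, psi_coef. replace (S m + j)%nat with (m + S j)%nat by lia.
destruct (m + S j <=? 1)%nat; [ring|]. rewrite <- RtoC_mult. f_equal.
rewrite (fact_simpl m), mult_INR. pose proof (INR_S_pos m). pose proof (INR_fact_lt_0 m). field. split; lra.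
Qed.

Lemma Cradius_ext a b : (forall n, a n = b n) -> Cradius a = Cradius b.
Proof. intros H. apply CV_radius_ext. intros; now rewrite H. Qed.

Lemma Cradius_psi_coef j : Rbar_le 1 (Cradius (psi_coef j)).
Proof.
induction j.
- apply Cradius_bounded_1. intros m. unfold psi_coef. destruct (Nat.leb_spec (m + 0) 1); [rewrite Cmod_0; lra|].
  rewrite Cmod_R. unfold Rdiv. rewrite Rmult_assoc, Rabs_mult.
  pose proof (INR_fact_lt_0 m). pose proof (INR_fact_lt_0 (m + 0 - 2)).
  rewrite (Rabs_pos_eq (_ * / _)) by (apply Rmult_le_pos; [lra|left; now apply Rinv_0_lt_compat]).
  assert (INR (fact (m + 0 - 2)) * / INR (fact m) <= 1).
  { apply Rmult_le_reg_r with (INR (fact m)); [assumption|]. rewrite Rmult_assoc, Rinv_l, Rmult_1_r, Rmult_1_l by lra.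
    apply le_INR, fact_le. lia. }
  assert (0 <= INR (fact (m + 0 - 2)) * / INR (fact m)) by (apply Rmult_le_pos; [lra|left; now apply Rinv_0_lt_compat]).
  pose proof (bern_div_fact_bound (m + 0 - 1)). pose proof (Rabs_pos (bern_div_fact (m + 0 - 1))). nra.
- rewrite <- (Cradius_ext (deriv_coef (psi_coef j))) by apply deriv_coef_psi_coef. now rewrite Cradius_deriv_coef.
Qed.

Lemma is_Cderive_psi j (z : C) : Cmod z < 1 -> is_Cderive (psi j) z (psi (S j) z).
Proof.
intros H. unfold psi at 2. rewrite (CPSeries_ext (psi_coef (S j)) (deriv_coef (psi_coef j))) by (intros; symmetry; apply deriv_coef_psi_coef).
apply CPSeries_derive, Cradius_1_lt; [apply Cradius_psi_coef|exact H].
Qed.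

Lemma psi_0_0 : psi 0 0 = 0. Proof. unfold psi. rewrite CPSeries_0. reflexivity. Qed.
Lemma psi_1_0 : psi 1 0 = 0. Proof. unfold psi. rewrite CPSeries_0. reflexivity. Qed.

Lemma Cradius_bern_div_fact : Rbar_le 1 (Cradius (fun n => RtoC (bern_div_fact n))).
Proof. apply Cradius_bounded_1. intros n. rewrite Cmod_R. apply bern_div_fact_bound. Qed.

(** The second member of the chain is 1 / (e^z - 1) - 1 / z. *)
Lemma psi_2_bern_div_fact z : Cmod z < 1 -> (1 + z * psi 2 z)%C = CPSeries (fun n => RtoC (bern_div_fact n)) z.
Proof.
intros H. rewrite (CPSeries_incr (fun n => RtoC (bern_div_fact n))) by (apply Cradius_1_lt; [apply Cradius_bern_div_fact|exact H]).
rewrite bern_div_fact_0. f_equal. f_equal. apply CPSeries_ext. intros m. unfold psi_coef.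
destruct (Nat.leb_spec (m + 2) 1); [lia|]. f_equal.
replace (m + 2 - 1)%nat with (S m) by lia. replace (m + 2 - 2)%nat with m by lia.
field. apply INR_fact_neq_0.
Qed.

(** The generating function of the Bernoulli numbers for complex arguments, from the Cauchy
    product with the series of (e^z - 1) / z. *)
Lemma bernoulli_gen_C z : Cmod z < 1 -> ((1 + z * psi 2 z) * (Cexp z - 1))%C = z.
Proof.
intros H. rewrite psi_2_bern_div_fact by exact H.
assert (Ee : Cexp z = (1 + z * CPSeries (fun n => exp_coef (S n)) z)%C).
{ rewrite Cexp_CPSeries, CPSeries_incr by apply Cradius_exp_coef. unfold exp_coef at 1. simpl fact. simpl INR. rewrite Rinv_1. reflexivity. }
assert (Re1 : Rbar_le 1 (Cradius (fun n => exp_coef (S n)))).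
{ apply Cradius_bounded_1. intros n. unfold exp_coef. rewrite Cmod_RtoC_pos by (left; apply Rinv_0_lt_compat, INR_fact_lt_0).
  rewrite <- Rinv_1. apply Rinv_le_contravar; [lra|]. apply (le_INR 1). apply lt_O_fact. }
rewrite Ee.
replace (CPSeries (fun n => RtoC (bern_div_fact n)) z * (1 + z * CPSeries (fun n => exp_coef (S n)) z - 1))%C with
 (z * (CPSeries (fun n => RtoC (bern_div_fact n)) z * CPSeries (fun n => exp_coef (S n)) z))%C by ring.
unfold CPSeries at 1 2. rewrite <- CSeries_cauchy_prod.
- rewrite (CSeries_ext _ (fun n => RtoC (if (n =? 0)%nat then 1 else 0) * z ^ n)%C).
  + fold (CPSeries (fun n => RtoC (if (n =? 0)%nat then 1 else 0)) z). rewrite CPSeries_delta. ring.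
  + intros n. unfold cauchy_prod. rewrite <- bern_div_fact_cauchy. rewrite (Cmult_comm (csum _ _)), <- csum_scal.
    apply csum_ext. intros k Hk. unfold exp_coef. replace (S n - k)%nat with (S (n - k)) by lia.
    replace (z ^ n)%C with (z ^ k * z ^ (n - k))%C by (rewrite <- Cpow_add_r; f_equal; lia).
    unfold Rdiv. rewrite RtoC_mult. ring.
- apply CPSeries_abs, Cradius_1_lt; [apply Cradius_bern_div_fact|exact H].
- apply CPSeries_abs, Cradius_1_lt; [apply Re1|exact H].
Qed.

(** The coefficients of Li_(2-j), including [k = 0] so that the power series machinery
    applies. *)
Definition polylog_coef (j k : nat) : C := match k with O => RtoC 0 | S _ => RtoC (INR k ^ j / INR k ^ 2) end.
Definition polylog_exp (j : nat) (z : C) : C := CPSeries (polylog_coef j) (Cexp (- z)%C).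
(** The sign turns z |-> Li_(2-j)(e^(-z)) into a chain of derivatives whose member [j = 1] is
    log (1 - e^(-z)). *)
Definition polylog_chain (j : nat) (z : C) : C := (RtoC ((-1) ^ j) * polylog_exp j z)%C.

Lemma polylog_coef_S j k : polylog_coef (S j) k = (RtoC (INR k) * polylog_coef j k)%C.
Proof. destruct k; [simpl; ring|]. unfold polylog_coef. rewrite <- RtoC_mult. f_equal. change (INR (S k) ^ S j) with (INR (S k) * INR (S k) ^ j). unfold Rdiv. ring. Qed.

Lemma Cradius_polylog_coef j : Rbar_le 1 (Cradius (polylog_coef j)).
Proof.
induction j.
- apply Cradius_bounded_1. intros [|n]; [simpl; rewrite Cmod_0; lra|]. unfold polylog_coef. pose proof (INR_S_pos n).
  rewrite Cmod_RtoC_pos by (apply Rdiv_le_0_compat; [simpl; lra|apply pow_lt; lra]).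
  simpl (INR (S n) ^ 0). apply Rmult_le_reg_r with (INR (S n) ^ 2); [apply pow_lt; lra|].
  unfold Rdiv. rewrite Rmult_assoc, Rinv_l by (apply pow_nonzero; lra). rewrite !Rmult_1_l.
  apply pow_R1_Rle. apply (le_INR 1). lia.
- replace (Cradius (polylog_coef (S j))) with (Cradius (polylog_coef j)); [exact IHj|].
  rewrite <- Cradius_deriv_coef. unfold Cradius. rewrite <- (CV_radius_incr_1 (fun n => Cmod (deriv_coef (polylog_coef j) n))). apply CV_radius_ext.
  intros [|n].
  + simpl. now rewrite Cmod_0.
  + simpl PS_incr_1. rewrite polylog_coef_S. unfold deriv_coef. reflexivity.
Qed.

Lemma Cmod_Cexp_opp_lt z : 0 < Re z -> Cmod (Cexp (- z)%C) < 1.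
Proof. intros H. rewrite Cmod_Cexp. rewrite <- exp_0. apply exp_increasing. unfold Re in *; simpl; lra. Qed.

Lemma CPSeries_q_deriv_coef j q : Cmod q < 1 -> CPSeries (polylog_coef (S j)) q = (q * CPSeries (deriv_coef (polylog_coef j)) q)%C.
Proof.
intros H. rewrite CPSeries_incr by (apply Cradius_1_lt; [apply Cradius_polylog_coef|exact H]).
rewrite (CPSeries_ext (fun n => polylog_coef (S j) (S n)) (deriv_coef (polylog_coef j))) by (intros n; now rewrite polylog_coef_S).
simpl. ring.
Qed.

Lemma is_Cderive_polylog_exp j (z : C) : 0 < Re z -> is_Cderive (polylog_exp j) z (- polylog_exp (S j) z)%C.
Proof.
intros H. pose proof (Cmod_Cexp_opp_lt z H) as Hq.
unfold polylog_exp at 2. rewrite CPSeries_q_deriv_coef by exact Hq.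
replace (- (Cexp (- z) * CPSeries (deriv_coef (polylog_coef j)) (Cexp (- z))))%C with
  ((- (1)) * Cexp (- z) * CPSeries (deriv_coef (polylog_coef j)) (Cexp (- z)))%C by ring.
apply (is_Cderive_comp (CPSeries (polylog_coef j)) (fun y => Cexp (- y)%C)).
- apply CPSeries_derive, Cradius_1_lt; [apply Cradius_polylog_coef|exact Hq].
- apply (is_Cderive_comp Cexp (fun y => - y)%C); [apply is_Cderive_Cexp|].
  apply (is_Cderive_ext (fun y => 0 + (- (1)) * y)%C); [intros; ring|]. apply is_Cderive_affine.
Qed.

Lemma is_Cderive_polylog_chain j (z : C) : 0 < Re z -> is_Cderive (polylog_chain j) z (polylog_chain (S j) z).
Proof.
intros H. unfold polylog_chain at 2.
replace (RtoC ((-1) ^ S j) * polylog_exp (S j) z)%C with (RtoC ((-1) ^ j) * (- polylog_exp (S j) z))%C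
  by (change ((-1) ^ S j) with (-1 * (-1) ^ j); rewrite RtoC_mult; ring).
apply (is_Cderive_scal _ (polylog_exp j)). now apply is_Cderive_polylog_exp.
Qed.

Lemma deriv_coef_polylog_coef_1 n : deriv_coef (polylog_coef 1) n = RtoC 1.
Proof. unfold deriv_coef, polylog_coef. rewrite <- RtoC_mult. f_equal. pose proof (INR_S_pos n). field. lra. Qed.

(** Both sides have derivative 1 / (1 - q) along the segment from 0. *)
Lemma CPSeries_polylog_coef_1 q : Cmod q < 1 -> CPSeries (polylog_coef 1) q = (- Clog (1 - q))%C.
Proof.
intros H.
set (f := fun s : R => (CPSeries (polylog_coef 1) (0 + RtoC s * q) + Clog (1 + RtoC s * - q))%C).
assert (Hs : forall s, 0 <= s <= 1 -> Cmod (RtoC s * q)%C < 1).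
{ intros s Hs. rewrite Cmod_mult, Cmod_RtoC_pos by lra. pose proof (Cmod_ge_0 q). nra. }
assert (E : f 1 = f 0).
{ apply curve_derive_zero_const; [lra|]. intros s Hs'. specialize (Hs s Hs'). unfold f.
  assert (Hc : off_cut (1 + RtoC s * - q)%C).
  { apply off_cut_1_plus. replace (RtoC s * - q)%C with (- (RtoC s * q))%C by ring. now rewrite Cmod_opp. }
  replace (curve_derive _ s 0) with (curve_derive (fun s : R => (CPSeries (polylog_coef 1) (0 + RtoC s * q) + Clog (1 + RtoC s * - q))%C) s
    (CPSeries (deriv_coef (polylog_coef 1)) (0 + RtoC s * q) * q + / (1 + RtoC s * - q) * - q)%C).
  - apply curve_derive_plus.
    + apply (curve_derive_line (CPSeries (polylog_coef 1)) 0 q). apply CPSeries_derive, Cradius_1_lt; [apply Cradius_polylog_coef|].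
      now rewrite Cplus_0_l.
    + apply (curve_derive_line Clog 1 (- q)%C). now apply is_Cderive_Clog.
  - f_equal. rewrite (CPSeries_ext _ (fun _ => RtoC 1)) by apply deriv_coef_polylog_coef_1.
    rewrite Cplus_0_l, CPSeries_geom by exact Hs.
    replace (1 + RtoC s * - q)%C with (1 - RtoC s * q)%C by ring. ring. }
unfold f in E.
replace (0 + RtoC 1 * q)%C with q in E by ring. replace (1 + RtoC 1 * - q)%C with (1 - q)%C in E by ring.
replace (0 + RtoC 0 * q)%C with (RtoC 0) in E by ring. replace (1 + RtoC 0 * - q)%C with (RtoC 1) in E by ring.
rewrite CPSeries_0, Clog_RtoC, ln_1 in E by lra. simpl in E.
replace (CPSeries (polylog_coef 1) q) with (CPSeries (polylog_coef 1) q + Clog (1 - q) - Clog (1 - q))%C by ring. rewrite E. ring.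
Qed.

Lemma polylog_chain_1 z : 0 < Re z -> polylog_chain 1 z = Clog (1 - Cexp (- z))%C.
Proof. intros H. unfold polylog_chain, polylog_exp. rewrite CPSeries_polylog_coef_1 by now apply Cmod_Cexp_opp_lt. simpl. rewrite Rmult_1_r. ring. Qed.

Lemma Cexp_polylog_chain_1 z : 0 < Re z -> Cexp (polylog_chain 1 z) = (1 - Cexp (- z))%C.
Proof.
intros H. rewrite polylog_chain_1, Cexp_Clog; [reflexivity| |exact H].
replace (1 - Cexp (- z))%C with (1 + - Cexp (- z))%C by ring. apply off_cut_1_plus. rewrite Cmod_opp. now apply Cmod_Cexp_opp_lt.
Qed.

Lemma re_pos_off_cut z : 0 < Re z -> off_cut z.
Proof. intros H. apply off_cut_iff. now right. Qed.

(** All three members are elementary: 1 / (e^z - 1) = 1 / z + (1 / (e^z - 1) - 1 / z). *)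
Lemma polylog_chain_2_overlap z : 0 < Re z -> Cmod z < 1 -> polylog_chain 2 z = (log_chain 2 z + psi 2 z)%C.
Proof.
intros H H1. pose proof (Cmod_Cexp_opp_lt z H) as Hq.
pose proof (off_cut_neq0 _ (re_pos_off_cut z H)) as Hz.
unfold polylog_chain, polylog_exp. rewrite CPSeries_q_deriv_coef by exact Hq.
rewrite (CPSeries_ext _ (fun _ => RtoC 1)) by apply deriv_coef_polylog_coef_1. rewrite CPSeries_geom by exact Hq.
pose proof (bernoulli_gen_C z H1) as B. rewrite Cexp_opp in *. pose proof (Cexp_neq0 z) as He.
set (ez := Cexp z) in *. set (p := psi 2 z) in *.
assert (He1 : (ez - 1)%C <> RtoC 0) by (intros Z; rewrite Z, Cmult_0_r in B; now symmetry in B).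
simpl log_chain. replace ((-1) ^ 2) with 1 by ring.
rewrite Rmult_1_l, (Cmult_1_r z).
assert (E : p = (/ (ez - 1) - / z)%C).
{ replace p with (((1 + z * p) * (ez - 1)) * / (z * (ez - 1)) - / z)%C by (field; split; assumption).
  rewrite B. field. split; assumption. }
rewrite E. replace (1 - / ez)%C with ((ez - 1) / ez)%C by (field; assumption). field. repeat split; assumption.
Qed.

Lemma Clim_Cderive_0 (f : C -> C) (l : C) (u : nat -> C) : is_Cderive f (RtoC 0) l -> Clim u 0 -> Clim (fun n => f (u n)) (f 0).
Proof.
intros H Hu e He. destruct (is_Cderive_cont f 0 l H e He) as [d [Hd K]].
destruct (Hu d Hd) as [N HN]. exists N. intros n Hn. specialize (HN n Hn).
replace (u n - 0)%C with (u n) in HN by ring. specialize (K (u n) HN). now rewrite Cplus_0_l in K.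
Qed.

(** A function with derivative 0 on the half disc is constant, as the half disc is convex; its
    value is read off at the boundary point 0. *)
Lemma half_disc_zero (E : C -> C) :
  (forall z : C, 0 < Re z -> Cmod z < 1 -> is_Cderive E z (RtoC 0)) ->
  Clim (fun n => E (RtoC (/ INR (S (S n))))) 0 ->
  forall z, 0 < Re z -> Cmod z < 1 -> E z = 0.
Proof.
intros HE HL z Hz Hz1.
assert (K : forall n, E (RtoC (/ INR (S (S n)))) = E z).
{ intros n. set (x := / INR (S (S n))).
  assert (Hx : 0 < x < 1).
  { unfold x. split; [apply Rinv_0_lt_compat, INR_S_pos|]. rewrite <- Rinv_1. apply Rinv_lt_contravar.
    - rewrite Rmult_1_l. apply INR_S_pos.
    - rewrite !S_INR. pose proof (pos_INR n). lra. }
  assert (A : (fun s : R => E (z + RtoC s * (RtoC x - z)))%C 1 = (fun s : R => E (z + RtoC s * (RtoC x - z)))%C 0).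
  { apply (curve_derive_zero_const (fun s : R => E (z + RtoC s * (RtoC x - z))%C) 0 1); [lra|]. intros s Hs.
    replace (RtoC 0) with (0 * (RtoC x - z))%C by ring.
    apply (curve_derive_line E z (RtoC x - z)%C). apply HE.
    - destruct z as [a b]. unfold Re in *; simpl in *. nra.
    - replace (z + RtoC s * (RtoC x - z))%C with (RtoC (1 - s) * z + RtoC s * RtoC x)%C by (rewrite RtoC_minus; ring).
      eapply Rle_lt_trans; [apply Cmod_triangle|]. rewrite !Cmod_mult, !Cmod_RtoC_pos by lra.
      pose proof (Cmod_ge_0 z). destruct (Rle_lt_dec x (Cmod z)); nra. }
  cbv beta in A. replace (z + RtoC 1 * (RtoC x - z))%C with (RtoC x) in A by ring.
  replace (z + RtoC 0 * (RtoC x - z))%C with z in A by ring. exact A. }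
apply (Clim_unique (fun _ => E z)); [apply Clim_const|].
revert HL. apply Clim_ext. exact K.
Qed.

Lemma inv_SS_lim : is_lim_seq (fun n => / INR (S (S n))) 0.
Proof. apply is_lim_seq_incr_1 with (u := fun n => / INR (S n)). apply is_lim_seq_inv_S. Qed.

Lemma Clim_inv_SS : Clim (fun n => RtoC (/ INR (S (S n)))) 0.
Proof. apply (Clim_incr (fun n => RtoC (/ INR (S n)))), Clim_inv_S. Qed.

(** One integration of [polylog_chain_2_overlap]; the constant is 0 because (1 - e^(-x)) / x ->
    1. *)
Lemma polylog_chain_1_overlap z : 0 < Re z -> Cmod z < 1 -> polylog_chain 1 z = (Clog z + psi 1 z)%C.
Proof.
intros Hz Hz1.
assert (K : (polylog_chain 1 z - Clog z - psi 1 z)%C = 0).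
{ apply (half_disc_zero (fun z => polylog_chain 1 z - Clog z - psi 1 z)%C); [| |assumption|assumption].
  - intros y Hy Hy1.
    replace (RtoC 0) with (polylog_chain 2 y - log_chain 2 y - psi 2 y)%C by (rewrite polylog_chain_2_overlap by assumption; ring).
    apply (is_Cderive_minus (fun z => polylog_chain 1 z - Clog z)%C (psi 1)); [|now apply is_Cderive_psi].
    apply (is_Cderive_minus (polylog_chain 1) Clog); [now apply is_Cderive_polylog_chain|].
    apply (is_Cderive_log_chain 1). now apply re_pos_off_cut.
  - replace (RtoC 0) with (0 - psi 1 0)%C by (rewrite psi_1_0; ring).
    apply Clim_minus.
    + apply (Clim_0_le _ (fun n => / INR (S (S n)))); [|apply inv_SS_lim].
      intros n. set (x := / INR (S (S n))).
      assert (Hx : 0 < x) by (unfold x; apply Rinv_0_lt_compat, INR_S_pos).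
      rewrite polylog_chain_1 by (simpl; exact Hx). rewrite <- RtoC_opp, Cexp_RtoC, <- RtoC_minus.
      pose proof (exp_ineq1 x ltac:(lra)) as E1. pose proof (exp_ineq1 (- x) ltac:(lra)) as E2.
      assert (E3 : exp (- x) < 1) by (rewrite <- exp_0; apply exp_increasing; lra).
      pose proof (exp_pos (- x)) as E5.
      assert (E4 : x * exp (- x) <= 1 - exp (- x)).
      { assert (exp x * exp (- x) = 1) by (rewrite <- exp_plus, Rplus_opp_r; apply exp_0). nra. }
      rewrite !Clog_RtoC by lra. rewrite <- RtoC_minus, Cmod_R. apply Rabs_le. split.
      * apply Rplus_le_reg_r with (ln x). ring_simplify.
        replace (- x + ln x) with (ln (x * exp (- x))) by (rewrite ln_mult, ln_exp by lra; ring).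
        apply ln_le; [apply Rmult_lt_0_compat; lra|lra].
      * assert (ln (1 - exp (- x)) <= ln x) by (apply ln_le; lra). lra.
    + apply (Clim_Cderive_0 (psi 1) (psi 2 0)); [apply is_Cderive_psi; rewrite Cmod_0; lra|apply Clim_inv_SS]. }
replace (polylog_chain 1 z) with ((polylog_chain 1 z - Clog z - psi 1 z) + (Clog z + psi 1 z))%C by ring. rewrite K. ring.
Qed.

(** Abel's theorem for Li_2 at 1; the series converges absolutely there, so dominated
    convergence applies. *)
Lemma polylog_exp_0_limit : Clim (fun n => polylog_exp 0 (RtoC (/ INR (S (S n))))) (RtoC (PI ^ 2 / 6)).
Proof.
assert (B1 : ex_series (fun k => Cmod (polylog_coef 0 k))).
{ apply (ex_series_incr_1 (K := R_AbsRing) (V := R_NormedModule)).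
  apply (ex_series_ext (fun k => / INR (S k) ^ 2)); [|apply ex_series_inv_sqr].
  intros k. unfold polylog_coef. pose proof (INR_S_pos k). rewrite Cmod_RtoC_pos.
  - simpl (INR (S k) ^ 0). unfold Rdiv. now rewrite Rmult_1_l.
  - apply Rdiv_le_0_compat; [simpl; lra|apply pow_lt; lra]. }
assert (E : RtoC (PI ^ 2 / 6) = CSeries (polylog_coef 0)).
{ rewrite CSeries_incr by exact B1. change (polylog_coef 0 0) with (RtoC 0). rewrite Cplus_0_l.
  unfold CSeries. apply injective_projections; simpl fst; simpl snd; symmetry.
  - apply is_series_unique. apply (is_series_ext (fun k => / INR (S k) ^ 2)); [|apply basel].
    intros k. unfold polylog_coef, Re. simpl (INR (S k) ^ 0). unfold RtoC, Rdiv. simpl fst. now rewrite Rmult_1_l.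
  - exact (is_series_unique _ _ is_series_zero). }
rewrite E. unfold polylog_exp, CPSeries.
apply (tannery (fun n k => polylog_coef 0 k * Cexp (- RtoC (/ INR (S (S n)))) ^ k)%C _ (fun k => Cmod (polylog_coef 0 k))); [|exact B1|].
- intros n k. rewrite Cmod_mult, Cmod_pow.
  assert (H : Cmod (Cexp (- RtoC (/ INR (S (S n))))%C) < 1).
  { apply Cmod_Cexp_opp_lt. change (0 < / INR (S (S n))). apply Rinv_0_lt_compat, INR_S_pos. }
  pose proof (Cmod_ge_0 (Cexp (- RtoC (/ INR (S (S n))))%C)). pose proof (Cmod_ge_0 (polylog_coef 0 k)).
  assert (Cmod (Cexp (- RtoC (/ INR (S (S n))))%C) ^ k <= 1) by (rewrite <- (pow1 k); apply pow_incr; lra). nra.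
- intros k. apply (Clim_ext (fun n => polylog_coef 0 k * Cexp (- RtoC (INR k) * RtoC (/ INR (S (S n)))))%C).
  { intros n. rewrite Cexp_pow. do 2 f_equal. ring. }
  assert (L : Clim (fun n => polylog_coef 0 k * Cexp (- RtoC (INR k) * RtoC (/ INR (S (S n)))))%C (polylog_coef 0 k * Cexp 0)%C).
  { apply Clim_scal. apply (Clim_Cderive_0 Cexp (Cexp 0)); [apply is_Cderive_Cexp|].
    apply Clim_mult_bounded_0, Clim_inv_SS. }
  rewrite Cexp_0, Cmult_1_r in L. exact L.
Qed.

(** A second integration: Li_2(e^(-z)) = pi^2/6 + z log z - z + psi_0(z).  The constant is
    Li_2(1), as the other terms vanish at 0. *)
Lemma polylog_chain_0_overlap z : 0 < Re z -> Cmod z < 1 -> polylog_chain 0 z = (RtoC (PI ^ 2 / 6) + log_chain 0 z + psi 0 z)%C.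
Proof.
intros Hz Hz1.
assert (K : (polylog_chain 0 z - log_chain 0 z - psi 0 z - RtoC (PI ^ 2 / 6))%C = 0).
{ apply (half_disc_zero (fun z => polylog_chain 0 z - log_chain 0 z - psi 0 z - RtoC (PI ^ 2 / 6))%C); [| |assumption|assumption].
  - intros y Hy Hy1.
    replace (RtoC 0) with (polylog_chain 1 y - log_chain 1 y - psi 1 y - 0)%C by (rewrite polylog_chain_1_overlap by assumption; simpl; ring).
    apply (is_Cderive_minus (fun z => polylog_chain 0 z - log_chain 0 z - psi 0 z)%C (fun _ => RtoC (PI ^ 2 / 6))); [|apply is_Cderive_const].
    apply (is_Cderive_minus (fun z => polylog_chain 0 z - log_chain 0 z)%C (psi 0)); [|now apply is_Cderive_psi].
    apply (is_Cderive_minus (polylog_chain 0) (log_chain 0)); [now apply is_Cderive_polylog_chain|].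
    apply (is_Cderive_log_chain 0). now apply re_pos_off_cut.
  - replace (RtoC 0) with (RtoC (PI ^ 2 / 6) - 0 - psi 0 0 - RtoC (PI ^ 2 / 6))%C by (rewrite psi_0_0; ring).
    apply Clim_minus; [|apply Clim_const]. apply Clim_minus; [apply Clim_minus|].
    + apply (Clim_ext (fun n => polylog_exp 0 (RtoC (/ INR (S (S n)))))); [|apply polylog_exp_0_limit].
      intros n. unfold polylog_chain. simpl. ring.
    + apply (Clim_ext (fun n => RtoC (- (ln (INR (S (S n))) / INR (S (S n)))) - RtoC (/ INR (S (S n))))%C).
      * intros n. unfold log_chain. pose proof (INR_S_pos (S n)).
        rewrite Clog_RtoC by now apply Rinv_0_lt_compat. rewrite ln_Rinv by assumption.
        rewrite <- RtoC_mult. f_equal. f_equal. unfold Rdiv. ring.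
      * replace (RtoC 0) with (0 - 0)%C by ring. apply Clim_minus; [|apply Clim_inv_SS].
        apply (Clim_ReIm _ 0); [|apply is_lim_seq_const].
        (* z log z -> 0 in the form (log n) / n -> 0. *)
        assert (L1 : is_lim_seq (fun n => ln (INR (S (S n))) / INR (S (S n))) 0).
        { apply (is_lim_comp_seq (fun y => ln y / y) (fun n => INR (S (S n))) p_infty 0).
          - apply is_lim_div_ln_p.
          - exists 0%nat. intros; easy.
          - apply (is_lim_seq_incr_1 (fun n => INR (S n))), (is_lim_seq_incr_1 INR), is_lim_seq_INR. }
        apply is_lim_seq_opp in L1. unfold Rbar_opp in L1. rewrite Ropp_0 in L1. exact L1.
    + apply (Clim_Cderive_0 (psi 0) (psi 1 0)); [apply is_Cderive_psi; rewrite Cmod_0; lra|apply Clim_inv_SS]. }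
replace (polylog_chain 0 z) with ((polylog_chain 0 z - log_chain 0 z - psi 0 z - RtoC (PI ^ 2 / 6)) + (RtoC (PI ^ 2 / 6) + log_chain 0 z + psi 0 z))%C by ring. rewrite K. ring.
Qed.

(** Differentiate [polylog_chain_1_overlap] repeatedly; the relation holds on an open set. *)
Lemma polylog_chain_overlap j z : (0 < j)%nat -> 0 < Re z -> Cmod z < 1 -> polylog_chain j z = (log_chain j z + psi j z)%C.
Proof.
destruct j; [lia|]. intros _. revert z. induction j; intros z Hz Hz1; [now apply polylog_chain_1_overlap|].
apply (is_Cderive_unique (polylog_chain (S j)) z); [now apply is_Cderive_polylog_chain|].
apply (is_Cderive_ext_near (fun y => log_chain (S j) y + psi (S j) y)%C _ _ _ (Rmin (Re z) (1 - Cmod z))).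
- apply Rmin_glb_lt; lra.
- intros y Hy. symmetry.
  assert (H1 : Cmod (y - z)%C < Re z) by (eapply Rlt_le_trans; [exact Hy|apply Rmin_l]).
  assert (H2 : Cmod (y - z)%C < 1 - Cmod z) by (eapply Rlt_le_trans; [exact Hy|apply Rmin_r]).
  apply IHj.
  + pose proof (re_le_Cmod (y - z)%C) as R. apply Rabs_le_between in R.
    change (Re (y - z)%C) with (Re y - Re z) in R. lra.
  + pose proof (Cmod_triangle_rev y z). lra.
- apply is_Cderive_plus; [apply is_Cderive_log_chain; now apply re_pos_off_cut|now apply is_Cderive_psi].
Qed.

(** * Sums over a ray *)

Lemma qpoch_S_l z q n : qpoch z q (S n) = ((1 - z) * qpoch (z * q) q n)%C.
Proof.
induction n.
- simpl. ring.
- change (qpoch z q (S (S n))) with (qpoch z q (S n) * (1 - z * q ^ S n))%C. rewrite IHn.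
  simpl qpoch. rewrite Cpow_S. ring.
Qed.

Lemma qpoch_inf_step z q l l' : is_qpoch_inf z q l -> is_qpoch_inf (z * q)%C q l' -> l = ((1 - z) * l')%C.
Proof.
intros H1 H2. apply filterlim_Clim in H1. apply filterlim_Clim in H2.
apply (Clim_unique (fun n => qpoch z q (S n))).
- now apply (Clim_incr (qpoch z q)).
- apply (Clim_ext (fun n => (1 - z) * qpoch (z * q) q n)%C); [intros; symmetry; apply qpoch_S_l|]. now apply Clim_scal.
Qed.

Definition ray_in_domain (beta y : C) : Prop := forall s, 0 <= s -> log_qpoch_domain beta (y + RtoC s * beta)%C.

Lemma ray_in_domain_shift beta y s : 0 <= s -> ray_in_domain beta y -> ray_in_domain beta (y + RtoC s * beta)%C.
Proof.
intros Hs H u Hu. replace (y + RtoC s * beta + RtoC u * beta)%C with (y + RtoC (s + u) * beta)%C by (rewrite RtoC_plus; ring).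
apply H. lra.
Qed.

Lemma re_pos_domain beta y : 0 < Re beta -> 0 < Re y -> log_qpoch_domain beta y.
Proof.
intros Hb Hy [n [s [Hs E]]]. apply (f_equal Re) in E. destruct beta as [b1 b2], y as [y1 y2].
unfold Re in *; simpl in *. nra.
Qed.

Lemma re_pos_ray beta y : 0 < Re beta -> 0 < Re y -> ray_in_domain beta y.
Proof.
intros Hb Hy s Hs. apply re_pos_domain; [assumption|]. destruct beta as [b1 b2], y as [y1 y2].
unfold Re in *; simpl in *. nra.
Qed.

Lemma analytic_curve_cont D f w b s : analytic_on D f -> D (w + RtoC s * b)%C -> curve_cont (fun u => f (w + RtoC u * b)%C) s.
Proof.
intros H HD. destruct (analytic_on_Cderive D f _ H HD) as [l Hl].
apply (curve_derive_curve_cont _ s (l * b)%C). now apply curve_derive_line.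
Qed.

Lemma curve_cont_line (f : C -> C) (w b l : C) s : is_Cderive f (w + RtoC s * b)%C l -> curve_cont (fun u => f (w + RtoC u * b)%C) s.
Proof. intros H. apply (curve_derive_curve_cont _ s (l * b)%C). now apply curve_derive_line. Qed.

Lemma curve_cont_ext f g s : (forall u, f u = g u) -> curve_cont f s -> curve_cont g s.
Proof.
intros E [H1 H2]. split.
- intros eps He. destruct (H1 eps He) as [d [Hd K]]. exists d. split; [exact Hd|]. intros x Hx. rewrite <- !E. now apply K.
- intros eps He. destruct (H2 eps He) as [d [Hd K]]. exists d. split; [exact Hd|]. intros x Hx. rewrite <- !E. now apply K.
Qed.

Lemma log_qpoch_exp_step beta G y : is_log_qpoch beta G ->
  log_qpoch_domain beta y -> log_qpoch_domain beta (y + beta)%C ->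
  Cexp (G y) = ((1 - Cexp (- y)) * Cexp (G (y + beta)%C))%C.
Proof.
intros [_ [H _]] H1 H2.
apply (qpoch_inf_step (Cexp (- y)) (Cexp (- beta))); [now apply H|].
rewrite <- Cexp_plus. replace (- y + - beta)%C with (- (y + beta))%C by ring. now apply H.
Qed.

(** The difference G(z) - G(z + beta) - L is a continuous logarithm of 1 along the ray. *)
Lemma log_qpoch_step_const beta G y (L : R -> C) a b :
  is_log_qpoch beta G -> 0 <= a <= b -> ray_in_domain beta y ->
  (forall s, a <= s <= b -> curve_cont L s) ->
  (forall s, a <= s <= b -> Cexp (L s) = (1 - Cexp (- (y + RtoC s * beta)))%C) ->
  (G (y + RtoC b * beta) - G (y + RtoC b * beta + beta) - L b =
   G (y + RtoC a * beta) - G (y + RtoC a * beta + beta) - L a)%C.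
Proof.
intros HG Hab Hr Hc He.
apply (log_path_const (fun s => G (y + RtoC s * beta) - G (y + RtoC s * beta + beta) - L s)%C a b); [lra| |].
- intros s Hs. apply curve_cont_minus; [apply curve_cont_minus|now apply Hc].
  + apply (analytic_curve_cont (log_qpoch_domain beta)); [apply HG|]. apply Hr. lra.
  + apply (curve_cont_ext (fun u => G (y + beta + RtoC u * beta)%C)); [intros u; f_equal; ring|].
    apply (analytic_curve_cont (log_qpoch_domain beta)); [apply HG|].
    replace (y + beta + RtoC s * beta)%C with (y + RtoC (s + 1) * beta)%C by (rewrite RtoC_plus; ring). apply Hr. lra.
- intros s Hs. rewrite !Cexp_minus, He by assumption.
  rewrite (log_qpoch_exp_step beta G (y + RtoC s * beta)); [|exact HG|apply Hr; lra|].
  + assert (Hn : (1 - Cexp (- (y + RtoC s * beta)))%C <> RtoC 0) by (rewrite <- He by assumption; apply Cexp_neq0).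
    field. repeat split; first [assumption | apply Cexp_neq0].
  + replace (y + RtoC s * beta + beta)%C with (y + RtoC (s + 1) * beta)%C by (rewrite RtoC_plus; ring). apply Hr. lra.
Qed.

(** The ray moves to the right, where G tends to 0. *)
Lemma log_qpoch_vanish beta G y : 0 < Re beta -> is_log_qpoch beta G ->
  forall eps, 0 < eps -> exists S0, 0 <= S0 /\ forall s, S0 <= s -> Cmod (G (y + RtoC s * beta)%C) < eps.
Proof.
intros Hb [_ [_ H]] eps He. destruct (H eps He) as [M HM].
exists (Rmax 0 ((M + 1 - Re y) / Re beta)). split; [apply Rmax_l|].
intros s Hs. apply HM.
assert (Hs2 : (M + 1 - Re y) / Re beta <= s) by (eapply Rle_trans; [apply Rmax_r|exact Hs]).
assert (E : M + 1 - Re y <= s * Re beta).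
{ apply Rmult_le_compat_r with (r := Re beta) in Hs2; [|lra]. unfold Rdiv in Hs2. rewrite Rmult_assoc, Rinv_l in Hs2; lra. }
replace (Re (y + RtoC s * beta)%C) with (Re y + s * Re beta); [lra|]. unfold Re; simpl; ring.
Qed.

Lemma re_line y s beta : Re (y + RtoC s * beta)%C = Re y + s * Re beta.
Proof. unfold Re; simpl; ring. Qed.

Lemma polylog_chain_1_small z : Re z >= 1 -> Cmod (polylog_chain 1 z) <= 4 * exp (- Re z).
Proof.
intros H. rewrite polylog_chain_1 by lra. replace (1 - Cexp (- z))%C with (1 + - Cexp (- z))%C by ring.
assert (E : Cmod (- Cexp (- z))%C = exp (- Re z)) by (rewrite Cmod_opp, Cmod_Cexp; f_equal).
rewrite <- E. apply Clog_1_plus_bound. rewrite E.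
rewrite exp_Ropp. apply Rinv_le_contravar; [lra|]. pose proof (exp_ineq1_le (Re z)). lra.
Qed.

Lemma exp_neg_le x : 0 < x -> exp (- x) <= / x.
Proof. intros H. rewrite exp_Ropp. apply Rinv_le_contravar; [assumption|]. pose proof (exp_ineq1_le x). lra. Qed.

(** In the right half plane the principal logarithm of 1 - e^(-z) is continuous along the whole
    ray and tends to 0, as do both values of G; the constant is therefore 0. *)
Lemma log_qpoch_step_pos beta G y : 0 < Re beta -> is_log_qpoch beta G -> 0 < Re y ->
  G y = (polylog_chain 1 y + G (y + beta))%C.
Proof.
intros Hb HG Hy.
assert (K : (G y - G (y + beta) - polylog_chain 1 y)%C = 0).
{ apply Cmod_eq_0. apply Rle_antisym; [|apply Cmod_ge_0]. apply le_epsilon. intros eps He. rewrite Rplus_0_l.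
  destruct (log_qpoch_vanish beta G y Hb HG (eps / 4) ltac:(lra)) as [S0 [HS0 K]].
  (* A point of the ray so far to the right that all three terms are small. *)
  set (s := S0 + (1 + 16 / eps) / Re beta).
  assert (H16 : 0 < 16 / eps) by (apply Rdiv_lt_0_compat; lra).
  assert (Hq : 0 < (1 + 16 / eps) / Re beta) by (apply Rdiv_lt_0_compat; lra).
  assert (Hs : S0 <= s) by (unfold s; lra).
  assert (Hre : 1 + 16 / eps <= Re (y + RtoC s * beta)%C).
  { rewrite re_line. unfold s. replace ((S0 + (1 + 16 / eps) / Re beta) * Re beta) with (S0 * Re beta + (1 + 16 / eps)) by (field; lra). nra. }
  pose proof (log_qpoch_step_const beta G y (fun s => polylog_chain 1 (y + RtoC s * beta)%C) 0 s HG ltac:(lra) (re_pos_ray _ _ Hb Hy)) as C.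
  assert (Hpos : forall u, 0 <= u -> 0 < Re (y + RtoC u * beta)%C) by (intros u Hu; rewrite re_line; nra).
  cbv beta in C. replace (y + RtoC 0 * beta)%C with y in C by ring.
  rewrite <- C.
  - pose proof (K s Hs) as K1. pose proof (K (s + 1) ltac:(lra)) as K2.
    replace (y + RtoC (s + 1) * beta)%C with (y + RtoC s * beta + beta)%C in K2 by (rewrite RtoC_plus; ring).
    pose proof (polylog_chain_1_small (y + RtoC s * beta)%C ltac:(lra)) as K3.
    pose proof (exp_neg_le (Re (y + RtoC s * beta)%C) ltac:(lra)) as K4.
    assert (K5 : / Re (y + RtoC s * beta)%C <= eps / 16).
    { replace (eps / 16) with (/ (16 / eps)) by (field; lra). apply Rinv_le_contravar; lra. }
    eapply Rle_trans; [apply Cmod_triangle_sub|]. pose proof (Cmod_triangle_sub (G (y + RtoC s * beta)%C) (G (y + RtoC s * beta + beta)%C)). lra.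
  - intros u Hu. apply (curve_cont_line (polylog_chain 1) y beta (polylog_chain 2 (y + RtoC u * beta)%C)). apply is_Cderive_polylog_chain, Hpos. lra.
  - intros u Hu. apply Cexp_polylog_chain_1, Hpos. lra. }
replace (G y) with ((G y - G (y + beta) - polylog_chain 1 y) + (polylog_chain 1 y + G (y + beta)))%C by ring. rewrite K. ring.
Qed.

(** If the ray starts outside the right half plane, a continuous logarithm [L] of 1 - e^(-z) has
    to be supplied only up to a point with positive real part, where it takes the principal
    value. *)
Lemma log_qpoch_step beta G y (L : R -> C) b : 0 < Re beta ->
  is_log_qpoch beta G -> 0 <= b -> ray_in_domain beta y ->
  (forall s, 0 <= s <= b -> curve_cont L s) ->
  (forall s, 0 <= s <= b -> Cexp (L s) = (1 - Cexp (- (y + RtoC s * beta)))%C) ->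
  0 < Re (y + RtoC b * beta)%C -> L b = polylog_chain 1 (y + RtoC b * beta)%C ->
  G y = (L 0 + G (y + beta))%C.
Proof.
intros Hb HG Hb0 Hr Hc He Hre HL.
pose proof (log_qpoch_step_const beta G y L 0 b HG ltac:(lra) Hr Hc He) as C.
replace (y + RtoC 0 * beta)%C with y in C by ring.
rewrite HL in C. rewrite (log_qpoch_step_pos beta G _ Hb HG Hre) in C.
replace (G y) with ((G y - G (y + beta) - L 0) + (L 0 + G (y + beta)))%C by ring. rewrite <- C. ring.
Qed.

Lemma log_qpoch_csum beta G y (l : nat -> C) n :
  (forall k, (k < n)%nat -> G (y + RtoC (INR k) * beta)%C = (l k + G (y + RtoC (INR k) * beta + beta))%C) ->
  G y = (csum n l + G (y + RtoC (INR n) * beta))%C.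
Proof.
intros H. induction n.
- simpl. replace (y + RtoC 0 * beta)%C with y by ring. ring.
- rewrite IHn by (intros; apply H; lia). rewrite H by lia. rewrite S_INR, RtoC_plus.
  replace (y + (RtoC (INR n) + 1) * beta)%C with (y + RtoC (INR n) * beta + beta)%C by ring. simpl csum. ring.
Qed.

Lemma log_qpoch_Clim_0 beta G y : 0 < Re beta -> is_log_qpoch beta G ->
  Clim (fun n => G (y + RtoC (INR n) * beta)%C) 0.
Proof.
intros Hb HG eps He. destruct (log_qpoch_vanish beta G y Hb HG eps He) as [S0 [_ K]].
destruct (exists_INR_ge S0) as [N HN]. exists N. intros n Hn.
replace (G (y + RtoC (INR n) * beta) - 0)%C with (G (y + RtoC (INR n) * beta)%C) by ring.
apply K. eapply Rle_trans; [exact HN|]. now apply le_INR.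
Qed.

(** A chain of complex derivatives restricted to a ray with step [beta].  The powers of [beta]
    make it a chain in the real parameter; dividing by [beta] normalises the member [j = 1] to
    [h 1]. *)
Definition scaled_curve (h : nat -> C -> C) (beta y : C) (j : nat) (s : R) : C :=
  (beta ^ j / beta * h j (y + RtoC s * beta))%C.
Definition em_scaled_sum (h : nat -> C -> C) (beta : C) (N : nat) (z : C) : C :=
  csum (S (S N)) (fun j => RtoC (bern_div_fact j) * (beta ^ j / beta * h j z))%C.

Lemma scaled_curve_curve_derive h beta y j s : beta <> RtoC 0 -> is_Cderive (h j) (y + RtoC s * beta)%C (h (S j) (y + RtoC s * beta)%C) ->
  curve_derive (scaled_curve h beta y j) s (scaled_curve h beta y (S j) s).
Proof.
intros Hb H. unfold scaled_curve.
replace (beta ^ S j / beta * h (S j) (y + RtoC s * beta))%C with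
 (beta ^ j / beta * (h (S j) (y + RtoC s * beta) * beta))%C by (rewrite Cpow_S; field; assumption).
apply curve_derive_scal. now apply curve_derive_line.
Qed.

Lemma scaled_curve_1 h beta y s : beta <> RtoC 0 -> scaled_curve h beta y 1 s = h 1%nat (y + RtoC s * beta)%C.
Proof. intros H. unfold scaled_curve. simpl. field. assumption. Qed.

Lemma Cmod_scaled_curve_coef beta j : beta <> RtoC 0 -> Cmod (beta ^ S j / beta)%C = Cmod beta ^ j.
Proof.
intros H. rewrite Cpow_S. replace (beta * beta ^ j / beta)%C with (beta ^ j)%C by (field; assumption). apply Cmod_pow.
Qed.

Lemma scaled_curve_sum h beta y N n : beta <> RtoC 0 ->
  csum n (fun k => h 1%nat (y + RtoC (INR k) * beta)%C) =
   (em_scaled_sum h beta N (y + RtoC (INR n) * beta) - em_scaled_sum h beta N y - csum n (fun k => em_err (S N) (scaled_curve h beta y) (INR k)))%C.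
Proof.
intros H. pose proof (em_sum_telescope (S N) (scaled_curve h beta y) n) as T.
rewrite (csum_ext n _ (fun k => h 1%nat (y + RtoC (INR k) * beta)%C)) in T by (intros; now apply scaled_curve_1).
rewrite T. unfold em_sum, scaled_curve, em_scaled_sum. replace (y + RtoC 0 * beta)%C with y by ring. reflexivity.
Qed.

Lemma psi_bounded j : exists M, 0 <= M /\ forall z, Cmod z <= / 2 -> Cmod (psi j z) <= M.
Proof.
assert (HC : Rbar_lt (Cmod (RtoC (/ 2))) (Cradius (psi_coef j))).
{ apply Cradius_1_lt; [apply Cradius_psi_coef|]. rewrite Cmod_RtoC_pos; lra. }
apply CPSeries_abs in HC. unfold Csummable in HC.
exists (Series (fun n => Cmod (psi_coef j n * RtoC (/ 2) ^ n)%C)). split; [apply Series_nonneg; [intros; apply Cmod_ge_0|exact HC]|].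
intros z Hz. apply Cmod_CSeries_bound; [|exact HC]. intros n. rewrite !Cmod_mult, !Cmod_pow.
apply Rmult_le_compat_l; [apply Cmod_ge_0|]. apply pow_incr. split; [apply Cmod_ge_0|]. rewrite Cmod_RtoC_pos; lra.
Qed.

Lemma polylog_chain_bounded j rho : 0 < rho -> exists M, 0 <= M /\ forall z, rho <= Re z -> Cmod (polylog_chain j z) <= M * exp (- Re z).
Proof.
intros Hr. set (q0 := RtoC (exp (- rho))).
assert (Hq0 : Cmod q0 = exp (- rho)) by (unfold q0; rewrite Cmod_RtoC_pos; [reflexivity|left; apply exp_pos]).
assert (HC : Rbar_lt (Cmod q0) (Cradius (polylog_coef j))).
{ apply Cradius_1_lt; [apply Cradius_polylog_coef|]. rewrite Hq0, <- exp_0. apply exp_increasing. lra. }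
assert (Hq0n : q0 <> RtoC 0) by (apply Cmod_gt_0; rewrite Hq0; apply exp_pos).
apply CPSeries_abs in HC. apply Csummable_incr in HC. apply (Csummable_scal (/ q0)) in HC.
apply (Csummable_ext _ (fun n => polylog_coef j (S n) * q0 ^ n)%C) in HC; [|intros n; rewrite Cpow_S; field; assumption].
exists (Series (fun n => Cmod (polylog_coef j (S n) * q0 ^ n)%C)).
split; [apply Series_nonneg; [intros; apply Cmod_ge_0|exact HC]|].
intros z Hz. unfold polylog_chain, polylog_exp. rewrite Cmod_mult, Cmod_R, pow_1_abs, Rmult_1_l.
rewrite CPSeries_incr by (apply Cradius_1_lt; [apply Cradius_polylog_coef|apply Cmod_Cexp_opp_lt; lra]).
change (polylog_coef j 0) with (RtoC 0). rewrite Cplus_0_l, Cmod_mult, Cmod_Cexp.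
change (Re (- z)%C) with (- Re z). rewrite Rmult_comm.
apply Rmult_le_compat_r; [left; apply exp_pos|].
apply Cmod_CSeries_bound; [|exact HC]. intros n. rewrite !Cmod_mult, !Cmod_pow.
apply Rmult_le_compat_l; [apply Cmod_ge_0|]. apply pow_incr. split; [apply Cmod_ge_0|].
rewrite Hq0, Cmod_Cexp. change (Re (- z)%C) with (- Re z).
destruct (Rle_lt_or_eq_dec _ _ Hz) as [L|E]; [left; apply exp_increasing; lra|rewrite E; lra].
Qed.

(** About 1 / |beta| steps inside the disc, each with an Euler-Maclaurin error
    O(|beta|^(N+1)). *)
Lemma psi_sum_estimate N : exists C, 0 <= C /\ forall beta w K, beta <> RtoC 0 -> Cmod beta * INR K <= 1 ->
  (forall s, 0 <= s <= INR K -> Cmod (w + RtoC s * beta)%C <= / 2) ->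
  Cmod (csum K (fun k => psi 1 (w + RtoC (INR k) * beta)) - (em_scaled_sum psi beta N (w + RtoC (INR K) * beta) - em_scaled_sum psi beta N w))%C
   <= C * Cmod beta ^ N.
Proof.
destruct (psi_bounded (S (S N))) as [M [HM0 HM]].
exists (INR (S (S N)) * M). split; [apply Rmult_le_pos; [apply pos_INR|assumption]|].
intros beta w K Hb HK Hw.
rewrite (scaled_curve_sum psi beta w N K Hb).
match goal with |- Cmod ?x <= _ => replace x with (- csum K (fun k => em_err (S N) (scaled_curve psi beta w) (INR k)))%C by ring end.
rewrite Cmod_opp. eapply Rle_trans.
- apply (Cmod_csum_const K _ (INR (S (S N)) * (Cmod beta ^ S N * M))). intros k Hk.
  assert (Hk1 : INR k + 1 <= INR K) by (rewrite <- S_INR; apply le_INR; lia). pose proof (pos_INR k).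
  apply em_err_bound.
  + intros j s _ Hs. apply scaled_curve_curve_derive; [assumption|]. apply is_Cderive_psi.
    specialize (Hw s ltac:(lra)). lra.
  + intros s Hs. unfold scaled_curve. rewrite Cmod_mult, Cmod_scaled_curve_coef by assumption.
    apply Rmult_le_compat_l; [apply pow_le, Cmod_ge_0|]. apply HM, Hw. lra.
- pose proof (pos_INR (S (S N))). pose proof (Cmod_ge_0 beta). assert (0 <= Cmod beta ^ N) by now apply pow_le.
  replace (INR K * (INR (S (S N)) * (Cmod beta ^ S N * M))) with ((INR (S (S N)) * M * Cmod beta ^ N) * (Cmod beta * INR K)) by (simpl; ring).
  rewrite <- (Rmult_1_r (INR (S (S N)) * M * Cmod beta ^ N)) at 2.
  apply Rmult_le_compat_l; [|assumption]. repeat apply Rmult_le_pos; assumption.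
Qed.

Lemma geom_sum_le x n : 0 <= x < 1 -> Cmod (csum n (fun k => RtoC (x ^ k))) <= / (1 - x).
Proof.
intros Hx.
assert (E : csum n (fun k => RtoC (x ^ k)) = RtoC ((1 - x ^ n) / (1 - x))).
{ induction n; [simpl; f_equal; field; lra|]. simpl csum. rewrite IHn, <- RtoC_plus. f_equal. simpl. field. lra. }
assert (0 <= x ^ n <= 1) by (split; [apply pow_le; lra|rewrite <- (pow1 n); apply pow_incr; lra]).
rewrite E, Cmod_RtoC_pos.
- unfold Rdiv. rewrite <- (Rmult_1_l (/ (1 - x))) at 2. apply Rmult_le_compat_r; [left; apply Rinv_0_lt_compat; lra|lra].
- apply Rdiv_le_0_compat; lra.
Qed.

Lemma one_minus_exp_ge a : 0 < a <= 1 -> a / 2 <= 1 - exp (- a).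
Proof.
intros H. rewrite exp_Ropp. pose proof (exp_ineq1_le a).
assert (/ exp a <= / (1 + a)) by (apply Rinv_le_contravar; lra).
assert (/ (1 + a) <= 1 - a / 2); [|lra].
apply Rmult_le_reg_r with (1 + a); [lra|]. rewrite Rinv_l by lra. nra.
Qed.

(** Exponential decay along the ray bounds the errors by a geometric series with sum O(1 / Re
    beta). *)
Lemma scaled_curve_err_sum N (h : nat -> C -> C) beta y M n : beta <> RtoC 0 -> 0 <= M -> 0 < Re beta <= 1 ->
  (forall j s, 0 <= s -> is_Cderive (h j) (y + RtoC s * beta)%C (h (S j) (y + RtoC s * beta)%C)) ->
  (forall s, 0 <= s -> Cmod (h (S (S N)) (y + RtoC s * beta)%C) <= M * exp (- (s * Re beta))) ->
  Cmod (csum n (fun k => em_err (S N) (scaled_curve h beta y) (INR k))) <= INR (S (S N)) * M * Cmod beta ^ S N * (2 / Re beta).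
Proof.
intros Hb HM Hre Hd HB.
assert (P0 : 0 <= INR (S (S N)) * (Cmod beta ^ S N * M)).
{ apply Rmult_le_pos; [apply pos_INR|]. apply Rmult_le_pos; [apply pow_le, Cmod_ge_0|assumption]. }
eapply Rle_trans.
- apply (csum_le_real n _ (fun k => INR (S (S N)) * (Cmod beta ^ S N * M) * exp (- Re beta) ^ k)).
  + intros k _. pose proof (pos_INR k). rewrite Rmult_assoc. apply em_err_bound.
    * intros j s _ Hs. apply scaled_curve_curve_derive; [assumption|]. apply Hd. lra.
    * intros s Hs. unfold scaled_curve. rewrite Cmod_mult, Cmod_scaled_curve_coef by assumption. rewrite Rmult_assoc.
      apply Rmult_le_compat_l; [apply pow_le, Cmod_ge_0|]. eapply Rle_trans; [apply HB; lra|].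
      apply Rmult_le_compat_l; [assumption|].
      rewrite <- Rpower_pow by apply exp_pos. unfold Rpower. rewrite ln_exp.
      destruct (Req_dec s (INR k)) as [->|Hn]; [right; f_equal; ring|].
      left. apply exp_increasing. nra.
  + intros k. apply Rmult_le_pos; [assumption|]. apply pow_le. left; apply exp_pos.
- rewrite (csum_ext _ _ (fun k => RtoC (INR (S (S N)) * (Cmod beta ^ S N * M)) * RtoC (exp (- Re beta) ^ k))%C) by (intros; now rewrite RtoC_mult).
  rewrite csum_scal, Cmod_mult, Cmod_RtoC_pos by assumption.
  replace (INR (S (S N)) * M * Cmod beta ^ S N * (2 / Re beta)) with (INR (S (S N)) * (Cmod beta ^ S N * M) * (2 / Re beta)) by ring.
  apply Rmult_le_compat_l; [assumption|].
  pose proof (exp_pos (- Re beta)).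
  assert (exp (- Re beta) < 1) by (rewrite <- exp_0; apply exp_increasing; lra).
  eapply Rle_trans; [apply geom_sum_le; lra|].
  pose proof (one_minus_exp_ge (Re beta) Hre).
  replace (2 / Re beta) with (/ (Re beta / 2)) by (field; lra). apply Rinv_le_contravar; lra.
Qed.

Lemma Clim_exp_decay (u : nat -> C) M a : 0 < a -> (forall n, Cmod (u n) <= M * exp (- (INR n * a))) -> Clim u 0.
Proof.
intros Ha H. apply (Clim_0_le _ (fun n => M * exp (- a) ^ n)).
- intros n. eapply Rle_trans; [apply H|]. right. f_equal.
  rewrite <- Rpower_pow by apply exp_pos. unfold Rpower. rewrite ln_exp. f_equal. ring.
- replace (Finite 0) with (Finite (M * 0)) by (f_equal; ring). apply is_lim_seq_mult'; [apply is_lim_seq_const|].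
  apply is_lim_seq_geom. rewrite Rabs_pos_eq by (left; apply exp_pos). rewrite <- exp_0. apply exp_increasing. lra.
Qed.

(** Let the number of steps tend to infinity: G and all members of the chain vanish at the end
    of the ray, and only the Euler-Maclaurin sum at the start remains. *)
Lemma log_qpoch_euler_maclaurin N (h : nat -> C -> C) beta G y M : beta <> RtoC 0 -> 0 < Re beta <= 1 ->
  is_log_qpoch beta G ->
  (forall k, G (y + RtoC (INR k) * beta)%C = (h 1%nat (y + RtoC (INR k) * beta) + G (y + RtoC (INR k) * beta + beta))%C) ->
  (forall j s, 0 <= s -> is_Cderive (h j) (y + RtoC s * beta)%C (h (S j) (y + RtoC s * beta)%C)) ->
  0 <= M -> (forall s, 0 <= s -> Cmod (h (S (S N)) (y + RtoC s * beta)%C) <= M * exp (- (s * Re beta))) ->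
  (forall j, Clim (fun n => h j (y + RtoC (INR n) * beta)%C) 0) ->
  Cmod (G y + em_scaled_sum h beta N y)%C <= INR (S (S N)) * M * Cmod beta ^ S N * (2 / Re beta).
Proof.
intros Hb Hre HG Hstep Hd HM HB HL. rewrite <- Cmod_opp.
apply (Clim_le (fun n => csum n (fun k => em_err (S N) (scaled_curve h beta y) (INR k)))); [|intros n; now apply scaled_curve_err_sum].
apply (Clim_ext (fun n => em_scaled_sum h beta N (y + RtoC (INR n) * beta) - em_scaled_sum h beta N y - (G y - G (y + RtoC (INR n) * beta)))%C).
- intros n. pose proof (scaled_curve_sum h beta y N n Hb) as E.
  rewrite (log_qpoch_csum beta G y _ n (fun k _ => Hstep k)). cbv beta. rewrite E. ring.
- replace (- (G y + em_scaled_sum h beta N y))%C with (0 - em_scaled_sum h beta N y - (G y - 0))%C by ring.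
  apply Clim_minus; [apply Clim_minus; [|apply Clim_const]|].
  + unfold em_scaled_sum. apply (Clim_csum_0 (S (S N)) (fun j n => RtoC (bern_div_fact j) * (beta ^ j / beta * h j (y + RtoC (INR n) * beta)))%C).
    intros j _. apply Clim_mult_bounded_0, Clim_mult_bounded_0, HL.
  + apply Clim_minus; [apply Clim_const|]. apply log_qpoch_Clim_0; [lra|assumption].
Qed.

(** The case of the polylogarithmic chain, uniformly for Re y >= rho > 0. *)
Lemma log_qpoch_right_half_plane N rho : 0 < rho -> exists C, 0 <= C /\ forall beta G y, 0 < Re beta <= 1 -> is_log_qpoch beta G -> rho <= Re y ->
  Cmod (G y + em_scaled_sum polylog_chain beta N y)%C <= C * Cmod beta ^ S N / Re beta.
Proof.
intros Hr. destruct (polylog_chain_bounded (S (S N)) rho Hr) as [M [HM0 HM]].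
exists (INR (S (S N)) * M * 2). split; [repeat apply Rmult_le_pos; try lra; apply pos_INR|].
intros beta G y Hb HG Hy.
assert (Hb0 : beta <> RtoC 0) by (intros E; rewrite E in Hb; simpl in Hb; lra).
assert (Hre : forall s, 0 <= s -> rho + s * Re beta <= Re (y + RtoC s * beta)%C) by (intros s Hs; rewrite re_line; lra).
assert (Hre0 : forall s, 0 <= s -> rho <= Re (y + RtoC s * beta)%C).
{ intros s Hs. specialize (Hre s Hs). assert (0 <= s * Re beta) by (apply Rmult_le_pos; lra). lra. }
assert (Hexp : forall M s, 0 <= s -> 0 <= M -> M * exp (- Re (y + RtoC s * beta)%C) <= M * exp (- (s * Re beta))).
{ intros M' s Hs HM'. specialize (Hre s Hs). apply Rmult_le_compat_l; [assumption|]. left. apply exp_increasing. lra. }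
eapply Rle_trans.
- apply (log_qpoch_euler_maclaurin N polylog_chain beta G y M Hb0 Hb HG).
  + intros k. apply log_qpoch_step_pos; [lra|assumption|]. specialize (Hre0 (INR k) (pos_INR k)). lra.
  + intros j s Hs. apply is_Cderive_polylog_chain. specialize (Hre0 s Hs). lra.
  + assumption.
  + intros s Hs. eapply Rle_trans; [apply HM, Hre0, Hs|]. now apply Hexp.
  + intros j. destruct (polylog_chain_bounded j rho Hr) as [Mj [HMj0 HMj]].
    apply (Clim_exp_decay _ Mj (Re beta)); [lra|]. intros n. eapply Rle_trans; [apply HMj, Hre0, pos_INR|].
    apply Hexp; [apply pos_INR|assumption].
- right. field. lra.
Qed.

(** * The uniform expansion *)

Lemma beta_of_eq theta r : beta_of theta r = (r * cos theta, r * sin theta).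
Proof.
unfold beta_of, Cexp, Cmult, RtoC, Re, Im; simpl. rewrite exp_0. f_equal; ring.
Qed.

Lemma Cexp_log_beta theta r : 0 < r -> Cexp (log_beta theta r) = beta_of theta r.
Proof. intros H. rewrite beta_of_eq. unfold Cexp, log_beta, Re, Im; simpl. rewrite exp_ln by assumption. reflexivity. Qed.

Lemma Cmod_beta theta r : 0 < r -> Cmod (beta_of theta r) = r.
Proof.
intros H. rewrite <- Cexp_log_beta, Cmod_Cexp by assumption. unfold log_beta, Re; simpl. now apply exp_ln.
Qed.

Lemma beta_neq0 theta r : 0 < r -> beta_of theta r <> RtoC 0.
Proof. intros H. apply Cmod_gt_0. rewrite Cmod_beta; assumption. Qed.

Lemma Re_beta theta r : Re (beta_of theta r) = r * cos theta.
Proof. now rewrite beta_of_eq. Qed.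

(** The function T(z) = e^(- psi_1(z)) (1 - e^(-z)) satisfies z T' = T, so T(z) / z is constant,
    and its limit at 0 is T'(0) = 1. *)
Lemma Cexp_psi_1 z : Cmod z < 1 -> (z * Cexp (psi 1 z))%C = (1 - Cexp (- z))%C.
Proof.
intros Hz. destruct (Ceq_dec z 0) as [->|Hz0].
{ replace (- 0)%C with (RtoC 0) by ring. rewrite Cexp_0. ring. }
set (T := fun y => (Cexp (- psi 1 y) * (1 - Cexp (- y)))%C).
set (T' := fun y => ((- psi 2 y) * T y + Cexp (- psi 1 y) * Cexp (- y))%C).
assert (Dneg : forall (f : C -> C) (y l : C), is_Cderive f y l -> is_Cderive (fun y => Cexp (- f y)%C) y (- l * Cexp (- f y))%C).
{ intros f y l H. apply (is_Cderive_comp Cexp (fun y => - f y)%C); [apply is_Cderive_Cexp|].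
  apply (is_Cderive_ext (fun y => 0 - f y)%C); [intros; ring|]. replace (- l)%C with (0 - l)%C by ring.
  apply (is_Cderive_minus (fun _ => RtoC 0) f); [apply is_Cderive_const|assumption]. }
assert (DT : forall y, Cmod y < 1 -> is_Cderive T y (T' y)).
{ intros y Hy. unfold T', T.
  replace (- psi 2 y * (Cexp (- psi 1 y) * (1 - Cexp (- y))) + Cexp (- psi 1 y) * Cexp (- y))%C with
   (- psi 2 y * Cexp (- psi 1 y) * (1 - Cexp (- y)) + Cexp (- psi 1 y) * (0 - (- (1) * Cexp (- y))))%C by ring.
  apply (is_Cderive_mult (fun y => Cexp (- psi 1 y)) (fun y => 1 - Cexp (- y)))%C.
  - apply Dneg. now apply is_Cderive_psi.
  - apply (is_Cderive_minus (fun _ => RtoC 1) (fun y => Cexp (- y)))%C; [apply is_Cderive_const|].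
    apply (Dneg (fun y => y)). apply is_Cderive_id. }
(* The equation z T' = T is the generating function of the Bernoulli numbers. *)
assert (ODE : forall y, Cmod y < 1 -> (y * T' y)%C = T y).
{ intros y Hy. pose proof (bernoulli_gen_C y Hy) as B.
  unfold T'. assert (E : (y * Cexp (- y))%C = ((1 + y * psi 2 y) * (1 - Cexp (- y)))%C).
  { rewrite Cexp_opp. pose proof (Cexp_neq0 y). rewrite <- B at 1. field. assumption. }
  replace (y * (- psi 2 y * T y + Cexp (- psi 1 y) * Cexp (- y)))%C with
   (- (y * psi 2 y) * T y + Cexp (- psi 1 y) * (y * Cexp (- y)))%C by ring.
  rewrite E. unfold T. ring. }
set (U := fun y => (T y * / y)%C).
assert (DU : forall y, Cmod y < 1 -> y <> RtoC 0 -> is_Cderive U y (RtoC 0)).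
{ intros y Hy Hy0. replace (RtoC 0) with (T' y * / y + T y * (- / (y * y)))%C.
  - apply (is_Cderive_mult T Cinv); [now apply DT|now apply is_Cderive_inv].
  - rewrite <- (ODE y Hy). field. assumption. }
assert (K : forall s, 0 < s <= 1 -> U (RtoC s * z)%C = U z).
{ intros s Hs.
  assert (A : U (0 + RtoC 1 * z)%C = U (0 + RtoC s * z)%C).
  { apply (curve_derive_zero_const (fun s : R => U (0 + RtoC s * z)%C) s 1); [lra|]. intros u Hu.
    pose proof (curve_derive_line U (RtoC 0) z (RtoC 0) u) as Q. rewrite Cmult_0_l in Q. apply Q, DU.
    - rewrite Cplus_0_l, Cmod_mult, Cmod_RtoC_pos by lra. pose proof (Cmod_ge_0 z). nra.
    - rewrite Cplus_0_l. apply Cmult_neq_0; [apply RtoC_neq0; lra|assumption]. }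
  rewrite !Cplus_0_l, Cmult_1_l in A. now symmetry. }
assert (T0 : T 0 = 0).
{ unfold T. replace (- 0)%C with (RtoC 0) by ring. rewrite Cexp_0. ring. }
assert (T0' : T' 0 = 1).
{ unfold T'. rewrite T0, psi_1_0. replace (- 0)%C with (RtoC 0) by ring. rewrite Cexp_0. ring. }
assert (U1 : U z = 1).
{ apply Ceq_minus, Cmod_eq_0. apply Rle_antisym; [|apply Cmod_ge_0]. apply le_epsilon. intros eps He. rewrite Rplus_0_l.
  pose proof (DT 0 ltac:(rewrite Cmod_0; lra)) as D0. rewrite is_Cderive_iff in D0.
  destruct (D0 eps He) as [d [Hd Hh]].
  set (s := Rmin 1 (d / 2)). assert (Hs : 0 < s <= 1) by (split; [apply Rmin_glb_lt; lra|apply Rmin_l]).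
  assert (Hs2 : s <= d / 2) by apply Rmin_r.
  assert (M : Cmod (RtoC s * z)%C = s * Cmod z) by (rewrite Cmod_mult, Cmod_RtoC_pos; lra).
  pose proof (Cmod_ge_0 z). specialize (Hh (RtoC s * z)%C ltac:(rewrite M; nra)).
  rewrite T0, T0', Cplus_0_l in Hh. rewrite <- (K s Hs). unfold U.
  assert (Hsz : (RtoC s * z)%C <> RtoC 0) by (apply Cmult_neq_0; [apply RtoC_neq0; lra|assumption]).
  set (v := (RtoC s * z)%C) in *.
  replace (T v * / v - 1)%C with ((T v - 0 - 1 * v) * / v)%C by (field; assumption).
  rewrite Cmod_mult, Cmod_inv by assumption. pose proof (proj1 (Cmod_gt_0 v) Hsz).
  apply Rmult_le_reg_r with (Cmod v); [assumption|]. rewrite Rmult_assoc, Rinv_l, Rmult_1_r by lra. exact Hh. }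
unfold U, T in U1.
assert (E : (Cexp (- psi 1 z) * (1 - Cexp (- z)))%C = z).
{ replace (Cexp (- psi 1 z) * (1 - Cexp (- z)))%C with (Cexp (- psi 1 z) * (1 - Cexp (- z)) * / z * z)%C by (field; assumption). rewrite U1. ring. }
rewrite <- E at 1. rewrite (Cexp_opp (psi 1 z)). field. apply Cexp_neq0.
Qed.

Lemma Im_Clog_re_pos z : 0 < Re z -> - (PI / 2) < Im (Clog z) < PI / 2.
Proof.
intros H. change (Im (Clog z)) with (2 * atan (Im z / (Cmod z + Re z))).
pose proof (im_le_Cmod z) as K. pose proof (Cmod_ge_0 z).
assert (Hu : -1 < Im z / (Cmod z + Re z) < 1).
{ apply Rabs_le_between in K. split.
  - apply Rmult_lt_reg_r with (Cmod z + Re z); [lra|]. unfold Rdiv. rewrite Rmult_assoc, Rinv_l; lra.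
  - apply Rmult_lt_reg_r with (Cmod z + Re z); [lra|]. unfold Rdiv. rewrite Rmult_assoc, Rinv_l; lra. }
destruct Hu as [u1 u2]. apply atan_increasing in u1. apply atan_increasing in u2.
rewrite atan_1 in u2. replace (-1) with (- (1)) in u1 by ring. rewrite atan_opp, atan_1 in u1. lra.
Qed.

(** The two sides differ by a multiple of 2 pi i, and the arguments theta, arg tau, arg (beta
    tau) are less than pi/2, pi, pi/2 in absolute value. *)
Lemma Clog_beta theta r tau : - PI / 2 < theta < PI / 2 -> 0 < r -> off_cut tau -> 0 < Re (beta_of theta r * tau)%C ->
  Clog (beta_of theta r * tau)%C = (log_beta theta r + Clog tau)%C.
Proof.
intros Ht Hr Hc Hp. pose proof (Im_Clog tau) as I1. pose proof (Im_Clog_re_pos _ Hp) as I2.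
assert (E : Cexp (log_beta theta r + Clog tau - Clog (beta_of theta r * tau))%C = 1).
{ rewrite Cexp_minus, Cexp_plus, Cexp_log_beta, !Cexp_Clog by (try assumption; now apply re_pos_off_cut).
  pose proof (beta_neq0 theta r Hr). pose proof (off_cut_neq0 _ Hc). field. split; assumption. }
apply Cexp_eq_1 in E. destruct E as [E1 [k E2]].
set (D := (log_beta theta r + Clog tau - Clog (beta_of theta r * tau))%C) in *.
assert (ED : Im D = theta + Im (Clog tau) - Im (Clog (beta_of theta r * tau))) by reflexivity.
assert (Hk : (k = 0)%Z).
{ apply IZR_abs_lt_1. pose proof PI_RGT_0. split; apply Rmult_lt_reg_l with (2 * PI); lra. }
subst k. assert (D = 0) by (apply injective_projections; [exact E1|]; change (Im D = 0); rewrite E2; ring).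
unfold D in H. symmetry. now apply Ceq_minus.
Qed.

(** If the ray meets the cut that ends in 2 pi i n, then w + u beta = 2 pi i n for its starting
    point w = beta t and some u >= 0.  Comparing real parts bounds u |beta|, hence n = 0, and t
    = - u lies on the negative axis. *)
Lemma small_ray_in_domain theta r t : 0 < cos theta -> 0 < r -> off_cut t ->
  Cmod (beta_of theta r * t)%C <= cos theta / 8 -> ray_in_domain (beta_of theta r) (beta_of theta r * t)%C.
Proof.
intros Hc Hr Ht Hw s Hs [n [sg [Hsg E]]].
pose proof (COS_bound theta) as [_ Hc1].
set (b := beta_of theta r) in *. set (w := (b * t)%C) in *.
assert (E2 : (w + RtoC (s - sg) * b)%C = (RtoC (2 * PI * IZR n) * Ci)%C).
{ rewrite RtoC_minus. replace (w + (RtoC s - RtoC sg) * b)%C with ((w + RtoC s * b) - b * RtoC sg)%C by ring. rewrite E. ring. }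
set (u := s - sg) in *. assert (Hu : 0 <= u) by (unfold u; lra).
pose proof (re_le_Cmod w) as Hre. apply Rabs_le_between in Hre.
assert (ER : Re w + u * (r * cos theta) = 0).
{ apply (f_equal Re) in E2. rewrite re_line in E2. unfold b in E2. rewrite Re_beta in E2. rewrite E2. unfold Re, Ci; simpl; ring. }
assert (Hur : u * r <= 1 / 8) by nra.
assert (EM : Cmod (RtoC (2 * PI * IZR n) * Ci)%C <= 1 / 4).
{ rewrite <- E2. eapply Rle_trans; [apply Cmod_triangle|]. rewrite Cmod_mult, Cmod_RtoC_pos by assumption.
  unfold b. rewrite Cmod_beta by assumption. lra. }
rewrite Cmod_mult, Cmod_Ci, Rmult_1_r, Cmod_R in EM.
assert (Hn : (n = 0)%Z).
{ apply Rabs_le_between in EM. pose proof PI2_1.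
  apply IZR_abs_lt_1. split; apply Rmult_lt_reg_l with (2 * PI); lra. }
subst n. assert (Eb : (b * (t + RtoC u))%C = 0).
{ replace (b * (t + RtoC u))%C with (w + RtoC u * b)%C by (unfold w; ring). rewrite E2. rewrite Rmult_0_r. ring. }
assert (Hb : b <> RtoC 0) by now apply beta_neq0.
assert (Et : (t + RtoC u)%C = 0).
{ replace (t + RtoC u)%C with (b * (t + RtoC u) * / b)%C by (field; assumption). rewrite Eb. ring. }
apply (off_cut_neq0 (t + RtoC u)%C); [now apply off_cut_plus_pos|exact Et].
Qed.

(** While the points of the ray stay in the disc, log beta + log (t + k + s) + psi_1 is a
    continuous logarithm of 1 - e^(-z), and it has the principal value as soon as the real part
    is positive. *)
Lemma log_qpoch_near_split theta r t K G : - PI / 2 < theta < PI / 2 -> 0 < cos theta -> 0 < r -> off_cut t ->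
  let b := beta_of theta r in let w := (b * t)%C in
  is_log_qpoch b G -> ray_in_domain b w ->
  (forall s, 0 <= s <= INR K -> Cmod (w + RtoC s * b)%C <= / 2) ->
  0 < Re (w + RtoC (INR K) * b)%C ->
  G w = (csum K (fun k => log_beta theta r + Clog (t + RtoC (INR k)) + psi 1 (w + RtoC (INR k) * b)) + G (w + RtoC (INR K) * b))%C.
Proof.
intros Hth Hc Hr Ht b w HG Hray Hsm HK.
assert (Hb : b <> RtoC 0) by now apply beta_neq0.
assert (Hbre : 0 < Re b) by (unfold b; rewrite Re_beta; nra).
apply log_qpoch_csum. intros k Hk.
assert (Hk1 : INR k <= INR K) by (apply le_INR; lia). pose proof (pos_INR k) as Hk0.
(* The continuous logarithm of 1 - e^(-z) along the ray, written with the point t + k + s off the cut. *)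
set (L := fun s : R => (log_beta theta r + Clog (t + RtoC (INR k) + RtoC s * 1) + psi 1 (w + RtoC (INR k) * b + RtoC s * b))%C).
assert (EL : forall s, (w + RtoC (INR k) * b + RtoC s * b)%C = (w + RtoC (INR k + s) * b)%C) by (intros; rewrite RtoC_plus; ring).
pose proof (log_qpoch_step b G (w + RtoC (INR k) * b)%C L (INR K - INR k)) as S.
replace (log_beta theta r + Clog (t + RtoC (INR k)) + psi 1 (w + RtoC (INR k) * b))%C with (L 0).
2: { unfold L. replace (t + RtoC (INR k) + RtoC 0 * 1)%C with (t + RtoC (INR k))%C by ring.
     now replace (w + RtoC (INR k) * b + RtoC 0 * b)%C with (w + RtoC (INR k) * b)%C by ring. }
assert (Hcut : forall s, 0 <= s -> off_cut (t + RtoC (INR k) + RtoC s * 1)%C).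
{ intros s Hs. rewrite Cmult_1_r. apply off_cut_plus_pos; [apply off_cut_plus_pos; assumption|assumption]. }
apply S; clear S; [assumption|assumption|lra|now apply ray_in_domain_shift| | | |].
- intros s Hs. unfold L. apply curve_cont_plus; [apply curve_cont_plus|].
  + apply (curve_derive_curve_cont _ s 0), curve_derive_const.
  + apply (curve_cont_line Clog (t + RtoC (INR k)) 1 (/ (t + RtoC (INR k) + RtoC s * 1))%C). apply is_Cderive_Clog, Hcut. lra.
  + apply (curve_cont_line (psi 1) (w + RtoC (INR k) * b)%C b (psi 2 (w + RtoC (INR k) * b + RtoC s * b)%C)).
    apply is_Cderive_psi. rewrite EL. specialize (Hsm (INR k + s) ltac:(lra)). lra.
- intros s Hs. unfold L. rewrite !Cexp_plus, Cexp_log_beta, Cexp_Clog by (try assumption; apply Hcut; lra).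
  fold b. rewrite <- Cexp_psi_1.
  + unfold w. ring.
  + rewrite EL. specialize (Hsm (INR k + s) ltac:(lra)). lra.
- rewrite EL. now replace (INR k + (INR K - INR k)) with (INR K) by ring.
- unfold L. rewrite EL. replace (INR k + (INR K - INR k)) with (INR K) by ring.
  replace (t + RtoC (INR k) + RtoC (INR K - INR k) * 1)%C with (t + RtoC (INR K))%C by (rewrite RtoC_minus; ring).
  rewrite polylog_chain_1_overlap; [|assumption|specialize (Hsm (INR K) ltac:(pose proof (pos_INR K); lra)); lra].
  f_equal.
  assert (Ew : (w + RtoC (INR K) * b)%C = (b * (t + RtoC (INR K)))%C) by (unfold w; ring).
  rewrite Ew. rewrite Ew in HK. unfold b. symmetry. apply Clog_beta; try assumption.
  apply off_cut_plus_pos; [assumption|apply pos_INR].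
Qed.

(** By homogeneity the chain of z log z - z at beta tau is that at tau up to the terms with log
    beta, which only occur for j = 0 and j = 1. *)
Lemma em_scaled_sum_log_chain N theta r tau : - PI / 2 < theta < PI / 2 -> 0 < r -> off_cut tau -> 0 < Re (beta_of theta r * tau)%C ->
  em_scaled_sum log_chain (beta_of theta r) N (beta_of theta r * tau)%C = (stirling_sum N tau + (tau - RtoC (/ 2)) * log_beta theta r)%C.
Proof.
intros Hth Hr Hc Hp. unfold em_scaled_sum, stirling_sum. rewrite !csum_S_l.
pose proof (beta_neq0 theta r Hr) as Hb. pose proof (off_cut_neq0 _ Hc) as Ht.
unfold log_chain at 1 2 4 5. rewrite !Clog_beta by assumption. rewrite bern_div_fact_0, bern_div_fact_1, RtoC_opp.
set (b := beta_of theta r) in *.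
rewrite (csum_ext N _ (fun k => (RtoC (bern_div_fact (S (S k))) * log_chain (S (S k)) tau)%C)).
- simpl (b ^ 0)%C. simpl (b ^ 1)%C. field. assumption.
- intros k _. f_equal. unfold log_chain. rewrite Cpow_mult_l. rewrite !(Cpow_S b). field.
  repeat split; first [assumption|now apply Cpow_neq0].
Qed.

(** The Euler-Maclaurin sum of the polylogarithms at the point where the two parts of the sum
    meet. *)
Lemma em_scaled_sum_polylog_chain N theta r tau : - PI / 2 < theta < PI / 2 -> 0 < r -> off_cut tau ->
  let b := beta_of theta r in 0 < Re (b * tau)%C -> Cmod (b * tau)%C < 1 ->
  em_scaled_sum polylog_chain b N (b * tau)%C =
   (RtoC (PI ^ 2 / 6) / b + em_scaled_sum psi b N (b * tau) + stirling_sum N tau + (tau - RtoC (/ 2)) * log_beta theta r)%C.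
Proof.
intros Hth Hr Hc b Hp H1. pose proof (em_scaled_sum_log_chain N theta r tau Hth Hr Hc Hp) as E. fold b in E.
pose proof (beta_neq0 theta r Hr) as Hb. fold b in Hb.
replace (RtoC (PI ^ 2 / 6) / b + em_scaled_sum psi b N (b * tau) + stirling_sum N tau + (tau - RtoC (/ 2)) * log_beta theta r)%C
 with (RtoC (PI ^ 2 / 6) / b + em_scaled_sum psi b N (b * tau) + (stirling_sum N tau + (tau - RtoC (/ 2)) * log_beta theta r))%C by ring.
rewrite <- E. unfold em_scaled_sum. rewrite !(csum_S_l (S N)).
rewrite polylog_chain_0_overlap by assumption. rewrite bern_div_fact_0.
rewrite (csum_ext _ (fun k => (RtoC (bern_div_fact (S k)) * (b ^ S k / b * polylog_chain (S k) (b * tau)))%C)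
  (fun k => (RtoC (bern_div_fact (S k)) * (b ^ S k / b * log_chain (S k) (b * tau)) + RtoC (bern_div_fact (S k)) * (b ^ S k / b * psi (S k) (b * tau)))%C)).
- rewrite csum_plus. simpl (b ^ 0)%C. field. assumption.
- intros k _. rewrite polylog_chain_overlap by (try lia; assumption). ring.
Qed.

Lemma sector_bound_re_pos tau : 0 < Re tau -> sector_bound (/ 2) tau.
Proof.
intros H s Hs. pose proof (Cmod_ge_0 tau) as H0. pose proof (Cmod_ge_0 (tau + RtoC s)%C) as H1.
pose proof (Cmod_sqr tau) as E0. pose proof (Cmod_sqr (tau + RtoC s)%C) as E1.
change (Re (tau + RtoC s)%C) with (Re tau + s) in E1. replace (Im (tau + RtoC s)%C) with (Im tau) in E1 by (unfold Im; simpl; ring).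
set (m := Cmod tau) in *. set (q := Cmod (tau + RtoC s)%C) in *.
assert (m * m + s * s <= q * q) by nra.
assert (Hq : (m + s) * (m + s) <= 2 * q * (2 * q)) by nra.
destruct (Rle_lt_dec (m + s) (2 * q)); [lra|nra].
Qed.

Definition uniform_main_part (theta r : R) (N : nat) (t : C) : C :=
  (- RtoC (PI ^ 2 / 6) / beta_of theta r + (RtoC (/ 2) - t) * log_beta theta r - log_Gamma t + RtoC (/ 2 * ln (2 * PI))
   - em_scaled_sum psi (beta_of theta r) N (beta_of theta r * t))%C.

(** Split the sum after K steps with 1/4 <= K |beta| <= 3/8 and collect the near part, the far
    part and Stirling's formula at t + K.  The constants are such that the first K points stay
    in the disc |z| <= 1/2 and the remaining ones satisfy Re z >= cos theta / 8. *)
Theorem log_qpoch_uniform_expansion theta N : - PI / 2 < theta < PI / 2 -> 0 < cos theta ->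
  exists C, forall r t G, 0 < r <= cos theta / 8 -> off_cut t -> Cmod (beta_of theta r * t)%C <= cos theta / 8 ->
  is_log_qpoch (beta_of theta r) G ->
  Cmod (G (beta_of theta r * t) - uniform_main_part theta r (S N) t)%C <= C * r ^ S N.
Proof.
intros Hth Hc. pose proof (COS_bound theta) as [_ Hc1].
destruct (psi_sum_estimate (S N)) as [C1 [HC1 H1]].
destruct (log_qpoch_right_half_plane (S N) (cos theta / 8) ltac:(lra)) as [C2 [HC2 H2]].
set (C3 := 2 * stirling_const (S N) (/ 2)).
exists (C1 + C2 / cos theta + C3 * 8 ^ S N).
intros r t G Hr Ht Hw HG.
set (b := beta_of theta r) in *. set (w := (b * t)%C) in *.
assert (Hr0 : 0 < r) by lra.
assert (Hmb : Cmod b = r) by now apply Cmod_beta.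
assert (Hb : b <> RtoC 0) by now apply beta_neq0.
assert (Hreb : Re b = r * cos theta) by apply Re_beta.
(* The next integer above 1 / (4 r); r <= 1/8 keeps the product with r at most 3/8. *)
assert (HK : exists K, 1 / 4 <= r * INR K <= 3 / 8).
{ exists (Z.to_nat (up (/ (4 * r)))). destruct (archimed (/ (4 * r))) as [U1 U2].
  assert (Hp : 0 < / (4 * r)) by (apply Rinv_0_lt_compat; lra).
  rewrite INR_IZR_INZ, Z2Nat.id by (apply le_IZR; lra).
  assert (Er : r * / (4 * r) = 1 / 4) by (field; lra).
  split; [|]; nra. }
destruct HK as [K [K1 K2]]. pose proof (pos_INR K) as K0.
set (zK := (w + RtoC (INR K) * b)%C). set (tau := (t + RtoC (INR K))%C).
assert (EzK : zK = (b * tau)%C) by (unfold zK, tau, w; ring).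
assert (Hsm : forall s, 0 <= s <= INR K -> Cmod (w + RtoC s * b)%C <= / 2).
{ intros s Hs. eapply Rle_trans; [apply Cmod_triangle|]. rewrite Cmod_mult, Cmod_RtoC_pos, Hmb by lra. nra. }
pose proof (re_le_Cmod w) as Hrew. apply Rabs_le_between in Hrew.
assert (HrezK : cos theta / 8 <= Re zK).
{ unfold zK. rewrite re_line, Hreb. nra. }
assert (Hcut : off_cut tau) by (apply off_cut_plus_pos; assumption).
assert (Hray : ray_in_domain b w) by (apply small_ray_in_domain; assumption).
pose proof (log_qpoch_near_split theta r t K G Hth Hc Hr0 Ht HG Hray Hsm ltac:(fold b w zK; lra)) as E1.
fold b w in E1. fold zK in E1. rewrite !csum_plus in E1.
assert (Ecst : csum K (fun _ => log_beta theta r) = (RtoC (INR K) * log_beta theta r)%C).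
{ clear. induction K; [simpl; ring|]. simpl csum. rewrite IHK, S_INR, RtoC_plus. ring. }
rewrite Ecst in E1.
pose proof (log_Gamma_shift t K Ht) as E2. fold tau in E2.
specialize (H1 b w K Hb ltac:(rewrite Hmb; lra) Hsm). fold zK in H1. rewrite Hmb in H1.
specialize (H2 b G zK ltac:(rewrite Hreb; nra) HG HrezK). rewrite Hmb, Hreb in H2.
assert (HzK1 : Cmod zK < 1) by (specialize (Hsm (INR K) ltac:(lra)); fold zK in Hsm; lra).
pose proof (em_scaled_sum_polylog_chain (S N) theta r tau Hth Hr0 Hcut) as E3. fold b in E3. cbv zeta in E3. rewrite <- EzK in E3.
specialize (E3 ltac:(lra) HzK1).
assert (Hrt : r * Cmod t <= 1 / 8).
{ replace (r * Cmod t) with (Cmod w); [lra|]. unfold w. rewrite Cmod_mult, Hmb. reflexivity. }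
assert (Htau : 1 / 8 <= r * Re tau).
{ pose proof (re_le_Cmod t) as Q. apply Rabs_le_between in Q.
  change (Re tau) with (Re t + INR K). nra. }
assert (Hretau : / (8 * r) <= Re tau).
{ apply Rmult_le_reg_l with r; [lra|]. replace (r * / (8 * r)) with (1 / 8) by (field; lra). exact Htau. }
assert (H8r : 1 <= / (8 * r)) by (rewrite <- Rinv_1; apply Rinv_le_contravar; lra).
pose proof (Cmod_pos_re tau) as Hmt.
pose proof (stirling N (/ 2) tau ltac:(lra) Hcut (sector_bound_re_pos tau ltac:(lra)) ltac:(lra)) as H3.
fold C3 in H3.
(* Stirling at tau with |tau| >= 1 / (8 r) turns the decay in tau into powers of r. *)
assert (H3' : Cmod (log_Gamma tau - RtoC (/ 2 * ln (2 * PI)) - stirling_sum (S N) tau)%C <= C3 * 8 ^ S N * r ^ S N).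
{ eapply Rle_trans; [exact H3|]. unfold Rdiv. rewrite Rmult_assoc. apply Rmult_le_compat_l.
  - unfold C3. pose proof (stirling_const_pos (S N) (/ 2) ltac:(lra)). lra.
  - rewrite <- Rpow_mult_distr. rewrite <- pow_inv. apply pow_incr. split; [left; apply Rinv_0_lt_compat; lra|].
    rewrite <- (Rinv_inv (8 * r)). apply Rinv_le_contravar; lra. }
assert (Hlog : (csum K (fun k => Clog (t + RtoC (INR k))) = log_Gamma tau - log_Gamma t)%C) by (rewrite E2; ring).
rewrite Hlog in E1.
unfold uniform_main_part. fold b. fold w.
(* The error is the sum of the near, far and Stirling errors; all other terms cancel. *)
match goal with |- Cmod ?x <= _ => replace x with
 ((csum K (fun k => psi 1 (w + RtoC (INR k) * b)) - (em_scaled_sum psi b (S N) zK - em_scaled_sum psi b (S N) w))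
  + ((G zK + em_scaled_sum polylog_chain b (S N) zK) + (log_Gamma tau - RtoC (/ 2 * ln (2 * PI)) - stirling_sum (S N) tau)))%C end.
- eapply Rle_trans; [apply Cmod_triangle|].
  replace ((C1 + C2 / cos theta + C3 * 8 ^ S N) * r ^ S N) with (C1 * r ^ S N + (C2 * r ^ S (S N) / (r * cos theta) + C3 * 8 ^ S N * r ^ S N)).
  + apply Rplus_le_compat; [exact H1|]. eapply Rle_trans; [apply Cmod_triangle|]. apply Rplus_le_compat; assumption.
  + simpl. field. split; lra.
- rewrite E1, E3. unfold tau. unfold Cdiv. ring.
Qed.

(** * Asymptotic orders and the double sum *)

Lemma pow_beta_plus theta r a b : pow_beta theta r (a + b) = (pow_beta theta r a * pow_beta theta r b)%C.
Proof. unfold pow_beta. rewrite <- Cexp_plus, RtoC_plus. f_equal. ring. Qed.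

Lemma pow_beta_0 theta r : pow_beta theta r 0 = 1.
Proof. unfold pow_beta. rewrite Cmult_0_l. apply Cexp_0. Qed.

Lemma pow_beta_1 theta r : 0 < r -> pow_beta theta r 1 = beta_of theta r.
Proof. intros H. unfold pow_beta. rewrite Cmult_1_l. now apply Cexp_log_beta. Qed.

Lemma pow_beta_pow theta r a n : (pow_beta theta r a ^ n)%C = pow_beta theta r (a * INR n).
Proof. unfold pow_beta. rewrite Cexp_pow. f_equal. rewrite RtoC_mult. ring. Qed.

Lemma pow_beta_opp theta r a : pow_beta theta r (- a) = (/ pow_beta theta r a)%C.
Proof. unfold pow_beta. rewrite <- Cexp_opp. f_equal. rewrite RtoC_opp. ring. Qed.

Lemma Cmod_pow_beta theta r a : Cmod (pow_beta theta r a) = Rpower r a.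
Proof. unfold pow_beta. rewrite Cmod_Cexp. unfold Rpower. f_equal. unfold log_beta, Re; simpl. ring. Qed.

Lemma pow_beta_neq0 theta r a : pow_beta theta r a <> RtoC 0.
Proof. apply Cexp_neq0. Qed.

Lemma beta_pow_div theta r j : 0 < r -> (beta_of theta r ^ j / beta_of theta r)%C = pow_beta theta r (INR j - 1).
Proof.
intros H. unfold Rminus. rewrite pow_beta_plus, pow_beta_opp, pow_beta_1 by assumption.
rewrite <- (Rmult_1_l (INR j)), <- pow_beta_pow, pow_beta_1 by assumption. reflexivity.
Qed.

Lemma Rpower_le_small r a b : 0 < r < 1 -> a <= b -> Rpower r b <= Rpower r a.
Proof.
intros H Hab. unfold Rpower.
assert (ln r < 0) by (rewrite <- ln_1; apply ln_increasing; lra).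
destruct (Req_dec a b) as [->|]; [lra|]. left. apply exp_increasing. nra.
Qed.

Lemma Rpower_pos r a : 0 < Rpower r a.
Proof. apply exp_pos. Qed.

Lemma bigO_intro L e (g : R -> C) d Cst : L <= e -> 0 < d ->
  (forall r, 0 < r < d -> Cmod (g r) <= Cst * Rpower r e) -> bigO_pow L g.
Proof.
intros HL Hd H. exists (Rabs Cst). exists (mkposreal (Rmin d 1) (Rmin_pos _ _ Hd Rlt_0_1)).
intros r Hr Hr0. assert (Hr1 : r < Rmin d 1).
{ unfold ball in Hr; simpl in Hr. unfold AbsRing_ball, abs, minus, plus, opp in Hr; simpl in Hr.
  rewrite Ropp_0, Rplus_0_r, Rabs_pos_eq in Hr by lra. exact Hr. }
assert (r < d) by (eapply Rlt_le_trans; [exact Hr1|apply Rmin_l]).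
assert (r < 1) by (eapply Rlt_le_trans; [exact Hr1|apply Rmin_r]).
eapply Rle_trans; [apply H; lra|]. pose proof (Rle_abs Cst). pose proof (Rabs_pos Cst).
pose proof (Rpower_pos r e). pose proof (Rpower_le_small r L e ltac:(lra) HL).
apply Rle_trans with (Rabs Cst * Rpower r e); [nra|]. apply Rmult_le_compat_l; assumption.
Qed.

Lemma bigO_plus L f g : bigO_pow L f -> bigO_pow L g -> bigO_pow L (fun r => f r + g r)%C.
Proof.
intros [K1 H1] [K2 H2]. exists (K1 + K2). generalize (filter_and _ _ H1 H2). apply filter_imp.
intros r [A B]. eapply Rle_trans; [apply Cmod_triangle|]. lra.
Qed.

Lemma bigO_ext_ev L f g d : 0 < d -> (forall r, 0 < r < d -> f r = g r) -> bigO_pow L f -> bigO_pow L g.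
Proof.
intros Hd E [K [e H]]. exists K. exists (mkposreal (Rmin d e) (Rmin_pos _ _ Hd (cond_pos e))).
intros r Hr Hr0. assert (Hr1 : r < Rmin d e).
{ unfold ball in Hr; simpl in Hr. unfold AbsRing_ball, abs, minus, plus, opp in Hr; simpl in Hr.
  rewrite Ropp_0, Rplus_0_r, Rabs_pos_eq in Hr by lra. exact Hr. }
rewrite <- E by (split; [lra|]; eapply Rlt_le_trans; [exact Hr1|apply Rmin_l]).
apply H; [|lra]. unfold ball; simpl. unfold AbsRing_ball, abs, minus, plus, opp; simpl.
rewrite Ropp_0, Rplus_0_r, Rabs_pos_eq by lra. eapply Rlt_le_trans; [exact Hr1|apply Rmin_r].
Qed.

Lemma bigO_scal L (c : C) f : bigO_pow L f -> bigO_pow L (fun r => c * f r)%C.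
Proof.
intros [K H]. exists (Cmod c * K). revert H. apply filter_imp. intros r H. rewrite Cmod_mult, Rmult_assoc.
apply Rmult_le_compat_l; [apply Cmod_ge_0|assumption].
Qed.

Lemma bigO_0 L : bigO_pow L (fun _ => RtoC 0).
Proof. exists 0. apply filter_forall. intros r. rewrite Cmod_0. lra. Qed.

Lemma bigO_csum L n (f : nat -> R -> C) : (forall j, (j < n)%nat -> bigO_pow L (f j)) -> bigO_pow L (fun r => csum n (fun j => f j r)).
Proof.
induction n; intros H; [apply bigO_0|]. simpl. apply bigO_plus; [apply IHn; intros; apply H; lia|apply H; lia].
Qed.

Lemma csum_triangle M (a : nat -> nat -> C) :
  csum M (fun j => csum (M - j) (fun i => a j i)) = csum M (fun m => csum (S m) (fun j => a j (m - j)%nat)).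
Proof.
induction M; [reflexivity|].
change (csum (S M) (fun m => csum (S m) (fun j => a j (m - j)%nat))) with
 (csum M (fun m => csum (S m) (fun j => a j (m - j)%nat)) + csum (S M) (fun j => a j (M - j)%nat))%C.
rewrite <- IHM.
change (csum (S M) (fun j => csum (S M - j) (fun i => a j i))) with
 (csum M (fun j => csum (S M - j) (fun i => a j i)) + csum (S M - M) (fun i => a M i))%C.
change (csum (S M) (fun j => a j (M - j)%nat)) with (csum M (fun j => a j (M - j)%nat) + a M (M - M)%nat)%C.
rewrite (csum_ext M (fun j => csum (S M - j) (fun i => a j i)) (fun j => csum (M - j) (fun i => a j i) + a j (M - j)%nat)%C).
- rewrite csum_plus. replace (S M - M)%nat with 1%nat by lia. rewrite Nat.sub_diag. simpl. ring.
- intros j Hj. replace (S M - j)%nat with (S (M - j)) by lia. reflexivity.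
Qed.

(** The tail of the power series, uniformly on the disc |w| <= 1/2. *)
Lemma psi_taylor j m : exists C, 0 <= C /\ forall w, Cmod w <= / 2 ->
  Cmod (psi j w - csum m (fun i => psi_coef j i * w ^ i))%C <= C * Cmod w ^ m.
Proof.
assert (HC : Rbar_lt (Cmod (RtoC (/ 2))) (Cradius (psi_coef j))).
{ apply Cradius_1_lt; [apply Cradius_psi_coef|]. rewrite Cmod_RtoC_pos; lra. }
apply CPSeries_abs, (Csummable_incr_n m) in HC. unfold Csummable in HC.
assert (HC2 : ex_series (fun n => Cmod (psi_coef j (m + n)) * (/ 2) ^ n)).
{ apply (ex_series_ext (fun n => 2 ^ m * Cmod (psi_coef j (m + n) * RtoC (/ 2) ^ (m + n))%C)).
  - intros n. rewrite Cmod_mult, Cmod_pow, Cmod_RtoC_pos, pow_add by lra.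
    assert (E : 2 ^ m * (/ 2) ^ m = 1) by (rewrite <- Rpow_mult_distr, Rinv_r, pow1 by lra; reflexivity).
    match goal with |- @eq _ ?l ?r => change (@eq R l r) end.
    transitivity (Cmod (psi_coef j (m + n)) * (/ 2) ^ n * (2 ^ m * (/ 2) ^ m)); [ring|]. rewrite E. ring.
  - exact (ex_series_scal_R (2 ^ m) _ HC). }
exists (Series (fun n => Cmod (psi_coef j (m + n)) * (/ 2) ^ n)). split.
{ apply Series_nonneg; [|exact HC2]. intros n. apply Rmult_le_pos; [apply Cmod_ge_0|apply pow_le; lra]. }
intros w Hw. pose proof (Cmod_ge_0 w) as Hw0.
assert (Hcv : Csummable (fun n => psi_coef j n * w ^ n)%C) by (apply CPSeries_abs, Cradius_1_lt; [apply Cradius_psi_coef|lra]).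
unfold psi, CPSeries. rewrite (CSeries_incr_n m _ Hcv).
match goal with |- Cmod (?a + ?b - ?a)%C <= _ => replace (a + b - a)%C with b by ring end.
rewrite Rmult_comm, <- Series_scal_l.
apply Cmod_CSeries_bound.
- intros n. rewrite Cmod_mult, Cmod_pow, pow_add.
  replace (Cmod (psi_coef j (m + n)) * (Cmod w ^ m * Cmod w ^ n)) with (Cmod w ^ m * (Cmod (psi_coef j (m + n)) * Cmod w ^ n)) by ring.
  apply Rmult_le_compat_l; [now apply pow_le|]. apply Rmult_le_compat_l; [apply Cmod_ge_0|]. apply pow_incr. lra.
- exact (ex_series_scal_R (Cmod w ^ m) _ HC2).
Qed.

(** The exponent is written as for c > 1; the form for c <= 1 is obtained by
    [double_exponent_rearranged]. *)
Definition double_term (c theta : R) (x : C) (r : R) (n k : nat) : C :=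
  (RtoC (bernoulli k * bernoulli n) * x ^ (n + 1 - k)
         / RtoC (INR (fact k) * INR n * INR (fact (n + 1 - k)))
         * pow_beta theta r (INR k - 1 + c * INR (n + 1 - k)))%C.

Definition double_sum c theta x N r : C := Csum 1 N (fun n => Csum 0 (n + 1) (double_term c theta x r n)).

Lemma bernoulli_bern_div_fact k : bernoulli k = INR (fact k) * bern_div_fact k.
Proof. reflexivity. Qed.

(** Collect the coefficients of psi_j along the diagonals i + j = n + 1; the diagonals with i +
    j <= 1 vanish because the constant terms in [psi_coef] do. *)
Lemma double_sum_psi_coef c theta x N r : 0 < r ->
  double_sum c theta x N r =
  csum (S (S N)) (fun j => RtoC (bern_div_fact j) * (beta_of theta r ^ j / beta_of theta r *
     csum (S (S N) - j) (fun i => psi_coef j i * (x * pow_beta theta r c) ^ i)))%C.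
Proof.
intros Hr.
rewrite (csum_ext _ _ (fun j => csum (S (S N) - j) (fun i => RtoC (bern_div_fact j) * (beta_of theta r ^ j / beta_of theta r *
     (psi_coef j i * (x * pow_beta theta r c) ^ i))))%C).
2: { intros j _. rewrite !csum_scal. reflexivity. }
rewrite (csum_triangle (S (S N)) (fun j i => RtoC (bern_div_fact j) * (beta_of theta r ^ j / beta_of theta r *
     (psi_coef j i * (x * pow_beta theta r c) ^ i)))%C).
rewrite (csum_S_l (S N)), (csum_S_l N).
assert (Z : forall j i, (i + j <= 1)%nat -> psi_coef j i = 0).
{ intros j i Hij. unfold psi_coef. destruct (Nat.leb_spec (i + j) 1); [reflexivity|lia]. }
unfold double_sum. rewrite Csum_csum_from. replace (S N - 1)%nat with N by lia.
rewrite (csum_zero 1) by (intros k Hk; rewrite Z by lia; ring).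
rewrite (csum_zero 2) by (intros k Hk; rewrite Z by lia; ring).
rewrite !Cplus_0_l. apply csum_ext. intros n _. rewrite Csum_csum.
replace (S (1 + n + 1)) with (S (S (S n))) by lia. apply csum_ext. intros k Hk.
unfold double_term. replace (1 + n + 1 - k)%nat with (S (S n) - k)%nat by lia.
rewrite beta_pow_div by assumption.
unfold psi_coef. replace (S (S n) - k + k)%nat with (S (S n)) by lia.
destruct (Nat.leb_spec (S (S n)) 1); [lia|].
replace (S (S n) - 1)%nat with (S n) by lia. replace (S (S n) - 2)%nat with n by lia.
replace (1 + n)%nat with (S n) by lia.
rewrite Cpow_mult_l, pow_beta_pow, pow_beta_plus.
set (i := (S (S n) - k)%nat).
rewrite !bernoulli_bern_div_fact. rewrite (fact_simpl n), mult_INR.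
pose proof (INR_fact_neq_0 k). pose proof (INR_fact_neq_0 n). pose proof (INR_fact_neq_0 i). pose proof (INR_S_pos n).
assert (E : (RtoC (INR (fact k) * bern_div_fact k * (INR (S n) * INR (fact n) * bern_div_fact (S n))) / RtoC (INR (fact k) * INR (S n) * INR (fact i)))%C
   = (RtoC (bern_div_fact k) * RtoC (bern_div_fact (S n) * INR (fact n) / INR (fact i)))%C).
{ rewrite <- RtoC_div, <- RtoC_mult.
  - f_equal. field. repeat split; try assumption; lra.
  - apply Rmult_integral_contrapositive_currified; [apply Rmult_integral_contrapositive_currified; [assumption|lra]|assumption]. }
transitivity ((RtoC (INR (fact k) * bern_div_fact k * (INR (S n) * INR (fact n) * bern_div_fact (S n))) / RtoC (INR (fact k) * INR (S n) * INR (fact i)))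
   * x ^ i * (pow_beta theta r (INR k - 1) * pow_beta theta r (c * INR i)))%C; [unfold Cdiv; ring|].
rewrite E. ring.
Qed.

Lemma Rpower_INR r n : 0 < r -> r ^ n = Rpower r (INR n).
Proof. intros H. symmetry. now apply Rpower_pow. Qed.

Lemma Rpower_small c (A d : R) : 0 < c -> 0 <= A -> 0 < d -> exists e, 0 < e /\ forall r, 0 < r < e -> A * Rpower r c <= d.
Proof.
intros Hc HA Hd. exists (exp (ln (d / (A + 1)) / c)). split; [apply exp_pos|]. intros r Hr.
assert (Hp : 0 < d / (A + 1)) by (apply Rdiv_lt_0_compat; lra).
assert (Rpower r c <= d / (A + 1)).
{ unfold Rpower. rewrite <- (exp_ln (d / (A + 1))) by assumption.
  assert (c * ln r < ln (d / (A + 1))).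
  { assert (ln r < ln (d / (A + 1)) / c) by (rewrite <- (ln_exp (_ / c)); apply ln_increasing; lra).
    apply Rmult_lt_compat_l with (r := c) in H; [|assumption]. replace (c * (ln (d / (A + 1)) / c)) with (ln (d / (A + 1))) in H by (field; lra). exact H. }
  left. now apply exp_increasing. }
pose proof (Rpower_pos r c).
apply Rle_trans with ((A + 1) * (d / (A + 1))); [nra|right; field; lra].
Qed.

Definition expansion_rhs (c theta : R) (x : C) (N : nat) (r : R) : C :=
  (- RtoC (PI ^ 2 / 6) * pow_beta theta r (-1) + (RtoC (/ 2) - x * pow_beta theta r (c - 1)) * log_beta theta r
   - log_Gamma (x * pow_beta theta r (c - 1)) + RtoC (/ 2 * ln (2 * PI)) - double_sum c theta x N r)%C.

(** Insert t = x beta^(c-1) into the uniform expansion and replace each psi_j(x beta^c) by its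
    Taylor polynomial with i + j <= N + 2.  The omitted terms have exponents j - 1 + c i >=
    min(1, c) (i + j) - 1. *)
Theorem log_qpoch_expansion c theta x LogQ N L : 0 < c -> - PI / 2 < theta < PI / 2 ->
  (forall r, 0 < r -> off_cut (x * pow_beta theta r (c - 1))%C) ->
  (forall beta : C, 0 < Re beta -> is_log_qpoch beta (LogQ beta)) ->
  L <= Rmin 1 c * INR (S (S N)) - 1 ->
  bigO_pow L (fun r => LogQ (beta_of theta r) (x * pow_beta theta r c) - expansion_rhs c theta x (S N) r)%C.
Proof.
intros Hc Hth Hcut HQ HL.
assert (Hcos : 0 < cos theta) by (apply cos_gt_0; lra).
pose proof (COS_bound theta) as [_ Hcos1].
set (mu := Rmin 1 c) in *. assert (Hmu0 : 0 < mu) by (apply Rmin_glb_lt; lra).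
assert (Hmu1 : mu <= 1) by apply Rmin_l. assert (Hmuc : mu <= c) by apply Rmin_r.
destruct (Rpower_small c (Cmod x) (cos theta / 8) Hc (Cmod_ge_0 x) ltac:(lra)) as [e [He He2]].
assert (Ew : forall r, 0 < r -> (beta_of theta r * (x * pow_beta theta r (c - 1)))%C = (x * pow_beta theta r c)%C).
{ intros r Hr. rewrite <- pow_beta_1 by assumption. replace c with (1 + (c - 1)) at 2 by ring. rewrite pow_beta_plus. ring. }
assert (Hw : forall r, 0 < r < e -> Cmod (x * pow_beta theta r c)%C <= cos theta / 8).
{ intros r Hr. rewrite Cmod_mult, Cmod_pow_beta. now apply He2. }
destruct (log_qpoch_uniform_expansion theta N Hth Hcos) as [C0 HC0].
(* The error splits into that of the uniform expansion and the Taylor remainders of the psi_j. *)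
apply (bigO_ext_ev L (fun r => (LogQ (beta_of theta r) (x * pow_beta theta r c) - uniform_main_part theta r (S N) (x * pow_beta theta r (c - 1)))
   + csum (S (S (S N))) (fun j => (- RtoC (bern_div_fact j)) * (pow_beta theta r (INR j - 1) *
       (psi j (x * pow_beta theta r c) - csum (S (S (S N)) - j) (fun i => psi_coef j i * (x * pow_beta theta r c) ^ i)))))%C _ 1 Rlt_0_1).
- intros r Hr. unfold expansion_rhs, uniform_main_part. rewrite Ew by lra. rewrite double_sum_psi_coef by lra.
  replace (-1) with (- (1)) by ring. rewrite pow_beta_opp, pow_beta_1 by lra.
  unfold em_scaled_sum.
  rewrite (csum_ext (S (S (S N))) (fun j => (- RtoC (bern_div_fact j)) * (pow_beta theta r (INR j - 1) *
       (psi j (x * pow_beta theta r c) - csum (S (S (S N)) - j) (fun i => psi_coef j i * (x * pow_beta theta r c) ^ i))))%C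
   (fun j => RtoC (bern_div_fact j) * (beta_of theta r ^ j / beta_of theta r *
     csum (S (S (S N)) - j) (fun i => psi_coef j i * (x * pow_beta theta r c) ^ i)) -
     RtoC (bern_div_fact j) * (beta_of theta r ^ j / beta_of theta r * psi j (x * pow_beta theta r c)))%C).
  + rewrite csum_minus. unfold Cdiv. ring.
  + intros j _. rewrite beta_pow_div by lra. ring.
- apply bigO_plus.
  + apply (bigO_intro L (INR (S N)) _ (Rmin e (cos theta / 8)) C0).
    * eapply Rle_trans; [exact HL|]. rewrite (S_INR (S N)). pose proof (INR_S_pos N). nra.
    * apply Rmin_glb_lt; lra.
    * intros r [Hr0 Hr]. assert (r < e) by (eapply Rlt_le_trans; [exact Hr|apply Rmin_l]).
      assert (r < cos theta / 8) by (eapply Rlt_le_trans; [exact Hr|apply Rmin_r]).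
      rewrite <- Rpower_INR by assumption.
      specialize (HC0 r (x * pow_beta theta r (c - 1))%C (LogQ (beta_of theta r))).
      rewrite Ew in HC0 by assumption. apply HC0; [lra|now apply Hcut|apply Hw; lra|].
      apply HQ. rewrite Re_beta. nra.
  + apply (bigO_csum L (S (S (S N))) (fun j r => (- RtoC (bern_div_fact j)) * (pow_beta theta r (INR j - 1) *
       (psi j (x * pow_beta theta r c) - csum (S (S (S N)) - j) (fun i => psi_coef j i * (x * pow_beta theta r c) ^ i))))%C).
    intros j Hj. apply bigO_scal.
    destruct (psi_taylor j (S (S (S N)) - j)) as [Cj [HCj HCj2]].
    apply (bigO_intro L (INR j - 1 + c * INR (S (S (S N)) - j)) _ e (Cj * Cmod x ^ (S (S (S N)) - j))); [|assumption|].
    * eapply Rle_trans; [exact HL|]. rewrite minus_INR by lia. rewrite (S_INR (S (S N))).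
      assert (INR j <= INR (S (S N)) + 0) by (rewrite Rplus_0_r; apply le_INR; lia).
      pose proof (pos_INR j). nra.
    * intros r Hr. rewrite Cmod_mult, Cmod_pow_beta, Rpower_plus.
      specialize (Hw r Hr). specialize (HCj2 (x * pow_beta theta r c)%C ltac:(lra)).
      rewrite Cmod_mult, Cmod_pow_beta, Rpow_mult_distr in HCj2.
      rewrite <- (Rpower_pow _ (Rpower r c)) in HCj2 by apply Rpower_pos. rewrite Rpower_mult in HCj2.
      pose proof (Rpower_pos r (INR j - 1)).
      replace (Cj * Cmod x ^ (S (S (S N)) - j) * (Rpower r (INR j - 1) * Rpower r (c * INR (S (S (S N)) - j)))) with
       (Rpower r (INR j - 1) * (Cj * (Cmod x ^ (S (S (S N)) - j) * Rpower r (c * INR (S (S (S N)) - j))))) by ring.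
      apply Rmult_le_compat_l; [lra|exact HCj2].
Qed.

(** * Branches of the logarithm *)

(** Rotation of a plane cut along e^(i phi) R_(<= 0) onto the plane with the standard cut. *)
Definition unrotate (phi : R) (x : C) : C := (Cexp (0%R, (- phi)%R) * x)%C.

Lemma Cexp_rot_inv phi : (Cexp (0%R, phi) * Cexp (0%R, (- phi)%R))%C = 1.
Proof.
rewrite <- Cexp_plus. replace ((0%R, phi) + (0%R, (- phi)%R))%C with (RtoC 0); [apply Cexp_0|].
apply injective_projections; simpl; ring.
Qed.

Lemma rot_unrotate phi x : (Cexp (0%R, phi) * unrotate phi x)%C = x.
Proof. unfold unrotate. rewrite Cmult_assoc, Cexp_rot_inv. ring. Qed.

Lemma slit_plane_off_cut phi x : slit_plane phi x <-> off_cut (unrotate phi x).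
Proof.
split.
- intros H. apply off_cut_iff. destruct (Req_dec (Im (unrotate phi x)) 0) as [E|E]; [|now left]. right.
  destruct (Rlt_le_dec 0 (Re (unrotate phi x))) as [L|L]; [assumption|exfalso]. apply H.
  exists (Re (unrotate phi x)). split; [exact L|].
  rewrite <- (rot_unrotate phi x) at 1. f_equal. apply injective_projections; [reflexivity|exact E].
- intros H [s [Hs E]]. assert (E2 : unrotate phi x = RtoC s).
  { unfold unrotate. rewrite E, Cmult_assoc, (Cmult_comm (Cexp (0%R, (- phi)%R))), Cexp_rot_inv. ring. }
  rewrite E2 in H. apply off_cut_iff in H. simpl in H. lra.
Qed.

(** The domain of the principal logarithm is star-shaped with respect to 1, so segments to 1
    serve as paths. *)
Lemma off_cut_star xi s : off_cut xi -> 0 <= s <= 1 -> off_cut (xi + RtoC s * (1 - xi))%C.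
Proof.
intros H Hs. apply off_cut_iff. apply off_cut_iff in H. destruct xi as [a b]. unfold Re, Im in *; simpl in *.
destruct (Req_dec s 1) as [->|Hn]; [right; lra|].
destruct H as [H|H]; [left; nra|right; nra].
Qed.

(** Any branch and the rotated principal logarithm differ by a constant, computed at the tip
    e^(i phi). *)
Lemma log_branch_segment phi l x : is_log_branch phi l -> slit_plane phi x ->
  (l x - Clog (unrotate phi x))%C = l (Cexp (0%R, phi)).
Proof.
intros [Han [Hexp _]] Hx. apply slit_plane_off_cut in Hx. set (xi := unrotate phi x) in *.
set (e := Cexp (0%R, phi)).
assert (P : forall s, 0 <= s <= 1 -> slit_plane phi (e * xi + RtoC s * (e * (1 - xi)))%C).
{ intros s Hs. apply slit_plane_off_cut. unfold unrotate.
  replace (Cexp (0%R, (- phi)%R) * (e * xi + RtoC s * (e * (1 - xi))))%C with ((e * Cexp (0%R, (- phi)%R)) * (xi + RtoC s * (1 - xi)))%C by ring.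
  unfold e. rewrite Cexp_rot_inv, Cmult_1_l. now apply off_cut_star. }
(* The segment from xi to 1, rotated, runs from x to the tip inside the cut plane. *)
pose proof (log_path_const (fun s => l (e * xi + RtoC s * (e * (1 - xi))) - Clog (xi + RtoC s * (1 - xi)) - (0%R, phi))%C 0 1) as K.
cbv beta in K.
replace (e * xi + RtoC 1 * (e * (1 - xi)))%C with e in K by ring.
replace (xi + RtoC 1 * (1 - xi))%C with (RtoC 1) in K by ring.
replace (e * xi + RtoC 0 * (e * (1 - xi)))%C with (e * xi)%C in K by ring.
replace (xi + RtoC 0 * (1 - xi))%C with xi in K by ring.
assert (Ex : (e * xi)%C = x) by (unfold e, xi; apply rot_unrotate).
rewrite Ex, Clog_RtoC, ln_1 in K by lra. rewrite Ex in P.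
replace (l x - Clog xi)%C with ((l x - Clog xi - (0%R, phi)) + (0%R, phi))%C by ring.
rewrite <- K; [unfold e; ring|lra| |].
- intros s Hs. apply curve_cont_minus; [apply curve_cont_minus|].
  + apply (analytic_curve_cont (slit_plane phi)); [exact Han|now apply P].
  + apply (curve_cont_line Clog xi (1 - xi) (/ (xi + RtoC s * (1 - xi)))%C). apply is_Cderive_Clog. now apply off_cut_star.
  + apply (curve_derive_curve_cont _ s 0). apply curve_derive_const.
- intros s Hs. rewrite !Cexp_minus, Hexp, Cexp_Clog by (try apply P; try apply off_cut_star; assumption).
  fold e. pose proof (off_cut_neq0 _ (off_cut_star _ _ Hx Hs)). pose proof (Cexp_neq0 (0%R, phi)). fold e in H0.
  replace (x + RtoC s * (e * (1 - xi)))%C with (e * (xi + RtoC s * (1 - xi)))%C by (rewrite <- Ex; ring).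
  field. split; assumption.
Qed.

(** For |phi| < PI the branch is normalised on the positive half-line and has to be continued
    from 1 to the tip; for |phi| >= PI the value at the tip is the normalisation itself. *)
Lemma log_branch_tip phi l : is_log_branch phi l -> l (Cexp (0%R, phi)) = (0%R, phi).
Proof.
intros Hl. destruct (Rlt_le_dec (Rabs phi) PI) as [H|H]; [|now apply Hl].
assert (E : unrotate phi 1 = Cexp (0%R, (- phi)%R)) by (unfold unrotate; ring).
assert (HI : - PI < - phi < PI) by (apply Rabs_def2 in H; lra).
assert (Hcut : off_cut (Cexp (0%R, (- phi)%R))).
{ apply off_cut_iff. unfold Cexp, Re, Im; simpl. rewrite exp_0, !Rmult_1_l.
  destruct (Req_dec (sin (- phi)) 0) as [S|S]; [right|now left].
  apply sin_eq_0_0 in S. destruct S as [k Hk].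
  assert (Hk0 : (k = 0)%Z).
  { apply IZR_abs_lt_1. pose proof PI_RGT_0. split; apply Rmult_lt_reg_r with PI; lra. }
  rewrite Hk, Hk0, Rmult_0_l, cos_0. lra. }
assert (H1 : slit_plane phi 1) by (apply slit_plane_off_cut; rewrite E; exact Hcut).
pose proof (log_branch_segment phi l 1 Hl H1) as K. rewrite E in K.
assert (EC : Clog (Cexp (0%R, (- phi)%R)) = (0%R, (- phi)%R)) by (symmetry; apply Clog_unique; [exact Hcut|reflexivity|exact HI]).
rewrite EC in K.
assert (L1 : l 1 = 0).
{ destruct Hl as [_ [Hexp [Him _]]]. specialize (Hexp 1 H1). specialize (Him H 1 Rlt_0_1).
  apply Cexp_eq_1 in Hexp. apply injective_projections; [apply Hexp|exact Him]. }
rewrite <- K, L1. apply injective_projections; simpl; ring.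
Qed.

Lemma log_branch_eq phi l x : is_log_branch phi l -> slit_plane phi x -> l x = (Clog (unrotate phi x) + (0%R, phi))%C.
Proof.
intros Hl Hx. pose proof (log_branch_segment phi l x Hl Hx) as K. rewrite (log_branch_tip phi l Hl) in K.
rewrite <- K. ring.
Qed.

(** The direction of x beta^(c-1) does not depend on |beta|, and the rotation by arg
    (beta^(c-1)) is the one that moves the cut of the statement to the standard position. *)
Lemma pow_beta_unrotate c theta r x : 0 < r ->
  (x * pow_beta theta r (c - 1))%C = (RtoC (Rpower r (c - 1)) * unrotate ((1 - c) * theta) x)%C.
Proof.
intros Hr. unfold unrotate, pow_beta, Rpower. rewrite <- Cexp_RtoC.
replace (RtoC (c - 1) * log_beta theta r)%C with (RtoC ((c - 1) * ln r) + (0%R, (- ((1 - c) * theta))%R))%C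
  by (apply injective_projections; unfold log_beta; simpl; ring).
rewrite Cexp_plus. ring.
Qed.

Lemma off_cut_scaled_point c theta x r : 0 < r -> slit_plane ((1 - c) * theta) x -> off_cut (x * pow_beta theta r (c - 1))%C.
Proof.
intros Hr Hx. rewrite pow_beta_unrotate by assumption. apply off_cut_scal; [apply Rpower_pos|]. now apply slit_plane_off_cut.
Qed.

(** This is the place where the branch of log x in the statement matters: the principal
    logarithm of x beta^(c-1) is log x + (c - 1) log beta. *)
Lemma Clog_scaled_point c theta x r l : 0 < r -> is_log_branch ((1 - c) * theta) l -> slit_plane ((1 - c) * theta) x ->
  Clog (x * pow_beta theta r (c - 1))%C = (l x + RtoC (c - 1) * log_beta theta r)%C.
Proof.
intros Hr Hl Hx. rewrite pow_beta_unrotate by assumption.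
rewrite Clog_scal by (try apply Rpower_pos; now apply slit_plane_off_cut).
rewrite (log_branch_eq _ l x Hl Hx).
assert (E : ln (Rpower r (c - 1)) = (c - 1) * ln r) by (unfold Rpower; apply ln_exp).
rewrite E. set (q := Clog _). apply injective_projections; unfold log_beta; simpl; ring.
Qed.

Lemma CV_radius_bern_div_fact : Rbar_le 1 (CV_radius bern_div_fact).
Proof. apply CV_radius_ge_1. apply bern_div_fact_bound. Qed.

Lemma PSeries_bern_div_fact x : x <> 0 -> Rabs x < 1 -> PSeries bern_div_fact x = x / (exp x - 1).
Proof.
intros H0 H1. pose proof (bernoulli_generating x H0 H1) as G.
apply (is_series_scal (K := R_AbsRing) (V := R_NormedModule) x) in G.
unfold PSeries. apply is_series_unique.
replace (x / (exp x - 1)) with (scal x (/ (exp x - 1))) by reflexivity.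
revert G. apply is_series_ext. intros n. rewrite bern_div_fact_bernoulli. unfold scal; simpl; unfold mult; simpl.
unfold Z.sub. rewrite powerRZ_add by assumption. rewrite <- pow_powerRZ. simpl. field. split; [apply INR_fact_neq_0|assumption].
Qed.

(** The function x / (e^x - 1) + x / 2 is even; equivalently, replacing x by -x in x / (e^x - 1)
    adds x. *)
Lemma bern_div_fact_odd k : bern_div_fact (2 * k + 3) = 0.
Proof.
(* Coefficients of x |-> f(-x) and of x |-> f(x) + x for f(x) = x / (e^x - 1). *)
set (a := fun n => (-1) ^ n * bern_div_fact n). set (d := fun n => bern_div_fact n + (if (n =? 1)%nat then 1 else 0)).
assert (Ra : Rbar_le 1 (CV_radius a)).
{ apply CV_radius_ge_1. intros n. unfold a. rewrite Rabs_mult, pow_1_abs, Rmult_1_l. apply bern_div_fact_bound. }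
assert (Rd1 : CV_radius (fun n => if (n =? 1)%nat then 1 else 0) = p_infty).
{ rewrite <- CV_radius_derive. rewrite <- CV_radius_derive.
  rewrite (CV_radius_ext _ (fun _ => 0)); [apply CV_radius_const_0|].
  intros n. unfold PS_derive. simpl. ring. }
assert (Rd : Rbar_le 1 (CV_radius d)).
{ eapply Rbar_le_trans; [|exact (CV_radius_plus bern_div_fact (fun n => if (n =? 1)%nat then 1 else 0))]. rewrite Rd1.
  assert (H : Rbar_min (CV_radius bern_div_fact) p_infty = CV_radius bern_div_fact).
  { unfold Rbar_min. destruct (CV_radius bern_div_fact); simpl; try reflexivity. }
  rewrite H. apply CV_radius_bern_div_fact. }
assert (E : a (2 * k + 3)%nat = d (2 * k + 3)%nat).
{ apply PSeries_ext_recip.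
  - eapply Rbar_lt_le_trans; [|exact Ra]. simpl; lra.
  - eapply Rbar_lt_le_trans; [|exact Rd]. simpl; lra.
  - exists (mkposreal (/ 2) ltac:(lra)). intros x Hx. unfold ball in Hx; simpl in Hx.
    unfold AbsRing_ball, abs, minus, plus, opp in Hx; simpl in Hx. rewrite Ropp_0, Rplus_0_r in Hx.
    assert (Ea : PSeries a x = PSeries bern_div_fact (- x)).
    { unfold PSeries. apply Series_ext. intros n. unfold a. replace (- x) with (-1 * x) by ring. rewrite Rpow_mult_distr. ring. }
    assert (Ed : PSeries d x = PSeries bern_div_fact x + x).
    { unfold d. rewrite (PSeries_ext _ (PS_plus bern_div_fact (fun n => if (n =? 1)%nat then 1 else 0))) by reflexivity.
      rewrite PSeries_plus.
      - f_equal. rewrite (PSeries_ext _ (PS_incr_1 (PS_scal 1 (fun n => if (n =? 0)%nat then 1 else 0)))).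
        + rewrite PSeries_incr_1, PSeries_scal. unfold PSeries.
          rewrite (Series_ext _ (fun n => if (n =? 0)%nat then 1 else 0)).
          * rewrite (is_series_unique _ 1); [ring|].
            apply filterlim_ext with (fun _ => 1); [|apply filterlim_const].
            intros n. induction n; [now rewrite sum_O|]. rewrite sum_Sn, <- IHn. unfold plus; simpl; ring.
          * intros [|n]; simpl; ring.
        + intros [|[|n]]; unfold PS_incr_1, PS_scal, scal; simpl; unfold mult; simpl; try reflexivity; try ring.
      - apply CV_radius_inside. eapply Rbar_lt_le_trans; [|exact CV_radius_bern_div_fact]. simpl; lra.
      - apply CV_radius_inside.
        match goal with |- Rbar_lt _ (CV_radius ?f) => replace (CV_radius f) with p_infty by (symmetry; exact Rd1) end. exact I. }
    rewrite Ea, Ed. destruct (Req_dec x 0) as [->|Hx0].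
    + rewrite Ropp_0. ring.
    + rewrite !PSeries_bern_div_fact by (try rewrite Rabs_Ropp; try lra).
      rewrite exp_Ropp. pose proof (exp_pos x).
      assert (exp x <> 1) by (intros Z; apply Hx0; rewrite <- exp_0 in Z; now apply exp_inv in Z).
      field. repeat split; lra. }
unfold a, d in E. replace (2 * k + 3 =? 1)%nat with false in E by (symmetry; apply Nat.eqb_neq; lia).
assert (Es : (-1) ^ (2 * k + 3) = -1).
{ rewrite pow_add, pow_mult. replace ((-1) ^ 2) with 1 by ring. rewrite pow1. ring. }
rewrite Es in E. lra.
Qed.

(** The optimal constant is the cosine of half the argument of [xi], by the half-angle
    formula. *)
Lemma sector_bound_off_cut xi : off_cut xi -> exists kap, 0 < kap /\ forall rho, 0 < rho -> sector_bound kap (RtoC rho * xi)%C.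
Proof.
intros H. pose proof (proj1 (Cmod_gt_0 _) (off_cut_neq0 _ H)) as Hm. unfold off_cut in H.
set (m := Cmod xi) in *. set (a := Re xi) in *.
exists (sqrt ((m + a) / (2 * m))). assert (Hp : 0 < (m + a) / (2 * m)) by (apply Rdiv_lt_0_compat; lra).
split; [now apply sqrt_lt_R0|]. intros rho Hr s Hs.
rewrite Cmod_mult, Cmod_RtoC_pos by lra. fold m.
pose proof (Cmod_sqr xi) as E0. pose proof (Cmod_sqr (RtoC rho * xi + RtoC s)%C) as E1.
replace (Re (RtoC rho * xi + RtoC s)%C) with (rho * a + s) in E1 by (unfold a, Re; simpl; ring).
replace (Im (RtoC rho * xi + RtoC s)%C) with (rho * Im xi) in E1 by (unfold Im; simpl; ring).
fold m in E0. fold a in E0. set (q := Cmod (RtoC rho * xi + RtoC s)%C) in *.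
assert (Hq : 0 <= q) by apply Cmod_ge_0.
apply Rsqr_incr_0_var; [|exact Hq]. unfold Rsqr.
replace (sqrt ((m + a) / (2 * m)) * (rho * m + s) * (sqrt ((m + a) / (2 * m)) * (rho * m + s))) with
 (sqrt ((m + a) / (2 * m)) * sqrt ((m + a) / (2 * m)) * ((rho * m + s) * (rho * m + s))) by ring.
rewrite sqrt_sqrt by lra. rewrite E1.
assert (a <= m) by (unfold a, m; apply Cmod_pos_re).
apply Rmult_le_reg_r with (2 * m); [lra|].
replace ((m + a) / (2 * m) * ((rho * m + s) * (rho * m + s)) * (2 * m)) with ((m + a) * ((rho * m + s) * (rho * m + s))) by (field; lra).
assert (Ei : rho * Im xi * (rho * Im xi) = rho * rho * (m * m - a * a)) by (rewrite E0; ring). rewrite Ei.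
assert (0 <= (m - a) * ((rho * m - s) * (rho * m - s))) by (apply Rmult_le_pos; [lra|apply Rle_0_sqr]).
(* The difference of the two sides is (m - a) (rho m - s)^2. *)
match goal with |- ?l <= ?r => replace r with (l + (m - a) * ((rho * m - s) * (rho * m - s))) by ring end. lra.
Qed.

(** The factor (n+1)^t in the partial products may be replaced by n^t. *)
Lemma log_Gamma_exp_is_Gamma t : off_cut t -> is_Gamma t (Cexp (log_Gamma t)).
Proof.
intros Ht. apply filterlim_Clim.
set (u := fun n => (t * RtoC (ln (INR n)) - t * RtoC (ln (INR (S n))) + log_Gamma_partial n t)%C).
assert (Hu : Clim u (0 + log_Gamma t)%C).
{ apply Clim_plus; [|now apply log_Gamma_lim].
  intros e He. destruct (Clim_mult_bounded_0 (- t)%C (fun n => RtoC (ln (INR (S (S n)) / INR (S n))))) with (eps := e) as [N HN]; [|exact He|].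
  - apply (Clim_0_le _ (fun n => 3 * / INR (S n))).
    + intros n. rewrite Cmod_R. pose proof (ln_step_bound n) as B. pose proof (INR_S_pos n).
      assert (Hi : 0 < / INR (S n)) by now apply Rinv_0_lt_compat.
      assert (Hi1 : / INR (S n) <= 1) by (rewrite <- Rinv_1; apply Rinv_le_contravar; [lra|apply (le_INR 1); lia]).
      set (q := / INR (S n)) in *. set (l := ln _) in *.
      replace l with ((l - q) + q) by ring. eapply Rle_trans; [apply Rabs_triang|]. rewrite (Rabs_pos_eq q) by lra. simpl in B. nra.
    + replace (Finite 0) with (Finite (3 * 0)) by (f_equal; ring). apply is_lim_seq_mult'; [apply is_lim_seq_const|apply is_lim_seq_inv_S].
  - exists (S N). intros n Hn. destruct n; [lia|]. specialize (HN n ltac:(lia)).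
    rewrite ln_div in HN by apply INR_S_pos. rewrite RtoC_minus in HN.
    eapply Rle_lt_trans; [|exact HN]. right. f_equal. ring. }
rewrite Cplus_0_l in Hu.
apply (Clim_eventually (fun n => Cexp (u n)) _ _ 1).
- intros n Hn. unfold u, log_Gamma_partial.
  replace (t * RtoC (ln (INR n)) - t * RtoC (ln (INR (S n))) + (t * RtoC (ln (INR (S n))) + RtoC (ln (INR (fact n))) - csum (S n) (fun k => Clog (t + RtoC (INR k)))))%C
   with (t * RtoC (ln (INR n)) + RtoC (ln (INR (fact n))) - csum (S n) (fun k => Clog (t + RtoC (INR k))))%C by ring.
  rewrite Cexp_minus, Cexp_plus, Cexp_RtoC, exp_ln by apply INR_fact_lt_0.
  assert (E : forall m, Cexp (csum m (fun k => Clog (t + RtoC (INR k)))) = rising t m).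
  { induction m; [apply Cexp_0|]. simpl csum. rewrite Cexp_plus, IHm, Cexp_Clog; [reflexivity|]. apply off_cut_plus_pos; [assumption|apply pos_INR]. }
  rewrite E. unfold Cdiv. ring.
- intros e He.
  destruct (is_Cderive_cont Cexp (log_Gamma t) _ (is_Cderive_Cexp (log_Gamma t)) e He) as [d [Hd K]].
  destruct (Hu d Hd) as [N HN]. exists N. intros n Hn. specialize (K (u n - log_Gamma t)%C (HN n Hn)).
  now rewrite Cminus_plus_l in K.
Qed.

Lemma is_Cderive_mean_value_line (f g : C -> C) a b B :
  (forall s, 0 <= s <= 1 -> is_Cderive f (a + RtoC s * (b - a))%C (g (a + RtoC s * (b - a))%C)) ->
  (forall s, 0 <= s <= 1 -> Cmod (g (a + RtoC s * (b - a))%C) <= B) ->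
  Cmod (f b - f a)%C <= B * Cmod (b - a)%C.
Proof.
intros Hd HB.
pose proof (curve_derive_mean_value (fun s => f (a + RtoC s * (b - a))%C) (fun s => g (a + RtoC s * (b - a)) * (b - a))%C 0 1 (B * Cmod (b - a)%C) ltac:(lra)) as M.
cbv beta in M. replace (a + RtoC 1 * (b - a))%C with b in M by ring. replace (a + RtoC 0 * (b - a))%C with a in M by ring.
rewrite Rminus_0_r, Rmult_1_r in M. apply M.
- intros s Hs. apply (curve_derive_line f a (b - a)%C). now apply Hd.
- intros s Hs. rewrite Cmod_mult. apply Rmult_le_compat_r; [apply Cmod_ge_0|now apply HB].
Qed.

(** * The cases c < 1 and c = 1 *)

(** The derivative log (1 + 1/k) - (1/k) / (1 + t/k) is O(1/k^2) for bounded [t]. *)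
Lemma log_Gamma_term_lipschitz k M a b : Cmod a <= M -> Cmod b <= M -> 2 * M <= INR (S k) ->
  Cmod (log_Gamma_term b k - log_Gamma_term a k)%C <= (2 + 2 * M) * / INR (S k) ^ 2 * Cmod (b - a)%C.
Proof.
intros Ha Hb Hk. pose proof (INR_S_pos k) as Hp. set (i := / INR (S k)).
assert (Hi : 0 < i) by now apply Rinv_0_lt_compat.
assert (HiM : M * i <= / 2).
{ apply Rmult_le_reg_r with (INR (S k)); [assumption|]. unfold i. rewrite Rmult_assoc, Rinv_l; lra. }
set (l := ln (INR (S (S k)) / INR (S k))).
assert (Hl : Rabs (l - i) <= 2 * i ^ 2) by apply ln_step_bound.
replace ((2 + 2 * M) * / INR (S k) ^ 2) with ((2 + 2 * M) * i ^ 2) by (unfold i; rewrite pow_inv; reflexivity).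
assert (Hseg : forall s, 0 <= s <= 1 -> Cmod ((a + RtoC s * (b - a)) * RtoC i)%C <= M * i).
{ intros s Hs. rewrite Cmod_mult, (Cmod_RtoC_pos i) by lra. apply Rmult_le_compat_r; [lra|].
  replace (a + RtoC s * (b - a))%C with (RtoC (1 - s) * a + RtoC s * b)%C by (rewrite RtoC_minus; ring).
  eapply Rle_trans; [apply Cmod_triangle|]. rewrite !Cmod_mult, !Cmod_RtoC_pos by lra. nra. }
apply (is_Cderive_mean_value_line (fun t => log_Gamma_term t k) (fun t => RtoC l - / (1 + t * RtoC i) * RtoC i)%C a b).
- intros s Hs. specialize (Hseg s Hs). unfold log_Gamma_term. fold l. fold i. set (y := (a + RtoC s * (b - a))%C) in *.
  apply (is_Cderive_minus (fun t => t * RtoC l)%C (fun t => Clog (1 + t * RtoC i))%C).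
  + apply (is_Cderive_ext (fun t => 0 + RtoC l * t)%C); [intros; ring|]. apply is_Cderive_affine.
  + rewrite Cmult_comm. apply (is_Cderive_comp Clog (fun t => 1 + t * RtoC i)%C).
    * apply is_Cderive_Clog, off_cut_1_plus. lra.
    * apply (is_Cderive_ext (fun t => 1 + RtoC i * t)%C); [intros; ring|]. apply is_Cderive_affine.
- intros s Hs. specialize (Hseg s Hs). set (u := ((a + RtoC s * (b - a)) * RtoC i)%C) in *.
  assert (H2 : / 2 <= Cmod (1 + u)%C).
  { pose proof (Cmod_triangle_rev 1 (- u)%C) as T. rewrite Cmod_1, Cmod_opp in T.
    replace (1 - - u)%C with (1 + u)%C in T by ring. lra. }
  assert (Hn : (1 + u)%C <> RtoC 0) by (apply Cmod_gt_0; lra).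
  replace (RtoC l - / (1 + u) * RtoC i)%C with (RtoC (l - i) + RtoC i * (u / (1 + u)))%C by (rewrite RtoC_minus; field; assumption).
  eapply Rle_trans; [apply Cmod_triangle|]. rewrite Cmod_R, Cmod_mult, Cmod_RtoC_pos, Cmod_div by (try assumption; lra).
  assert (Hinv : / Cmod (1 + u)%C <= 2) by (rewrite <- (Rinv_inv 2); apply Rinv_le_contravar; lra).
  assert (0 < / Cmod (1 + u)%C) by (apply Rinv_0_lt_compat; lra).
  pose proof (Cmod_ge_0 u). unfold Rdiv.
  assert (Cmod u * / Cmod (1 + u)%C <= M * i * 2) by (apply Rmult_le_compat; lra).
  simpl in *. nra.
Qed.

(** Finitely many terms are differentiable, and the others form a series with summable Lipschitz
    constants. *)
Lemma log_Gamma_continuous_line w d s : (forall u, 0 <= u <= 1 -> off_cut (w + RtoC u * d)%C) -> 0 <= s <= 1 ->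
  curve_cont (fun u => log_Gamma (w + RtoC u * d)%C) s.
Proof.
intros Hcut Hs.
set (M := Cmod w + 2 * Cmod d). pose proof (Cmod_ge_0 w) as Hw0. pose proof (Cmod_ge_0 d) as Hd0.
destruct (exists_INR_ge (2 * M)) as [n Hn].
assert (HM : forall u, -1 <= u <= 2 -> Cmod (w + RtoC u * d)%C <= M).
{ intros u Hu. eapply Rle_trans; [apply Cmod_triangle|]. rewrite Cmod_mult, Cmod_R. unfold M.
  assert (Rabs u <= 2) by (apply Rabs_le; lra). nra. }
apply (curve_cont_ext (fun u => (csum n (log_Gamma_term (w + RtoC u * d)) - Clog (w + RtoC u * d)) + CSeries (fun k => log_Gamma_term (w + RtoC u * d) (n + k)%nat))%C).
{ intros u. unfold log_Gamma. rewrite (CSeries_incr_n n (log_Gamma_term (w + RtoC u * d)) (log_Gamma_term_conv _)). ring. }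
apply curve_cont_plus; [apply curve_cont_minus|].
- clear Hn. induction n.
  + simpl. apply (curve_derive_curve_cont _ s 0), curve_derive_const.
  + simpl csum. apply (curve_cont_plus (fun u => csum n (log_Gamma_term (w + RtoC u * d))) (fun u => log_Gamma_term (w + RtoC u * d) n)); [exact IHn|].
    set (l := RtoC (ln (INR (S (S n)) / INR (S n)))). set (i := RtoC (/ INR (S n))).
    assert (Hc1 : off_cut (1 + (w + RtoC s * d) * i)%C).
    { replace (1 + (w + RtoC s * d) * i)%C with (RtoC (/ INR (S n)) * (w + RtoC s * d + RtoC (INR (S n))))%C.
      - pose proof (INR_S_pos n). apply off_cut_scal; [now apply Rinv_0_lt_compat|]. apply off_cut_plus_pos; [now apply Hcut|lra].
      - unfold i. pose proof (INR_S_pos n). rewrite RtoC_inv by lra. field. apply RtoC_neq0. lra. }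
    apply (curve_cont_line (fun t => log_Gamma_term t n) w d (l - / (1 + (w + RtoC s * d) * i) * i)%C).
    unfold log_Gamma_term. fold l. fold i.
    apply (is_Cderive_minus (fun t => t * l)%C (fun t => Clog (1 + t * i))%C).
    * apply (is_Cderive_ext (fun t => 0 + l * t)%C); [intros; ring|]. apply is_Cderive_affine.
    * rewrite (Cmult_comm (/ (1 + (w + RtoC s * d) * i))%C). apply (is_Cderive_comp Clog (fun t => 1 + t * i)%C).
      -- now apply is_Cderive_Clog.
      -- apply (is_Cderive_ext (fun t => 1 + i * t)%C); [intros; ring|]. apply is_Cderive_affine.
- apply (curve_cont_line Clog w d (/ (w + RtoC s * d))%C). apply is_Cderive_Clog. now apply Hcut.
- set (B := fun k => (2 + 2 * M) * / INR (S (n + k)) ^ 2).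
  assert (HB : ex_series B).
  { apply (ex_series_scal_R (2 + 2 * M)).
    apply (ex_series_shift (fun k => / INR (S k) ^ 2) n), ex_series_inv_sqr. }
  assert (HBp : 0 <= Series B).
  { apply Series_nonneg; [|exact HB]. intros k. unfold B, M. apply Rmult_le_pos; [lra|]. left; apply Rinv_0_lt_compat, pow_lt, INR_S_pos. }
  apply curve_cont_eps. intros e He.
  exists (Rmin 1 (e / ((Series B + 1) * (Cmod d + 1)))).
  assert (Hden : 0 < (Series B + 1) * (Cmod d + 1)) by (apply Rmult_lt_0_compat; lra).
  split; [apply Rmin_glb_lt; [lra|now apply Rdiv_lt_0_compat]|]. intros h Hh.
  assert (h1 : Rabs h < 1) by (eapply Rlt_le_trans; [exact Hh|apply Rmin_l]).
  assert (h2 : Rabs h < e / ((Series B + 1) * (Cmod d + 1))) by (eapply Rlt_le_trans; [exact Hh|apply Rmin_r]).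
  apply Rabs_def2 in h1.
  rewrite <- CSeries_minus by (apply (Csummable_incr_n n (log_Gamma_term _)), log_Gamma_term_conv).
  pose proof (Rabs_pos h).
  apply Rle_lt_trans with (Series (fun k => Rabs h * Cmod d * B k)).
  + apply Cmod_CSeries_bound.
    * intros k. eapply Rle_trans; [apply (log_Gamma_term_lipschitz (n + k) M); [apply HM; lra|apply HM; lra|]|].
      -- eapply Rle_trans; [exact Hn|]. apply le_INR; lia.
      -- right. replace (w + RtoC (s + h) * d - (w + RtoC s * d))%C with (RtoC h * d)%C by (rewrite RtoC_plus; ring).
         rewrite Cmod_mult, Cmod_R. unfold B. ring.
    * exact (ex_series_scal_R _ _ HB).
  + rewrite Series_scal_l.
    apply Rle_lt_trans with (Rabs h * ((Series B + 1) * (Cmod d + 1))); [|].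
    * rewrite Rmult_assoc. apply Rmult_le_compat_l; [assumption|]. nra.
    * apply Rmult_lt_compat_r with (r := (Series B + 1) * (Cmod d + 1)) in h2; [|assumption].
      unfold Rdiv in h2. rewrite Rmult_assoc, Rinv_l in h2; lra.
Qed.

Lemma log_Gamma_1_real : Im (log_Gamma 1) = 0.
Proof.
unfold log_Gamma. rewrite Clog_RtoC, ln_1 by lra.
assert (E : forall k, Im (log_Gamma_term 1 k) = 0).
{ intros k. unfold log_Gamma_term. pose proof (INR_S_pos k). assert (0 < / INR (S k)) by now apply Rinv_0_lt_compat.
  replace (1 + 1 * RtoC (/ INR (S k)))%C with (RtoC (1 + / INR (S k))) by (rewrite RtoC_plus; ring).
  rewrite Clog_RtoC by lra. unfold Im; simpl; ring. }
unfold Im, CSeries; simpl. rewrite (Series_ext _ (fun _ => 0)) by exact E.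
rewrite (is_series_unique _ _ is_series_zero). ring.
Qed.

(** Both functions are continuous logarithms of Gamma on a star-shaped domain and are real at
    1. *)
Lemma logGamma_eq l x : is_log_Gamma_branch 0 l -> slit_plane 0 x -> l x = log_Gamma x.
Proof.
intros [Han [Hexp Hre]] Hx.
assert (Hsc : forall y, slit_plane 0 y <-> off_cut y).
{ intros y. rewrite slit_plane_off_cut. unfold unrotate. rewrite Ropp_0. change (0%R, 0%R) with (RtoC 0). rewrite Cexp_0, Cmult_1_l. reflexivity. }
apply Hsc in Hx.
assert (HE : forall y, off_cut y -> Cexp (l y - log_Gamma y)%C = 1).
{ intros y Hy. rewrite Cexp_minus.
  pose proof (Hexp y (proj2 (Hsc y) Hy)) as G1. pose proof (log_Gamma_exp_is_Gamma y Hy) as G2.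
  apply filterlim_Clim in G1. apply filterlim_Clim in G2. rewrite (Clim_unique _ _ _ G1 G2). field. apply Cexp_neq0. }
pose proof (log_path_const (fun s => l (x + RtoC s * (1 - x)) - log_Gamma (x + RtoC s * (1 - x)))%C 0 1 ltac:(lra)) as K.
cbv beta in K. replace (x + RtoC 1 * (1 - x))%C with (RtoC 1) in K by ring. replace (x + RtoC 0 * (1 - x))%C with x in K by ring.
assert (K1 : (l 1 - log_Gamma 1)%C = 0).
{ pose proof (Cexp_eq_1 _ (HE 1 off_cut_1)) as [E1 _]. apply injective_projections; [exact E1|].
  pose proof (Hre 1 Rlt_0_1). pose proof log_Gamma_1_real. change ((Im (l 1) + - Im (log_Gamma 1))%R = 0). lra. }
rewrite K1 in K. apply Ceq_minus. symmetry. apply K.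
- intros s Hs. apply curve_cont_minus.
  + apply (analytic_curve_cont (slit_plane 0)); [exact Han|]. apply Hsc. now apply off_cut_star.
  + apply log_Gamma_continuous_line; [|assumption]. intros u Hu. now apply off_cut_star.
- intros s Hs. apply HE. now apply off_cut_star.
Qed.

Lemma double_sum_exponent_large c L : 0 < c -> exists n0, forall N, (n0 <= N)%nat -> L <= Rmin 1 c * INR (S N) - 1.
Proof.
intros Hc. assert (Hmu : 0 < Rmin 1 c) by (apply Rmin_glb_lt; lra).
destruct (exists_INR_ge ((L + 1) / Rmin 1 c)) as [n0 Hn0]. exists n0. intros N HN.
assert (INR n0 <= INR (S N)) by (apply le_INR; lia).
assert (E : (L + 1) / Rmin 1 c * Rmin 1 c = L + 1) by (field; lra). nra.
Qed.

Lemma double_exponent_rearranged c (n k : nat) : (k <= n + 1)%nat ->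
  INR k - 1 + c * INR (n + 1 - k) = (1 - c) * (INR k - 1) + c * INR n.
Proof. intros H. rewrite minus_INR, plus_INR by assumption. simpl (INR 1). ring. Qed.

Lemma stirling_coef (k : nat) : bern_div_fact (2 * k + 2) * INR (fact (2 * k)) = bernoulli (2 * (1 + k)) / (INR (2 * (1 + k)) * INR (2 * (1 + k) - 1)).
Proof.
rewrite bernoulli_bern_div_fact. replace (2 * (1 + k))%nat with (2 * k + 2)%nat by lia.
replace (2 * k + 2 - 1)%nat with (S (2 * k)) by lia. replace (2 * k + 2)%nat with (S (S (2 * k))) by lia.
rewrite !fact_simpl, !mult_INR. pose proof (INR_S_pos (S (2 * k))). pose proof (INR_S_pos (2 * k)). field. split; lra.
Qed.

Lemma csum_even_odd K (u : nat -> C) : (forall k, u (2 * k + 1)%nat = 0) -> csum (2 * K) u = csum K (fun k => u (2 * k)%nat).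
Proof.
intros H. induction K; [reflexivity|].
replace (2 * S K)%nat with (S (S (2 * K))) by lia.
change (csum (S (S (2 * K))) u) with (csum (2 * K) u + u (2 * K)%nat + u (S (2 * K)))%C.
rewrite IHK. replace (S (2 * K)) with (2 * K + 1)%nat by lia. rewrite H.
change (csum (S K) ?v) with (csum K v + v K)%C. cbv beta. ring.
Qed.

(** Truncating at an even order and dropping the vanishing odd Bernoulli numbers gives the sum
    over k for c < 1. *)
Lemma stirling_sum_even K t : off_cut t -> stirling_sum (2 * K) t =
  (t * Clog t - t - RtoC (/ 2) * Clog t + csum K (fun k => RtoC (bernoulli (2 * (1 + k)))
    / (RtoC (INR (2 * (1 + k)) * INR (2 * (1 + k) - 1)) * t ^ (2 * (1 + k) - 1))))%C.
Proof.
intros Ht. pose proof (off_cut_neq0 _ Ht) as Hn. unfold stirling_sum. rewrite (csum_S_l (S (2 * K))), (csum_S_l (2 * K)).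
rewrite bern_div_fact_0, bern_div_fact_1. simpl (log_chain 0 t). simpl (log_chain 1 t).
rewrite csum_even_odd.
- rewrite RtoC_opp.
  rewrite (csum_ext K (fun k => RtoC (bern_div_fact (S (S (2 * k)))) * log_chain (S (S (2 * k))) t)%C (fun k => RtoC (bernoulli (2 * (1 + k)))
    / (RtoC (INR (2 * (1 + k)) * INR (2 * (1 + k) - 1)) * t ^ (2 * (1 + k) - 1)))%C).
  + ring.
  + intros k _. unfold log_chain. rewrite pow_mult. replace ((-1) ^ 2) with 1 by ring. rewrite pow1, Rmult_1_l.
    rewrite Cmult_assoc, <- RtoC_mult. replace (S (S (2 * k))) with (2 * k + 2)%nat by lia. rewrite stirling_coef.
    replace (2 * (1 + k) - 1)%nat with (S (2 * k)) by lia.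
    pose proof (INR_S_pos (2 * k)). assert (0 < INR (2 * (1 + k))) by (apply lt_0_INR; lia).
    rewrite RtoC_div by (apply Rmult_integral_contrapositive_currified; lra).
    field. split; first [now apply Cpow_neq0 | apply RtoC_neq0, Rmult_integral_contrapositive_currified; lra].
- intros k. replace (S (S (2 * k + 1))) with (2 * k + 3)%nat by lia. rewrite bern_div_fact_odd. ring.
Qed.

(** Here t = x beta^(c-1) tends to infinity in the fixed direction of [unrotate ((1 - c) *
    theta) x], so Stirling's formula applies with one constant, and powers of 1/|t| are powers
    of |beta|^(1-c). *)
Theorem expansion_c_lt_1 c theta x LogQ logx : 0 < c < 1 -> - PI / 2 < theta < PI / 2 ->
  slit_plane ((1 - c) * theta) x -> is_log_branch ((1 - c) * theta) logx ->
  (forall beta : C, 0 < Re beta -> is_log_qpoch beta (LogQ beta)) ->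
  let pw := pow_beta theta in let lb := log_beta theta in
  asymp2 (fun r => LogQ (beta_of theta r) (x * pw r c)%C) (fun K N r =>
     - RtoC (PI ^ 2 / 6) * pw r (-1)%R
     + x * (1 - logx x - RtoC c * lb r) * pw r (c - 1)%R
     + RtoC (c / 2) * lb r
     + RtoC (1 / 2) * logx x
     - Csum 1 K (fun k =>
         RtoC (bernoulli (2 * k))
         / (RtoC (INR (2 * k) * INR (2 * k - 1)) * x ^ (2 * k - 1))
         * pw r ((1 - c) * INR (2 * k - 1))%R)
     - Csum 1 N (fun n => Csum 0 (n + 1) (fun k =>
         RtoC (bernoulli k * bernoulli n) * x ^ (n + 1 - k)
         / RtoC (INR (fact k) * INR n * INR (fact (n + 1 - k)))
         * pw r ((1 - c) * (INR k - 1) + c * INR n)%R)))%C.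
Proof.
intros Hc Hth Hx Hl HQ pw lb L HL.
destruct (double_sum_exponent_large c L ltac:(lra)) as [n1 Hn1].
destruct (exists_INR_ge (L / (1 - c))) as [n2 Hn2].
exists (S (n1 + n2)). intros K N HK HN.
destruct N as [|N]; [lia|]. destruct K as [|K]; [lia|].
assert (Hx0 : x <> RtoC 0).
{ intros E. apply Hx. exists 0. split; [lra|]. rewrite E. ring. }
pose proof (log_qpoch_expansion c theta x LogQ N L ltac:(lra) Hth (fun r Hr => off_cut_scaled_point c theta x r Hr Hx) HQ (Hn1 (S N) ltac:(lia))) as HB.
set (xi := unrotate ((1 - c) * theta) x) in *.
assert (Hxi : off_cut xi) by now apply slit_plane_off_cut.
destruct (sector_bound_off_cut xi Hxi) as [kap [Hkap Hcone]].
pose proof (proj1 (Cmod_gt_0 _) (off_cut_neq0 _ Hxi)) as Hm.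
(* The error of Stirling's formula at t, with Bernoulli numbers up to index 2 (K + 1). *)
assert (HS : bigO_pow L (fun r => - (log_Gamma (x * pw r (c - 1)%R) - RtoC (/ 2 * ln (2 * PI)) - stirling_sum (2 * S K) (x * pw r (c - 1)%R)))%C).
{ destruct (Rpower_small (1 - c) 1 (Cmod xi) ltac:(lra) ltac:(lra) Hm) as [e [He He2]].
  apply (bigO_intro L ((1 - c) * INR (2 * S K)) _ e (2 * stirling_const (2 * S K) kap / Cmod xi ^ (2 * S K))); [|exact He|].
  - assert (INR n2 <= INR (2 * S K)) by (apply le_INR; lia).
    assert (E : L / (1 - c) * (1 - c) = L) by (field; lra). nra.
  - intros r Hr. unfold pw. rewrite pow_beta_unrotate by lra. fold xi. rewrite Cmod_opp.
    pose proof (Rpower_pos r (c - 1)) as Hp. pose proof (Rpower_pos r (1 - c)) as Hp'.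
    assert (Epp : Rpower r (c - 1) * Rpower r (1 - c) = 1).
    { rewrite <- Rpower_plus. replace (c - 1 + (1 - c)) with 0 by ring. apply Rpower_O. lra. }
    assert (EM : Cmod (RtoC (Rpower r (c - 1)) * xi)%C = Rpower r (c - 1) * Cmod xi) by (rewrite Cmod_mult, Cmod_RtoC_pos; lra).
    replace (2 * S K)%nat with (S (2 * K + 1)) by lia.
    eapply Rle_trans; [apply (stirling (2 * K + 1) kap); [assumption|now apply off_cut_scal|now apply Hcone|]|].
    + rewrite EM. specialize (He2 r Hr). apply Rle_trans with (Rpower r (c - 1) * Rpower r (1 - c)); [lra|]. apply Rmult_le_compat_l; lra.
    + rewrite EM, Rpow_mult_distr. right.
      assert (E2 : Rpower r ((1 - c) * INR (S (2 * K + 1))) = / Rpower r (c - 1) ^ S (2 * K + 1)).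
      { rewrite <- Rpower_mult, Rpower_pow by assumption. rewrite <- pow_inv. f_equal.
        apply Rmult_eq_reg_l with (Rpower r (c - 1)); [|lra]. rewrite Epp. field. lra. }
      rewrite E2. field. split; apply pow_nonzero; lra. }
apply (bigO_ext_ev L (fun r => (LogQ (beta_of theta r) (x * pow_beta theta r c) - expansion_rhs c theta x (S N) r) +
   - (log_Gamma (x * pw r (c - 1)%R) - RtoC (/ 2 * ln (2 * PI)) - stirling_sum (2 * S K) (x * pw r (c - 1)%R)))%C _ 1 Rlt_0_1); [|now apply bigO_plus].
intros r Hr. unfold expansion_rhs, double_sum.
assert (Hcut : off_cut (x * pw r (c - 1)%R)%C) by (apply off_cut_scaled_point; [lra|assumption]).
rewrite (stirling_sum_even (S K)) by exact Hcut.
unfold pw in *. rewrite (Clog_scaled_point c theta x r logx) by (try assumption; lra). fold lb.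
rewrite (Csum_csum_from 1 (S K)). replace (S (S K) - 1)%nat with (S K) by lia.
rewrite (csum_ext (S K) (fun k => RtoC (bernoulli (2 * (1 + k))) /
        (RtoC (INR (2 * (1 + k)) * INR (2 * (1 + k) - 1)) * (x * pow_beta theta r (c - 1)) ^ (2 * (1 + k) - 1)))%C
  (fun k => RtoC (bernoulli (2 * (1 + k))) / (RtoC (INR (2 * (1 + k)) * INR (2 * (1 + k) - 1)) * x ^ (2 * (1 + k) - 1)) *
      pow_beta theta r ((1 - c) * INR (2 * (1 + k) - 1)))%C).
2: { intros k _. rewrite Cpow_mult_l, pow_beta_pow.
     replace ((1 - c) * INR (2 * (1 + k) - 1)) with (- ((c - 1) * INR (2 * (1 + k) - 1))) by ring.
     rewrite pow_beta_opp.
     assert (0 < INR (2 * (1 + k))) by (apply lt_0_INR; lia). assert (0 < INR (2 * (1 + k) - 1)) by (apply lt_0_INR; lia).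
     field. repeat split; first [apply pow_beta_neq0 | now apply Cpow_neq0 | apply RtoC_neq0, Rmult_integral_contrapositive_currified; lra]. }
assert (ED : Csum 1 (S N) (fun n => Csum 0 (n + 1) (double_term c theta x r n)) = Csum 1 (S N) (fun n => Csum 0 (n + 1) (fun k =>
         RtoC (bernoulli k * bernoulli n) * x ^ (n + 1 - k)
         / RtoC (INR (fact k) * INR n * INR (fact (n + 1 - k)))
         * pow_beta theta r ((1 - c) * (INR k - 1) + c * INR n)%R))%C).
{ rewrite !Csum_csum_from. apply csum_ext. intros n _. rewrite !Csum_csum. apply csum_ext. intros k Hk.
  unfold double_term. rewrite double_exponent_rearranged by lia. reflexivity. }
rewrite ED.
set (S1 := csum (S K) _). set (S2 := Csum 1 (S N) _). fold (lb r).
assert (E2 : RtoC (/ 2) = (/ 2)%C) by (rewrite RtoC_inv; [reflexivity|lra]).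
assert (E3 : RtoC (1 / 2) = (/ 2)%C) by (unfold Rdiv; rewrite Rmult_1_l; exact E2).
assert (E4 : RtoC (c / 2) = (RtoC c * / 2)%C) by (unfold Rdiv; rewrite RtoC_mult, E2; reflexivity).
rewrite E2, E3, E4, RtoC_minus. field.
Qed.

(** Here t = x, and the inner sum over [k] is a Bernoulli polynomial. *)
Theorem expansion_c_eq_1 theta x LogQ logGamma : - PI / 2 < theta < PI / 2 ->
  slit_plane ((1 - 1) * theta) x -> is_log_Gamma_branch ((1 - 1) * theta) logGamma ->
  (forall beta : C, 0 < Re beta -> is_log_qpoch beta (LogQ beta)) ->
  let pw := pow_beta theta in let lb := log_beta theta in
  asymp (fun r => LogQ (beta_of theta r) (x * pw r 1)%C) (fun N r =>
     - RtoC (PI ^ 2 / 6) * pw r (-1)%R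
     + (RtoC (1 / 2) - x) * lb r
     - logGamma x
     + RtoC (1 / 2 * ln (2 * PI))
     - Csum 1 N (fun n =>
         RtoC (bernoulli n) * bernoulli_poly (n + 1) x
         / RtoC (INR n * INR (fact (n + 1)))
         * pw r (INR n)))%C.
Proof.
intros Hth Hx Hl HQ pw lb L HL.
destruct (double_sum_exponent_large 1 L Rlt_0_1) as [n1 Hn1].
exists (S n1). intros N HN. destruct N as [|N]; [lia|].
pose proof (log_qpoch_expansion 1 theta x LogQ N L Rlt_0_1 Hth (fun r Hr => off_cut_scaled_point 1 theta x r Hr Hx) HQ (Hn1 (S N) ltac:(lia))) as HB.
revert HB. apply (bigO_ext_ev L _ _ 1 Rlt_0_1). intros r Hr. unfold expansion_rhs, pw.
replace ((1 - 1) * theta) with 0 in * by ring. rewrite (logGamma_eq logGamma x Hl Hx).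
replace (1 - 1) with 0 by ring. rewrite pow_beta_0, Cmult_1_r.
replace (1 / 2) with (/ 2) by field. fold (lb r).
assert (E : double_sum 1 theta x (S N) r = Csum 1 (S N) (fun n =>
         RtoC (bernoulli n) * bernoulli_poly (n + 1) x / RtoC (INR n * INR (fact (n + 1))) * pow_beta theta r (INR n))%C).
{ unfold double_sum. rewrite !Csum_csum_from. apply csum_ext. intros n _.
  rewrite Csum_csum. unfold bernoulli_poly. rewrite sum_n_csum.
  set (m := (1 + n)%nat). assert (Hm : 0 < INR m) by (apply lt_0_INR; unfold m; lia).
  replace (RtoC (bernoulli m) * csum (S (m + 1)) (fun k => RtoC (Binomial.C (m + 1) k * bernoulli k) * x ^ (m + 1 - k))
    / RtoC (INR m * INR (fact (m + 1))) * pow_beta theta r (INR m))%C with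
   (RtoC (bernoulli m) / RtoC (INR m * INR (fact (m + 1))) * pow_beta theta r (INR m) *
     csum (S (m + 1)) (fun k => RtoC (Binomial.C (m + 1) k * bernoulli k) * x ^ (m + 1 - k)))%C by (unfold Cdiv; ring).
  rewrite <- csum_scal. apply csum_ext. intros k Hk. unfold double_term.
  rewrite double_exponent_rearranged by lia. replace ((1 - 1) * (INR k - 1) + 1 * INR m) with (INR m) by ring.
  unfold Binomial.C. pose proof (INR_fact_neq_0 k). pose proof (INR_fact_neq_0 (m + 1 - k)). pose proof (INR_fact_neq_0 (m + 1)).
  assert (E : (RtoC (bernoulli k * bernoulli m) / RtoC (INR (fact k) * INR m * INR (fact (m + 1 - k))))%C =
    (RtoC (bernoulli m) / RtoC (INR m * INR (fact (m + 1))) * RtoC (INR (fact (m + 1)) / (INR (fact k) * INR (fact (m + 1 - k))) * bernoulli k))%C).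
  { rewrite <- !RtoC_div, <- RtoC_mult.
    - f_equal. field. repeat split; try assumption; lra.
    - apply Rmult_integral_contrapositive_currified; [lra|assumption].
    - apply Rmult_integral_contrapositive_currified; [apply Rmult_integral_contrapositive_currified; [assumption|lra]|assumption]. }
  transitivity (RtoC (bernoulli k * bernoulli m) / RtoC (INR (fact k) * INR m * INR (fact (m + 1 - k))) * x ^ (m + 1 - k) * pow_beta theta r (INR m))%C; [unfold Cdiv; ring|].
  rewrite E. ring. }
rewrite E. reflexivity.
Qed.

(** * The case c > 1 *)

(** The coefficient of [t] in the expansion of [log_Gamma_term] at 0. *)
Definition gamma_term (m : nat) : R := ln (INR (S (S m)) / INR (S m)) - / INR (S m).

Lemma gamma_term_conv : Csummable (fun m => RtoC (gamma_term m)).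
Proof.
apply (Csummable_le _ (fun k => 2 * / INR (S k) ^ 2)).
- intros k. rewrite Cmod_R. rewrite <- pow_inv. apply ln_step_bound.
- apply (ex_series_scal_R 2), ex_series_inv_sqr.
Qed.

Lemma Series_gamma_term : Series gamma_term = - euler_gamma.
Proof.
pose proof (Csummable_Re _ gamma_term_conv) as HC. change (ex_series gamma_term) in HC.
pose proof (Series_correct _ HC) as HS.
assert (E : forall p, sum_n gamma_term p = - (sum_n_m (fun k => / INR k) 1 (S p) - ln (INR (S (S p))))).
{ induction p.
  - rewrite sum_O, sum_n_n. unfold gamma_term. rewrite ln_div by apply INR_S_pos. simpl (INR 1). rewrite ln_1. simpl. lra.
  - rewrite sum_Sn, IHp, (sum_n_Sm _ 1 (S p)) by lia. unfold gamma_term. rewrite ln_div by apply INR_S_pos.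
    unfold plus; simpl plus. change (@plus _ ?a ?b) with (a + b).
    set (q := sum_n_m _ 1 (S p)). set (i := / INR (S (S p))). set (l1 := ln (INR (S (S (S p))))). set (l2 := ln _).
    change (- (q - l2) + (l1 - l2 - i) = - (q + i - l1)). ring. }
assert (L1 : is_lim_seq (fun p => sum_n_m (fun k => / INR k) 1 (S p) - ln (INR (S p))) (- Series gamma_term)).
{ apply (is_lim_seq_ext (fun p => - sum_n gamma_term p + (gamma_term p + / INR (S p)))).
  - intros p. rewrite E. unfold gamma_term. rewrite ln_div by apply INR_S_pos.
    set (q := sum_n_m _ 1 (S p)). change ((- - (q - ln (INR (S (S p)))) + (ln (INR (S (S p))) - ln (INR (S p)) - / INR (S p) + / INR (S p))) = q - ln (INR (S p))). ring.
  - replace (Finite (- Series gamma_term)) with (Finite (- Series gamma_term + (0 + 0))) by (f_equal; ring).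
    apply is_lim_seq_plus'.
    + apply is_lim_seq_opp with (l := Finite (Series gamma_term)). exact HS.
    + apply is_lim_seq_plus'; [now apply ex_series_lim_0|apply is_lim_seq_inv_S]. }
(* The limit in the definition of Euler's constant runs over n, the partial sums over p = n - 1. *)
assert (L2 : is_lim_seq (fun n => sum_n_m (fun k => / INR k) 1 n - ln (INR n)) (- Series gamma_term)).
{ now apply is_lim_seq_incr_1. }
unfold euler_gamma. rewrite (is_lim_seq_unique _ _ L2). simpl. ring.
Qed.

Lemma Csummable_csum K (A : nat -> nat -> C) : (forall p, (p < K)%nat -> Csummable (fun m => A p m)) ->
  Csummable (fun m => csum K (fun p => A p m)) /\ CSeries (fun m => csum K (fun p => A p m)) = csum K (fun p => CSeries (fun m => A p m)).
Proof.
induction K; intros H.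
- simpl. assert (Z : Csummable (fun _ => RtoC 0)).
  { apply (Csummable_le _ (fun _ => 0)); [intros; rewrite Cmod_0; lra|]. apply ex_series_zero. }
  split; [exact Z|]. now apply CSeries_zero.
- destruct IHK as [H1 H2]; [intros; apply H; lia|]. simpl. split.
  + apply Csummable_plus; [exact H1|apply H; lia].
  + rewrite CSeries_plus by (try exact H1; apply H; lia). rewrite H2. reflexivity.
Qed.

Lemma inv_pow_conv p : ex_series (fun m => / INR (S m) ^ (p + 2)).
Proof.
apply (ex_series_dominated _ (fun k => / INR (S k) ^ 2)); [|apply ex_series_inv_sqr].
intros k. pose proof (INR_S_pos k). rewrite Rabs_pos_eq by (left; apply Rinv_0_lt_compat, pow_lt; assumption).
apply Rinv_le_contravar; [apply pow_lt; assumption|]. apply Rle_pow; [apply (le_INR 1); lia|lia].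
Qed.

(** Expand every logarithm log (1 + t/k) of the Euler product and sum over k: the linear terms
    give Euler's constant, the others the zeta values, and the remainders are O(t^(K+2) /
    k^(K+2)). *)
Lemma log_Gamma_small K : exists C, 0 <= C /\ forall t, Cmod t <= / 2 ->
  Cmod (log_Gamma t + Clog t + RtoC euler_gamma * t - csum K (fun p => RtoC (zeta_nat (2 + p)) * (- t) ^ (2 + p) / RtoC (INR (2 + p))))%C
   <= C * Cmod t ^ (K + 2).
Proof.
exists (2 * Series (fun m => / INR (S m) ^ (K + 2))). split.
{ apply Rmult_le_pos; [lra|]. apply Series_nonneg; [|apply inv_pow_conv]. intros m. left. apply Rinv_0_lt_compat, pow_lt, INR_S_pos. }
intros t Ht.
(* The term of degree p + 2 in t of the m-th logarithm. *)
set (A := fun p m => (RtoC ((-1) ^ S p / INR (S (S p))) * t ^ (p + 2) * RtoC (/ INR (S m) ^ (p + 2)))%C).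
set (v := fun m => (t * RtoC (gamma_term m) - csum K (fun p => A p m))%C).
assert (HA : forall p, (p < K)%nat -> Csummable (fun m => A p m)).
{ intros p _. unfold A. apply Csummable_scal. unfold Csummable.
  apply (ex_series_ext (fun m => / INR (S m) ^ (p + 2))); [|apply inv_pow_conv].
  intros m. rewrite Cmod_RtoC_pos; [reflexivity|]. left. apply Rinv_0_lt_compat, pow_lt, INR_S_pos. }
destruct (Csummable_csum K A HA) as [HA1 HA2].
assert (Hg : Csummable (fun m => t * RtoC (gamma_term m))%C) by (apply Csummable_scal, gamma_term_conv).
assert (Hv : Csummable v) by (apply Csummable_minus; assumption).
assert (Ev : CSeries v = (- RtoC euler_gamma * t + csum K (fun p => RtoC (zeta_nat (2 + p)) * (- t) ^ (2 + p) / RtoC (INR (2 + p))))%C).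
{ unfold v. rewrite CSeries_minus, HA2, CSeries_scal, RtoC_CSeries, Series_gamma_term by (try assumption; apply gamma_term_conv).
  rewrite (csum_ext K (fun p => RtoC (zeta_nat (2 + p)) * (- t) ^ (2 + p) / RtoC (INR (2 + p)))%C (fun p => (- (1)) * CSeries (fun m => A p m))%C).
  - rewrite csum_scal, RtoC_opp. ring.
  - intros p _. unfold A. rewrite CSeries_scal.
    + rewrite RtoC_CSeries. unfold zeta_nat. replace (2 + p)%nat with (p + 2)%nat by lia.
      replace (S (S p)) with (p + 2)%nat by lia.
      assert (E1 : ((- t) ^ (p + 2))%C = (RtoC ((-1) ^ (p + 2)) * t ^ (p + 2))%C).
      { replace (- t)%C with (RtoC (-1) * t)%C by ring. rewrite Cpow_mult_l, RtoC_pow. reflexivity. }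
      rewrite E1. replace (p + 2)%nat with (S (S p)) by lia. unfold Rdiv. rewrite RtoC_mult, RtoC_inv by (pose proof (INR_S_pos (S p)); lra).
      change ((-1) ^ S (S p)) with (-1 * (-1) ^ S p). rewrite (RtoC_mult (-1)). unfold Cdiv. ring.
    + unfold Csummable. apply (ex_series_ext (fun m => / INR (S m) ^ (p + 2))); [|apply inv_pow_conv].
      intros m. rewrite Cmod_RtoC_pos; [reflexivity|]. left. apply Rinv_0_lt_compat, pow_lt, INR_S_pos. }
replace (log_Gamma t + Clog t + RtoC euler_gamma * t - csum K (fun p => RtoC (zeta_nat (2 + p)) * (- t) ^ (2 + p) / RtoC (INR (2 + p))))%C with
 (CSeries (fun m => log_Gamma_term t m - v m)%C).
2: { rewrite CSeries_minus, Ev by (try assumption; apply log_Gamma_term_conv). unfold log_Gamma. change (CSeries (fun m => log_Gamma_term t m)) with (CSeries (log_Gamma_term t)). ring. }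
rewrite Rmult_assoc, (Rmult_comm (Series _)), <- Rmult_assoc, <- Series_scal_l.
apply Cmod_CSeries_bound.
- intros m. pose proof (INR_S_pos m).
  assert (Hu : Cmod (t * RtoC (/ INR (S m)))%C <= / 2).
  { rewrite Cmod_over_INR. pose proof (Cmod_ge_0 t).
    assert (/ INR (S m) <= 1) by (rewrite <- Rinv_1; apply Rinv_le_contravar; [lra|apply (le_INR 1); lia]).
    assert (0 < / INR (S m)) by now apply Rinv_0_lt_compat. unfold Rdiv. nra. }
  pose proof (Clog_taylor _ (S K) Hu) as T. rewrite csum_S_l in T.
  replace (log_Gamma_term t m - v m)%C with (- (Clog (1 + t * RtoC (/ INR (S m))) -
    (RtoC ((-1) ^ 0 / INR 1) * (t * RtoC (/ INR (S m))) ^ 1 + csum K (fun k => RtoC ((-1) ^ S k / INR (S (S k))) * (t * RtoC (/ INR (S m))) ^ S (S k)))))%C.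
  + rewrite Cmod_opp. eapply Rle_trans; [exact T|]. rewrite Cmod_over_INR. replace (S (S K)) with (K + 2)%nat by lia.
    unfold Rdiv. rewrite Rpow_mult_distr, pow_inv. right. ring.
  + unfold v, log_Gamma_term, gamma_term.
    rewrite (csum_ext K (fun p => A p m) (fun k => RtoC ((-1) ^ S k / INR (S (S k))) * (t * RtoC (/ INR (S m))) ^ S (S k))%C).
    * replace ((-1) ^ 0 / INR 1) with 1 by (simpl; field). rewrite RtoC_minus, Cpow_1_r.
      set (S1 := csum K _). ring.
    * intros p _. unfold A. replace (p + 2)%nat with (S (S p)) by lia. rewrite Cpow_mult_l, <- RtoC_pow, pow_inv. ring.
- exact (ex_series_scal_R _ _ (inv_pow_conv K)).
Qed.

(** Here t = x beta^(c-1) tends to 0. *)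
Theorem expansion_c_gt_1 c theta x LogQ logx : 1 < c -> - PI / 2 < theta < PI / 2 ->
  slit_plane ((1 - c) * theta) x -> is_log_branch ((1 - c) * theta) logx ->
  (forall beta : C, 0 < Re beta -> is_log_qpoch beta (LogQ beta)) ->
  let pw := pow_beta theta in let lb := log_beta theta in
  asymp2 (fun r => LogQ (beta_of theta r) (x * pw r c)%C) (fun K N r =>
     - RtoC (PI ^ 2 / 6) * pw r (-1)%R
     + RtoC (c - 1 / 2) * lb r
     + logx x
     + RtoC (1 / 2 * ln (2 * PI))
     + x * (RtoC euler_gamma - lb r) * pw r (c - 1)%R
     - Csum 2 K (fun k =>
         RtoC (zeta_nat k) * (- x) ^ k / RtoC (INR k)
         * pw r ((c - 1) * INR k)%R)
     - Csum 1 N (fun n => Csum 0 (n + 1) (fun k =>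
         RtoC (bernoulli k * bernoulli n) * x ^ (n + 1 - k)
         / RtoC (INR (fact k) * INR n * INR (fact (n + 1 - k)))
         * pw r (INR k - 1 + c * INR (n + 1 - k))%R)))%C.
Proof.
intros Hc Hth Hx Hl HQ pw lb L HL.
destruct (double_sum_exponent_large c L ltac:(lra)) as [n1 Hn1].
destruct (exists_INR_ge (L / (c - 1))) as [n2 Hn2].
exists (S (n1 + n2)). intros K N HK HN.
destruct N as [|N]; [lia|]. destruct K as [|K]; [lia|].
pose proof (log_qpoch_expansion c theta x LogQ N L ltac:(lra) Hth (fun r Hr => off_cut_scaled_point c theta x r Hr Hx) HQ (Hn1 (S N) ltac:(lia))) as HB.
destruct (log_Gamma_small K) as [CK [HCK HK2]].
set (Z := fun t : C => csum K (fun p => RtoC (zeta_nat (2 + p)) * (- t) ^ (2 + p) / RtoC (INR (2 + p)))%C).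
(* The error of the expansion of log Gamma at 0. *)
assert (HS : bigO_pow L (fun r => - (log_Gamma (x * pw r (c - 1)%R) + Clog (x * pw r (c - 1)%R) + RtoC euler_gamma * (x * pw r (c - 1)%R) - Z (x * pw r (c - 1)%R)))%C).
{ destruct (Rpower_small (c - 1) (Cmod x) (/ 2) ltac:(lra) (Cmod_ge_0 x) ltac:(lra)) as [e [He He2]].
  apply (bigO_intro L ((c - 1) * INR (K + 2)) _ e (CK * Cmod x ^ (K + 2))); [|exact He|].
  - assert (INR n2 <= INR (K + 2)) by (apply le_INR; lia).
    assert (E : L / (c - 1) * (c - 1) = L) by (field; lra). nra.
  - intros r Hr. rewrite Cmod_opp.
    assert (EM : Cmod (x * pw r (c - 1)%R)%C = Cmod x * Rpower r (c - 1)) by (unfold pw; rewrite Cmod_mult, Cmod_pow_beta; reflexivity).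
    eapply Rle_trans; [apply HK2; rewrite EM; now apply He2|].
    rewrite EM, Rpow_mult_distr, <- (Rpower_pow _ (Rpower r (c - 1))), Rpower_mult by apply Rpower_pos. lra. }
apply (bigO_ext_ev L (fun r => (LogQ (beta_of theta r) (x * pow_beta theta r c) - expansion_rhs c theta x (S N) r) +
   - (log_Gamma (x * pw r (c - 1)%R) + Clog (x * pw r (c - 1)%R) + RtoC euler_gamma * (x * pw r (c - 1)%R) - Z (x * pw r (c - 1)%R)))%C _ 1 Rlt_0_1); [|now apply bigO_plus].
intros r Hr. unfold expansion_rhs, double_sum, pw.
rewrite (Clog_scaled_point c theta x r logx) by (try assumption; lra). fold lb.
change (Csum 1 (S N) (fun n => Csum 0 (n + 1) (fun k =>
         RtoC (bernoulli k * bernoulli n) * x ^ (n + 1 - k)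
         / RtoC (INR (fact k) * INR n * INR (fact (n + 1 - k)))
         * pow_beta theta r (INR k - 1 + c * INR (n + 1 - k))%R)))%C with
  (Csum 1 (S N) (fun n => Csum 0 (n + 1) (double_term c theta x r n))).
rewrite (Csum_csum_from 2 (S K)). replace (S (S K) - 2)%nat with K by lia.
unfold Z.
rewrite (csum_ext K (fun p => RtoC (zeta_nat (2 + p)) * (- (x * pow_beta theta r (c - 1))) ^ (2 + p) / RtoC (INR (2 + p)))%C
  (fun p => RtoC (zeta_nat (2 + p)) * (- x) ^ (2 + p) / RtoC (INR (2 + p)) * pow_beta theta r ((c - 1) * INR (2 + p)))%C).
2: { intros p _. replace (- (x * pow_beta theta r (c - 1)))%C with ((- x) * pow_beta theta r (c - 1))%C by ring.
     rewrite Cpow_mult_l, pow_beta_pow. unfold Cdiv. ring. }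
set (S1 := csum K _). set (S2 := Csum 1 (S N) _). fold (lb r).
assert (E2 : RtoC (/ 2) = (/ 2)%C) by (rewrite RtoC_inv; [reflexivity|lra]).
assert (E3 : RtoC (c - 1 / 2) = (RtoC c - / 2)%C) by (unfold Rdiv; rewrite Rmult_1_l, RtoC_minus, E2; reflexivity).
assert (E4 : 1 / 2 * ln (2 * PI) = / 2 * ln (2 * PI)) by field.
rewrite E4, E2, E3, RtoC_minus. field.
Qed.

(** * The case c = 0 *)

(** Local analyticity in a form closed under sums, translations and derivatives, for use in the
    identity theorem [identity_ray]. *)
Definition pser_at (f : C -> C) (z0 : C) : Prop :=
  exists (a : nat -> C) (d : R), 0 < d /\ (forall z, Cmod z < d -> Csummable (fun n => a n * z ^ n)%C) /\
    forall z, Cmod z < d -> f (z0 + z)%C = CPSeries a z.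

Lemma analytic_pser_at D f z0 : analytic_on D f -> D z0 -> pser_at f z0.
Proof.
intros H HD. destruct (analytic_on_CPSeries D f z0 H HD) as [a [d [Hd [HC E]]]]. exists a, d.
split; [exact Hd|]. split.
- intros z Hz. apply CPSeries_abs. eapply Rbar_lt_le_trans; [|exact HC]. exact Hz.
- intros z Hz. rewrite E; rewrite Cplus_minus_l; [reflexivity|exact Hz].
Qed.

Lemma pser_at_Cradius (a : nat -> C) d : 0 < d -> (forall z, Cmod z < d -> Csummable (fun n => a n * z ^ n)%C) -> Rbar_le d (Cradius a).
Proof.
intros Hd H. apply Cradius_ge_below; [exact Hd|]. intros rho Hr.
pose proof (H (RtoC rho) ltac:(rewrite Cmod_RtoC_pos; lra)) as L.
apply Clim_csum, Clim_csum_terms_bounded in L. destruct L as [M HM]. exists M. intros n. specialize (HM n).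
rewrite Cmod_mult, Cmod_pow, Cmod_RtoC_pos in HM by lra. exact HM.
Qed.

Lemma pser_at_plus f g z0 : pser_at f z0 -> pser_at g z0 -> pser_at (fun z => f z + g z)%C z0.
Proof.
intros [a [d [Hd [Ha Ea]]]] [b [d' [Hd' [Hb Eb]]]].
exists (fun n => a n + b n)%C, (Rmin d d'). split; [now apply Rmin_glb_lt|].
assert (M : forall z : C, Cmod z < Rmin d d' -> Cmod z < d /\ Cmod z < d').
{ intros z Hz. split; eapply Rlt_le_trans; try exact Hz; [apply Rmin_l|apply Rmin_r]. }
split.
- intros z Hz. destruct (M z Hz). apply (Csummable_ext (fun n => a n * z ^ n + b n * z ^ n)%C); [intros; ring|]. apply Csummable_plus; auto.
- intros z Hz. destruct (M z Hz). rewrite Ea, Eb by assumption. unfold CPSeries. rewrite <- CSeries_plus by auto. apply CSeries_ext. intros; ring.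
Qed.

Lemma pser_at_scal c f z0 : pser_at f z0 -> pser_at (fun z => c * f z)%C z0.
Proof.
intros [a [d [Hd [Ha Ea]]]]. exists (fun n => c * a n)%C, d. split; [exact Hd|]. split.
- intros z Hz. apply (Csummable_ext (fun n => c * (a n * z ^ n))%C); [intros; ring|]. apply Csummable_scal; auto.
- intros z Hz. rewrite Ea by assumption. unfold CPSeries. rewrite <- CSeries_scal by auto. apply CSeries_ext. intros; ring.
Qed.

Lemma pser_at_shift f b z0 : pser_at f (z0 + b)%C -> pser_at (fun z => f (z + b)%C) z0.
Proof.
intros [a [d [Hd [Ha Ea]]]]. exists a, d. split; [exact Hd|]. split; [exact Ha|].
intros z Hz. rewrite <- Ea by assumption. f_equal. ring.
Qed.

(** The complex derivative as a total function, read off along the real direction. *)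
Definition Cderiv (f : C -> C) (z : C) : C :=
  (Derive (fun u => Re (f (z + RtoC u * 1)%C)) 0, Derive (fun u => Im (f (z + RtoC u * 1)%C)) 0).

Lemma is_Cderive_Cderiv (f : C -> C) (z l : C) : is_Cderive f z l -> Cderiv f z = l.
Proof.
intros H. pose proof (curve_derive_line f z 1 l 0) as K. replace (z + RtoC 0 * 1)%C with z in K by ring.
destruct (K H) as [K1 K2]. rewrite Cmult_1_r in K1, K2. apply is_derive_unique in K1. apply is_derive_unique in K2.
unfold Cderiv. apply injective_projections; assumption.
Qed.

Lemma pser_at_derive_near f z0 : pser_at f z0 -> exists a d, 0 < d /\ Rbar_le d (Cradius a) /\
  forall z, Cmod z < d -> is_Cderive f (z0 + z)%C (CPSeries (deriv_coef a) z).
Proof.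
intros [a [d [Hd [Ha Ea]]]]. exists a, d. pose proof (pser_at_Cradius a d Hd Ha) as HC.
split; [exact Hd|]. split; [exact HC|]. intros z Hz.
apply (is_Cderive_ext_near (fun y => CPSeries a (y - z0)%C) _ _ _ (d - Cmod z)); [lra| |].
- intros y Hy. rewrite <- Ea.
  + f_equal. ring.
  + replace (y - z0)%C with ((y - (z0 + z)) + z)%C by ring. eapply Rle_lt_trans; [apply Cmod_triangle|]. lra.
- replace (CPSeries (deriv_coef a) z) with (1 * CPSeries (deriv_coef a) (z0 + z - z0))%C by (rewrite Cplus_minus_l; ring).
  apply (is_Cderive_comp (CPSeries a) (fun y => y - z0)%C).
  + apply CPSeries_derive. rewrite Cplus_minus_l. eapply Rbar_lt_le_trans; [|exact HC]. exact Hz.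
  + replace (RtoC 1) with (1 - 0)%C by ring. apply is_Cderive_minus; [apply is_Cderive_id|apply is_Cderive_const].
Qed.

Lemma pser_at_Cderive f z0 : pser_at f z0 -> is_Cderive f z0 (Cderiv f z0).
Proof.
intros H. destruct (pser_at_derive_near f z0 H) as [a [d [Hd [_ K]]]].
specialize (K 0 ltac:(rewrite Cmod_0; lra)). rewrite Cplus_0_r in K.
now rewrite (is_Cderive_Cderiv _ _ _ K).
Qed.

Lemma pser_at_Cderiv f z0 : pser_at f z0 -> pser_at (Cderiv f) z0.
Proof.
intros H. destruct (pser_at_derive_near f z0 H) as [a [d [Hd [HC K]]]].
exists (deriv_coef a), d. split; [exact Hd|]. split.
- intros z Hz. apply CPSeries_abs. rewrite Cradius_deriv_coef. eapply Rbar_lt_le_trans; [|exact HC]. exact Hz.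
- intros z Hz. now apply is_Cderive_Cderiv, K.
Qed.

(** If the series vanishes on a ray near 0, its constant term vanishes by continuity; divide by
    the variable and repeat. *)
Lemma CPSeries_zero_ray (e : C) d : e <> RtoC 0 -> 0 < d -> forall n a,
  Rbar_lt 0 (Cradius a) -> (forall t, 0 < t < d -> Rbar_lt (Cmod (RtoC t * e)%C) (Cradius a)) ->
  (forall t, 0 < t < d -> CPSeries a (RtoC t * e)%C = 0) -> a n = 0.
Proof.
intros He Hd n.
assert (A0 : forall a, Rbar_lt 0 (Cradius a) -> (forall t, 0 < t < d -> CPSeries a (RtoC t * e)%C = 0) -> a 0%nat = 0).
{ intros a HC H. rewrite <- (CPSeries_0 a).
  assert (HC0 : Rbar_lt (Cmod 0) (Cradius a)) by (rewrite Cmod_0; exact HC).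
  apply Cmod_eq_0. apply Rle_antisym; [|apply Cmod_ge_0]. apply le_epsilon. intros eps Heps. rewrite Rplus_0_l.
  destruct (is_Cderive_cont (CPSeries a) 0 _ (CPSeries_derive a 0 HC0) eps Heps) as [q [Hq K]].
  pose proof (proj1 (Cmod_gt_0 e) He) as Hme.
  set (t := Rmin (d / 2) (q / (2 * Cmod e))).
  assert (Ht : 0 < t) by (apply Rmin_glb_lt; [lra|apply Rdiv_lt_0_compat; lra]).
  assert (Ht1 : t <= d / 2) by apply Rmin_l. assert (Ht2 : t <= q / (2 * Cmod e)) by apply Rmin_r.
  specialize (K (RtoC t * e)%C). rewrite Cplus_0_l, H in K by lra.
  replace (0 - CPSeries a 0)%C with (- CPSeries a 0)%C in K by ring. rewrite Cmod_opp in K. left. apply K.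
  rewrite Cmod_mult, Cmod_RtoC_pos by lra.
  apply Rle_lt_trans with (q / (2 * Cmod e) * Cmod e); [apply Rmult_le_compat_r; lra|].
  replace (q / (2 * Cmod e) * Cmod e) with (q / 2) by (field; lra). lra. }
induction n; intros a HC HC2 H; [now apply A0|].
assert (ES : Cradius (fun n => a (S n)) = Cradius a) by (unfold Cradius; rewrite <- (CV_radius_decr_1 (fun n => Cmod (a n))); reflexivity).
apply (IHn (fun n => a (S n))); rewrite ?ES; try assumption.
assert (A00 : a 0%nat = 0) by now apply A0.
intros t Ht. specialize (H t Ht). rewrite CPSeries_incr, A00 in H by now apply HC2.
assert (Hte : (RtoC t * e)%C <> RtoC 0) by (apply Cmult_neq_0; [apply RtoC_neq0; lra|assumption]).
set (q := CPSeries _ _) in *. rewrite Cplus_0_l in H.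
  replace q with (/ (RtoC t * e) * (RtoC t * e * q))%C by (field; split; [assumption|apply RtoC_neq0; lra]).
  rewrite H. ring.
Qed.

(** If a function is analytic along a ray and vanishes near infinity, the supremum of the
    parameters at which it does not vanish would be a point all of whose Taylor coefficients are
    zero, since the function vanishes on one side of it. *)
Lemma identity_ray f x e U : e <> RtoC 0 ->
  (forall u, 0 <= u -> pser_at f (x + RtoC u * e)%C) ->
  (forall u, U <= u -> f (x + RtoC u * e)%C = 0) ->
  forall u, 0 <= u -> f (x + RtoC u * e)%C = 0.
Proof.
intros He Hp HU u0 Hu0. apply NNPP. intros Hne.
set (E := fun u => 0 <= u /\ f (x + RtoC u * e)%C <> RtoC 0).
destruct (completeness E) as [s [Hs1 Hs2]].
- exists U. intros u [_ Hu]. destruct (Rle_lt_dec u U); [assumption|]. exfalso. apply Hu, HU. lra.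
- exists u0. split; assumption.
- assert (Hs0 : 0 <= s) by (eapply Rle_trans; [exact Hu0|apply Hs1; split; assumption]).
  assert (Habove : forall u, s < u -> f (x + RtoC u * e)%C = 0).
  { intros u Hu. apply NNPP. intros K. assert (u <= s) by (apply Hs1; split; [lra|exact K]). lra. }
  destruct (Hp s Hs0) as [a [d [Hd [Ha Ea]]]].
  pose proof (pser_at_Cradius a d Hd Ha) as HC. pose proof (proj1 (Cmod_gt_0 e) He) as Hme.
  assert (Hsmall : forall t, Rabs t < d / Cmod e -> Cmod (RtoC t * e)%C < d).
  { intros t Ht. rewrite Cmod_mult, Cmod_R. apply Rmult_lt_reg_r with (/ Cmod e); [now apply Rinv_0_lt_compat|].
    rewrite Rmult_assoc, Rinv_r by lra. rewrite Rmult_1_r. exact Ht. }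
  assert (Hde : 0 < d / Cmod e) by (apply Rdiv_lt_0_compat; lra).
  (* The function vanishes at the points of the ray beyond s, which determines its expansion at s. *)
  assert (Hz : forall n, a n = 0).
  { intros n. apply (CPSeries_zero_ray e (d / Cmod e) He Hde n a).
    - eapply Rbar_lt_le_trans; [|exact HC]. exact Hd.
    - intros t Ht. eapply Rbar_lt_le_trans; [|exact HC]. simpl. apply Hsmall. rewrite Rabs_pos_eq; lra.
    - intros t Ht. rewrite <- Ea by (apply Hsmall; rewrite Rabs_pos_eq; lra).
      replace (x + RtoC s * e + RtoC t * e)%C with (x + RtoC (s + t) * e)%C by (rewrite RtoC_plus; ring). apply Habove. lra. }
  assert (Hnear : forall u, s - d / Cmod e / 2 < u <= s -> f (x + RtoC u * e)%C = 0).
  { intros u Hu. replace (x + RtoC u * e)%C with (x + RtoC s * e + RtoC (u - s) * e)%C by (rewrite RtoC_minus; ring).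
    rewrite Ea by (apply Hsmall; apply Rabs_def1; lra). unfold CPSeries. apply CSeries_zero. intros n. rewrite Hz. ring. }
  assert (Hub : is_upper_bound E (s - d / Cmod e / 2)).
  { intros u [Hu1 Hu2]. destruct (Rle_lt_dec u (s - d / Cmod e / 2)); [assumption|exfalso].
    apply Hu2. destruct (Rle_lt_dec u s); [apply Hnear; lra|now apply Habove]. }
  specialize (Hs2 _ Hub). lra.
Qed.

Lemma curve_cont_bounded (f : R -> C) a b : a <= b -> (forall s, a <= s <= b -> curve_cont f s) -> exists M, 0 <= M /\ forall s, a <= s <= b -> Cmod (f s) <= M.
Proof.
intros Hab Hc.
destruct (continuity_ab_maj (fun u => Rabs (Re (f u))) a b Hab) as [m1 [H1 _]].
{ intros s Hs. apply (continuity_pt_comp (fun u => Re (f u)) Rabs); [now apply Hc|apply Rcontinuity_abs]. }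
destruct (continuity_ab_maj (fun u => Rabs (Im (f u))) a b Hab) as [m2 [H2 _]].
{ intros s Hs. apply (continuity_pt_comp (fun u => Im (f u)) Rabs); [now apply Hc|apply Rcontinuity_abs]. }
exists (Rabs (Re (f m1)) + Rabs (Im (f m2))). split.
- pose proof (Rabs_pos (Re (f m1))). pose proof (Rabs_pos (Im (f m2))). lra.
- intros s Hs. eapply Rle_trans; [apply Cmod_le_re_im|]. specialize (H1 s Hs). specialize (H2 s Hs). lra.
Qed.

Lemma log_qpoch_domain_scale theta r y : 0 < r -> log_qpoch_domain (Cexp (0%R, theta)) y <-> log_qpoch_domain (beta_of theta r) y.
Proof.
intros Hr. unfold log_qpoch_domain, beta_of. split; intros H [n [s [Hs E]]]; apply H; exists n.
- exists (r * s). split; [nra|]. rewrite E, (RtoC_mult r s). ring.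
- exists (s / r). split.
  + apply Rmult_le_reg_r with r; [assumption|]. unfold Rdiv. rewrite Rmult_assoc, Rinv_l; lra.
  + rewrite E. replace (RtoC r * Cexp (0%R, theta) * RtoC (s / r))%C with (Cexp (0%R, theta) * RtoC (r * (s / r)))%C by (rewrite RtoC_mult; ring).
    do 3 f_equal. field. lra.
Qed.

Lemma log_qpoch_domain_ray e y u : 0 <= u -> log_qpoch_domain e y -> log_qpoch_domain e (y + RtoC u * e)%C.
Proof.
intros Hu H [n [s [Hs E]]]. apply H. exists n, (s - u). split; [lra|].
rewrite RtoC_minus. transitivity (y + RtoC u * e - RtoC u * e)%C; [ring|]. rewrite E. ring.
Qed.

(** On the right half plane the given continuation is the power series. *)
Lemma is_polylog_exp_eq theta l j z : is_polylog_exp theta (2 - Z.of_nat j) l -> 0 < Re z -> l z = polylog_exp j z.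
Proof.
intros [_ H] Hz. specialize (H z Hz). pose proof (Cmod_Cexp_opp_lt z Hz) as Hq.
set (q := Cexp (- z)%C) in *.
assert (E : forall k, (q ^ S k / RtoC (powerRZ (INR (S k)) (2 - Z.of_nat j)))%C = (polylog_coef j (S k) * q ^ S k)%C).
{ intros k. pose proof (INR_S_pos k) as Hp. unfold polylog_coef.
  assert (E : powerRZ (INR (S k)) (2 - Z.of_nat j) = INR (S k) ^ 2 / INR (S k) ^ j).
  { unfold Z.sub. rewrite powerRZ_add by lra. rewrite powerRZ_neg, <- pow_powerRZ by lra. rewrite pow_inv. reflexivity. }
  rewrite E. assert (0 < INR (S k) ^ 2) by (apply pow_lt; lra). assert (0 < INR (S k) ^ j) by (apply pow_lt; lra).
  rewrite !RtoC_div by lra. field. repeat split; apply RtoC_neq0; lra. }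
assert (HC : Csummable (fun k => polylog_coef j k * q ^ k)%C) by (apply CPSeries_abs, Cradius_1_lt; [apply Cradius_polylog_coef|exact Hq]).
unfold polylog_exp, CPSeries. fold q. rewrite (CSeries_incr _ HC). change (polylog_coef j 0) with (RtoC 0). rewrite Cmult_0_l, Cplus_0_l.
apply is_series_CSeries; [now apply (Csummable_incr (fun k => polylog_coef j k * q ^ k)%C)|].
revert H. apply (is_series_ext (K := C_AbsRing) (V := C_NormedModule)). exact E.
Qed.

(** The given continuations of Li_(2-j)(e^(-z)) satisfy on the whole ray the relations that hold
    in the right half plane: each is the negative derivative of its predecessor, and Li_1 is the
    negative of G(z) - G(z + beta).  They are bounded on the initial segment and decay
    exponentially afterwards, so [log_qpoch_euler_maclaurin] applies at [x] itself. *)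
Theorem expansion_c_eq_0 theta x LogQ (Li : Z -> C -> C) : - PI / 2 < theta < PI / 2 ->
  log_qpoch_domain (Cexp (0%R, theta)) x ->
  (forall n : Z, is_polylog_exp theta n (Li n)) ->
  (forall beta : C, 0 < Re beta -> is_log_qpoch beta (LogQ beta)) ->
  let pw := pow_beta theta in
  asymp (fun r => LogQ (beta_of theta r) (x * pw r 0)%C) (fun K r =>
     Csum 0 K (fun k =>
       RtoC (powerRZ (-1) (Z.of_nat k - 1) * bernoulli k / INR (fact k))
       * Li (2 - Z.of_nat k)%Z x * pw r (INR k - 1)%R)%C).
Proof.
intros Hth Hx HLi HQ pw.
assert (Hcos : 0 < cos theta) by (apply cos_gt_0; lra).
pose proof (COS_bound theta) as [_ Hcos1].
set (e := Cexp (0%R, theta)) in *.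
assert (Hree : Re e = cos theta) by (unfold e, Cexp, Re; simpl; rewrite exp_0; ring).
assert (He : e <> RtoC 0) by apply Cexp_neq0.
assert (Hbe : forall r, beta_of theta r = (RtoC r * e)%C) by reflexivity.
set (U1 := Rmax 0 ((1 - Re x) / cos theta)).
assert (HU1 : 0 <= U1) by apply Rmax_l.
assert (HU : forall u, U1 <= u -> 1 <= Re (x + RtoC u * e)%C).
{ intros u Hu. rewrite re_line, Hree.
  assert ((1 - Re x) / cos theta <= u) by (eapply Rle_trans; [apply Rmax_r|exact Hu]).
  apply Rmult_le_compat_r with (r := cos theta) in H; [|lra]. unfold Rdiv in H. rewrite Rmult_assoc, Rinv_l in H; lra. }
assert (HD : forall u, 0 <= u -> log_qpoch_domain e (x + RtoC u * e)%C) by (intros u Hu; now apply log_qpoch_domain_ray).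
set (A := fun (j : nat) => Li (2 - Z.of_nat j)%Z).
assert (HAp : forall j u, 0 <= u -> pser_at (A j) (x + RtoC u * e)%C).
{ intros j u Hu. apply (analytic_pser_at (log_qpoch_domain e)); [apply HLi|now apply HD]. }
assert (HALis : forall j z, 0 < Re z -> A j z = polylog_exp j z) by (intros j z Hz; apply (is_polylog_exp_eq theta); [apply HLi|exact Hz]).
assert (HAd : forall j u, 0 <= u -> is_Cderive (A j) (x + RtoC u * e)%C (- A (S j) (x + RtoC u * e))%C).
{ intros j u Hu.
  assert (Z : (Cderiv (A j) (x + RtoC u * e) + 1 * A (S j) (x + RtoC u * e))%C = 0).
  { apply (identity_ray (fun z => Cderiv (A j) z + 1 * A (S j) z)%C x e U1 He); [| |exact Hu].
    - intros v Hv. apply pser_at_plus; [now apply pser_at_Cderiv, HAp|now apply pser_at_scal, HAp].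
    - intros v Hv. specialize (HU v Hv). set (z := (x + RtoC v * e)%C) in *.
      rewrite (is_Cderive_Cderiv (A j) z (- polylog_exp (S j) z)%C).
      + rewrite HALis by lra. ring.
      + apply (is_Cderive_ext_near (polylog_exp j) _ _ _ (Re z)); [lra| |apply is_Cderive_polylog_exp; lra].
        intros y Hy. symmetry. apply HALis. pose proof (re_le_Cmod (y - z)%C) as Q. apply Rabs_le_between in Q.
        change (Re (y - z)%C) with (Re y - Re z) in Q. lra. }
  replace (- A (S j) (x + RtoC u * e))%C with (Cderiv (A j) (x + RtoC u * e)).
  - apply pser_at_Cderive. now apply HAp.
  - replace (Cderiv (A j) (x + RtoC u * e)) with ((Cderiv (A j) (x + RtoC u * e) + 1 * A (S j) (x + RtoC u * e)) - A (S j) (x + RtoC u * e))%C by ring.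
    rewrite Z. ring. }
(* Exponential decay: the series beyond the parameter U1, compactness before it. *)
assert (HAb : forall j, exists M, 0 <= M /\ forall u, 0 <= u -> Cmod (A j (x + RtoC u * e)%C) <= M * exp (- (u * cos theta))).
{ intros j. destruct (polylog_chain_bounded j 1 Rlt_0_1) as [M1 [HM10 HM1]].
  destruct (curve_cont_bounded (fun u => A j (x + RtoC u * e)%C) 0 U1 HU1) as [M2 [HM20 HM2]].
  { intros s Hs. apply (curve_cont_line (A j) x e (- A (S j) (x + RtoC s * e))%C). apply HAd. lra. }
  exists (M1 * exp (- Re x) + M2 * exp (U1 * cos theta)).
  pose proof (exp_pos (- Re x)). pose proof (exp_pos (U1 * cos theta)).
  split; [assert (0 <= M1 * exp (- Re x)) by (apply Rmult_le_pos; lra); assert (0 <= M2 * exp (U1 * cos theta)) by (apply Rmult_le_pos; lra); lra|].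
  intros u Hu. rewrite Rmult_plus_distr_r, !Rmult_assoc, <- !exp_plus.
  assert (P1 : 0 <= M1 * exp (- Re x + - (u * cos theta))) by (apply Rmult_le_pos; [assumption|left; apply exp_pos]).
  assert (P2 : 0 <= M2 * exp (U1 * cos theta + - (u * cos theta))) by (apply Rmult_le_pos; [assumption|left; apply exp_pos]).
  destruct (Rle_lt_dec U1 u) as [L|L].
  - specialize (HU u L). specialize (HM1 (x + RtoC u * e)%C HU).
    unfold polylog_chain in HM1. rewrite Cmod_mult, Cmod_R, pow_1_abs, Rmult_1_l in HM1.
    rewrite HALis by lra. rewrite re_line, Hree in HM1.
    replace (- (Re x + u * cos theta)) with (- Re x + - (u * cos theta)) in HM1 by ring. lra.
  - specialize (HM2 u ltac:(lra)).
    assert (1 <= exp (U1 * cos theta + - (u * cos theta))).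
    { rewrite <- exp_0. destruct (Req_dec (U1 * cos theta + - (u * cos theta)) 0) as [->|]; [lra|]. left. apply exp_increasing. nra. }
    cbv beta in HM2. nra. }
intros L HL. destruct (exists_INR_ge (L + 1)) as [n0 Hn0].
exists (S (S n0)). intros K HK. destruct K as [|N]; [lia|].
set (h := fun (j : nat) (z : C) => (RtoC ((-1) ^ j) * A j z)%C).
assert (Hhm : forall j z, Cmod (h j z) = Cmod (A j z)).
{ intros j z. unfold h. rewrite Cmod_mult, Cmod_R, pow_1_abs. ring. }
destruct (HAb (S (S N))) as [M [HM0 HM]].
apply (bigO_intro L (INR N) _ 1 (INR (S (S N)) * M * (2 / cos theta))); [|lra|].
{ assert (INR n0 <= INR N) by (apply le_INR; lia). lra. }
intros r Hr.
assert (Hreb : Re (beta_of theta r) = r * cos theta) by apply Re_beta.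
assert (Hb : beta_of theta r <> RtoC 0) by (apply beta_neq0; lra).
assert (Hrb : 0 < Re (beta_of theta r) <= 1) by (rewrite Hreb; split; nra).
pose proof (HQ (beta_of theta r) ltac:(lra)) as HG. set (G := LogQ (beta_of theta r)) in *.
assert (Epw : (x * pw r 0)%C = x) by (unfold pw; rewrite pow_beta_0; ring). rewrite Epw.
assert (Erow : forall s, (x + RtoC s * beta_of theta r)%C = (x + RtoC (s * r) * e)%C) by (intros s; rewrite Hbe, RtoC_mult; ring).
assert (Hstep : forall u, 0 <= u -> (G (x + RtoC u * e) + (- (1)) * G (x + RtoC u * e + beta_of theta r) + 1 * A 1%nat (x + RtoC u * e))%C = 0).
{ intros u Hu. apply (identity_ray (fun z => G z + (- (1)) * G (z + beta_of theta r) + 1 * A 1%nat z)%C x e U1 He); [| |exact Hu].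
  - intros v Hv. apply pser_at_plus; [apply pser_at_plus|].
    + apply (analytic_pser_at (log_qpoch_domain (beta_of theta r))); [apply HG|]. apply log_qpoch_domain_scale; [lra|]. now apply HD.
    + apply (pser_at_scal _ (fun z => G (z + beta_of theta r)%C)), pser_at_shift.
      apply (analytic_pser_at (log_qpoch_domain (beta_of theta r))); [apply HG|]. apply log_qpoch_domain_scale; [lra|].
      replace (x + RtoC v * e + beta_of theta r)%C with (x + RtoC (v + r) * e)%C by (rewrite Hbe, RtoC_plus; ring). apply HD. lra.
    + now apply pser_at_scal, HAp.
  - intros v Hv. specialize (HU v Hv). set (z := (x + RtoC v * e)%C) in *.
    rewrite (log_qpoch_step_pos (beta_of theta r) G z) by (try assumption; lra).
    rewrite HALis by lra. unfold polylog_chain. simpl ((-1) ^ 1). rewrite Rmult_1_r. ring. }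
assert (EM : Cmod (G x + em_scaled_sum h (beta_of theta r) N x)%C <= INR (S (S N)) * M * Cmod (beta_of theta r) ^ S N * (2 / Re (beta_of theta r))).
{ apply (log_qpoch_euler_maclaurin N h); try assumption.
  - intros k. rewrite Erow. pose proof (Hstep (INR k * r) ltac:(pose proof (pos_INR k); nra)) as E.
    unfold h. simpl ((-1) ^ 1). rewrite Rmult_1_r.
    set (z := (x + RtoC (INR k * r) * e)%C) in *.
    replace (G z) with ((G z + - (1) * G (z + beta_of theta r) + 1 * A 1%nat z) + (RtoC (-1) * A 1%nat z + G (z + beta_of theta r)))%C by ring.
    rewrite E. ring.
  - intros j s Hs. rewrite Erow. unfold h at 2.
    replace (RtoC ((-1) ^ S j) * A (S j) (x + RtoC (s * r) * e))%C with (RtoC ((-1) ^ j) * (- A (S j) (x + RtoC (s * r) * e)))%C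
     by (change ((-1) ^ S j) with (-1 * (-1) ^ j); rewrite (RtoC_mult (-1)); ring).
    apply (is_Cderive_scal _ (A j)). apply HAd. nra.
  - intros s Hs. rewrite Hhm, Erow, Hreb. eapply Rle_trans; [apply HM; nra|]. right. do 3 f_equal. ring.
  - intros j. destruct (HAb j) as [Mj [_ HMj]]. apply (Clim_exp_decay _ Mj (Re (beta_of theta r))); [lra|].
    intros n. rewrite Hhm, Erow, Hreb. eapply Rle_trans; [apply HMj; pose proof (pos_INR n); nra|]. right. do 3 f_equal. ring. }
rewrite Cmod_beta, Hreb in EM by lra.
replace (INR (S (S N)) * M * (2 / cos theta) * Rpower r (INR N)) with (INR (S (S N)) * M * r ^ S N * (2 / (r * cos theta))).
2: { rewrite Rpower_pow by lra. simpl pow. field. split; lra. }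
eapply Rle_trans; [|exact EM]. right. f_equal.
rewrite Csum_csum. unfold em_scaled_sum.
rewrite (csum_ext _ (fun k => RtoC (powerRZ (-1) (Z.of_nat k - 1) * bernoulli k / INR (fact k)) * Li (2 - Z.of_nat k)%Z x * pw r (INR k - 1)%R)%C
  (fun j => (- (1)) * (RtoC (bern_div_fact j) * (beta_of theta r ^ j / beta_of theta r * h j x)))%C).
- rewrite csum_scal. ring.
- intros k _. unfold pw. rewrite beta_pow_div by lra. unfold h, A.
  assert (E : powerRZ (-1) (Z.of_nat k - 1) * bernoulli k / INR (fact k) = (-1) * ((-1) ^ k * bern_div_fact k)).
  { rewrite bern_div_fact_bernoulli. unfold Z.sub. rewrite powerRZ_add by lra. rewrite <- pow_powerRZ. simpl. field. apply INR_fact_neq_0. }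
  rewrite E, !RtoC_mult. ring.
Qed.

Theorem corollary3 :
  forall (c theta : R) (x : C) (LogQ : C -> C -> C),
  0 <= c ->
  - PI / 2 < theta < PI / 2 ->
  (c = 0 -> log_qpoch_domain (Cexp (0%R, theta)) x) ->
  (0 < c -> slit_plane ((1 - c) * theta) x) ->
  (forall beta : C, 0 < Re beta -> is_log_qpoch beta (LogQ beta)) ->
  let beta := beta_of theta in
  let lb := log_beta theta in
  let pw := pow_beta theta in
  let F := fun r : R => LogQ (beta r) (x * pw r c)%C in
  (c = 0 ->
   forall Li : Z -> C -> C,
   (forall n : Z, is_polylog_exp theta n (Li n)) ->
   asymp F (fun K r =>
     Csum 0 K (fun k =>
       RtoC (powerRZ (-1) (Z.of_nat k - 1) * bernoulli k / INR (fact k))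
       * Li (2 - Z.of_nat k)%Z x * pw r (INR k - 1)%R)%C)) /\
  (0 < c < 1 ->
   forall logx : C -> C,
   is_log_branch ((1 - c) * theta) logx ->
   asymp2 F (fun K N r =>
     - RtoC (PI ^ 2 / 6) * pw r (-1)%R
     + x * (1 - logx x - RtoC c * lb r) * pw r (c - 1)%R
     + RtoC (c / 2) * lb r
     + RtoC (1 / 2) * logx x
     - Csum 1 K (fun k =>
         RtoC (bernoulli (2 * k))
         / (RtoC (INR (2 * k) * INR (2 * k - 1)) * x ^ (2 * k - 1))
         * pw r ((1 - c) * INR (2 * k - 1))%R)
     - Csum 1 N (fun n => Csum 0 (n + 1) (fun k =>
         RtoC (bernoulli k * bernoulli n) * x ^ (n + 1 - k)
         / RtoC (INR (fact k) * INR n * INR (fact (n + 1 - k)))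
         * pw r ((1 - c) * (INR k - 1) + c * INR n)%R)))%C) /\
  (c = 1 ->
   forall logGamma : C -> C,
   is_log_Gamma_branch ((1 - c) * theta) logGamma ->
   asymp F (fun N r =>
     - RtoC (PI ^ 2 / 6) * pw r (-1)%R
     + (RtoC (1 / 2) - x) * lb r
     - logGamma x
     + RtoC (1 / 2 * ln (2 * PI))
     - Csum 1 N (fun n =>
         RtoC (bernoulli n) * bernoulli_poly (n + 1) x
         / RtoC (INR n * INR (fact (n + 1)))
         * pw r (INR n)))%C) /\
  (1 < c ->
   forall logx : C -> C,
   is_log_branch ((1 - c) * theta) logx ->
   asymp2 F (fun K N r =>
     - RtoC (PI ^ 2 / 6) * pw r (-1)%R
     + RtoC (c - 1 / 2) * lb r
     + logx x
     + RtoC (1 / 2 * ln (2 * PI))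
     + x * (RtoC euler_gamma - lb r) * pw r (c - 1)%R
     - Csum 2 K (fun k =>
         RtoC (zeta_nat k) * (- x) ^ k / RtoC (INR k)
         * pw r ((c - 1) * INR k)%R)
     - Csum 1 N (fun n => Csum 0 (n + 1) (fun k =>
         RtoC (bernoulli k * bernoulli n) * x ^ (n + 1 - k)
         / RtoC (INR (fact k) * INR n * INR (fact (n + 1 - k)))
         * pw r (INR k - 1 + c * INR (n + 1 - k))%R)))%C).
Proof.
intros c theta x LogQ Hc0 Hth Hx0 Hx1 HQ beta lb pw F.
split; [|split; [|split]].
- intros Hc Li HLi. unfold F. subst c. apply (expansion_c_eq_0 theta x LogQ Li Hth (Hx0 eq_refl) HLi HQ).
- intros Hc logx Hl. apply (expansion_c_lt_1 c theta x LogQ logx Hc Hth); [apply Hx1; lra|exact Hl|exact HQ].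
- intros Hc logGamma Hl. unfold F. subst c.
  apply (expansion_c_eq_1 theta x LogQ logGamma Hth); [apply Hx1; lra|exact Hl|exact HQ].
- intros Hc logx Hl. apply (expansion_c_gt_1 c theta x LogQ logx Hc Hth); [apply Hx1; lra|exact Hl|exact HQ].
Qed.
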